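(* Let $A,B\in\mathfrak A_2$, let $b=(M,d,L)$ be a fixed budget and $N\ge M$. Then $$D_b^{(N)}O_b^{(N)}(\Phi_N(A)\Phi_N(B))=P_b(A\star_NB),\qquad P_b(A\star_NB)\longrightarrow P_b(A\star B)=D_bO_b(\Phi(A)\Phi(B))\quad(N\to\infty)$$ in every norm $p_\sigma$, $\sigma\ge1$. Suppose $\widehat y$ is noisy finite data such that for each $m\le M$ the retained degree-$m$ coordinates of $\widehat y-O_b^{(N)}(\Phi_N(A)\Phi_N(B))$ have total Euclidean norm at most $\delta_m$. Set $\kappa_L=(\min_{k\le L}r_k)^{-2}$, $\chi_{m,N}=\big(N^m/(N)_{\underline m}\big)^{1/2}$, $\chi_{0,N}=1$, and $\widehat C=D_b^{(N)}\widehat y$. If $\sigma\ge1$, $\rho,\eta>0$ satisfy $\frac1{1+\rho^2}+\frac1{1+\eta^2}\le\frac1{1+\sigma^2}$, and $R_+>\rho$, $S_+>\eta$, $q=\max(\rho/R_+,\eta/S_+)<1$, then $$p_\sigma(\widehat C-A\star B)\le\kappa_L\sum_{m=0}^M\sigma^m\chi_{m,N}\delta_m+p_\sigma\big((I-P_b)(A\star B)\big)+\frac{q^2}{N(1-q)^3}p_{R_+}(A)p_{S_+}(B).$$ Along cofinal budgets $b_N=(M_N,d_N,L_N)$ with $M_N\le N$, if the noise term (the first term on the right) tends to zero for every $\sigma\ge1$, then the corresponding outputs satisfy $\widehat C_N\to A\star B$ in $\mathfrak A_2$.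
   Context: $H$ is a real separable Hilbert space with orthonormal basis $(e_j)$, $E$ a complex separable Hilbert space, $\mathcal S_2(E)$ the Hilbert--Schmidt operators. Coefficient arrays $A=(A_\alpha)$, $A_\alpha\in\mathcal S_2(E)$, are indexed by finitely supported multi-indices; $p_\rho(A)=\sum_m\rho^m\big(\sum_{|\alpha|=m}\|A_\alpha\|_2^2\big)^{1/2}$; $\mathfrak A_2=\{A:p_\rho(A)<\infty\ \forall\rho\ge1\}$ with the topology of these norms. $(t)_{\underline r}=t(t-1)\cdots(t-r+1)$, $(t)_{\underline 0}=1$. $(\xi_{j,a})$ are independent symmetric $\pm1$ signs; $Q^{(j)}_{k,N}=k!N^{-k/2}\sum_{I\subset\{1,\dots,N\},|I|=k}\prod_{a\in I}\xi_{j,a}$ for $0\le k\le N$, zero for $k>N$; $\Psi_{\alpha,N}=\prod_jQ^{(j)}_{\alpha_j,N}/\sqrt{\alpha_j!}$; $d_{\alpha,N}=\prod_j(N)_{\underline{\alpha_j}}/N^{\alpha_j}$ (so $\mathbb E\Psi_{\alpha,N}^2=d_{\alpha,N}$); $\Phi_N(A)=\sum_\alpha A_\alpha\Psi_{\alpha,N}$. With independent standard Gaussians $g_j$, $\Psi_\alpha=\prod_jH_{\alpha_j}(g_j)/\sqrt{\alpha_j!}$ (probabilists' Hermite) and $\Phi(A)=\sum_\alpha A_\alpha\Psi_\alpha$. Products: with $\gamma=\alpha+\beta-2r$, $r\le\alpha\wedge\beta$, $c(\alpha,\beta,r)=r!\binom\alpha r\binom\beta r\sqrt{\gamma!/(\alpha!\beta!)}$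 (componentwise multi-index conventions), $\vartheta_N(\alpha,\beta,r)=\prod_j(N-\gamma_j)_{\underline{r_j}}/N^{r_j}$, and $\vartheta_N=0$ if some component of $\alpha,\beta$ or $\gamma$ exceeds $N$: $(A\star_NB)_\gamma=\sum c\,\vartheta_N\,A_\alpha B_\beta$ and $(A\star B)_\gamma=\sum c\,A_\alpha B_\beta$, sums over $\alpha+\beta-2r=\gamma$ (extended by continuity from finite arrays to $\mathfrak A_2$). Observations: fix a positive injective Hilbert--Schmidt operator $R$ on $E$ with $\|R\|_2=1$, $Rf_l=r_lf_l$ for an orthonormal basis $(f_l)$; matrix entries refer to $(f_l)$. A budget $b=(M,d,L)$ retains $|\alpha|\le M$, $\operatorname{supp}\alpha\subset\{1,\dots,d\}$, and matrix entries $k,l\le L$; $P_b$ is the corresponding coefficient projection. For $N\ge M$, $(O_b^{(N)}F)_{\alpha;kl}=\mathbb E\big[d_{\alpha,N}^{-1/2}\Psi_{\alpha,N}(RFR)_{kl}\big]$ on the retained coordinates (test and response on the same sample), and $D_b^{(N)}$ divides the $(\alpha;kl)$ coordinate by $r_kr_l\sqrt{d_{\alpha,N}}$ and sets unobserved coefficients to zero. $O_b,D_b$ are defined in the same way with $\Psi_\alpha$ in place of $d_{\alpha,N}^{-1/2}\Psi_{\alpha,N}$ and with $d_{\alpha,N}$ replaced by $1$. *)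

(* Defs.v *)
From HB Require Import structures.
From mathcomp Require Import all_boot all_order all_algebra.
From mathcomp Require Import finmap.
From mathcomp Require Import complex.
From mathcomp Require Import all_classical all_reals all_analysis.

Set Implicit Arguments.
Unset Strict Implicit.
Unset Printing Implicit Defensive.

Import Order.TTheory GRing.Theory Num.Theory.
Import numFieldNormedType.Exports.

Local Open Scope classical_set_scope.
Local Open Scope ring_scope.

(* Index set of an orthonormal basis of a separable Hilbert space: [None]
   stands for a countably infinite basis, [Some n] for a basis of n vectors.
   Indices start at 0, so that the first d of them are those with [val k < d]. *)
Definition in_dim (dim : option nat) (k : nat) : bool :=
  if dim is Some n then (k < n)%N else true.

Definition ix (dim : option nat) := {k : nat | in_dim dim k}.

Section Hilbert.
Context {K : numFieldType} {V : completeNormedModType K} {theta : K -> K}.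
Variable dot : {dot V for theta}.

(* [V] is a Hilbert space: it is complete, and its norm comes from [dot], which
   is linear in its first argument and [theta]-linear in the second. *)
Definition norm_from_dot := forall x : V, dot x x = `|x| ^+ 2.

Definition orthonormal_basis (dim : option nat) (e : ix dim -> V) :=
  (forall j k, dot (e j) (e k) = (j == k)%:R) /\
  dense (range (fun c : {fsfun ix dim -> K with 0} =>
    \sum_(k <- finsupp c) c k *: e k)).

End Hilbert.

Section MultiIndices.
Context {R : realType} {dim : option nat}.

Definition midx (dim : option nat) := {fsfun ix dim -> nat with 0%N}.

Implicit Types al be r ga : midx dim.

Definition mdeg al : nat := (\sum_(j <- finsupp al) al j)%N.

Definition mfact al : nat := (\prod_(j <- finsupp al) (al j)`!)%N.

Definition mbinom al r : nat := (\prod_(j <- finsupp r) 'C(al j, r j))%N.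

Definition contraction al be r ga :=
  forall j, [/\ (r j <= al j)%N, (r j <= be j)%N &
                (ga j = al j + be j - 2 * r j)%N].

Definition product_coeff al be r ga : R :=
  (mfact r * mbinom al r * mbinom be r)%N%:R *
  Num.sqrt ((mfact ga)%:R / (mfact al * mfact be)%N%:R).

(* [n ^_ k] is the falling factorial n(n-1)...(n-k+1). *)
Definition vartheta (N : nat) al be r ga : R :=
  if `[< forall j, [/\ (al j <= N)%N, (be j <= N)%N & (ga j <= N)%N] >] then
    \prod_(j <- finsupp r) (((N - ga j) ^_ r j)%:R / N%:R ^+ r j)
  else 0.

Definition dweight (N : nat) al : R :=
  \prod_(j <- finsupp al) ((N ^_ al j)%:R / N%:R ^+ al j).

Definition chiN (m N : nat) : R := Num.sqrt (N%:R ^+ m / (N ^_ m)%:R).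

End MultiIndices.

Section Probability.
Context {R : realType} {d : measure_display} {T : measurableType d}.
Variable P : probability T R.

Definition mutually_independent (I : choiceType) (X : I -> {RV P >-> R}) :=
  forall (J : {fset I}) (B : I -> set R), (forall i, measurable (B i)) ->
    P (\bigcap_(i in [set` J]) (X i @^-1` B i)) =
    (\prod_(i <- J) fine (P (X i @^-1` B i)))%:E.

Definition symmetric_sign (X : {RV P >-> R}) :=
  P [set w | X w = 1] = (2^-1)%:E /\ P [set w | X w = -1] = (2^-1)%:E.

Definition standard_gaussian (X : {RV P >-> R}) :=
  forall U : set R, measurable U -> distribution P X U = normal_prob 0 1 U.

Definition cexpectation (Z : T -> R[i]) : R[i] :=
  Complex (fine 'E_P[fun w => complex.Re (Z w)])
          (fine 'E_P[fun w => complex.Im (Z w)]).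

Context {dim : option nat}.

Section Signs.
Variable xi : ix dim -> nat -> {RV P >-> R}.

(* The sum is empty when k > N. *)
Definition Qsum (j : ix dim) (k N : nat) (w : T) : R :=
  k`!%:R * Num.sqrt N%:R ^- k *
  \sum_(I : {set 'I_N} | #|I| == k) \prod_(a in I) xi j a w.

Definition PsiN (N : nat) (al : midx dim) (w : T) : R :=
  \prod_(j <- finsupp al) (Qsum j (al j) N w / Num.sqrt (al j)`!%:R).

End Signs.

(* Probabilists' Hermite polynomials *)
Fixpoint hermite (n : nat) : {poly R} :=
  if n is n'.+1 then 'X * hermite n' - (hermite n')^`() else 1.

Definition Psi (g : ix dim -> {RV P >-> R}) (al : midx dim) (w : T) : R :=
  \prod_(j <- finsupp al) ((hermite (al j)).[g j w] / Num.sqrt (al j)`!%:R).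

End Probability.

Section HilbertSchmidt.
Context {R : realType} {E : completeNormedModType R[i]}.
Context {dimE : option nat} (f : ix dimE -> E).
Local Open Scope ereal_scope.

(* The norm of [E] takes its values in [R[i]]. *)
Definition rnorm (x : E) : R := complex.Re `|x|%R.

(* Squared Hilbert--Schmidt norm, +oo if the operator is not Hilbert--Schmidt;
   [f] is meant to be an orthonormal basis. *)
Definition hs_norm2 (A : E -> E) : \bar R :=
  \esum_(k in [set: ix dimE]) (rnorm (A (f k)) ^+ 2)%:E.

Definition hilbert_schmidt (A : E -> E) :=
  [/\ linear A, continuous A & hs_norm2 A < +oo].

End HilbertSchmidt.

Definition entry {R : realType} {E : completeNormedModType R[i]}
    (dot : {dot E for Num.conj}) (dimE : option nat) (f : ix dimE -> E)
    (A : E -> E) (k l : ix dimE) : R[i] := dot (A (f l)) (f k).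

Notation coeff_array dimH E := (midx dimH -> E -> E).

Section Arrays.
Context {R : realType} {E : completeNormedModType R[i]} {dimH dimE : option nat}.
Variable f : ix dimE -> E.
Implicit Types A B C : coeff_array dimH E.

Definition array_sub A B : coeff_array dimH E := fun al x => A al x - B al x.

Definition pnorm (rho : R) A : \bar R :=
  (\sum_(0 <= m <oo) (rho ^+ m)%:E *
     (\esum_(al in [set al | mdeg al = m]) hs_norm2 f (A al)) `^ 2^-1)%E.

Definition frakA2 : set (coeff_array dimH E) :=
  [set A | (forall al, hilbert_schmidt f (A al)) /\
           (forall rho, 1 <= rho -> (pnorm rho A < +oo)%E)].

Definition cvg_frakA2 (u : nat -> coeff_array dimH E) (C : coeff_array dimH E) :=
  [/\ forall n, frakA2 (u n), frakA2 C &
      forall rho, 1 <= rho ->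
        pnorm rho (array_sub (u n) C) @[n --> \oo] --> 0%E].

Definition finite_array A :=
  (forall al, hilbert_schmidt f (A al)) /\
  finite_set [set al | exists x, A al x != 0].

Section Product.
Variable theta : midx dimH -> midx dimH -> midx dimH -> midx dimH -> R.

(* The product of finite arrays; a triple is (alpha, beta, r). *)
Definition fin_array_prod A B : coeff_array dimH E := fun ga x =>
  \sum_(t \in [set t : midx dimH * midx dimH * midx dimH |
                contraction t.1.1 t.1.2 t.2 ga])
    (product_coeff t.1.1 t.1.2 t.2 ga * theta t.1.1 t.1.2 t.2 ga)%:C%C *:
      A t.1.1 (B t.1.2 x).

(* Extension by continuity: the limit of the products of finite arrays, along
   all finite arrays converging to A and to B. *)
Definition array_prod A B : coeff_array dimH E :=
  xget (fun _ _ => 0) [set C | frakA2 C /\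
    forall An Bn : nat -> coeff_array dimH E,
      (forall n, finite_array (An n)) -> (forall n, finite_array (Bn n)) ->
      cvg_frakA2 An A -> cvg_frakA2 Bn B ->
      cvg_frakA2 (fun n => fin_array_prod (An n) (Bn n)) C].

End Product.

Definition starN (N : nat) A B := array_prod (vartheta N) A B.

Definition star A B := array_prod (fun _ _ _ _ => 1) A B.

End Arrays.

Section RandomSeries.
Context {R : realType} {E : completeNormedModType R[i]} {dimH dimE : option nat}.
Variables (dot : {dot E for Num.conj}) (f : ix dimE -> E).
Context {d : measure_display} {T : measurableType d} (P : probability T R).

(* [X] is a measurable Hilbert--Schmidt-operator-valued version of the sum
   of [A al * psi al] over all multi-indices, which converges unconditionally
   in L^2 for the Hilbert--Schmidt norm. *)
Definition is_chaos_sum (psi : midx dimH -> T -> R) (A : coeff_array dimH E)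
    (X : T -> E -> E) :=
  [/\ forall w, hilbert_schmidt f (X w),
      forall k l, measurable_fun setT (fun w => complex.Re (entry dot f (X w) k l))
        /\ measurable_fun setT (fun w => complex.Im (entry dot f (X w) k l)) &
      forall eps : R, 0 < eps -> exists F0 : {fset midx dimH},
        forall F : {fset midx dimH}, (F0 `<=` F)%fset ->
        (\int[P]_w hs_norm2 f
           (fun x => X w x - \sum_(al <- F) (psi al w)%:C%C *: A al x)%R
         <= eps%:E)%E].

Definition chaos_sum (psi : midx dimH -> T -> R) (A : coeff_array dimH E) : T -> E -> E :=
  xget (fun _ _ => 0) [set X | is_chaos_sum psi A X].

Definition PhiN (xi : ix dimH -> nat -> {RV P >-> R}) (N : nat) A :=
  chaos_sum (PsiN xi N) A.

Definition Phi (g : ix dimH -> {RV P >-> R}) A := chaos_sum (Psi g) A.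

Definition rprod (X Y : T -> E -> E) : T -> E -> E := fun w x => X w (Y w x).

End RandomSeries.

Record budget := Budget { bM : nat; bd : nat; bL : nat }.

Section Observations.
Context {R : realType} {E : completeNormedModType R[i]} {dimH dimE : option nat}.
Variables (dot : {dot E for Num.conj}) (f : ix dimE -> E).
Variables (Rop : E -> E) (r : ix dimE -> R).
Implicit Types (b : budget) (al : midx dimH) (k l : ix dimE).

Definition retained_idx b al : bool :=
  (mdeg al <= bM b)%N && all (fun j => (val j < bd b)%N) (finsupp al).

Definition retained_row b k : bool := (val k < bL b)%N.

Definition obs_data (dimH dimE : option nat) := midx dimH -> ix dimE -> ix dimE -> R[i].

Definition retained b al k l : bool :=
  [&& retained_idx b al, retained_row b k & retained_row b l].

(* The array whose only nonzero matrix entries are the [y al k l] with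
   [retained b al k l]. *)
Definition assemble b (y : obs_data dimH dimE) : coeff_array dimH E := fun al x =>
  if retained_idx b al then
    \sum_(k \in [set k | retained_row b k])
      \sum_(l \in [set l | retained_row b l]) (y al k l * dot x (f l)) *: f k
  else 0.

Definition budget_proj b (A : coeff_array dimH E) : coeff_array dimH E :=
  assemble b (fun al => entry dot f (A al)).

(* [observe] and [reconstruct] are used with ([PsiN xi N], [dweight N]) and with
   ([Psi g], the constant 1). *)
Definition observe {d : measure_display} {T : measurableType d}
    (P : probability T R) (psi : midx dimH -> T -> R) (wt : midx dimH -> R)
    b (F : T -> E -> E) : obs_data dimH dimE := fun al k l =>
  if retained b al k l then
    cexpectation P (fun w => ((Num.sqrt (wt al))^-1 * psi al w)%:C%C *
                             entry dot f (fun x => Rop (F w (Rop x))) k l)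
  else 0.

Definition reconstruct (wt : midx dimH -> R) b (y : obs_data dimH dimE) : coeff_array dimH E :=
  assemble b (fun al k l => y al k l / (r k * r l * Num.sqrt (wt al))%:C%C).

(* Euclidean norm of the retained degree-m coordinates *)
Definition data_norm b (m : nat) (y : obs_data dimH dimE) : \bar R :=
  ((\esum_(t in [set t : midx dimH * ix dimE * ix dimE |
                  retained b t.1.1 t.1.2 t.2 /\ mdeg t.1.1 = m])
      ((complex.Re `|y t.1.1 t.1.2 t.2|) ^+ 2)%:E) `^ 2^-1)%E.

Definition data_sub (y z : obs_data dimH dimE) : obs_data dimH dimE :=
  fun al k l => y al k l - z al k l.

(* The infimum is the minimum of finitely many positive numbers. *)
Definition kappaL (L : nat) : R :=
  inf [set r k | k in [set k : ix dimE | (val k < L)%N]] ^- 2.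

Definition noise_term (sigma : R) b (N : nat) (delta : nat -> R) : R :=
  kappaL (bL b) * \sum_(m < (bM b).+1) sigma ^+ m * chiN m N * delta m.

End Observations.

(* [b] eventually exceeds every fixed budget; in a finite-dimensional space d_N,
   resp. L_N, only has to reach the dimension. *)
Definition cofinal_budgets (dimH dimE : option nat) (b : nat -> budget) :=
  [/\ forall M, \forall N \near \oo, (M <= bM (b N))%N,
      forall j : ix dimH, \forall N \near \oo, (val j < bd (b N))%N &
      forall k : ix dimE, \forall N \near \oo, (val k < bL (b N))%N].

(* Main.v *)
Require Import Defs.
From HB Require Import structures.
From mathcomp Require Import all_boot all_order all_algebra.
From mathcomp Require Import finmap.
From mathcomp Require Import complex.
From mathcomp Require Import all_classical all_reals all_analysis.
From mathcomp Require Import measurable_realfun.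
From mathcomp Require Import ring lra zify.

(** The product of two chaos series is again a chaos series, whose
    coefficients are given by a linearization formula. For one coordinate,
    the normalized elementary symmetric polynomials of N signs and the
    Hermite polynomials satisfy the same three-term recurrence q_(n+1) = x
    q_n - n (1 - (n - 1) h) q_(n-1), with h = 1/N for the signs and h = 0
    for the Gaussians, and an induction on this recurrence ([linearization])
    expands q_m q_n; tensorizing over the coordinates ([tensor_product])
    produces exactly the coefficients c and theta of the two array products.
    What the rest of the argument needs to know about the random variables
    is collected in [chaos_system]: the linearization formula holds almost
    surely, and only the constant basis function has a nonzero mean. Both
    models are instances ([sign_chaos_system], [gaussian_chaos_system]), so
    the identities for the signs and for the Gaussians have one and the same
    proof.

    The analytic heart is a product estimate without probability: if 1/(1 +
    rho^2) + 1/(1 + eta^2) <= 1/(1 + sigma^2), then the array product maps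
    the norms of radii rho and eta to the norm of radius sigma, degree by
    degree ([sprod_norm_le]). It comes from Cauchy--Schwarz and Vandermonde
    for each number of contractions, followed by a second Cauchy--Schwarz
    over that number. It shows that the products of finite arrays extend by
    continuity ([array_prod_spec]), and, since theta differs from 1 by at
    most C(m + n, 2)/N in degrees m and n ([vartheta_defect]), enlarging the
    radii by a factor 1/q and bounding C(m + n, 2) q^(m + n) by q^2/(1 -
    q)^3 gives the rate 1/N ([starN_star_le]).

    To identify the observed coefficients, one takes means of the product of
    two chaos sums against a basis function psi_g. For partial sums this
    mean is read off from orthogonality. The passage to the limit is
    delicate because psi_g is not bounded, so convergence in L^2 is not
    enough: by the linearization formula, psi_g times a chaos is again a
    chaos whose coefficients grow at most like 2^degree, which the space of
    arrays tolerates. Hence the partial sums converge in L^2 for the weight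
    psi_g^2 as well ([chaos_sum_psi2_cvg]), and the mean of the full product
    is the coefficient of the array product ([chaos_product_mean]). Dividing
    by the weights of the observation leaves the budget projection
    ([reconstruct_observe]).

    The error splits into three parts: the noise, amplified at most by kappa
    and chi because the reconstruction divides by r_k r_l and by the square
    root of the variance ([pnorm_reconstruct_le]); the coefficients outside
    the budget; and the distance of the two products, which the budget
    projection does not increase. Along cofinal budgets the second part
    vanishes by dominated convergence ([budget_proj_cvg]) and the third by
    the rate. *)

Set Implicit Arguments.
Unset Strict Implicit.
Unset Printing Implicit Defensive.

Import Order.TTheory GRing.Theory Num.Theory.
Import numFieldNormedType.Exports.

Local Open Scope classical_set_scope.
Local Open Scope ring_scope.

(** * Inequalities for unordered sums *)

Section EsumTools.
Context {R : realType}.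
Local Open Scope ereal_scope.
Implicit Types (I J : choiceType).

Lemma esum_ub I (D : set I) (a : I -> \bar R) i :
  (forall j, 0 <= a j) -> D i -> a i <= \esum_(j in D) a j.
Proof.
move=> a0 Di; apply: esum_ge; exists [set i].
  by split; [exact: finite_set1 | move=> j ->].
by rewrite fsbig_set1.
Qed.

Lemma esum_eq0P I (D : set I) (a : I -> \bar R) :
  (forall j, 0 <= a j) -> \esum_(j in D) a j = 0 ->
  forall j, D j -> a j = 0.
Proof.
move=> a0 s0 j Dj; apply/eqP; rewrite eq_le a0// andbT -s0; exact: esum_ub.
Qed.

Lemma esumZl I (D : set I) (a : I -> \bar R) (c : \bar R) :
  0 <= c -> (forall i, 0 <= a i) ->
  \esum_(i in D) (c * a i) = c * \esum_(i in D) a i.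
Proof.
move=> c0 a0.
have le1 (k : \bar R) (b : I -> \bar R) : 0 <= k -> (forall i : I, 0 <= b i) ->
    \esum_(i in D) (k * b i) <= k * \esum_(i in D) b i.
  move=> k0 b0; apply: ge_ereal_sup => _ [X [finX XD] <-].
  rewrite -ge0_mule_fsumr//; apply: lee_pmul => //.
    exact: fsume_ge0.
  by apply: ereal_sup_ubound; exists X => //.
apply/eqP; rewrite eq_le le1//=.
have s0 : 0 <= \esum_(i in D) a i by exact: esum_ge0.
have [->|cn0] := eqVneq c 0.
  by rewrite mul0e esum_ge0// => i _; rewrite mul0e.
have {cn0}c0 : 0 < c by rewrite lt_neqAle eq_sym cn0.
case: c c0 => [r||//] c0.
- have rr (x : \bar R) : x = r^-1%:E * (r%:E * x).
    by rewrite muleA -EFinM mulVf ?mul1e// gt_eqF.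
  under [X in _ * X]eq_esum do rewrite [a _]rr.
  apply: (@le_trans _ _ (r%:E * (r^-1%:E * \esum_(i in D) (r%:E * a i)))).
    apply: lee_pmul => //; first exact: ltW.
      by apply: esum_ge0 => i _; rewrite -rr.
    apply: le1; first by rewrite lee_fin invr_ge0 ltW.
    by move=> i; rewrite mule_ge0// ltW.
  by rewrite muleA -EFinM divff ?mul1e// gt_eqF.
- have [->|] := eqVneq (\esum_(i in D) a i) 0.
    by rewrite mule0 esum_ge0// => i _; rewrite mule_ge0.
  move=> sn0; have [i [Di ai]] : exists i, D i /\ a i != 0.
    apply: contra_neqP sn0 => /forallNP h; apply: esum1 => i Di.
    by apply/eqP/negP => /negP ai; apply: (h i).
  rewrite gt0_mulye; last by rewrite lt_neqAle eq_sym sn0 s0.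
  apply: le_trans (@esum_ub _ _ (fun i => +oo * a i) i _ Di).
    by rewrite gt0_mulye// lt_neqAle eq_sym ai a0.
  by move=> j; rewrite mule_ge0.
Qed.

Lemma esumZr I (D : set I) (a : I -> \bar R) (c : \bar R) :
  0 <= c -> (forall i, 0 <= a i) ->
  \esum_(i in D) (a i * c) = (\esum_(i in D) a i) * c.
Proof.
by move=> c0 a0; rewrite muleC -esumZl//; apply: eq_esum => i _; rewrite muleC.
Qed.

Lemma esumM I J (D : set I) (F : set J) (a : I -> \bar R) (b : J -> \bar R) :
  (forall i, 0 <= a i) -> (forall j, 0 <= b j) ->
  (\esum_(i in D) a i) * (\esum_(j in F) b j) =
  \esum_(i in D) \esum_(j in F) (a i * b j).
Proof.
move=> a0 b0; rewrite -esumZr//; last exact: esum_ge0.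
by apply: eq_esum => i _; rewrite esumZl.
Qed.

Lemma esum_exchange I J (D : set I) (F : set J) (a : I -> J -> \bar R) :
  (forall i j, 0 <= a i j) ->
  \esum_(i in D) \esum_(j in F) a i j = \esum_(j in F) \esum_(i in D) a i j.
Proof.
move=> a0; rewrite !esum_esum//.
rewrite (@reindex_esum _ _ _ (F `*`` fun=> D) _ (fun p => (p.2, p.1)))//.
split => [[j i] [/= ? ?]//|[j i] [j' i'] _ _ [-> ->]//|[i j] [/= ? ?]].
by exists (j, i).
Qed.

Lemma sqreM (x y : \bar R) : (x * y) ^+ 2 = x ^+ 2 * y ^+ 2.
Proof. by rewrite !expe2 muleACA. Qed.

Lemma sqrte_le (x y : \bar R) : 0 <= x -> x <= y -> sqrte x <= sqrte y.
Proof. by move=> x0 xy; rewrite lee_sqrt// (le_trans x0). Qed.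

Lemma sqrte_le_sqr (x y : \bar R) : 0 <= x -> 0 <= y -> x <= y ^+ 2 -> sqrte x <= y.
Proof.
move=> x0 y0 xy; rewrite -(gee0_abs y0) -sqrte_sqr; exact: sqrte_le.
Qed.

Lemma le_sqr_sqrte (x y : \bar R) : 0 <= y -> x ^+ 2 <= y -> x <= sqrte y.
Proof.
move=> y0 xy; rewrite (le_trans (lee_abs x))// -sqrte_sqr.
by apply: sqrte_le => //; exact: sqre_ge0.
Qed.

(** Termwise 2uv <= x u^2 + v^2/x, and x is optimised once both sums are
    known to be finite and nonzero. *)
Lemma esum_cauchy_schwarz I (D : set I) (u v : I -> \bar R) :
  (forall i, 0 <= u i) -> (forall i, 0 <= v i) ->
  \esum_(i in D) (u i * v i) <=
  sqrte (\esum_(i in D) (u i ^+ 2)) * sqrte (\esum_(i in D) (v i ^+ 2)).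
Proof.
move=> u0 v0.
have uv0 i : 0 <= u i * v i by rewrite mule_ge0.
have nul (w z : I -> \bar R) : (forall i : I, 0 <= w i) -> \esum_(i in D) (w i ^+ 2) = 0 ->
    \esum_(i in D) (w i * z i) = 0.
  move=> w0 W0; apply: esum1 => i Di.
  have /eqP := @esum_eq0P _ D (fun i => w i ^+ 2) (fun i => sqre_ge0 (w i)) W0 i Di.
  by rewrite expe_eq0/= => /eqP ->; rewrite mul0e.
have U0 : 0 <= \esum_(i in D) (u i ^+ 2) by apply: esum_ge0 => i _; exact: sqre_ge0.
have V0 : 0 <= \esum_(i in D) (v i ^+ 2) by apply: esum_ge0 => i _; exact: sqre_ge0.
set U := esum _ (fun i => u i ^+ 2) in U0 *.
set V := esum _ (fun i => v i ^+ 2) in V0 *.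
have [UE|Un0] := eqVneq U 0; first by rewrite nul// UE sqrte0 mul0e.
have [VE|Vn0] := eqVneq V 0.
  by under eq_esum do rewrite muleC; rewrite nul// VE sqrte0 mule0.
have Ugt : 0 < U by rewrite lt_neqAle eq_sym Un0.
have Vgt : 0 < V by rewrite lt_neqAle eq_sym Vn0.
case UE : U Ugt => [x||//] Ugt; last first.
  rewrite /= gt0_mulye ?leey//.
  rewrite lt_neqAle sqrte_ge0 andbT eq_sym; apply: contra_neq Vn0 => sV.
  by rewrite -(sqr_sqrte V0) sV expe2 mul0e.
case VE : V Vgt => [y||//] Vgt; last first.
  by rewrite /= gt0_muley ?leey// lte_fin sqrtr_gt0.
rewrite !lte_fin in Ugt Vgt.
set t := (Num.sqrt y / Num.sqrt x)%R.
have sx : (0 < Num.sqrt x)%R by rewrite sqrtr_gt0.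
have sy : (0 < Num.sqrt y)%R by rewrite sqrtr_gt0.
have t0 : (0 < t)%R by rewrite divr_gt0.
have fin (w : I -> \bar R) W (z : R) : (forall i : I, 0 <= w i) -> W = z%:E ->
    \esum_(i in D) (w i ^+ 2) = W -> forall i, D i -> w i \is a fin_num.
  move=> w0 -> Ww i Di; rewrite ge0_fin_numE//.
  have : w i ^+ 2 < +oo.
    apply: (@le_lt_trans _ _ z%:E); last by rewrite ltry.
    rewrite -Ww; apply: (@esum_ub _ _ (fun i => w i ^+ 2)) => //.
    by move=> j; exact: sqre_ge0.
  case: (w i) (w0 i) => [r _ _|_|//]; first by rewrite ltry.
  by rewrite expe2 mulyy.
have fu := fin u U x u0 UE erefl; have fv := fin v V y v0 VE erefl.
apply: (@le_trans _ _ (\esum_(i in D) ((t / 2)%:E * u i ^+ 2 + (t^-1 / 2)%:E * v i ^+ 2))).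
  apply: le_esum => i Di.
  rewrite -(fineK (fu i Di)) -(fineK (fv i Di)) !expe2 -!EFinM -EFinD lee_fin.
  set a := fine _; set b := fine _.
  have -> : ((t / 2) * (a * a) + (t^-1 / 2) * (b * b) =
             a * b + (t * a - b) ^+ 2 / (2 * t))%R.
    by field; rewrite gt_eqF.
  by rewrite lerDl divr_ge0 ?sqr_ge0// mulr_ge0// ltW.
rewrite esumD; last 2 first.
- by move=> i _; rewrite mule_ge0 ?sqre_ge0// lee_fin divr_ge0// ltW.
- by move=> i _; rewrite mule_ge0 ?sqre_ge0// lee_fin divr_ge0// ?invr_ge0 ltW.
rewrite !esumZl ?lee_fin ?divr_ge0 ?invr_ge0 ?(ltW t0)// => [|i|i]; try exact: sqre_ge0.
rewrite -/U -/V UE VE /= -!EFinM -EFinD lee_fin.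
move: sx sy (sqr_sqrtr (ltW Ugt)) (sqr_sqrtr (ltW Vgt)); rewrite /t.
move: (Num.sqrt x) (Num.sqrt y) => a b a0 b0 <- <-.
by rewrite le_eqVlt; apply/orP; left; apply/eqP; field; rewrite !gt_eqF.
Qed.

(** Expanding the square of the sum and applying Cauchy--Schwarz to each of the
    cross terms gives the square of the sum of the norms. *)
Lemma esum_minkowski I J (D : set I) (F : set J) (u : J -> I -> \bar R) :
  (forall j i, 0 <= u j i) ->
  sqrte (\esum_(i in D) ((\esum_(j in F) u j i) ^+ 2)) <=
  \esum_(j in F) sqrte (\esum_(i in D) (u j i ^+ 2)).
Proof.
move=> u0.
have s0 j : 0 <= sqrte (\esum_(i in D) (u j i ^+ 2)) by exact: sqrte_ge0.
apply: sqrte_le_sqr; first by apply: esum_ge0 => i _; exact: sqre_ge0.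
  by apply: esum_ge0 => j _; exact: s0.
rewrite expe2 esumM//.
under eq_esum => i _.
  rewrite expe2 esumM//; over.
rewrite esum_exchange; last by move=> i j; apply: esum_ge0 => k _; rewrite mule_ge0.
apply: le_esum => j _.
rewrite esum_exchange; last by move=> i k; rewrite mule_ge0.
by apply: le_esum => k _; exact: esum_cauchy_schwarz.
Qed.

Lemma esum2_minkowski I (D : set I) (u v : I -> \bar R) :
  (forall i, 0 <= u i) -> (forall i, 0 <= v i) ->
  sqrte (\esum_(i in D) ((u i + v i) ^+ 2)) <=
  sqrte (\esum_(i in D) (u i ^+ 2)) + sqrte (\esum_(i in D) (v i ^+ 2)).
Proof.
move=> u0 v0.
have e2 (g : bool -> \bar R) : (forall b, 0 <= g b) ->
    \esum_(b in [set: bool]) g b = g true + g false.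
  move=> g0; rewrite setT_bool esum_fset//.
  by rewrite fsbigU0//= ?fsbig_set1// => b [/= -> ].
have := @esum_minkowski I bool D setT (fun b => if b then u else v).
rewrite e2; last by move=> b; exact: sqrte_ge0.
move=> /(_ (fun j => if j as b return forall i, 0 <= (if b then u else v) i
                     then u0 else v0)).
apply: le_trans; apply: sqrte_le; first by apply: esum_ge0 => i _; exact: sqre_ge0.
by apply: le_esum => i _; rewrite e2//; case.
Qed.

End EsumTools.

Section EsumFibers.
Context {R : realType}.
Local Open Scope ereal_scope.

Lemma esum_subset (I : choiceType) (D F : set I) (a : I -> \bar R) :
  D `<=` F -> \esum_(i in D) a i <= \esum_(i in F) a i.
Proof.
move=> DF; apply: ge_ereal_sup => _ [X [finX XD] <-].
apply: ereal_sup_ubound; exists X => //; split => //; exact: subset_trans DF.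
Qed.

Lemma esum_fiber (I J : choiceType) (D : set I) (F : set J) (p : I -> J)
    (a : I -> \bar R) :
  (forall i, 0 <= a i) -> (forall i, D i -> F (p i)) ->
  \esum_(i in D) a i = \esum_(j in F) \esum_(i in D `&` [set i | p i = j]) a i.
Proof.
move=> a0 DF; rewrite esum_esum//.
rewrite (@reindex_esum _ _ _ D _ (fun i => (p i, i)))//.
split => [i Di|i i' _ _ [] //|[j i] [/= Fj [Di pj]]] /=.
- by split => //=; exact: DF.
- by exists i => //; rewrite pj.
Qed.

Lemma esum_inj_le (I J : choiceType) (D : set I) (F : set J) (e : I -> J)
    (b : J -> \bar R) :
  {in D &, injective e} -> (forall i, D i -> F (e i)) ->
  \esum_(i in D) b (e i) <= \esum_(j in F) b j.
Proof.
move=> einj DF; rewrite -esum_image//.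
by apply: esum_subset => _ [i Di <-]; exact: DF.
Qed.

Lemma esum_seq (I : choiceType) (s : seq I) (D : set I) (a : I -> \bar R) :
  uniq s -> (forall i, 0 <= a i) -> (forall i, D i <-> i \in s) ->
  \esum_(i in D) a i = \sum_(i <- s) a i.
Proof.
move=> us a0 Ds; have -> : D = [set` s] by apply/seteqP; split => i /Ds.
by rewrite esum_fset// -fsbig_seq.
Qed.

End EsumFibers.

(** * Multi-indices and contractions *)

Section MultiIndexAlgebra.
Context {dim : option nat}.
Implicit Types (al be mu nu r ga n : midx dim).

Definition madd al be : midx dim :=
  [fsfun j in (finsupp al `|` finsupp be)%fset => (al j + be j)%N | 0%N].
Definition msub al be : midx dim :=
  [fsfun j in finsupp al => (al j - be j)%N | 0%N].
Definition mzero : midx dim := [fsfun].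

Lemma maddE al be j : madd al be j = (al j + be j)%N.
Proof.
rewrite fsfun_fun inE; case: finsuppP => //= _; case: finsuppP => //.
Qed.

Lemma msubE al be j : msub al be j = (al j - be j)%N.
Proof. by rewrite fsfun_fun; case: finsuppP. Qed.

Lemma mzeroE j : mzero j = 0%N. Proof. by rewrite fsfun0E. Qed.

Definition mle al be := forall j, (al j <= be j)%N.

Lemma finsupp_mle al be : mle al be -> (finsupp al `<=` finsupp be)%fset.
Proof.
move=> ab; apply/fsubsetP => j; rewrite !mem_finsupp -!lt0n => aj.
by rewrite (leq_trans aj)// ab.
Qed.

Lemma madd_subK mu al : mle mu al -> madd (msub al mu) mu = al.
Proof. by move=> h; apply/fsfunP => j; rewrite maddE msubE subnK// h. Qed.

Lemma madd_addK mu nu : msub (madd mu nu) nu = mu.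
Proof. by apply/fsfunP => j; rewrite msubE maddE addnK. Qed.

Lemma maddC mu nu : madd mu nu = madd nu mu.
Proof. by apply/fsfunP => j; rewrite !maddE addnC. Qed.

Lemma maddIr nu : injective (madd^~ nu).
Proof. by move=> mu mu' /= h; rewrite -(madd_addK mu nu) h madd_addK. Qed.

Lemma mle_maddr mu nu : mle nu (madd mu nu).
Proof. by move=> j; rewrite maddE leq_addl. Qed.

Lemma mle_maddl mu nu : mle mu (madd mu nu).
Proof. by move=> j; rewrite maddE leq_addr. Qed.

Lemma finsupp_maddl al be : (finsupp al `<=` finsupp (madd al be))%fset.
Proof. exact/finsupp_mle/mle_maddl. Qed.

Lemma finsupp_maddr al be : (finsupp be `<=` finsupp (madd al be))%fset.
Proof. exact/finsupp_mle/mle_maddr. Qed.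

Lemma mprod_incl (A : Type) (idx : A) (op : Monoid.com_law idx)
    (S : {fset ix dim}) (F : ix dim -> nat -> A) al :
  (finsupp al `<=` S)%fset -> (forall j, F j 0%N = idx) ->
  \big[op/idx]_(j <- finsupp al) F j (al j) = \big[op/idx]_(j <- S) F j (al j).
Proof.
move=> sS F0; apply: big_fset_incl => // j _ nj.
by rewrite fsfun_dflt.
Qed.

Lemma mdegE (S : {fset ix dim}) al : (finsupp al `<=` S)%fset ->
  mdeg al = (\sum_(j <- S) al j)%N.
Proof. by move=> sS; rewrite /mdeg (@mprod_incl _ _ _ S (fun _ i => i)). Qed.

Lemma mfactE (S : {fset ix dim}) al : (finsupp al `<=` S)%fset ->
  mfact al = (\prod_(j <- S) (al j)`!)%N.
Proof. by move=> sS; rewrite /mfact (@mprod_incl _ _ _ S (fun _ i => i`!)). Qed.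

Lemma mbinomE (S : {fset ix dim}) al r : (finsupp r `<=` S)%fset ->
  mbinom al r = (\prod_(j <- S) 'C(al j, r j))%N.
Proof.
move=> sS; rewrite /mbinom (@mprod_incl _ _ _ S (fun j i => 'C(al j, i)))//.
by move=> j; rewrite bin0.
Qed.

Lemma mdeg_add mu nu : mdeg (madd mu nu) = (mdeg mu + mdeg nu)%N.
Proof.
rewrite (mdegE (finsupp_maddl mu nu)) (mdegE (finsupp_maddr mu nu)).
by rewrite (mdegE (fsubset_refl _)) -big_split/=; apply: eq_bigr => j _; rewrite maddE.
Qed.

Lemma mfact_add mu nu :
  mfact (madd mu nu) = (mbinom (madd mu nu) nu * (mfact nu * mfact mu))%N.
Proof.
rewrite (mfactE (finsupp_maddl mu nu)) (mfactE (finsupp_maddr mu nu)).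
rewrite (mbinomE _ (finsupp_maddr mu nu)) (mfactE (fsubset_refl _)) -!big_split/=.
apply: eq_bigr => j _; rewrite maddE -(@bin_fact (mu j + nu j) (nu j)) ?leq_addl//.
by rewrite addnK.
Qed.

Lemma mfact_gt0 al : (0 < mfact al)%N.
Proof. by rewrite /mfact prodn_gt0// => j; exact: fact_gt0. Qed.

Lemma mdeg_ge al j : (al j <= mdeg al)%N.
Proof.
have [jal|jal] := boolP (j \in finsupp al); last by rewrite fsfun_dflt.
by rewrite /mdeg (big_fsetD1 j)//= leq_addr.
Qed.

Definition box_fun n (F : {ffun finsupp n -> 'I_(mdeg n).+1}) : midx dim :=
  [fsfun j : finsupp n => (F j : nat) | 0%N].

Lemma box_funE n F (j : finsupp n) : box_fun F (val j) = F j.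
Proof. by rewrite fsfun_ffun insubT//= => p; congr (nat_of_ord (F _)); exact: val_inj. Qed.

Lemma box_fun_out n (F : {ffun finsupp n -> _}) j :
  j \notin finsupp n -> box_fun F j = 0%N.
Proof. by move=> nj; rewrite fsfun_ffun insubN. Qed.

Definition box_family n :=
  [pred F : {ffun finsupp n -> 'I_(mdeg n).+1} | [forall j, F j <= n (val j)]%N].

(** Listing the multi-indices below [n] by independent choices of one
    exponent for each coordinate of the support is what lets products of
    sums be expanded. *)
Definition box n : {fset midx dim} :=
  [fset box_fun F | F in box_family n]%fset.

Lemma box_fun_inj n : injective (@box_fun n).
Proof.
move=> F G FG; apply/ffunP => j; apply/val_inj.
by have := congr1 (fun h : midx dim => h (val j)) FG; rewrite !box_funE.
Qed.

Lemma in_box n r : reflect (mle r n) (r \in box n).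
Proof.
apply: (iffP idP) => [/imfsetP[F /= /forallP hF ->] j|rn].
  have [jn|jn] := boolP (j \in finsupp n); last by rewrite box_fun_out.
  by rewrite (box_funE F [` jn]%fset).
apply/imfsetP; exists [ffun j => inord (r (val j))] => /=.
  apply/forallP => j; rewrite ffunE inordK// ltnS.
  by rewrite (leq_trans (rn _))// mdeg_ge.
apply/fsfunP => j; have [jn|jn] := boolP (j \in finsupp n).
  rewrite (box_funE _ [` jn]%fset) ffunE/= inordK// ltnS.
  by rewrite (leq_trans (rn _))// mdeg_ge.
rewrite box_fun_out//; apply/eqP; rewrite -leqn0 (leq_trans (rn _))//.
by rewrite fsfun_dflt.
Qed.

Lemma prod_sum_box (A : comPzSemiRingType) n (F : ix dim -> nat -> A) :
  \prod_(j <- finsupp n) \sum_(i < (n j).+1) F j i =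
  \sum_(r <- box n) \prod_(j <- finsupp n) F j (r j).
Proof.
rewrite big_imfset/=; last by move=> x y _ _; exact: box_fun_inj.
rewrite big_seq_fsetE/=.
pose Q (j : finsupp n) := [pred i : 'I_(mdeg n).+1 | (i <= n (val j))%N].
transitivity (\prod_(j : finsupp n) \sum_(i | Q j i) F (val j) i).
  apply: eq_bigr => j _.
  rewrite -(big_mkord xpredT (F (val j))) (big_nat_widen _ _ (mdeg n).+1).
    by rewrite big_mkord; apply: eq_bigl => i; rewrite /Q/= ltnS.
  by rewrite ltnS mdeg_ge.
rewrite bigA_distr_big_dep/= big_enum_cond/=.
apply: eq_big => [G|G _].
  by rewrite andbT; apply/familyP/forallP => h j; exact: (h j).
by rewrite [RHS]big_seq_fsetE; apply: eq_bigr => j _; rewrite box_funE.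
Qed.

(** Both sides are the coefficient of X^k in the product of the (1 + X)^(n_j). *)
Lemma vandermonde_box n k :
  (\sum_(r <- box n | mdeg r == k) mbinom n r = 'C(mdeg n, k))%N.
Proof.
have e1 m : (1 + 'X) ^+ m = \sum_(i < m.+1) ('C(m, i)%:R : int)%:P * 'X^i.
  rewrite exprDn; apply: eq_bigr => i _.
  by rewrite expr1n mul1r -mulr_natl polyC_natr.
have : (1 + 'X : {poly int}) ^+ mdeg n =
    \sum_(r <- box n) (mbinom n r)%:R%:P * 'X^(mdeg r).
  rewrite /mdeg -prodrXr; under eq_bigr do rewrite e1.
  rewrite (prod_sum_box n (fun j i => ('C(n j, i)%:R)%:P * 'X^i)).
  apply: eq_big_seq => r /in_box rn; rewrite big_split/=.
  rewrite (mbinomE _ (finsupp_mle rn)) natr_prod rmorph_prod/=; congr (_ * _).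
  by rewrite prodrXr -(mdegE (finsupp_mle rn)).
move=> /(congr1 (fun p : {poly int} => p`_k)).
rewrite coef_sum; under [in RHS]eq_bigr do rewrite coefCM coefXn.
rewrite e1 coef_sum => h; apply/eqP; rewrite -(@eqr_nat int) natr_sum; apply/eqP.
rewrite big_mkcond/= -[RHS]/((_)%:R).
transitivity (\sum_(r <- box n) ((mbinom n r)%:R * (k == mdeg r)%:R : int)).
  by apply: eq_bigr => r _; rewrite eq_sym; case: ifP; rewrite ?mulr1 ?mulr0.
rewrite -h; under eq_bigr do rewrite coefCM coefXn.
have [kn|kn] := ltnP k (mdeg n).+1.
  rewrite (bigD1 (Ordinal kn))//= eqxx mulr1 big1 ?addr0// => i ik.
  by rewrite (_ : k == i = false) ?mulr0//; apply: contraNF ik => /eqP ki; apply/eqP/val_inj.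
rewrite bin_small// big1// => i _; rewrite (_ : k == i = false) ?mulr0//.
by apply/negbTE; rewrite neq_ltn (leq_trans (ltn_ord i) kn) orbT.
Qed.

Lemma contractionP al be r ga :
  Defs.contraction al be r ga <->
  exists mu nu, [/\ al = madd mu r, be = madd nu r & ga = madd mu nu].
Proof.
split => [h|[mu [nu [-> -> ->]]] j]; last by rewrite !maddE; split; lia.
exists (msub al r), (msub be r); split; apply/fsfunP => j.
- by rewrite madd_subK// => i; case: (h i).
- by rewrite madd_subK// => i; case: (h i).
- by rewrite maddE !msubE; case: (h j); lia.
Qed.

End MultiIndexAlgebra.

Section ProductCoefficient.
Context {R : realType} {dim : option nat}.
Implicit Types (mu nu r : midx dim).

Lemma product_coeffE mu nu r :
  product_coeff (madd mu r) (madd nu r) r (madd mu nu) =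
  Num.sqrt ((mbinom (madd mu nu) mu * mbinom (madd mu r) r *
             mbinom (madd nu r) r)%N%:R) :> R.
Proof.
rewrite /product_coeff (maddC mu nu) (mfact_add nu mu) (mfact_add mu r) (mfact_add nu r).
set X := mbinom _ mu; set Y := mbinom _ r; set Z := mbinom _ r.
have p m : (mfact m)%:R != 0 :> R by rewrite pnatr_eq0 -lt0n mfact_gt0.
have [Y0|Yn0] := eqVneq (Y%:R : R) 0; first by rewrite !natrM Y0 !(mulr0, mul0r) sqrtr0.
have [Z0|Zn0] := eqVneq (Z%:R : R) 0; first by rewrite !natrM Z0 !(mulr0, mul0r) sqrtr0.
rewrite -[X in X * _]ger0_norm ?ler0n// -sqrtr_sqr -sqrtrM ?sqr_ge0//.
congr Num.sqrt; rewrite !natrM; by field; rewrite ?p ?Yn0 ?Zn0.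
Qed.

End ProductCoefficient.

(** * The graded product estimate *)

#[local] Arguments expe : simpl never.

Section ScalarProduct.
Context {R : realType} {dim : option nat}.
Local Open Scope ereal_scope.
Implicit Types (a b : midx dim -> \bar R) (al be mu nu r ga : midx dim).
Notation mtriple := (midx dim * midx dim * midx dim)%type.

Definition l2deg a (m : nat) : \bar R :=
  sqrte (\esum_(al in [set al | mdeg al = m]) (a al ^+ 2)).

(** The scalar majorant of an array product: norms in place of operators,
    and a bound [tau] on the kernel that depends on the degrees only. *)
Definition sprod (tau : nat -> nat -> \bar R) a b ga : \bar R :=
  \esum_(t in [set t : mtriple | Defs.contraction t.1.1 t.1.2 t.2 ga])
    (tau (mdeg t.1.1) (mdeg t.1.2) *
     ((product_coeff t.1.1 t.1.2 t.2 ga)%:E * (a t.1.1 * b t.1.2))).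

(** The constant that Cauchy--Schwarz and Vandermonde give for the part of a
    product with uncontracted degrees [i] and [j] and contracted degree [k]. *)
Definition hoelder_coeff (i j k : nat) : R :=
  Num.sqrt ('C(i + j, i) * 'C(i + k, k) * 'C(j + k, k))%N%:R.

(** A splitting of [al] is determined by its second part, so the sum is a
    Vandermonde sum. *)
Lemma esum_split_le al k :
  \esum_(p in [set p : midx dim * midx dim | madd p.1 p.2 = al /\ mdeg p.2 = k])
     (mbinom al p.2)%:R%:E <= ('C(mdeg al, k))%:R%:E :> \bar R.
Proof.
apply: (@le_trans _ _
    (\esum_(r in [set r | r \in box al /\ mdeg r = k]) (mbinom al r)%:R%:E)).
  apply: (@esum_inj_le _ _ _ _ _ (fun p : midx dim * midx dim => p.2)
    (fun r => (mbinom al r)%:R%:E)).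
    move=> [m1 r1] [m2 r2]; rewrite !inE/= => -[h1 _] [h2 _] h.
    by move: h1 h2; rewrite h => <- /maddIr ->.
  move=> [m1 r1] /= [<- <-]; split => //; apply/in_box; exact: mle_maddr.
rewrite (@esum_seq _ _ [seq r <- box al | mdeg r == k]).
- rewrite big_filter sumEFin -natr_sum vandermonde_box//.
- by rewrite filter_uniq// fset_uniq.
- by move=> r; rewrite lee_fin ler0n.
- move=> r; rewrite mem_filter/=; split => [[-> ->]|/andP[/eqP -> ->]]//.
  by rewrite eqxx.
Qed.

(** The square norm of [a] with one factor [mu] of each splitting held
    fixed; the binomial weights are those that make the sum over [mu]
    collapse. *)
Definition weighted_diag a k mu : \bar R :=
  \esum_(r in [set r | mdeg r = k])
    ((mbinom (madd mu r) r)%:R%:E * a (madd mu r) ^+ 2).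

Lemma weighted_diag_ge0 a k mu : 0 <= weighted_diag a k mu.
Proof. by apply: esum_ge0 => r _; rewrite mule_ge0 ?sqre_ge0// lee_fin ler0n. Qed.

Lemma esum_weighted_diag_le a i k :
  \esum_(mu in [set mu | mdeg mu = i]) weighted_diag a k mu <=
  'C(i + k, k)%:R%:E * l2deg a (i + k) ^+ 2.
Proof.
rewrite /l2deg sqr_sqrte; last by apply: esum_ge0 => *; exact: sqre_ge0.
rewrite -esumZl ?lee_fin ?ler0n//; last by move=> ?; exact: sqre_ge0.
have w0 (p : midx dim * midx dim) :
    0 <= (mbinom (madd p.1 p.2) p.2)%:R%:E * a (madd p.1 p.2) ^+ 2.
  by rewrite mule_ge0 ?sqre_ge0// lee_fin ler0n.
rewrite esum_esum; last by move=> mu r _ _; exact: (w0 (mu, r)).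
rewrite (@esum_fiber _ _ _ _ [set al | mdeg al = (i + k)%N]
  (fun p => madd p.1 p.2) _ w0); last first.
  by move=> [mu r] [/= <- <-]; rewrite mdeg_add.
apply: le_esum => al /= dal.
apply: (@le_trans _ _ (\esum_(p in [set p : midx dim * midx dim |
   madd p.1 p.2 = al /\ mdeg p.2 = k]) ((mbinom al p.2)%:R%:E * a al ^+ 2))).
  rewrite [leLHS](@eq_esum _ _ _ _ (fun p => (mbinom al p.2)%:R%:E * a al ^+ 2)).
    by apply: esum_subset => -[mu r] /= [[_ ?] ?].
  by move=> [mu r] /= [_ ->].
rewrite esumZr ?sqre_ge0//.
apply: lee_wpmul2r; first exact: sqre_ge0.
by rewrite -dal; exact: esum_split_le.
Qed.

(** For fixed uncontracted parts, the sum over the contracted multi-index.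
    The square root of the product coefficient is distributed over the two
    factors. *)
Definition cross a b k mu nu : \bar R :=
  \esum_(r in [set r | mdeg r = k])
    ((Num.sqrt (mbinom (madd mu r) r)%:R)%:E * a (madd mu r) *
     ((Num.sqrt (mbinom (madd nu r) r)%:R)%:E * b (madd nu r))).

Lemma cross_le a b k mu nu : (forall al, 0 <= a al) -> (forall al, 0 <= b al) ->
  cross a b k mu nu ^+ 2 <= weighted_diag a k mu * weighted_diag b k nu.
Proof.
move=> a0 b0.
have sq c m r : ((Num.sqrt (mbinom m r)%:R)%:E * c : \bar R) ^+ 2 =
    (mbinom m r)%:R%:E * c ^+ 2.
  by rewrite sqreM -EFin_expe sqr_sqrtr ?ler0n.
have nn c m r : 0 <= c -> 0 <= (Num.sqrt (mbinom m r)%:R)%:E * c :> \bar R.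
  by move=> c0; rewrite mule_ge0// lee_fin sqrtr_ge0.
have c0 : 0 <= cross a b k mu nu.
  by apply: esum_ge0 => r _; rewrite mule_ge0// nn.
rewrite -(sqr_sqrte (weighted_diag_ge0 a k mu)).
rewrite -(sqr_sqrte (weighted_diag_ge0 b k nu)) -sqreM.
rewrite lee_sqr ?mule_ge0 ?sqrte_ge0//.
rewrite /cross /weighted_diag.
under [X in sqrte X * _]eq_esum do rewrite -sq.
under [X in _ * sqrte X]eq_esum do rewrite -sq.
apply: esum_cauchy_schwarz => r; exact: nn.
Qed.

Lemma expe_le (x y : \bar R) k : 0 <= x -> x <= y -> x ^+ k <= y ^+ k.
Proof.
move=> x0 xy; elim: k => [|k IH]; first by rewrite !expe0.
by rewrite !expeS lee_pmul// expe_ge0.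
Qed.

Definition piece a b i j k ga : \bar R :=
  \esum_(q in [set q : midx dim * midx dim |
      [/\ madd q.1 q.2 = ga, mdeg q.1 = j & mdeg q.2 = i]])
    ((Num.sqrt (mbinom ga q.2)%:R)%:E * cross a b k q.2 q.1).

(** Two applications of Cauchy--Schwarz: [cross_le] over the contracted
    index, then one over the splittings of the result, whose weights sum to
    a binomial coefficient by Vandermonde. *)
Lemma piece_le a b i j k : (forall al, 0 <= a al) -> (forall al, 0 <= b al) ->
  l2deg (piece a b i j k) (i + j) <=
  (hoelder_coeff i j k)%:E * (l2deg a (i + k) * l2deg b (j + k)).
Proof.
move=> a0 b0.
have c0 mu nu : 0 <= cross a b k mu nu.
  apply: esum_ge0 => r _.
  by rewrite !mule_ge0// lee_fin sqrtr_ge0.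
have ww0 (q : midx dim * midx dim) :
    0 <= weighted_diag a k q.2 * weighted_diag b k q.1.
  by rewrite mule_ge0// weighted_diag_ge0.
apply: sqrte_le_sqr.
- by apply: esum_ge0 => *; exact: sqre_ge0.
- by rewrite !mule_ge0 ?sqrte_ge0// lee_fin sqrtr_ge0.
apply: (@le_trans _ _ (\esum_(ga in [set ga | mdeg ga = (i + j)%N])
   ('C(i + j, i)%:R%:E * \esum_(q in [set q : midx dim * midx dim |
       (mdeg q.1 = j /\ mdeg q.2 = i) /\ madd q.1 q.2 = ga])
     (weighted_diag a k q.2 * weighted_diag b k q.1)))).
  apply: le_esum => ga /= dga.
  apply: (@le_trans _ _ ((sqrte (\esum_(q in [set q : midx dim * midx dim |
      [/\ madd q.1 q.2 = ga, mdeg q.1 = j & mdeg q.2 = i]])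
      ((Num.sqrt (mbinom ga q.2)%:R)%:E ^+ 2)) *
      sqrte (\esum_(q in [set q : midx dim * midx dim |
      [/\ madd q.1 q.2 = ga, mdeg q.1 = j & mdeg q.2 = i]])
      (cross a b k q.2 q.1 ^+ 2))) ^+ 2)).
    apply: expe_le.
      by apply: esum_ge0 => q _; rewrite mule_ge0// lee_fin sqrtr_ge0.
    by apply: esum_cauchy_schwarz => // q; rewrite lee_fin sqrtr_ge0.
  rewrite sqreM !sqr_sqrte; try by apply: esum_ge0 => *; exact: sqre_ge0.
  apply: lee_pmul; try by apply: esum_ge0 => *; exact: sqre_ge0.
    rewrite -dga; apply: le_trans (esum_split_le ga i).
    rewrite [leLHS](@eq_esum _ _ _ _ (fun q => (mbinom ga q.2)%:R%:E)).
      by apply: esum_subset => -[nu mu] /= [].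
    by move=> q _; rewrite -EFin_expe sqr_sqrtr// ler0n.
  apply: (@le_trans _ _ (\esum_(q in [set q : midx dim * midx dim |
      [/\ madd q.1 q.2 = ga, mdeg q.1 = j & mdeg q.2 = i]])
      (weighted_diag a k q.2 * weighted_diag b k q.1))).
    by apply: le_esum => q _; exact: cross_le.
  by apply: esum_subset => -[nu mu] /= [].
rewrite esumZl ?lee_fin ?ler0n//; last by move=> ga; exact: esum_ge0.
rewrite -(@esum_fiber _ _ _ [set q : midx dim * midx dim | mdeg q.1 = j /\ mdeg q.2 = i]
   [set ga | mdeg ga = (i + j)%N] (fun q => madd q.1 q.2) _ ww0); last first.
  by move=> [nu mu] /= [<- <-]; rewrite mdeg_add addnC.
rewrite (_ : [set q | _] = [set nu | mdeg nu = j] `*`` fun=> [set mu | mdeg mu = i]);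
  last by apply/seteqP; split => -[].
rewrite -(esum_esum (a := fun nu mu => weighted_diag a k mu * weighted_diag b k nu));
  last by move=> nu mu _ _; exact: (ww0 (nu, mu)).
rewrite esum_exchange; last by move=> nu mu; exact: (ww0 (nu, mu)).
rewrite -esumM; try by move=> ?; exact: weighted_diag_ge0.
rewrite !sqreM -EFin_expe /hoelder_coeff sqr_sqrtr ?ler0n// !natrM !EFinM -!muleA.
apply: lee_wpmul2l; first by rewrite lee_fin ler0n.
apply: (@le_trans _ _ (('C(i + k, k)%:R%:E * l2deg a (i + k) ^+ 2) *
                       ('C(j + k, k)%:R%:E * l2deg b (j + k) ^+ 2))).
  apply: lee_pmul; try by apply: esum_ge0 => ? _; exact: weighted_diag_ge0.
  - exact: esum_weighted_diag_le.
  - exact: esum_weighted_diag_le.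
rewrite -!muleA le_eqVlt; apply/orP; left; apply/eqP; congr (_ * _).
by rewrite [RHS]muleCA; congr (_ * _); rewrite [RHS]muleCA.
Qed.

(** A contraction is the choice of two uncontracted parts and one contracted
    part, and the product coefficient factors accordingly; the triples are
    then sorted by the three degrees. *)
Lemma sprod_pieces tau a b ga : (forall m k, 0 <= tau m k) ->
  (forall al, 0 <= a al) -> (forall al, 0 <= b al) ->
  sprod tau a b ga = \esum_(t in [set t : nat * nat * nat | (t.1.1 + t.1.2 = mdeg ga)%N])
    (tau (t.1.1 + t.2)%N (t.1.2 + t.2)%N * piece a b t.1.1 t.1.2 t.2 ga).
Proof.
move=> tau0 a0 b0.
pose e (p : mtriple) : mtriple := (madd p.1.2 p.2, madd p.1.1 p.2, p.2).
have bij : set_bij [set p : mtriple | madd p.1.1 p.1.2 = ga]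
    [set t : mtriple | Defs.contraction t.1.1 t.1.2 t.2 ga] e.
  split.
  - move=> [[nu mu] r] /= <-; apply/contractionP; exists mu, nu.
    by split => //; exact: maddC.
  - move=> [[nu mu] r] [[nu' mu'] r'] _ _ [h1 h2 rr].
    by move: h1 h2; rewrite -rr => /maddIr -> /maddIr ->.
  - move=> [[al be] r] /= /contractionP[mu [nu [-> -> ->]]].
    by exists ((nu, mu), r) => //=; exact: maddC.
have sq0 (x : R) : 0 <= (Num.sqrt x)%:E by rewrite lee_fin sqrtr_ge0.
pose F (p : mtriple) := tau (mdeg p.1.2 + mdeg p.2)%N (mdeg p.1.1 + mdeg p.2)%N *
  ((Num.sqrt (mbinom ga p.1.2)%:R)%:E *
   ((Num.sqrt (mbinom (madd p.1.2 p.2) p.2)%:R)%:E * a (madd p.1.2 p.2) *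
    ((Num.sqrt (mbinom (madd p.1.1 p.2) p.2)%:R)%:E * b (madd p.1.1 p.2)))).
have F0 p : 0 <= F p by rewrite /F !mule_ge0.
rewrite /sprod (@reindex_esum _ _ _ _ _ e _ bij).
rewrite [LHS](@eq_esum _ _ _ _ F); last first.
  move=> [[nu mu] r] /= gaE; rewrite /F/= !mdeg_add; congr (_ * _).
  rewrite -gaE (maddC nu mu) product_coeffE !natrM !sqrtrM ?ler0n// ?mulr_ge0 ?ler0n// !EFinM.
  by rewrite -!muleA; do 2 congr (_ * _); exact: muleCA.
pose pi (p : mtriple) := (mdeg p.1.2, mdeg p.1.1, mdeg p.2).
rewrite (@esum_fiber _ _ _ _ [set t | (t.1.1 + t.1.2 = mdeg ga)%N] pi _ F0); last first.
  by move=> [[nu mu] r] /= <-; rewrite mdeg_add addnC.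
apply: eq_esum => -[[i j] k] /= ij.
rewrite -esumZl//; last first.
  by move=> q; rewrite mule_ge0// /cross; apply: esum_ge0 => r _; rewrite !mule_ge0.
under [RHS]eq_esum => q _.
  rewrite /cross -esumZl//; last by move=> r; rewrite !mule_ge0.
  rewrite -esumZl//; last by move=> r; rewrite !mule_ge0.
  over.
rewrite esum_esum; last by move=> q r _ _; rewrite !mule_ge0.
rewrite (_ : [set p | _] `&` _ = [set q : midx dim * midx dim |
      [/\ madd q.1 q.2 = ga, mdeg q.1 = j & mdeg q.2 = i]] `*`` fun=> [set r | mdeg r = k]).
  by apply: eq_esum => -[[nu mu] r] /= [[_ <- <-] <-].
apply/seteqP; split => -[[nu mu] r] /=; first by move=> [-> [-> -> ->]].
by move=> [[-> <- <-] <-].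
Qed.

Lemma l2deg_sprod_le tau a b d : (forall m k, 0 <= tau m k) ->
  (forall al, 0 <= a al) -> (forall al, 0 <= b al) ->
  l2deg (sprod tau a b) d <=
  \esum_(t in [set t : nat * nat * nat | (t.1.1 + t.1.2 = d)%N])
    (tau (t.1.1 + t.2)%N (t.1.2 + t.2)%N *
     ((hoelder_coeff t.1.1 t.1.2 t.2)%:E *
      (l2deg a (t.1.1 + t.2) * l2deg b (t.1.2 + t.2)))).
Proof.
move=> tau0 a0 b0.
have p0 i j k ga : 0 <= piece a b i j k ga.
  apply: esum_ge0 => q _; rewrite mule_ge0 ?lee_fin ?sqrtr_ge0//.
  by apply: esum_ge0 => r _; rewrite !mule_ge0// lee_fin sqrtr_ge0.
rewrite {1}/l2deg (@eq_esum _ _ _ _ (fun ga =>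
   (\esum_(t in [set t : nat * nat * nat | (t.1.1 + t.1.2 = d)%N])
    (tau (t.1.1 + t.2)%N (t.1.2 + t.2)%N * piece a b t.1.1 t.1.2 t.2 ga)) ^+ 2)); last first.
  by move=> ga /= <-; rewrite sprod_pieces.
apply: le_trans (esum_minkowski _ _ _) _; first by move=> t ga; rewrite mule_ge0.
apply: le_esum => -[[i j] k] /= <-.
under eq_esum do rewrite sqreM.
rewrite esumZl ?sqre_ge0//; last by move=> ga; exact: sqre_ge0.
rewrite sqrteM ?sqre_ge0// sqrte_sqr gee0_abs//.
by apply: lee_wpmul2l => //; exact: piece_le.
Qed.

End ScalarProduct.

Section HypercontractiveSum.
Context {R : realType}.
Variables (sigma rho eta : R).
Hypotheses (sigma1 : 1 <= sigma) (rho0 : 0 < rho) (eta0 : 0 < eta).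
Hypothesis hyp : (1 + rho ^+ 2)^-1 + (1 + eta ^+ 2)^-1 <= (1 + sigma ^+ 2)^-1.

Let s := sigma ^+ 2.
Let t := (rho ^+ 2 - s) / (1 + s).

Let s1 : 1 <= s.
Proof. by rewrite /s expr_ge1// (le_trans ler01). Qed.

Let p1s : 0 < 1 + s.
Proof. by rewrite ltr_pwDl// sqr_ge0. Qed.

Let t0 : 0 < t.
Proof.
rewrite /t; apply: divr_gt0 => //.
rewrite subr_gt0.
have e0 : 0 < (1 + eta ^+ 2)^-1 by rewrite invr_gt0 ltr_pwDl// sqr_ge0.
have : (1 + rho ^+ 2)^-1 < (1 + s)^-1 by apply: lt_le_trans hyp; rewrite ltrDl.
have p (x : R) : 0 < 1 + x ^+ 2 by rewrite ltr_pwDl// sqr_ge0.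
by rewrite ltf_pV2 ?posrE ?ltrD2l//; exact: p.
Qed.

Let rhoE : rho ^+ 2 = s * (1 + t) + t.
Proof. by rewrite /t; field; rewrite gt_eqF// p1s. Qed.

Let etaE : s * (1 + t^-1) + t^-1 <= eta ^+ 2.
Proof.
have s1' := s1; have t0' := t0.
set e := eta ^+ 2; have e0 : 0 < e by rewrite exprn_gt0.
have : (1 + e)^-1 <= (1 + s)^-1 - (1 + rho ^+ 2)^-1 by rewrite lerBrDr addrC.
have -> : (1 + s)^-1 - (1 + rho ^+ 2)^-1 = t / ((1 + s) * (1 + t)).
  rewrite rhoE; field.
  by apply/and3P; split; apply: lt0r_neq0; nra.
rewrite -[t / _]invrK lef_pV2 ?posrE; last 2 first.
- by lra.
- by rewrite invr_gt0 divr_gt0// mulr_gt0// addr_gt0.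
rewrite invf_div => h.
suff -> : s * (1 + t^-1) + t^-1 = (1 + s) * (1 + t) / t - 1 by lra.
by field; rewrite gt_eqF.
Qed.

Local Open Scope ereal_scope.

(** The left side is one term of the binomial expansion of the right side. *)
Lemma bin_pow_le i j : ('C(i + j, i)%:R * t ^+ j <= (1 + t) ^+ (i + j))%R.
Proof.
rewrite exprDn.
have jij : (j < (i + j).+1)%N by rewrite ltnS leq_addl.
rewrite (bigD1 (Ordinal jij))//= expr1n mul1r -bin_sub ?leq_addr//.
rewrite addKn mulr_natl lerDl; apply: sumr_ge0 => k _.
by rewrite expr1n mul1r mulrn_wge0// exprn_ge0// ltW.
Qed.

(** With s = sigma^2, the parameter t is chosen such that rho^2 = s (1 + t)
    + t, and the hypothesis on the radii says that then s (1 + 1/t) + 1/t <=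
    eta^2. By [bin_pow_le] each term is at most the geometric mean of one
    term in the binomial expansion of rho^(2m) and one term in that of (s (1
    + 1/t) + 1/t)^n; Cauchy--Schwarz over the contracted degree concludes. *)
Lemma hoelder_coeff_sum m n :
  \esum_(p in [set p : nat * nat * nat | (p.1.1 + p.2 = m /\ p.1.2 + p.2 = n)%N])
    (sigma ^+ (p.1.1 + p.1.2) * hoelder_coeff p.1.1 p.1.2 p.2)%:E <=
  (rho ^+ m * eta ^+ n)%:E.
Proof.
have sg0 := le_trans ler01 sigma1.
have s0 : (0 <= s)%R := le_trans ler01 s1.
have t0' := ltW t0; have ti : (0 <= t^-1)%R by rewrite invr_ge0.
set D := [set p | _].
(* Each term is at most [u] times [v], whose squares are terms of binomial
   expansions. *)
pose u (p : nat * nat * nat) : R := Num.sqrt ('C(m, p.2)%:R *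
   ((s * (1 + t)) ^+ (m - p.2) * t ^+ p.2)).
pose v (p : nat * nat * nat) : R := Num.sqrt ('C(n, p.2)%:R *
   ((s * (1 + t^-1)) ^+ (n - p.2) * t^-1 ^+ p.2)).
apply: (@le_trans _ _ (\esum_(p in D) ((u p)%:E * (v p)%:E))).
  apply: le_esum => -[[i j] k] /= [im jn]; rewrite -EFinM lee_fin /u /v/=.
  have -> : (m - k = i)%N by rewrite -im addnK.
  have -> : (n - k = j)%N by rewrite -jn addnK.
  rewrite -sqrtrM; last by rewrite !mulr_ge0 ?ler0n ?exprn_ge0// !mulr_ge0 ?addr_ge0.
  have -> : (sigma ^+ (i + j) = Num.sqrt (s ^+ (i + j)))%R.
    by rewrite /s -exprM mulnC exprM sqrtr_sqr ger0_norm// exprn_ge0.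
  rewrite -sqrtrM ?exprn_ge0//.
  apply: ler_wsqrtr; rewrite im jn !natrM [((s * (1 + t)) ^+ i)%R]exprMn [((s * (1 + t^-1)) ^+ j)%R]exprMn.
  rewrite (_ : ('C(m, k)%:R * (s ^+ i * (1 + t) ^+ i * t ^+ k) *
      ('C(n, k)%:R * (s ^+ j * (1 + t^-1) ^+ j * t^-1 ^+ k)) =
      s ^+ (i + j) * ((1 + t) ^+ i * (1 + t^-1) ^+ j * 'C(m, k)%:R * 'C(n, k)%:R))%R); last first.
    rewrite exprD exprVn; field; apply: lt0r_neq0; exact: exprn_gt0.
  apply: ler_wpM2l; first exact: exprn_ge0.
  apply: ler_wpM2r; first exact: ler0n.
  apply: ler_wpM2r; first exact: ler0n.
  have -> : ((1 + t^-1) = (1 + t) / t)%R by field; rewrite gt_eqF.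
  rewrite expr_div_n mulrA -exprD ler_pdivlMr ?exprn_gt0//.
  exact: bin_pow_le.
apply: le_trans (esum_cauchy_schwarz _ _ _) _.
- by move=> p; rewrite lee_fin sqrtr_ge0.
- by move=> p; rewrite lee_fin sqrtr_ge0.
have X0 (x y : R) N k : (0 <= x -> 0 <= y -> 0 <= 'C(N, k)%:R * (x ^+ (N - k) * y ^+ k))%R.
  by move=> x0 y0; rewrite !mulr_ge0 ?exprn_ge0.
have binom (x y : R) N : (0 <= x)%R -> (0 <= y)%R -> (forall p, D p -> p.2 <= N)%N ->
    {in D &, injective (fun p => p.2)} ->
    \esum_(p in D) ('C(N, p.2)%:R * (x ^+ (N - p.2) * y ^+ p.2))%:E <=
      ((x + y) ^+ N)%:E.
  move=> x0 y0 DN Dinj.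
  apply: le_trans (@esum_inj_le _ _ _ D [set k | (k < N.+1)%N] (fun p => p.2)
    (fun k => ('C(N, k)%:R * (x ^+ (N - k) * y ^+ k))%:E) Dinj DN) _.
  rewrite (@esum_seq _ _ (iota 0 N.+1)) ?iota_uniq//.
  - rewrite -[N.+1]subn0 -/(index_iota 0 N.+1) big_mkord sumEFin lee_fin exprDn.
    by apply: ler_sum => k _; rewrite mulr_natl.
  - by move=> k; rewrite lee_fin X0.
  - by move=> k; rewrite mem_iota/=.
(* For fixed [m] and [n] the contracted degree determines the other two. *)
have Dinj : {in D &, injective (fun p : nat * nat * nat => p.2)}.
  move=> [[i j] k] [[i' j'] k']; rewrite !inE /D/= => -[h1 h2] [h3 h4] kk.
  by subst k'; congr (_, _, _); apply: (@addIn k); rewrite ?h1 ?h2 ?h3 ?h4.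
apply: (@le_trans _ _ (sqrte ((rho ^+ 2) ^+ m)%:E * sqrte ((eta ^+ 2) ^+ n)%:E)); last first.
  have sq (x : R) N : (0 <= x)%R -> (Num.sqrt ((x ^+ 2) ^+ N) = x ^+ N)%R.
    by move=> x0; rewrite -exprM mulnC exprM sqrtr_sqr ger0_norm// exprn_ge0.
  by rewrite /= -EFinM !sq// ltW.
apply: lee_pmul; rewrite ?sqrte_ge0//; apply: sqrte_le.
- by apply: esum_ge0 => *; exact: sqre_ge0.
- rewrite [leLHS](@eq_esum _ _ _ _ (fun p => ('C(m, p.2)%:R *
      ((s * (1 + t)) ^+ (m - p.2) * t ^+ p.2))%:E)).
    rewrite rhoE; apply: binom => //; first by rewrite mulr_ge0// addr_ge0.
    by move=> [[i j] k] [/= <- _]; rewrite leq_addl.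
  by move=> p _; rewrite /u -EFin_expe sqr_sqrtr// X0// mulr_ge0// addr_ge0.
- by apply: esum_ge0 => *; exact: sqre_ge0.
- rewrite [leLHS](@eq_esum _ _ _ _ (fun p => ('C(n, p.2)%:R *
      ((s * (1 + t^-1)) ^+ (n - p.2) * t^-1 ^+ p.2))%:E)).
    apply: (@le_trans _ _ (((s * (1 + t^-1)) + t^-1) ^+ n)%:E).
      apply: binom => //; first by rewrite mulr_ge0// addr_ge0.
      by move=> [[i j] k] [/= _ <-]; rewrite leq_addl.
    by rewrite lee_fin lerXn2r// nnegrE ?sqr_ge0// addr_ge0// mulr_ge0// addr_ge0.
  by move=> p _; rewrite /v -EFin_expe sqr_sqrtr// X0// mulr_ge0// addr_ge0.
Qed.

Context {dim : option nat}.

(** Minkowski's inequality over the pieces of [sprod_pieces] reduces the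
    product estimate to the numerical sum over the contracted degree in
    [hoelder_coeff_sum]. *)
Lemma sprod_norm_le tau (a b : midx dim -> \bar R) : (forall m k, 0 <= tau m k) ->
  (forall al, 0 <= a al) -> (forall al, 0 <= b al) ->
  \esum_(d in [set: nat]) ((sigma ^+ d)%:E * l2deg (sprod tau a b) d) <=
  \esum_(m in [set: nat]) \esum_(n in [set: nat])
    (tau m n * (((rho ^+ m)%:E * l2deg a m) * ((eta ^+ n)%:E * l2deg b n))).
Proof.
move=> tau0 a0 b0.
have sg0 d : 0 <= (sigma ^+ d)%:E by rewrite lee_fin exprn_ge0// (le_trans ler01 sigma1).
have h0 i j k : 0 <= (hoelder_coeff i j k : R)%:E by rewrite lee_fin sqrtr_ge0.
have l0 c m : 0 <= l2deg (c : midx dim -> \bar R) m by exact: sqrte_ge0.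
pose F (p : nat * nat * nat) := (sigma ^+ (p.1.1 + p.1.2))%:E *
  (tau (p.1.1 + p.2)%N (p.1.2 + p.2)%N *
   ((hoelder_coeff p.1.1 p.1.2 p.2)%:E *
    (l2deg a (p.1.1 + p.2) * l2deg b (p.1.2 + p.2)))).
have F0 p : 0 <= F p by rewrite /F !mule_ge0.
apply: (@le_trans _ _ (\esum_(p in [set: nat * nat * nat]) F p)).
  rewrite [leRHS](@esum_fiber _ _ _ _ [set: nat] (fun p => p.1.1 + p.1.2)%N)//.
  apply: le_esum => d _.
  rewrite [leRHS](@eq_esum _ _ _ F (fun p => (sigma ^+ d)%:E *
     (tau (p.1.1 + p.2)%N (p.1.2 + p.2)%N *
      ((hoelder_coeff p.1.1 p.1.2 p.2)%:E *
       (l2deg a (p.1.1 + p.2) * l2deg b (p.1.2 + p.2)))))); last by move=> p [_ /= <-].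
  rewrite setTI esumZl//; last by move=> p; rewrite !mule_ge0.
  by apply: lee_wpmul2l => //; exact: l2deg_sprod_le.
rewrite (@esum_fiber _ _ _ _ [set: nat * nat] (fun p => (p.1.1 + p.2, p.1.2 + p.2)%N))//.
rewrite [leRHS]esum_esum; last by move=> m n _ _; rewrite !mule_ge0// lee_fin exprn_ge0// ltW.
rewrite (_ : [set: nat] `*`` (fun=> [set: nat]) = setT); last by apply/seteqP; split.
apply: le_esum => -[m n] _ /=; rewrite setTI.
rewrite [leLHS](@eq_esum _ _ _ F (fun p => (sigma ^+ (p.1.1 + p.1.2) *
     hoelder_coeff p.1.1 p.1.2 p.2)%:E * (tau m n * (l2deg a m * l2deg b n)))); last first.
  move=> [[i j] k] [/= <- <-]; rewrite /F/= EFinM -!muleA; congr (_ * _).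
  by rewrite muleCA.
rewrite esumZr ?mule_ge0//; last first.
  by move=> p; rewrite EFinM mule_ge0.
apply: (@le_trans _ _ ((rho ^+ m * eta ^+ n)%:E * (tau m n * (l2deg a m * l2deg b n)))).
  apply: lee_wpmul2r; first by rewrite !mule_ge0.
  rewrite (_ : [set p | _] = [set p : nat * nat * nat |
     (p.1.1 + p.2 = m /\ p.1.2 + p.2 = n)%N]); first exact: hoelder_coeff_sum.
  by apply/seteqP; split => -[[i j] k] /= [-> ->].
rewrite EFinM muleCA; apply: lee_wpmul2l => //.
by rewrite muleACA.
Qed.

End HypercontractiveSum.

(** * Complex Hilbert spaces *)

Section ComplexScalars.
Context {R : realType}.
Implicit Types (z w : R[i]) (x : R).

Lemma ReD z w : complex.Re (z + w) = complex.Re z + complex.Re w.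
Proof. by case: z w => [a b] [c d]. Qed.

Lemma ReN z : complex.Re (- z) = - complex.Re z.
Proof. by case: z. Qed.

Lemma ReM z w : complex.Re (z * w) =
  complex.Re z * complex.Re w - complex.Im z * complex.Im w.
Proof. by case: z w => [a b] [c d]. Qed.

Lemma ImM z w : complex.Im (z * w) =
  complex.Re z * complex.Im w + complex.Im z * complex.Re w.
Proof. by case: z w => [a b] [c d]. Qed.

Lemma Re_rM x z : complex.Re (x%:C%C * z) = x * complex.Re z.
Proof. by rewrite ReM /= mul0r subr0. Qed.

Lemma Im_rM x z : complex.Im (x%:C%C * z) = x * complex.Im z.
Proof. by rewrite ImM /= mul0r addr0. Qed.

Lemma Re_sum (I : Type) (s : seq I) (P : pred I) (F : I -> R[i]) :
  complex.Re (\sum_(i <- s | P i) F i) = \sum_(i <- s | P i) complex.Re (F i).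
Proof. by elim/big_rec2: _ => //= i x y _ <-; rewrite ReD. Qed.

Lemma Re_conj z : complex.Re (z^*)%R = complex.Re z.
Proof. by case: z. Qed.

Definition cmod z : R := complex.Re `|z|.

Lemma cmodE z : `|z| = (cmod z)%:C%C.
Proof. by rewrite /cmod RRe_real// normr_real. Qed.

Lemma cmod_ge0 z : 0 <= cmod z.
Proof. by rewrite -lecR -cmodE normr_ge0. Qed.

Lemma cmodM z w : cmod (z * w) = cmod z * cmod w.
Proof. by apply: complexI; rewrite -cmodE normrM !cmodE -rmorphM. Qed.

Lemma cmod_real x : cmod x%:C%C = `|x|.
Proof. by apply: complexI; rewrite -cmodE normc_def /= expr0n/= addr0 sqrtr_sqr. Qed.

Lemma cmodD z w : cmod (z + w) <= cmod z + cmod w.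
Proof. by rewrite -lecR rmorphD/= -!cmodE ler_normD. Qed.

Lemma cmod0 : cmod 0 = 0.
Proof. by rewrite /cmod normr0. Qed.

Lemma cmodN z : cmod (- z) = cmod z.
Proof. by rewrite /cmod normrN. Qed.

Lemma cmod_sqr z : cmod z ^+ 2 = complex.Re z ^+ 2 + complex.Im z ^+ 2.
Proof. by apply: complexI; rewrite rmorphXn/= -cmodE -add_Re2_Im2. Qed.

Lemma normr_Re_le z : `|complex.Re z| <= cmod z.
Proof. by rewrite -lecR -cmodE normc_ge_Re. Qed.

End ComplexScalars.

Section HilbertGeometry.
Context {R : realType} {E : completeNormedModType R[i]}.
Implicit Types (x y : E) (c : R[i]) (t : R).

Lemma rnormE x : `|x| = (rnorm x)%:C%C.
Proof. by rewrite /rnorm RRe_real// normr_real. Qed.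

Lemma rnorm_ge0 x : 0 <= rnorm x.
Proof. by rewrite -lecR -rnormE normr_ge0. Qed.

Lemma rnorm0 : rnorm (0 : E) = 0.
Proof. by rewrite /rnorm normr0. Qed.

Lemma rnormN x : rnorm (- x) = rnorm x.
Proof. by rewrite /rnorm normrN. Qed.

Lemma rnormB x y : rnorm (x - y) = rnorm (y - x).
Proof. by rewrite -rnormN opprB. Qed.

Lemma rnormD x y : rnorm (x + y) <= rnorm x + rnorm y.
Proof. by rewrite -lecR rmorphD/= -!rnormE ler_normD. Qed.

Lemma rnormZ c x : rnorm (c *: x) = cmod c * rnorm x.
Proof. by apply: complexI; rewrite -rnormE normrZ cmodE rnormE -rmorphM. Qed.

Lemma rnorm_eq0 x : rnorm x = 0 -> x = 0.
Proof. by move=> h; apply/eqP; rewrite -normr_eq0 rnormE h. Qed.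

Lemma rnorm_sum (I : Type) (s : seq I) (F : I -> E) :
  rnorm (\sum_(i <- s) F i) <= \sum_(i <- s) rnorm (F i).
Proof.
elim/big_rec2: _ => [|i y x _ h]; first by rewrite rnorm0.
by rewrite (le_trans (rnormD _ _))// lerD2l.
Qed.

Lemma rnorm_dist x y : `|rnorm x - rnorm y| <= rnorm (x - y).
Proof.
rewrite ler_norml; apply/andP; split.
  by rewrite lerNl opprB lerBlDr (rnormB x) (le_trans _ (rnormD _ _)) ?subrK.
by rewrite lerBlDr (le_trans _ (rnormD _ _)) ?subrK.
Qed.

Lemma rnorm_cvg (u : nat -> E) (l : E) :
  rnorm (l - u n) @[n --> \oo] --> (0 : R) <-> u n @[n --> \oo] --> l.
Proof.
split => h.
  apply/cvgrPdist_lt => eps e0.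
  have [e ee] : exists e : R, eps = e%:C%C.
    by apply/complex_realP; exact: gtr0_real.
  move: e0; rewrite ee ltcR => e0.
  move/cvgrPdist_lt : h => /(_ e e0); apply: filterS => n.
  by rewrite sub0r normrN ger0_norm ?rnorm_ge0// rnormE ltcR.
apply/cvgrPdist_lt => e e0.
move/cvgrPdist_lt : h => /(_ e%:C%C); rewrite ltcR => /(_ e0); apply: filterS => n.
by rewrite sub0r normrN ger0_norm ?rnorm_ge0// rnormE ltcR.
Qed.

Lemma rnorm_cauchy (u : nat -> E) :
  (forall eps : R, 0 < eps -> exists N, forall n m, (N <= n)%N -> (N <= m)%N ->
    rnorm (u n - u m) <= eps) ->
  exists l, rnorm (l - u n) @[n --> \oo] --> (0 : R).
Proof.
move=> h; suff cu : cvg (u n @[n --> \oo]).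
  by exists (lim (u n @[n --> \oo])); apply/rnorm_cvg.
apply: cauchy_cvg; apply: cauchy_exP => eps e0.
have [e ee] : exists e : R, eps = e%:C%C.
  by apply/complex_realP; exact: gtr0_real.
move: e0; rewrite ee ltcR => e0.
have [N hN] := h _ (divr_gt0 e0 (ltr0n R 2)).
exists (u N), N => // n /= Nn; rewrite -ball_normE/= rnormE ltcR.
apply: le_lt_trans (_ : e / 2 < e); last by lra.
exact: hN.
Qed.

Lemma rnorm_cvg_norm (u : nat -> E) l :
  rnorm (l - u n) @[n --> \oo] --> (0 : R) -> rnorm (u n) @[n --> \oo] --> rnorm l.
Proof.
move=> h; apply/cvgrPdist_le => e e0.
move/cvgrPdist_le : h => /(_ e e0); apply: filterS => n.
rewrite sub0r normrN (ger0_norm (rnorm_ge0 _)); apply: le_trans.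
exact: rnorm_dist.
Qed.

Section Dot.
Variable dot : {dot E for Num.conj}.
Hypothesis hE : norm_from_dot dot.

Lemma dotDl x y z : dot (x + y) z = dot x z + dot y z.
Proof. by rewrite linearDl. Qed.
Lemma dotDr x y z : dot z (x + y) = dot z x + dot z y.
Proof. by rewrite linearDr. Qed.
Lemma dotZl c x y : dot (c *: x) y = c * dot x y.
Proof. by rewrite linearZl_LR. Qed.
Lemma dotZr c x y : dot x (c *: y) = (c^*)%R * dot x y.
Proof. by rewrite linearZr_LR. Qed.
Lemma dotNl x y : dot (- x) y = - dot x y.
Proof. by rewrite linearNl. Qed.
Lemma dotBl x y z : dot (x - y) z = dot x z - dot y z.
Proof. by rewrite dotDl dotNl. Qed.
Lemma dot0l x : dot 0 x = 0.
Proof. by rewrite linear0l. Qed.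
Lemma dot_suml (I : Type) (s : seq I) (F : I -> E) y :
  dot (\sum_(i <- s) F i) y = \sum_(i <- s) dot (F i) y.
Proof. by elim/big_rec2: _ => [|i u v _ <-]; rewrite ?dot0l ?dotDl. Qed.
Lemma dot_sumr (I : Type) (s : seq I) (F : I -> E) y :
  dot y (\sum_(i <- s) F i) = \sum_(i <- s) dot y (F i).
Proof. by elim/big_rec2: _ => [|i u v _ <-]; rewrite ?linear0r ?dotDr. Qed.
Lemma dotC x y : dot x y = ((dot y x)^*)%R.
Proof. by rewrite hermC expr0 mul1r. Qed.

Lemma rnorm_sqr x : rnorm x ^+ 2 = complex.Re (dot x x).
Proof. by rewrite hE rnormE -rmorphXn. Qed.

Lemma rnorm_sqrD x y :
  rnorm (x + y) ^+ 2 = rnorm x ^+ 2 + 2 * complex.Re (dot x y) + rnorm y ^+ 2.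
Proof.
rewrite !rnorm_sqr dotDl !dotDr !ReD (dotC y x) Re_conj; ring.
Qed.

Lemma cauchy_schwarz_dot x y : cmod (dot x y) <= rnorm x * rnorm y.
Proof.
have [y0|yn0] := eqVneq (rnorm y) 0.
  by rewrite y0 mulr0 (rnorm_eq0 y0) linear0r cmod0.
have yp : 0 < rnorm y by rewrite lt_neqAle eq_sym yn0 rnorm_ge0.
set c := - (dot x y / (rnorm y ^+ 2)%:C%C).
have : 0 <= rnorm (x + c *: y) ^+ 2 by exact: sqr_ge0.
rewrite rnorm_sqrD dotZr rnormZ exprMn.
have mc : cmod c = cmod (dot x y) / rnorm y ^+ 2.
  by rewrite /c cmodN -fmorphV/= cmodM cmod_real ger0_norm ?invr_ge0 ?sqr_ge0.
have -> : complex.Re ((c^*)%R * dot x y) = - (cmod (dot x y) ^+ 2 / rnorm y ^+ 2).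
  rewrite /c rmorphN/= mulNr ReN; congr (- _).
  rewrite rmorphM/= -fmorphV/= [((_^-1)%:C%C)^*]conj_Creal; last first.
    by apply/complex_realP; exists (rnorm y ^+ 2)^-1.
  rewrite mulrAC [_^* * _]mulrC -normCK cmodE -rmorphXn mulrC Re_rM/= mulrC.
  by [].
rewrite mc => h; rewrite -ler_sqr ?nnegrE ?cmod_ge0 ?mulr_ge0 ?rnorm_ge0// exprMn.
move: h; set m := cmod _ ^+ 2 => h.
have y2 : 0 < rnorm y ^+ 2 by rewrite exprn_gt0.
rewrite -ler_pdivrMr//.
suff e : rnorm x ^+ 2 + 2 * - (m / rnorm y ^+ 2) + (cmod (dot x y) / rnorm y ^+ 2) ^+ 2 * rnorm y ^+ 2 = rnorm x ^+ 2 - m / rnorm y ^+ 2.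
  by move: h; rewrite e subr_ge0.
by rewrite /m; field.
Qed.

Lemma Re_dot_le x y : `|complex.Re (dot x y)| <= rnorm x * rnorm y.
Proof. exact: le_trans (normr_Re_le _) (cauchy_schwarz_dot x y). Qed.

End Dot.
End HilbertGeometry.

(** * Orthonormal expansions and Hilbert--Schmidt operators *)

Lemma cvg_le_ereal (R : realType) (u : nat -> R) (l : R) (S : \bar R) :
  u n @[n --> \oo] --> l -> (\forall n \near \oo, (u n)%:E <= S)%E -> (l%:E <= S)%E.
Proof.
case: S => [s| |]; first 2 last.
- by move=> _ [N _ /(_ N (leqnn N))].
- move=> ul uS; rewrite lee_fin -(cvg_lim (@Rhausdorff R) ul).
  by apply: limr_le; [apply/cvg_ex; exists l|move: uS; apply: filterS => n; rewrite lee_fin].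
- by rewrite leey.
Qed.

Section IndexEnumeration.
Context {dim : option nat}.

(** The basis indices below [n] as a list: partial sums along these lists
    make expansions in a finite or infinite basis ordinary limits of
    sequences. *)
Definition ixs (n : nat) : seq (ix dim) := pmap insub (iota 0 n).

Lemma mem_ixs (k : ix dim) n : (k \in ixs n) = (val k < n)%N.
Proof. by rewrite /ixs mem_pmap_sub mem_iota. Qed.

Lemma ixs_uniq n : uniq (ixs n).
Proof. by rewrite pmap_sub_uniq// iota_uniq. Qed.

Lemma fsbig_ixs (A : zmodType) n (F : ix dim -> A) :
  \sum_(k \in [set k | (val k < n)%N]) F k = \sum_(k <- ixs n) F k.
Proof.
rewrite (fsbig_seq _ _ (ixs_uniq n)); apply: eq_fsbigl.
by apply/seteqP; split => k /=; rewrite mem_ixs.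
Qed.

Lemma ixs_sub (X : {fset ix dim}) : exists N, forall n, (N <= n)%N ->
  {subset X <= ixs n}.
Proof.
exists (\max_(k <- X) (val k).+1)%N => n Nn k kX; rewrite mem_ixs.
by apply: leq_trans Nn; apply: (@leq_bigmax_seq _ _ _ (fun k => (val k).+1)).
Qed.

End IndexEnumeration.

Section OrthonormalBasis.
Context {R : realType} {E : completeNormedModType R[i]} {dimE : option nat}.
Variables (dot : {dot E for Num.conj}) (f : ix dimE -> E).
Hypotheses (hE : norm_from_dot dot) (hf : orthonormal_basis dot f).
Implicit Types (x y : E) (k l : ix dimE).

Lemma dot_basis j k : dot (f j) (f k) = (j == k)%:R.
Proof. exact: hf.1. Qed.

Lemma dot_comb (s : seq (ix dimE)) (c : ix dimE -> R[i]) j : uniq s ->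
  dot (\sum_(k <- s) c k *: f k) (f j) = if j \in s then c j else 0.
Proof.
move=> us; rewrite dot_suml; under eq_bigr do rewrite dotZl dot_basis.
case: ifPn => js.
  rewrite (bigD1_seq j)//= eqxx mulr1 big1 ?addr0// => k kj.
  by rewrite (negbTE kj) mulr0.
rewrite big_seq big1// => k ks; case: eqVneq => [kj|]; last by rewrite mulr0.
by rewrite -kj ks in js.
Qed.

Lemma rnorm_sqr_comb (s : seq (ix dimE)) (c : ix dimE -> R[i]) : uniq s ->
  rnorm (\sum_(k <- s) c k *: f k) ^+ 2 = \sum_(k <- s) cmod (c k) ^+ 2.
Proof.
move=> us; rewrite (rnorm_sqr hE) dot_sumr Re_sum big_seq [RHS]big_seq.
apply: eq_bigr => k ks; rewrite dotZr dot_comb// ks mulrC -normCK cmodE.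
by rewrite -rmorphXn.
Qed.

Definition proj_on (s : seq (ix dimE)) x := \sum_(k <- s) dot x (f k) *: f k.

Lemma dot_residual s x (c : ix dimE -> R[i]) : uniq s ->
  dot (x - proj_on s x) (\sum_(k <- s) c k *: f k) = 0.
Proof.
move=> us; rewrite dot_sumr big_seq big1// => k ks.
by rewrite dotZr dotBl dot_comb// ks subrr mulr0.
Qed.

Lemma pythagoras s x : uniq s ->
  rnorm (x - proj_on s x) ^+ 2 = rnorm x ^+ 2 - \sum_(k <- s) cmod (dot x (f k)) ^+ 2.
Proof.
move=> us; have : rnorm ((x - proj_on s x) + proj_on s x) ^+ 2 = rnorm x ^+ 2.
  by rewrite subrK.
rewrite (rnorm_sqrD hE) dot_residual// mulr0 addr0 rnorm_sqr_comb// => <-.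
by rewrite addrK.
Qed.

Lemma bessel s x : uniq s -> \sum_(k <- s) cmod (dot x (f k)) ^+ 2 <= rnorm x ^+ 2.
Proof. by move=> us; rewrite -subr_ge0 -pythagoras// sqr_ge0. Qed.

Lemma proj_on_le s x : uniq s -> rnorm (proj_on s x) <= rnorm x.
Proof.
move=> us; rewrite -ler_sqr ?nnegrE ?rnorm_ge0//.
by rewrite rnorm_sqr_comb// bessel.
Qed.

Lemma best_approximation s x (c : ix dimE -> R[i]) : uniq s ->
  rnorm (x - proj_on s x) <= rnorm (x - \sum_(k <- s) c k *: f k).
Proof.
move=> us; rewrite -ler_sqr ?nnegrE ?rnorm_ge0//.
have -> : x - \sum_(k <- s) c k *: f k =
    (x - proj_on s x) + \sum_(k <- s) (dot x (f k) - c k) *: f k.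
  under [in RHS]eq_bigr do rewrite scalerBl; rewrite sumrB /proj_on.
  by rewrite addrA subrK.
rewrite [leRHS](rnorm_sqrD hE) (dot_residual x (fun k => dot x (f k) - c k) us).
by rewrite mulr0 addr0 lerDl sqr_ge0.
Qed.

(** By density some finite combination of the basis is close to [x], and the
    projections onto larger spans approximate at least as well. *)
Lemma expansion_cvg x : rnorm (x - proj_on (ixs n) x) @[n --> \oo] --> (0 : R).
Proof.
apply/cvgrPdist_lt => e e0.
have [v [xv [c _ cv]]] : ball x e%:C%C `&` range (fun c : {fsfun ix dimE -> R[i] with 0} =>
    \sum_(k <- finsupp c) c k *: f k) !=set0.
  apply: hf.2; last by apply: ball_open; rewrite ltcR.
  by exists x; apply: ballxx; rewrite ltcR.
have [N hN] := ixs_sub (finsupp c).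
exists N => // n /= Nn; rewrite sub0r normrN ger0_norm ?rnorm_ge0//.
apply: le_lt_trans (best_approximation x c (ixs_uniq n)) _.
move: xv; rewrite -ball_normE/= rnormE ltcR -cv.
rewrite (@big_fset_incl _ _ _ _ (finsupp c) [fset k in ixs n]%fset).
- rewrite (_ : \sum_(k <- [fset k in ixs n]%fset) c k *: f k = \sum_(k <- ixs n) c k *: f k)//.
  apply: perm_big; apply: uniq_perm => //; first exact: ixs_uniq.
  by move=> k; rewrite in_fset.
- by apply/fsubsetP => k /hN; rewrite in_fset; exact.
- by move=> k _ kc; rewrite fsfun_dflt// scale0r.
Qed.

Lemma parseval x :
  \esum_(k in [set: ix dimE]) (cmod (dot x (f k)) ^+ 2)%:E = (rnorm x ^+ 2)%:E.
Proof.
apply/eqP; rewrite eq_le; apply/andP; split.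
  apply: ge_ereal_sup => _ [X [finX _] <-].
  by rewrite fsbig_finite//= sumEFin lee_fin bessel// fset_uniq.
have h : \sum_(k <- ixs n) cmod (dot x (f k)) ^+ 2 @[n --> \oo] --> rnorm x ^+ 2.
  have -> : (fun n => \sum_(k <- ixs n) cmod (dot x (f k)) ^+ 2) =
      (fun n => rnorm x ^+ 2 - rnorm (x - proj_on (ixs n) x) ^+ 2).
    by apply/funext => n; rewrite pythagoras ?ixs_uniq// opprB addrC subrK.
  rewrite -[X in _ --> X]subr0; apply: cvgB; first exact: cvg_cst.
  rewrite [X in _ --> X](_ : 0 = 0 ^+ 2); last by rewrite expr0n.
  by rewrite expr2; under eq_cvg do rewrite expr2; apply: cvgM; exact: expansion_cvg.
apply: cvg_le_ereal h _; apply: nearW => n.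
apply: esum_ge; exists [set` ixs n]; first by split => //; exact: finite_seq.
by rewrite -fsbig_seq ?ixs_uniq// sumEFin.
Qed.

Lemma expansion_cvgE x : proj_on (ixs n) x @[n --> \oo] --> x.
Proof. exact/rnorm_cvg/expansion_cvg. Qed.

End OrthonormalBasis.

Section LinearMaps.
Context {R : realType} {E : completeNormedModType R[i]}.
Variables (A : E -> E).
Hypothesis linA : linear A.

Lemma linear_map0 : A 0 = 0.
Proof. by have := linA (-1) 0 0; rewrite scaler0 addr0 scaleN1r addNr. Qed.
Lemma linear_mapD x y : A (x + y) = A x + A y.
Proof. by have := linA 1 x y; rewrite !scale1r. Qed.
Lemma linear_mapZ c x : A (c *: x) = c *: A x.
Proof. by have := linA c x 0; rewrite !addr0 linear_map0 addr0. Qed.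
Lemma linear_mapN x : A (- x) = - A x.
Proof. by rewrite -scaleN1r linear_mapZ scaleN1r. Qed.
Lemma linear_mapB x y : A (x - y) = A x - A y.
Proof. by rewrite linear_mapD linear_mapN. Qed.
Lemma linear_map_sum (I : Type) (s : seq I) (F : I -> E) :
  A (\sum_(i <- s) F i) = \sum_(i <- s) A (F i).
Proof. by elim/big_rec2: _ => [|i u v _ <-]; rewrite ?linear_map0 ?linear_mapD. Qed.

Lemma bounded_linear_continuous (K : R) :
  (forall x, rnorm (A x) <= K * rnorm x) -> continuous A.
Proof.
move=> bA x; apply/cvgrPdist_lt => eps e0.
have [e ee] : exists e : R, eps = e%:C%C.
  by apply/complex_realP; exact: gtr0_real.
move: e0; rewrite ee ltcR => e0.
have K0 : 0 < `|K| + 1 by rewrite ltr_wpDl.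
near=> y; rewrite -linear_mapB rnormE ltcR (le_lt_trans (bA _))//.
apply: (@le_lt_trans _ _ ((`|K| + 1) * rnorm (x - y))).
  apply: ler_wpM2r; first exact: rnorm_ge0.
  by rewrite (le_trans (ler_norm _))// lerDl.
rewrite mulrC -ltr_pdivlMr// -ltcR -rnormE; near: y.
apply: (@cvgr_dist_lt _ _ _ (nbhs x) _ id x); first exact: cvg_id.
by rewrite ltcR divr_gt0.
Unshelve. all: by end_near. Qed.

End LinearMaps.

Section HilbertSchmidtNorm.
Context {R : realType} {E : completeNormedModType R[i]} {dimE : option nat}.
Variables (dot : {dot E for Num.conj}) (f : ix dimE -> E).
Hypotheses (hE : norm_from_dot dot) (hf : orthonormal_basis dot f).
Implicit Types (A B : E -> E) (x y : E) (c : R[i]).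
Local Open Scope ereal_scope.

Definition hsn A : \bar R := sqrte (hs_norm2 f A).

Lemma hs_norm2_ge0 A : 0 <= hs_norm2 f A.
Proof. by apply: esum_ge0 => k _; rewrite lee_fin sqr_ge0. Qed.

Lemma hsn_ge0 A : 0 <= hsn A. Proof. exact: sqrte_ge0. Qed.

Lemma hsn_sqr A : hsn A ^+ 2 = hs_norm2 f A.
Proof. by rewrite sqr_sqrte// hs_norm2_ge0. Qed.

Lemma hs_norm2E A : hs_norm2 f A = \esum_(k in setT) ((rnorm (A (f k)))%:E ^+ 2).
Proof. by apply: eq_esum => k _; rewrite EFin_expe. Qed.

Lemma eq_hs_norm2 A B : (forall k, A (f k) = B (f k)) -> hs_norm2 f A = hs_norm2 f B.
Proof. by move=> AB; apply: eq_esum => k _; rewrite AB. Qed.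

Lemma hsnD A B : hsn (fun x => A x + B x)%R <= hsn A + hsn B.
Proof.
rewrite /hsn !hs_norm2E; apply: le_trans (esum2_minkowski _ _ _); last 2 first.
- by move=> k; rewrite lee_fin rnorm_ge0.
- by move=> k; rewrite lee_fin rnorm_ge0.
apply: sqrte_le; first by apply: esum_ge0 => *; exact: sqre_ge0.
apply: le_esum => k _; rewrite -EFinD -!EFin_expe lee_fin.
by rewrite lerXn2r ?nnegrE ?addr_ge0 ?rnorm_ge0 ?rnormD.
Qed.

Lemma hs_norm2Z c A : hs_norm2 f (fun x => c *: A x)%R = (cmod c ^+ 2)%:E * hs_norm2 f A.
Proof.
rewrite -esumZl ?lee_fin ?sqr_ge0//; last by move=> k; rewrite lee_fin sqr_ge0.
by apply: eq_esum => k _; rewrite rnormZ exprMn EFinM.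
Qed.

Lemma hsnZ c A : hsn (fun x => c *: A x)%R = (cmod c)%:E * hsn A.
Proof.
rewrite /hsn hs_norm2Z sqrteM ?lee_fin ?sqr_ge0//=.
by rewrite sqrtr_sqr ger0_norm ?cmod_ge0.
Qed.

Lemma hsn0 : hsn (fun=> 0%R) = 0.
Proof. by rewrite /hsn /hs_norm2 esum1 ?sqrte0// => k _; rewrite rnorm0 expr0n. Qed.

Lemma hsnN A : hsn (fun x => - A x)%R = hsn A.
Proof. by rewrite /hsn; congr sqrte; apply: eq_esum => k _; rewrite rnormN. Qed.

Lemma hsnB A B : hsn (fun x => A x - B x)%R <= hsn A + hsn B.
Proof. by rewrite -(hsnN B); exact: hsnD. Qed.

Lemma hsn_sum (I : Type) (s : seq I) (F : I -> E -> E) :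
  hsn (fun x => \sum_(i <- s) F i x)%R <= \sum_(i <- s) hsn (F i).
Proof.
elim: s => [|i s IH].
  rewrite big_nil (_ : (fun x => _) = fun=> 0%R) ?hsn0//.
  by apply/funext => x; rewrite big_nil.
rewrite big_cons (_ : (fun x => _) = fun x => F i x + \sum_(j <- s) F j x)%R.
  by rewrite (le_trans (hsnD _ _))// leeD2l.
by apply/funext => x; rewrite big_cons.
Qed.

(** Cauchy--Schwarz on the expansion of [x]; continuity passes from partial
    expansions to [x]. *)
Lemma hs_op_bound A x : linear A -> continuous A ->
  (rnorm (A x))%:E <= hsn A * (rnorm x)%:E.
Proof.
move=> linA contA.
have h : rnorm (A (proj_on dot f (ixs n) x)) @[n --> \oo] --> rnorm (A x).
  apply: rnorm_cvg_norm; apply/rnorm_cvg.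
  by apply: continuous_cvg; [exact: contA|exact: (expansion_cvgE hE hf)].
apply: cvg_le_ereal h _; apply: nearW => n.
rewrite /proj_on linear_map_sum//.
apply: (@le_trans _ _ (\sum_(k <- ixs n) ((cmod (dot x (f k)))%:E * (rnorm (A (f k)))%:E))).
  under [leRHS]eq_bigr do rewrite -EFinM.
  rewrite sumEFin lee_fin (le_trans (rnorm_sum _ _))//.
  by apply: ler_sum => k _; rewrite linear_mapZ// rnormZ.
rewrite muleC (_ : (rnorm x)%:E = sqrte (\esum_(k in setT) ((cmod (dot x (f k)))%:E ^+ 2))).
  rewrite /hsn hs_norm2E; apply: le_trans (esum_cauchy_schwarz _ _ _).
  - rewrite -(@esum_seq _ _ _ [set` ixs n]) ?ixs_uniq//; first exact: esum_subset.
    by move=> k; rewrite mule_ge0 ?lee_fin ?cmod_ge0 ?rnorm_ge0.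
  - by move=> k; rewrite lee_fin cmod_ge0.
  - by move=> k; rewrite lee_fin rnorm_ge0.
under eq_esum do rewrite -EFin_expe.
by rewrite (parseval hE hf) /= sqrtr_sqr ger0_norm ?rnorm_ge0.
Qed.

Lemma hs_norm2_comp A B : linear A -> continuous A ->
  hs_norm2 f (fun x => A (B x)) <= hs_norm2 f A * hs_norm2 f B.
Proof.
move=> linA contA; rewrite -[leRHS]esumZl ?hs_norm2_ge0//; last first.
  by move=> k; rewrite lee_fin sqr_ge0.
apply: le_esum => k _; rewrite -hsn_sqr !EFin_expe -sqreM.
rewrite lee_sqr ?lee_fin ?rnorm_ge0 ?mule_ge0 ?hsn_ge0 ?lee_fin ?rnorm_ge0//.
exact: hs_op_bound.
Qed.

Lemma hsn_comp A B : linear A -> continuous A ->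
  hsn (fun x => A (B x)) <= hsn A * hsn B.
Proof.
move=> linA contA; rewrite /hsn -sqrteM ?hs_norm2_ge0//.
by apply: sqrte_le; [exact: hs_norm2_ge0|exact: hs_norm2_comp].
Qed.

Definition hsr A : R := fine (hsn A).

Lemma hsr_ge0 A : (0 <= hsr A)%R.
Proof. by rewrite fine_ge0// hsn_ge0. Qed.

Lemma hs_norm2_lty A : hs_norm2 f A < +oo <-> hsn A < +oo.
Proof.
rewrite -!ge0_fin_numE ?hsn_ge0 ?hs_norm2_ge0// /hsn.
by rewrite sqrte_fin_num ?hs_norm2_ge0.
Qed.

Lemma hsrE A : hs_norm2 f A < +oo -> hsn A = (hsr A)%:E.
Proof. by move=> /hs_norm2_lty h; rewrite fineK// ge0_fin_numE// hsn_ge0. Qed.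

Lemma hsr_op_bound A x : hilbert_schmidt f A -> (rnorm (A x) <= hsr A * rnorm x)%R.
Proof. by move=> [lA cA hA]; rewrite -lee_fin EFinM -hsrE//; exact: hs_op_bound. Qed.

Lemma hilbert_schmidtP A (K : R) : linear A ->
  (forall x, (rnorm (A x) <= K * rnorm x)%R) -> hs_norm2 f A < +oo ->
  hilbert_schmidt f A.
Proof. by move=> lA bA hA; split => //; exact: bounded_linear_continuous bA. Qed.

Lemma hilbert_schmidt0 : hilbert_schmidt f (fun=> 0%R).
Proof.
apply: (@hilbert_schmidtP _ 0%R).
- by move=> c x y; rewrite scaler0 addr0.
- by move=> x; rewrite rnorm0 mul0r.
- by apply/hs_norm2_lty; rewrite hsn0.
Qed.

Lemma hilbert_schmidtD A B : hilbert_schmidt f A -> hilbert_schmidt f B ->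
  hilbert_schmidt f (fun x => A x + B x)%R.
Proof.
move=> hA hB; apply: (@hilbert_schmidtP _ (hsr A + hsr B)%R).
- by move=> c x y; case: hA hB => lA _ _ [lB _ _]; rewrite lA lB scalerDr addrACA.
- move=> x; rewrite mulrDl (le_trans (rnormD _ _))//.
  by apply: lerD; exact: hsr_op_bound.
- apply/hs_norm2_lty; apply: le_lt_trans (hsnD A B) _.
  by case: hA hB => _ _ /hs_norm2_lty hA [_ _ /hs_norm2_lty hB]; rewrite lte_add_pinfty.
Qed.

Lemma hilbert_schmidtZ c A : hilbert_schmidt f A ->
  hilbert_schmidt f (fun x => c *: A x)%R.
Proof.
move=> hA; apply: (@hilbert_schmidtP _ (cmod c * hsr A)%R).
- by move=> b x y; case: hA => lA _ _; rewrite lA scalerDr !scalerA mulrC.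
- move=> x; rewrite rnormZ -mulrA; apply: ler_wpM2l; first exact: cmod_ge0.
  exact: hsr_op_bound.
- rewrite hs_norm2Z; case: hA => _ _ hA.
  by rewrite lte_mul_pinfty// lee_fin sqr_ge0.
Qed.

Lemma hilbert_schmidtB A B : hilbert_schmidt f A -> hilbert_schmidt f B ->
  hilbert_schmidt f (fun x => A x - B x)%R.
Proof.
move=> hA hB; rewrite (_ : (fun x => _) = (fun x => A x + (-1) *: B x)%R).
  by apply: hilbert_schmidtD => //; exact: hilbert_schmidtZ.
by apply/funext => x; rewrite scaleN1r.
Qed.

Lemma hilbert_schmidt_comp A B : hilbert_schmidt f A -> hilbert_schmidt f B ->
  hilbert_schmidt f (fun x => A (B x)).
Proof.
move=> hA hB; apply: (@hilbert_schmidtP _ (hsr A * hsr B)%R).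
- by move=> c x y; case: hA hB => lA _ _ [lB _ _]; rewrite lB lA.
- move=> x; rewrite -mulrA (le_trans (hsr_op_bound _ hA))//.
  by apply: ler_wpM2l; [exact: hsr_ge0|exact: hsr_op_bound].
- case: hA hB => lA cA hA [_ _ hB].
  apply: le_lt_trans (hs_norm2_comp _ lA cA) _.
  by rewrite lte_mul_pinfty ?hs_norm2_ge0// ge0_fin_numE// hs_norm2_ge0.
Qed.

Lemma hilbert_schmidt_sum (I : Type) (s : seq I) (F : I -> E -> E) :
  (forall i, hilbert_schmidt f (F i)) ->
  hilbert_schmidt f (fun x => \sum_(i <- s) F i x)%R.
Proof.
move=> hF; elim: s => [|i s IH].
  rewrite (_ : (fun x => _) = fun=> 0%R); first exact: hilbert_schmidt0.
  by apply/funext => x; rewrite big_nil.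
rewrite (_ : (fun x => _) = fun x => F i x + \sum_(j <- s) F j x)%R.
  exact: hilbert_schmidtD.
by apply/funext => x; rewrite big_cons.
Qed.

End HilbertSchmidtNorm.

(** * Norms graded by the degree *)

Section ExtendedLimits.
Context {R : realType}.
Local Open Scope ereal_scope.
Implicit Types u v : nat -> \bar R.

Lemma ecvg0P u : (forall n, 0 <= u n) ->
  (u n @[n --> \oo] --> 0 <->
   forall e : R, (0 < e)%R -> \forall n \near \oo, u n <= e%:E).
Proof.
move=> u0; split => [/fine_cvgP[fu /cvgrPdist_le h] e e0|h].
  move: fu (h e e0); apply: filterS2 => n fn.
  by rewrite sub0r normrN ger0_norm ?fine_ge0// -lee_fin fineK.
apply/fine_cvgP; split.
  move: (h 1%R ltr01); apply: filterS => n un1; rewrite ge0_fin_numE//.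
  by rewrite (le_lt_trans un1)// ltry.
apply/cvgrPdist_le => e e0; move: (h e e0); apply: filterS => n un.
rewrite sub0r normrN ger0_norm ?fine_ge0// -lee_fin fineK// ge0_fin_numE//.
by rewrite (le_lt_trans un)// ltry.
Qed.

Lemma ecvg0_le u v : (forall n, 0 <= u n) -> (\forall n \near \oo, u n <= v n) ->
  v n @[n --> \oo] --> 0 -> u n @[n --> \oo] --> 0.
Proof.
move=> u0 uv v0; apply: (@squeeze_cvge _ _ _ _ (fun=> 0) _ v) => //.
- by move: uv; apply: filterS => n ->; rewrite u0.
- exact: cvg_cst.
Qed.

Lemma ecvg0D u v : u n @[n --> \oo] --> 0 -> v n @[n --> \oo] --> 0 ->
  u n + v n @[n --> \oo] --> 0.
Proof. by move=> u0 v0; rewrite -[X in _ --> X]adde0; apply: cvgeD. Qed.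

Lemma ecvg0Z (r : R) u : u n @[n --> \oo] --> 0 -> r%:E * u n @[n --> \oo] --> 0.
Proof. by move=> u0; rewrite -[X in _ --> X](mule0 r%:E); apply: cvgeZl. Qed.

Lemma ecvg0_sqrte u : (forall n, 0 <= u n) -> u n @[n --> \oo] --> 0 ->
  sqrte (u n) @[n --> \oo] --> 0.
Proof.
move=> u0 /(ecvg0P u0) h; apply/ecvg0P => [n|e e0]; first exact: sqrte_ge0.
move: (h (e ^+ 2)%R (exprn_gt0 2 e0)); apply: filterS => n un.
by apply: sqrte_le_sqr => //; rewrite ?lee_fin ?ltW// -EFin_expe.
Qed.

Lemma lee_lim0 (x y : \bar R) u : u n @[n --> \oo] --> 0 -> (forall n, 0 <= u n) ->
  (forall n, x <= y + u n) -> x <= y.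
Proof.
move=> u0 ug h; apply/lee_addgt0Pr => e e0.
have [N _ /(_ N (leqnn N)) uN] := (ecvg0P ug).1 u0 e e0.
by rewrite (le_trans (h N))// leeD2l.
Qed.

(** The sum is a supremum over finite sets, and a finite set that comes
    within [e] of it leaves at most [e] for its complement. *)
Lemma esum_tail (I : choiceType) (a : I -> \bar R) : (forall i, 0 <= a i) ->
  \esum_(i in setT) a i < +oo -> forall e : R, (0 < e)%R ->
  exists X : {fset I}, \esum_(i in ~` [set` X]) a i <= e%:E.
Proof.
move=> a0 afin e e0; set S := esum _ _ in afin.
have S0 : 0 <= S by exact: esum_ge0.
have Sfin : S \is a fin_num by rewrite ge0_fin_numE.
have [_ [X [finX _] <-] hX] := ub_ereal_sup_adherent e0 Sfin.
exists (fset_set X); rewrite fset_setK//.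
have SE : S = \sum_(i \in X) a i + \esum_(i in ~` X) a i.
  by rewrite /S (esumID X)// !setTI esum_fset.
have sX : \sum_(i \in X) a i \is a fin_num.
  rewrite ge0_fin_numE ?fsume_ge0//; apply: le_lt_trans afin.
  by rewrite SE leeDl// esum_ge0.
have {}hX : S - e%:E < \sum_(x \in X) a x by exact: hX.
move: hX; rewrite SE; move: sX; set s := (\sum_(i \in X) a i)%R => sX.
have := esum_ge0 (fun i (_ : (~` X) i) => a0 i).
case: (esum (~` X) a) => [t||//] t0; last first.
  by rewrite -(fineK sX).
by rewrite -(fineK sX) -!EFinD lte_fin lee_fin; lra.
Qed.

End ExtendedLimits.

Section DegreeNorms.
Context {R : realType} {dim : option nat}.
Local Open Scope ereal_scope.
Implicit Types (a b : midx dim -> \bar R).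

Lemma l2deg_ge0 a m : 0 <= l2deg a m. Proof. exact: sqrte_ge0. Qed.

Lemma l2deg_sqr a m : l2deg a m ^+ 2 = \esum_(al in [set al | mdeg al = m]) (a al ^+ 2).
Proof. by rewrite sqr_sqrte// esum_ge0// => al _; exact: sqre_ge0. Qed.

Lemma l2deg_le a b m : (forall al, 0 <= a al) -> (forall al, mdeg al = m -> a al <= b al) ->
  l2deg a m <= l2deg b m.
Proof.
move=> a0 ab; apply: sqrte_le; first by apply: esum_ge0 => *; exact: sqre_ge0.
by apply: le_esum => al dal; apply: expe_le => //; exact: ab.
Qed.

Lemma l2degD a b m : (forall al, 0 <= a al) -> (forall al, 0 <= b al) ->
  l2deg (fun al => a al + b al) m <= l2deg a m + l2deg b m.
Proof. by move=> a0 b0; exact: esum2_minkowski. Qed.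

Lemma esum_sqr_le (I : choiceType) (D : set I) (x : I -> \bar R) :
  (forall i, 0 <= x i) -> \esum_(i in D) (x i ^+ 2) <= (\esum_(i in D) x i) ^+ 2.
Proof.
move=> x0; rewrite expe2 esumM//; apply: le_esum => i Di.
by rewrite expe2; apply: (@esum_ub _ _ _ (fun j => x i * x j)) => // j; rewrite mule_ge0.
Qed.

Lemma geometric_esum_le : \esum_(m in setT) ((2^-1 ^+ m)%:E : \bar R) <= 2%:E.
Proof.
rewrite -nneseries_esumT; last by move=> n; rewrite lee_fin exprn_ge0.
apply: lime_le; first by apply: is_cvg_nneseries => n _ _; rewrite lee_fin exprn_ge0.
apply: nearW => n; rewrite sumEFin lee_fin big_mkord.
have := subrX1 (2^-1 : R) n.
have := exprn_ge0 n (ltW (_ : 0 < 2^-1 :> R)%R); rewrite invr_gt0 ltr0n => /(_ isT).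
by move: (\sum_(i < n) _)%R (_ ^+ n)%R => x y; lra.
Qed.

(** A single weighted l^2 sum: unlike [degnorm] it is a sum over the
    multi-indices alone, so tails and limits can be treated termwise. *)
Definition wnorm (rho : R) a : \bar R :=
  \esum_(al in setT) (((rho ^+ mdeg al)%:E * a al) ^+ 2).

Lemma wnorm_ge0 rho a : 0 <= wnorm rho a.
Proof. by apply: esum_ge0 => al _; exact: sqre_ge0. Qed.

Lemma wnormE rho a : wnorm rho a =
  \esum_(m in setT) (((rho ^+ m)%:E * l2deg a m) ^+ 2).
Proof.
rewrite /wnorm (@esum_fiber _ _ _ _ [set: nat] (@mdeg dim))//; last by move=> al; exact: sqre_ge0.
apply: eq_esum => m _; rewrite setTI sqreM l2deg_sqr -esumZl ?sqre_ge0//; last first.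
  by move=> al; exact: sqre_ge0.
by apply: eq_esum => al /= <-; rewrite sqreM.
Qed.

Definition degnorm (rho : R) a : \bar R :=
  \esum_(m in setT) ((rho ^+ m)%:E * l2deg a m).

Lemma degnorm_ge0 rho a : (0 <= rho)%R -> 0 <= degnorm rho a.
Proof.
by move=> r0; apply: esum_ge0 => m _; rewrite mule_ge0 ?l2deg_ge0// lee_fin exprn_ge0.
Qed.

(** With [degnorm_le_wnorm], the two families of norms define the same
    topology: a sum of squares is at most the square of the sum, and
    conversely the geometric weights 2^-m are square summable. *)
Lemma wnorm_le_degnorm rho a : (0 <= rho)%R -> wnorm rho a <= degnorm rho a ^+ 2.
Proof.
move=> r0; rewrite wnormE; apply: esum_sqr_le => m.
by rewrite mule_ge0 ?l2deg_ge0// lee_fin exprn_ge0.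
Qed.

Lemma degnorm_le_wnorm rho a : (0 <= rho)%R ->
  degnorm rho a <= 2%:E * sqrte (wnorm (2 * rho) a).
Proof.
move=> r0; rewrite /degnorm.
have h m : 0 <= ((2 * rho) ^+ m)%:E * l2deg a m.
  by rewrite mule_ge0 ?l2deg_ge0// lee_fin exprn_ge0// mulr_ge0.
rewrite (@eq_esum _ _ _ _ (fun m => (2^-1 ^+ m)%:E * (((2 * rho) ^+ m)%:E * l2deg a m))).
  apply: le_trans (esum_cauchy_schwarz _ _ _) _ => //.
  rewrite wnormE; apply: lee_wpmul2r; first exact: sqrte_ge0.
  apply: sqrte_le_sqr => //; first by apply: esum_ge0 => *; exact: sqre_ge0.
  apply: le_trans (esum_sqr_le _ _) _; first by move=> m; rewrite lee_fin exprn_ge0.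
  apply: expe_le; last exact: geometric_esum_le.
  by apply: esum_ge0 => m _; rewrite lee_fin exprn_ge0.
move=> m _; rewrite muleA -EFinM exprMn mulrA -exprMn mulVf ?expr1n ?mul1r//.
Qed.

End DegreeNorms.

Section HilbertSchmidtLimits.
Context {R : realType} {E : completeNormedModType R[i]} {dimE : option nat}.
Variables (dot : {dot E for Num.conj}) (f : ix dimE -> E).
Hypotheses (hE : norm_from_dot dot) (hf : orthonormal_basis dot f).

(** Each finite subsum passes to the limit. *)
Lemma hs_norm2_limit (u : nat -> E -> E) (C : E -> E) (K : \bar R) :
  (forall x, rnorm (C x - u n x) @[n --> \oo] --> (0 : R)) ->
  (\forall n \near \oo, (hs_norm2 f (u n) <= K)%E) -> (hs_norm2 f C <= K)%E.
Proof.
move=> uC hK; apply: ge_ereal_sup => _ [X [finX _] <-].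
rewrite fsbig_finite//= sumEFin.
have h : \sum_(k <- fset_set X) rnorm (u n (f k)) ^+ 2 @[n --> \oo] -->
    \sum_(k <- fset_set X) rnorm (C (f k)) ^+ 2.
  apply: cvg_big => [|k _]; first exact: add_continuous.
  have h := rnorm_cvg_norm (uC (f k)).
  exact: (cvgM h h).
apply: cvg_le_ereal h _; move: hK; apply: filterS => n; apply: le_trans.
apply: esum_ge; exists X => //.
by rewrite fsbig_finite//= sumEFin.
Qed.

(** The limit is taken pointwise in the Hilbert space, and the Cauchy
    estimates pass to it by [hs_norm2_limit]. *)
Lemma hs_complete (u : nat -> E -> E) : (forall n, hilbert_schmidt f (u n)) ->
  (forall e : R, 0 < e -> exists N, forall n m, (N <= n)%N -> (N <= m)%N ->
     (hsn f (fun x => u n x - u m x)%R <= e%:E)%E) ->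
  exists C, [/\ hilbert_schmidt f C,
    forall x, rnorm (C x - u n x) @[n --> \oo] --> (0 : R) &
    forall e : R, 0 < e -> exists N, forall n, (N <= n)%N ->
      (hsn f (fun x => u n x - C x)%R <= e%:E)%E].
Proof.
move=> hu cu.
have bound e : 0 < e -> exists N, forall n m x, (N <= n)%N -> (N <= m)%N ->
    rnorm (u n x - u m x) <= e * rnorm x.
  move=> e0; have [N hN] := cu e e0; exists N => n m x Nn Nm.
  have hB := hilbert_schmidtB hE hf (hu n) (hu m).
  rewrite (le_trans (hsr_op_bound hE hf _ hB))//; apply: ler_wpM2r.
    exact: rnorm_ge0.
  by case: hB => _ _ hB; rewrite -lee_fin -hsrE// hN.
have lim x : exists l, rnorm (l - u n x) @[n --> \oo] --> (0 : R).
  apply: rnorm_cauchy => e e0.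
  have x1 : 0 < rnorm x + 1 by rewrite ltr_wpDl// rnorm_ge0.
  have [N hN] := bound (e / (rnorm x + 1)) (divr_gt0 e0 x1).
  exists N => n m Nn Nm; rewrite (le_trans (hN _ _ _ Nn Nm))// mulrAC ler_pdivrMr//.
  by rewrite ler_wpM2l ?lerDl// ltW.
have [C hC] := choice lim.
have hC' x : u n x @[n --> \oo] --> C x by exact/rnorm_cvg/hC.
have linC : linear C.
  move=> c x y.
  have h1 : u n (c *: x + y) @[n --> \oo] --> c *: C x + C y.
    rewrite (_ : (fun n => u n _) = fun n => c *: u n x + u n y); last first.
      by apply/funext => n; case: (hu n) => ->.
    by apply: cvgD => //; apply: cvgZr.
  exact: (cvg_unique _ (hC' (c *: x + y)) h1).
have close e : 0 < e -> exists N, forall n, (N <= n)%N ->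
      (hsn f (fun x => u n x - C x)%R <= e%:E)%E.
  move=> e0; have [N hN] := cu e e0; exists N => n Nn.
  rewrite /hsn; apply: sqrte_le_sqr; rewrite ?hs_norm2_ge0 ?lee_fin ?(ltW e0)//.
  apply: (@hs_norm2_limit (fun m x => u n x - u m x)).
    move=> x; rewrite (_ : (fun m => _) = fun m => rnorm (C x - u m x)) ?hC//.
    by apply/funext => m; rewrite opprB addrC addrA subrK rnormB.
  exists N => // m /= Nm; rewrite -hsn_sqr; apply: expe_le; first exact: hsn_ge0.
  exact: hN.
exists C; split => //.
have [N hN] := close 1 ltr01.
have [N' hN'] := bound 1 ltr01.
apply: (@hilbert_schmidtP _ _ _ f _ (hsr f (u N') + 1)) => //.
- move=> x; rewrite mulrDl mul1r.
  have h : rnorm (u n x) @[n --> \oo] --> rnorm (C x) by apply: rnorm_cvg_norm.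
  rewrite -lee_fin; apply: cvg_le_ereal h _; exists N' => // n /= Nn.
  rewrite lee_fin -[u n x](subrK (u N' x)) addrC (le_trans (rnormD _ _))//.
  apply: lerD; first exact: (hsr_op_bound hE hf).
  by rewrite (le_trans (hN' _ _ _ Nn (leqnn _)))// mul1r.
- apply/hs_norm2_lty.
  rewrite (_ : C = fun x => u N x - (u N x - C x)).
    apply: le_lt_trans (hsnB f _ _) _.
    apply: (@le_lt_trans _ _ (hsn f (u N) + 1%:E)%E); first by rewrite leeD2l// hN.
    by case: (hu N) => _ _ /hs_norm2_lty h; rewrite lte_add_pinfty ?ltry.
  by apply/funext => x; rewrite opprB addrC subrK.
Qed.

End HilbertSchmidtLimits.

(** * The complete space of coefficient arrays *)

Section CoefficientArrays.
Context {R : realType} {E : completeNormedModType R[i]} {dimH dimE : option nat}.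
Variables (dot : {dot E for Num.conj}) (f : ix dimE -> E).
Hypotheses (hE : norm_from_dot dot) (hf : orthonormal_basis dot f).
Local Open Scope ereal_scope.
Notation array := (coeff_array dimH E).
Implicit Types (A B C : array) (al be r ga : midx dimH).

Definition hsa A al : \bar R := hsn f (A al).

Lemma hsa_ge0 A al : 0 <= hsa A al. Proof. exact: hsn_ge0. Qed.

Lemma pnormE (rho : R) A : (0 <= rho)%R -> pnorm f rho A = degnorm rho (hsa A).
Proof.
move=> r0; rewrite /pnorm /degnorm -nneseries_esumT; last first.
  by move=> m; rewrite mule_ge0 ?l2deg_ge0// lee_fin exprn_ge0.
apply: eq_eseriesr => m _; rewrite poweR12_sqrt; last first.
  by apply: esum_ge0 => al _; exact: hs_norm2_ge0.
by congr (_ * sqrte _); apply: eq_esum => al _; rewrite hsn_sqr.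
Qed.

Lemma pnorm_ge0 (rho : R) A : (0 <= rho)%R -> 0 <= pnorm f rho A.
Proof. by move=> r0; rewrite pnormE// degnorm_ge0. Qed.

Lemma degnorm_le (rho : R) (a b : midx dimH -> \bar R) : (0 <= rho)%R ->
  (forall al, 0 <= a al) -> (forall al, a al <= b al) ->
  degnorm rho a <= degnorm rho b.
Proof.
move=> r0 a0 ab; apply: le_esum => m _; apply: lee_wpmul2l.
  by rewrite lee_fin exprn_ge0.
by apply: l2deg_le.
Qed.

Lemma pnorm_le (rho : R) A B : (0 <= rho)%R ->
  (forall al, hsa A al <= hsa B al) -> pnorm f rho A <= pnorm f rho B.
Proof. by move=> r0 AB; rewrite !pnormE//; apply: degnorm_le => // al; exact: hsa_ge0. Qed.

Lemma degnormD (rho : R) (a b : midx dimH -> \bar R) : (0 <= rho)%R ->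
  (forall al, 0 <= a al) -> (forall al, 0 <= b al) ->
  degnorm rho (fun al => a al + b al) <= degnorm rho a + degnorm rho b.
Proof.
move=> r0 a0 b0; rewrite /degnorm -esumD; last 2 first.
- by move=> m _; rewrite mule_ge0 ?l2deg_ge0// lee_fin exprn_ge0.
- by move=> m _; rewrite mule_ge0 ?l2deg_ge0// lee_fin exprn_ge0.
apply: le_esum => m _; rewrite -ge0_muleDr ?l2deg_ge0//.
by apply: lee_wpmul2l; rewrite ?lee_fin ?exprn_ge0// l2degD.
Qed.

Lemma pnorm_split (rho : R) A B C : (0 <= rho)%R ->
  (forall al x, A al x = B al x + C al x)%R ->
  pnorm f rho A <= pnorm f rho B + pnorm f rho C.
Proof.
move=> r0 ABC; rewrite !pnormE//; apply: le_trans (degnormD r0 (hsa_ge0 B) (hsa_ge0 C)).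
apply: degnorm_le => // al; first exact: hsa_ge0.
rewrite /hsa (_ : A al = fun x => B al x + C al x)%R ?hsnD//.
by apply/funext => x; exact: ABC.
Qed.

Lemma pnorm_triangle (rho : R) A B C : (0 <= rho)%R ->
  pnorm f rho (array_sub A C) <= pnorm f rho (array_sub A B) + pnorm f rho (array_sub B C).
Proof. by move=> r0; apply: pnorm_split => // al x; rewrite /array_sub addrA subrK. Qed.

Lemma pnorm_subC (rho : R) A B : (0 <= rho)%R ->
  pnorm f rho (array_sub A B) = pnorm f rho (array_sub B A).
Proof.
move=> r0; rewrite !pnormE//; congr degnorm; apply/funext => al.
rewrite /hsa -(hsnN f (array_sub A B al)); congr (hsn _ _); apply/funext => x.
by rewrite /array_sub opprB.
Qed.

Lemma pnorm_sub0 (rho : R) A : pnorm f rho (array_sub A (fun _ _ => 0%R)) = pnorm f rho A.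
Proof.
by congr pnorm; apply/funext => al; apply/funext => x; rewrite /array_sub subr0.
Qed.

Lemma hsa_le_pnorm A al : hsa A al <= pnorm f 1 A.
Proof.
rewrite pnormE//; apply: (@le_trans _ _ (l2deg (hsa A) (mdeg al))).
  apply: le_sqr_sqrte; first by apply: esum_ge0 => *; exact: sqre_ge0.
  by apply: (@esum_ub _ _ _ (fun al => hsa A al ^+ 2)) => // ?; exact: sqre_ge0.
rewrite -[leLHS]mul1e -[X in X%:E * _ <= _](expr1n R (mdeg al)).
apply: (@esum_ub _ _ _ (fun m => (1 ^+ m)%:E * l2deg (hsa A) m)) => // m.
by rewrite mule_ge0 ?l2deg_ge0// lee_fin exprn_ge0.
Qed.

Lemma wnorm_le_pnorm (rho : R) A : (0 <= rho)%R -> wnorm rho (hsa A) <= pnorm f rho A ^+ 2.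
Proof. by move=> r0; rewrite pnormE// wnorm_le_degnorm. Qed.

Lemma pnorm_le_wnorm (rho : R) A : (0 <= rho)%R ->
  pnorm f rho A <= 2%:E * sqrte (wnorm (2 * rho) (hsa A)).
Proof. by move=> r0; rewrite pnormE// degnorm_le_wnorm. Qed.

Lemma frakA2_hs A al : frakA2 f A -> hilbert_schmidt f (A al).
Proof. by case. Qed.

Lemma frakA2_wnorm A (rho : R) : frakA2 f A -> (1 <= rho)%R -> wnorm rho (hsa A) < +oo.
Proof.
move=> [_ hA] r1; apply: le_lt_trans (wnorm_le_pnorm _ _) _; first exact: le_trans ler01 r1.
have := hA _ r1; have := pnorm_ge0 A (le_trans ler01 r1).
case: (pnorm f rho A) => [p||//] _ // _.
by rewrite -EFin_expe ltry.
Qed.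

Lemma frakA2P A : (forall al, hilbert_schmidt f (A al)) ->
  (forall rho : R, (1 <= rho)%R -> wnorm rho (hsa A) < +oo) -> frakA2 f A.
Proof.
move=> hsA h; split => // rho r1; have r0 := le_trans ler01 r1.
apply: le_lt_trans (pnorm_le_wnorm _ r0) _.
have : wnorm (2 * rho) (hsa A) \is a fin_num.
  by rewrite ge0_fin_numE ?wnorm_ge0// h//; lra.
by case: (wnorm _ _) => [p||]//= _; rewrite -EFinM ltry.
Qed.

Lemma frakA2_sub A B : frakA2 f A -> frakA2 f B -> frakA2 f (array_sub A B).
Proof.
move=> [hA pA] [hB pB]; split => [al|rho r1]; first exact: (hilbert_schmidtB hE hf).
have r0 := le_trans ler01 r1.
have := @pnorm_triangle rho A (fun _ _ => 0%R) B r0.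
rewrite (pnorm_subC (fun _ _ => 0%R) B r0) !pnorm_sub0 => h; apply: le_lt_trans h _.
by apply: lte_add_pinfty; [exact: pA|exact: pB].
Qed.

Lemma esum_support (I : choiceType) (F : {fset I}) (a : I -> \bar R) :
  (forall i, 0 <= a i) -> (forall i, i \notin F -> a i = 0) ->
  \esum_(i in setT) a i = (\sum_(i <- F) a i)%R.
Proof.
move=> a0 aF; rewrite (esumID [set` F])// !setTI [X in _ + X]esum1 ?adde0.
  by apply: esum_seq.
by move=> i /= /negP; exact: aF.
Qed.

Lemma finite_arrayP A : finite_array f A -> exists F : {fset midx dimH},
  forall al, al \notin F -> A al = fun=> 0%R.
Proof.
move=> [_ finA]; exists (fset_set [set al | exists x, A al x != 0%R]) => al.
rewrite in_fset_set// notin_setE/= => /forallNP h; apply/funext => x.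
by have /negP := h x; rewrite negbK => /eqP.
Qed.

Lemma finite_array_intro A (F : {fset midx dimH}) :
  (forall al, hilbert_schmidt f (A al)) ->
  (forall al, al \notin F -> A al = fun=> 0%R) -> finite_array f A.
Proof.
move=> hA AF; split => //; apply: sub_finite_set (finite_fset F) => al /= [x].
by apply: contraNT => /AF ->.
Qed.

Lemma finite_array_frakA2 A : finite_array f A -> frakA2 f A.
Proof.
move=> finA; have [F AF] := finite_arrayP finA; have [hA _] := finA.
apply: frakA2P => // rho r1; rewrite /wnorm (esum_support (F := F)).
- apply/lte_sum_pinfty => al _; rewrite -ge0_fin_numE ?sqre_ge0//.
  apply: fin_numX; rewrite fin_numM// ge0_fin_numE ?hsa_ge0//.
  by apply/hs_norm2_lty; case: (hA al).
- by move=> al; exact: sqre_ge0.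
- by move=> al /AF; rewrite /hsa => ->; rewrite hsn0 mule0 expe2 mule0.
Qed.

Lemma finite_array_sub A B : finite_array f A -> finite_array f B ->
  finite_array f (array_sub A B).
Proof.
move=> fA fB; have [F AF] := finite_arrayP fA; have [G BG] := finite_arrayP fB.
apply: (@finite_array_intro _ (F `|` G)%fset).
  by move=> al; case: fA fB => hA _ [hB _]; exact: (hilbert_schmidtB hE hf).
move=> al; rewrite inE negb_or => /andP[/AF Aal /BG Bal]; apply/funext => x.
by rewrite /array_sub Aal Bal subr0.
Qed.

(** The limit is taken coefficient by coefficient; the weighted l^2 norm of
    the difference is controlled on finite sets of indices. *)
Lemma frakA2_complete (u : nat -> array) : (forall n, frakA2 f (u n)) ->
  (forall rho : R, (1 <= rho)%R -> forall e : R, (0 < e)%R -> exists N, forall n m,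
     (N <= n)%N -> (N <= m)%N -> pnorm f rho (array_sub (u n) (u m)) <= e%:E) ->
  exists C, cvg_frakA2 f u C.
Proof.
move=> fu cu.
have coef al : exists C : E -> E, [/\ hilbert_schmidt f C,
    forall x, rnorm (C x - u n al x)%R @[n --> \oo] --> (0%R : R) &
    forall e : R, (0 < e)%R -> exists N, forall n, (N <= n)%N ->
      hsn f (fun x => u n al x - C x)%R <= e%:E].
  apply: (hs_complete hE hf) => [n|e e0]; first exact: frakA2_hs.
  have [N hN] := cu 1%R (lexx _) e e0; exists N => n m Nn Nm.
  apply: le_trans (hN _ _ Nn Nm).
  exact: (hsa_le_pnorm (array_sub (u n) (u m)) al).
have [C hC] := choice coef.
(* The bound is uniform in the second index, which is sent to infinity on
   finite sets of multi-indices. *)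
have close (rho : R) : (1 <= rho)%R -> forall e : R, (0 < e)%R -> exists N, forall n,
    (N <= n)%N -> wnorm rho (hsa (array_sub (u n) C)) <= (e ^+ 2)%:E.
  move=> r1 e e0; have r0 := le_trans ler01 r1.
  have [N hN] := cu rho r1 e e0; exists N => n Nn.
  have fin al m : hsa (array_sub (u n) (u m)) al \is a fin_num.
    rewrite ge0_fin_numE ?hsa_ge0//; apply/hs_norm2_lty.
    by have [] := hilbert_schmidtB hE hf (frakA2_hs al (fu n)) (frakA2_hs al (fu m)).
  have finC al : hsa (array_sub (u n) C) al \is a fin_num.
    rewrite ge0_fin_numE ?hsa_ge0//; apply/hs_norm2_lty.
    have [hCal _ _] := hC al.
    by have [] := hilbert_schmidtB hE hf (frakA2_hs al (fu n)) hCal.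
  apply: ge_ereal_sup => _ [X [finX _] <-]; rewrite fsbig_finite//=.
  pose F m al : R := (rho ^+ mdeg al * fine (hsa (array_sub (u n) (u m)) al))%R.
  pose FC al : R := (rho ^+ mdeg al * fine (hsa (array_sub (u n) C) al))%R.
  have FCE al : ((rho ^+ mdeg al)%:E * hsa (array_sub (u n) C) al) ^+ 2 = (FC al ^+ 2)%:E.
    by rewrite -{1}(fineK (finC al)) -EFinM -EFin_expe.
  under eq_bigr do rewrite FCE; rewrite sumEFin.
  have h : (\sum_(al <- fset_set X) F m al ^+ 2)%R @[m --> \oo] -->
      (\sum_(al <- fset_set X) FC al ^+ 2)%R.
    apply: cvg_big => [|al _]; first exact: add_continuous.
    suff h : F m al @[m --> \oo] --> FC al by exact: (cvgM h h).
    apply: cvgM; first exact: cvg_cst.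
    apply/cvgrPdist_le => d d0; have [_ _ /(_ d d0)[M hM]] := hC al.
    exists M => // m /= Mm.
    have hm : hsn f (array_sub (u m) C al) <= d%:E by exact: hM.
    have h1 : hsa (array_sub (u n) C) al <= hsa (array_sub (u n) (u m)) al + d%:E.
      apply: (@le_trans _ _ (hsa (array_sub (u n) (u m)) al + hsa (array_sub (u m) C) al)).
        rewrite /hsa (_ : array_sub (u n) C al = fun x => array_sub (u n) (u m) al x +
          array_sub (u m) C al x)%R ?hsnD//.
        by apply/funext => x; rewrite /array_sub addrA subrK.
      by rewrite leeD2l.
    have h2 : hsa (array_sub (u n) (u m)) al <= hsa (array_sub (u n) C) al + d%:E.
      apply: (@le_trans _ _ (hsa (array_sub (u n) C) al + hsa (array_sub (u m) C) al)).
        rewrite /hsa (_ : array_sub (u n) (u m) al = fun x => array_sub (u n) C al x -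
          array_sub (u m) C al x)%R ?hsnB//.
        by apply/funext => x; rewrite /array_sub opprB addrA subrK.
      by rewrite leeD2l.
    move: h1 h2; rewrite -(fineK (finC al)) -(fineK (fin al m)) -!EFinD !lee_fin => h1 h2.
    by rewrite ler_norml; apply/andP; split; lra.
  apply: cvg_le_ereal h _; exists N => // m /= Nm.
  apply: (@le_trans _ _ (wnorm rho (hsa (array_sub (u n) (u m))))).
    apply: esum_ge; exists X => //.
    rewrite fsbig_finite//= -sumEFin; apply: lee_sum => al _.
    by rewrite -(fineK (fin al m)) -EFinM -EFin_expe.
  apply: le_trans (wnorm_le_pnorm _ r0) _; rewrite EFin_expe; apply: expe_le.
    exact: pnorm_ge0.
  exact: hN.
have hsC al : hilbert_schmidt f (C al) by have [] := hC al.
have uC rho : (1 <= rho)%R -> pnorm f rho (array_sub (u n) C) @[n --> \oo] --> 0.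
  move=> r1; have r0 := le_trans ler01 r1.
  apply/ecvg0P => [n|e e0]; first exact: pnorm_ge0.
  have r2 : (1 <= 2 * rho)%R by lra.
  have e2 : (0 < e / 2)%R by lra.
  have [N hN] := close _ r2 _ e2; exists N => // n /= Nn.
  apply: le_trans (pnorm_le_wnorm _ r0) _.
  rewrite (_ : e%:E = 2%:E * (e / 2)%:E); last by rewrite -EFinM mulrCA divff ?mulr1.
  apply: lee_wpmul2l => //; apply: sqrte_le_sqr.
  - exact: wnorm_ge0.
  - by rewrite lee_fin ltW.
  - by rewrite -EFin_expe hN.
exists C; split => //; split => // rho r1; have r0 := le_trans ler01 r1.
have [N _ hN] := (ecvg0P (fun n => pnorm_ge0 (array_sub (u n) C) r0)).1 (uC rho r1) 1%R ltr01.
have /= uN := hN N (leqnn N).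
rewrite -pnorm_sub0; apply: le_lt_trans (pnorm_triangle _ (u N) _ r0) _.
rewrite pnorm_sub0 pnorm_subC// lte_add_pinfty//; first by rewrite (le_lt_trans uN)// ltry.
by case: (fu N) => _; exact.
Qed.

Definition trunc (F : {fset midx dimH}) A : array :=
  fun al => if al \in F then A al else fun=> 0%R.

Lemma trunc_finite F A : frakA2 f A -> finite_array f (trunc F A).
Proof.
move=> fA; apply: (@finite_array_intro _ F).
  by move=> al; rewrite /trunc; case: ifP => _; [exact: frakA2_hs|exact: hilbert_schmidt0].
by move=> al /negbTE; rewrite /trunc => ->.
Qed.

(** An exhaustion of the countable set of multi-indices by finite sets,
    along which arrays and chaos sums are truncated. *)
Definition midx_upto (n : nat) : {fset midx dimH} :=
  seq_fset tt (pmap (@choice.pickle_inv (midx dimH)) (iota 0 n)).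

Lemma in_midx_upto (n : nat) al : (al \in midx_upto n) = (choice.pickle al < n)%N.
Proof.
rewrite seq_fsetE; apply/idP/idP.
  rewrite mem_pmap => /mapP[k]; rewrite mem_iota/= => kn ek.
  have := @choice.pickle_invK (midx dimH) k; rewrite -ek/= => ->; exact: kn.
move=> h; rewrite mem_pmap; apply/mapP; exists (choice.pickle al); first by rewrite mem_iota.
by rewrite choice.pickleK_inv.
Qed.

Lemma midx_upto_absorb (X : {fset midx dimH}) : exists N, forall n, (N <= n)%N ->
  (X `<=` midx_upto n)%fset.
Proof.
exists (\max_(al <- X) (choice.pickle al).+1)%N => n Nn; apply/fsubsetP => al alX.
rewrite in_midx_upto; apply: leq_trans Nn.
exact: (@leq_bigmax_seq _ _ _ (fun al => (choice.pickle al).+1)).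
Qed.

Lemma hsa_trunc_le F A al : hsa (trunc F A) al <= hsa A al.
Proof. by rewrite /hsa /trunc; case: ifP => // _; rewrite hsn0 hsn_ge0. Qed.

Lemma wnorm_tail (rho : R) A (X F : {fset midx dimH}) : (0 <= rho)%R -> (X `<=` F)%fset ->
  wnorm rho (hsa (array_sub (trunc F A) A)) <=
  \esum_(al in ~` [set` X]) (((rho ^+ mdeg al)%:E * hsa A al) ^+ 2).
Proof.
move=> r0 XF; rewrite /wnorm (esumID [set` X]); last by move=> al _; exact: sqre_ge0.
rewrite !setTI [X in X + _]esum1 ?add0e; last first.
  move=> al /= alX; rewrite /hsa /array_sub /trunc (fsubsetP XF _ alX).
  rewrite (_ : (fun x => _) = fun=> 0%R); first by rewrite hsn0 mule0 expe2 mule0.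
  by apply/funext => x; rewrite subrr.
apply: le_esum => al _; apply: expe_le.
  by rewrite mule_ge0 ?hsa_ge0 ?lee_fin ?exprn_ge0.
apply: lee_wpmul2l; first by rewrite lee_fin exprn_ge0.
rewrite /hsa /array_sub /trunc; case: ifP => _.
  rewrite (_ : (fun x => _) = fun=> 0%R); first by rewrite hsn0 hsn_ge0.
  by apply/funext => x; rewrite subrr.
rewrite (_ : (fun x => _) = fun x => - A al x)%R ?hsnN//.
by apply/funext => x; rewrite sub0r.
Qed.

(** The weighted square sum of the coefficients converges, hence its tails
    vanish along any exhaustion. *)
Lemma trunc_cvg A : frakA2 f A -> cvg_frakA2 f (fun n => trunc (midx_upto n) A) A.
Proof.
move=> fA; split => // [n|rho r1].
  exact/finite_array_frakA2/trunc_finite.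
have r0 := le_trans ler01 r1.
have r2 : (1 <= 2 * rho)%R by lra.
apply/ecvg0P => [n|e e0]; first exact: pnorm_ge0.
have e2 : (0 < (e / 2) ^+ 2)%R by rewrite exprn_gt0// divr_gt0.
have [X hX] := esum_tail (fun al => sqre_ge0 ((((2 * rho) ^+ mdeg al)%:E * hsa A al)))
  (frakA2_wnorm fA r2) e2.
have [N hN] := midx_upto_absorb X.
exists N => // n /= Nn; apply: le_trans (pnorm_le_wnorm _ r0) _.
rewrite (_ : e%:E = 2%:E * (e / 2)%:E); last by rewrite -EFinM mulrCA divff ?mulr1.
apply: lee_wpmul2l => //; apply: sqrte_le_sqr.
- exact: wnorm_ge0.
- by rewrite lee_fin divr_ge0// ltW.
- rewrite -EFin_expe; apply: le_trans hX; apply: wnorm_tail; last exact: hN.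
  exact: le_trans r2.
Qed.

End CoefficientArrays.

(** * Products of coefficient arrays *)

Section FiniteProducts.
Context {R : realType} {E : completeNormedModType R[i]} {dimH dimE : option nat}.
Variables (dot : {dot E for Num.conj}) (f : ix dimE -> E).
Hypotheses (hE : norm_from_dot dot) (hf : orthonormal_basis dot f).
Notation array := (coeff_array dimH E).
Notation mtriple := (midx dimH * midx dimH * midx dimH)%type.
Notation kernel := (midx dimH -> midx dimH -> midx dimH -> midx dimH -> R).
Implicit Types (A B C : array) (al be r ga : midx dimH) (F G : {fset midx dimH}).
Implicit Types (th : kernel).

Definition contr_set F G ga : {fset mtriple} :=
  [fset t in ((F `*` G) `*` (\bigcup_(al <- F) box al)) |
     `[< Defs.contraction t.1.1 t.1.2 t.2 ga >]]%fset.

Lemma in_contr_set F G ga (t : mtriple) : t \in contr_set F G ga <->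
  [/\ t.1.1 \in F, t.1.2 \in G & Defs.contraction t.1.1 t.1.2 t.2 ga].
Proof.
case: t => [[al be] r]; rewrite !inE/=; split.
  by move=> /andP[/andP[/andP[alF beG] _] /asboolP].
move=> [alF beG c]; rewrite alF beG/=; apply/andP; split; last exact/asboolP.
apply/bigfcupP; exists al; rewrite ?alF//.
by apply/in_box => j; case: (c j).
Qed.

Definition prod_term th A B ga (t : mtriple) : E -> E := fun x =>
  (product_coeff t.1.1 t.1.2 t.2 ga * th t.1.1 t.1.2 t.2 ga)%:C%C *:
     A t.1.1 (B t.1.2 x).

Definition vanishes_off F A := forall al, al \notin F -> A al = fun=> 0.

Lemma fin_array_prodE th A B F G ga x :
  (forall al, linear (A al)) -> vanishes_off F A -> vanishes_off G B ->
  fin_array_prod th A B ga x = \sum_(t <- contr_set F G ga) prod_term th A B ga t x.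
Proof.
move=> linA AF BG; rewrite /fin_array_prod.
rewrite (fsbigE (contr_set F G ga))//=.
- apply: big_rmcond_in => t /in_contr_set[_ _ c]; rewrite notin_setE/=.
  by move=> /(_ c).
- by move=> t /= /in_contr_set[].
- move=> [[al be] r] /= c /negP nt.
  have [alF|/AF ->] := boolP (al \in F); last by rewrite scaler0.
  have [beG|/BG ->] := boolP (be \in G); last by rewrite linear_map0// scaler0.
  by case: nt; apply/in_contr_set.
Qed.

Lemma vanishes_offS F F' A : (F `<=` F')%fset -> vanishes_off F A -> vanishes_off F' A.
Proof. by move=> FF AF al; move/fsubsetP : FF => FF h; apply: AF; apply: contraNN h => /FF. Qed.

Lemma finite_array_linear A al : finite_array f A -> linear (A al).
Proof. by case=> /(_ al)[]. Qed.

Lemma prod_term_hs th A B ga t : finite_array f A -> finite_array f B ->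
  hilbert_schmidt f (prod_term th A B ga t).
Proof.
move=> [hA _] [hB _]; apply: (hilbert_schmidtZ hE hf).
exact: (hilbert_schmidt_comp hE hf).
Qed.

Lemma fin_array_prod_finite th A B : finite_array f A -> finite_array f B ->
  finite_array f (fin_array_prod th A B).
Proof.
move=> fA fB; have [F AF] := finite_arrayP fA; have [G BG] := finite_arrayP fB.
pose S := (\bigcup_(al <- F) box al)%fset.
pose X := [fset madd (msub t.1.1 t.2) (msub t.1.2 t.2) | t in
   ((F `*` G) `*` S)]%fset.
have lA al := finite_array_linear al fA.
apply: (@finite_array_intro _ _ _ _ _ _ X).
  move=> ga; rewrite (_ : fin_array_prod th A B ga = fun x =>
    \sum_(t <- contr_set F G ga) prod_term th A B ga t x).
    by apply: (hilbert_schmidt_sum hE hf) => t; exact: prod_term_hs.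
  by apply/funext => x; exact: fin_array_prodE.
move=> ga gaX; apply/funext => x; rewrite (fin_array_prodE _ _ _ lA AF BG).
rewrite (_ : contr_set F G ga = fset0) ?big_seq_fset0//.
apply/eqP; rewrite -fsubset0; apply/fsubsetP => -[[al be] r].
move=> /in_contr_set/=[alF beG /contractionP[mu [nu [e1 e2 e3]]]].
case/negP: gaX; apply/imfsetP; exists ((al, be), r).
  rewrite !inE/= alF beG/=; apply/bigfcupP; exists al; rewrite ?alF//.
  by apply/in_box; rewrite e1; exact: mle_maddr.
by rewrite /= e1 e2 e3 !madd_addK.
Qed.

Lemma fin_array_prod_diff th A A' B B' ga x :
  finite_array f A -> finite_array f A' -> finite_array f B -> finite_array f B' ->
  fin_array_prod th A B ga x - fin_array_prod th A' B' ga x =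
  fin_array_prod th (array_sub A A') B ga x + fin_array_prod th A' (array_sub B B') ga x.
Proof.
move=> fA fA' fB fB'.
have [F0 AF] := finite_arrayP fA; have [F1 AF'] := finite_arrayP fA'.
have [G0 BG] := finite_arrayP fB; have [G1 BG'] := finite_arrayP fB'.
set F := (F0 `|` F1)%fset; set G := (G0 `|` G1)%fset.
have {}AF : vanishes_off F A by apply: vanishes_offS AF; exact: fsubsetUl.
have {}AF' : vanishes_off F A' by apply: vanishes_offS AF'; exact: fsubsetUr.
have {}BG : vanishes_off G B by apply: vanishes_offS BG; exact: fsubsetUl.
have {}BG' : vanishes_off G B' by apply: vanishes_offS BG'; exact: fsubsetUr.
have sub (C D : array) (H : {fset midx dimH}) :
    vanishes_off H C -> vanishes_off H D -> vanishes_off H (array_sub C D).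
  by move=> CH DH al alH; apply/funext => y; rewrite /array_sub CH// DH// subr0.
have lA al := finite_array_linear al fA; have lA' al := finite_array_linear al fA'.
have lAA al := finite_array_linear al (finite_array_sub hE hf fA fA').
rewrite (fin_array_prodE _ _ _ lA AF BG) (fin_array_prodE _ _ _ lA' AF' BG').
rewrite (fin_array_prodE _ _ _ lAA (sub _ _ _ AF AF') BG).
rewrite (fin_array_prodE _ _ _ lA' AF' (sub _ _ _ BG BG')).
rewrite -sumrB -big_split/=; apply: eq_bigr => t _.
rewrite /prod_term /array_sub (linear_mapB (lA' _)) -!scalerBr -scalerDr.
by rewrite addrA subrK.
Qed.

Lemma fin_array_prod_kernel_diff th th' A B ga x :
  finite_array f A -> finite_array f B ->
  fin_array_prod th A B ga x - fin_array_prod th' A B ga x =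
  fin_array_prod (fun al be r ga => th al be r ga - th' al be r ga) A B ga x.
Proof.
move=> fA fB; have [F AF] := finite_arrayP fA; have [G BG] := finite_arrayP fB.
have lA al := finite_array_linear al fA.
rewrite !(fin_array_prodE _ _ _ lA AF BG) -sumrB; apply: eq_bigr => t _.
by rewrite /prod_term -scalerBl -rmorphB/= mulrBr.
Qed.

Local Open Scope ereal_scope.

Definition dominated th (tau : nat -> nat -> R) := forall al be r ga,
  Defs.contraction al be r ga -> (`|th al be r ga| <= tau (mdeg al) (mdeg be))%R.

Lemma product_coeff_ge0 al be r ga : (0 <= product_coeff al be r ga :> R)%R.
Proof. by rewrite /product_coeff mulr_ge0// sqrtr_ge0. Qed.

(** Hilbert--Schmidt norms are submultiplicative, so the triangle inequality
    over the finitely many contractions bounds the product by its scalar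
    majorant. *)
Lemma hsa_fin_array_prod_le th tau A B ga : finite_array f A -> finite_array f B ->
  dominated th tau ->
  hsa f (fin_array_prod th A B) ga <=
  sprod (fun m n => (tau m n)%:E) (hsa f A) (hsa f B) ga.
Proof.
move=> fA fB dom; have [F AF] := finite_arrayP fA; have [G BG] := finite_arrayP fB.
have lA al := finite_array_linear al fA.
rewrite /hsa (_ : fin_array_prod th A B ga = fun x =>
    \sum_(t <- contr_set F G ga) prod_term th A B ga t x)%R; last first.
  by apply/funext => x; exact: fin_array_prodE.
apply: le_trans (hsn_sum _ _ _) _.
apply: (@le_trans _ _ (\sum_(t <- contr_set F G ga)
   ((`|tau (mdeg t.1.1) (mdeg t.1.2)|)%:E * ((product_coeff t.1.1 t.1.2 t.2 ga)%:E *
   (hsn f (A t.1.1) * hsn f (B t.1.2)))))).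
  rewrite big_seq [leRHS]big_seq; apply: lee_sum => t /in_contr_set[_ _ c].
  rewrite hsnZ cmod_real normrM (ger0_norm (product_coeff_ge0 _ _ _ _)).
  rewrite mulrC EFinM -muleA; apply: lee_pmul.
  - by rewrite lee_fin.
  - by rewrite mule_ge0 ?hsn_ge0// lee_fin product_coeff_ge0.
  - by rewrite lee_fin (le_trans (dom _ _ _ _ c))// ler_norm.
  - apply: lee_wpmul2l; first by rewrite lee_fin product_coeff_ge0.
    by apply: (hsn_comp hE hf); case: fA => /(_ t.1.1)[].
rewrite -(@esum_seq _ _ _ [set` contr_set F G ga])//.
- rewrite (@eq_esum _ _ _ _ (fun t => (tau (mdeg t.1.1) (mdeg t.1.2))%:E *
     ((product_coeff t.1.1 t.1.2 t.2 ga)%:E * (hsn f (A t.1.1) * hsn f (B t.1.2))))).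
    by apply: esum_subset => t /= /in_contr_set[].
  move=> t /= /in_contr_set[_ _ c]; rewrite ger0_norm//.
  by apply: le_trans (dom _ _ _ _ c).
- by move=> t; rewrite !mule_ge0 ?hsn_ge0 ?lee_fin ?product_coeff_ge0.
Qed.

Section Estimate.
Variables (sigma rho eta : R).
Hypotheses (sigma1 : (1 <= sigma)%R) (rho0 : (0 < rho)%R) (eta0 : (0 < eta)%R).
Hypothesis hyp : ((1 + rho ^+ 2)^-1 + (1 + eta ^+ 2)^-1 <= (1 + sigma ^+ 2)^-1)%R.

Lemma fin_array_prod_norm_le th tau A B : finite_array f A -> finite_array f B ->
  dominated th tau -> (forall m n, (0 <= tau m n)%R) ->
  pnorm f sigma (fin_array_prod th A B) <=
  \esum_(m in setT) \esum_(n in setT) ((tau m n)%:E *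
    (((rho ^+ m)%:E * l2deg (hsa f A) m) * ((eta ^+ n)%:E * l2deg (hsa f B) n))).
Proof.
move=> fA fB dom tau0; rewrite pnormE; last exact: le_trans ler01 sigma1.
apply: le_trans (sprod_norm_le sigma1 rho0 eta0 hyp _ (hsa_ge0 f A) (hsa_ge0 f B)).
  apply: degnorm_le; first exact: le_trans ler01 sigma1.
    by move=> ga; exact: hsa_ge0.
  by move=> ga; exact: hsa_fin_array_prod_le.
by move=> m n; rewrite lee_fin.
Qed.

Lemma fin_array_prod_norm_le1 th A B : finite_array f A -> finite_array f B ->
  dominated th (fun _ _ => 1%R) ->
  pnorm f sigma (fin_array_prod th A B) <= pnorm f rho A * pnorm f eta B.
Proof.
move=> fA fB dom; apply: le_trans (fin_array_prod_norm_le fA fB dom _) _ => //.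
rewrite (pnormE _ _ (ltW rho0)) (pnormE _ _ (ltW eta0)) /degnorm esumM; last 2 first.
- by move=> m; rewrite mule_ge0 ?l2deg_ge0// lee_fin exprn_ge0// ltW.
- by move=> m; rewrite mule_ge0 ?l2deg_ge0// lee_fin exprn_ge0// ltW.
by apply: le_esum => m _; apply: le_esum => n _; rewrite mul1e.
Qed.

End Estimate.

(** A symmetric choice of radii for the product estimate; the condition
    amounts to 1 <= 2 sigma^2. *)
Lemma double_radius (sigma : R) : (1 <= sigma)%R ->
  ((1 + (2 * sigma) ^+ 2)^-1 + (1 + (2 * sigma) ^+ 2)^-1 <= (1 + sigma ^+ 2)^-1)%R.
Proof.
move=> s1; have s2 : (1 <= sigma ^+ 2)%R by rewrite expr_ge1// (le_trans ler01).
set a := (1 + (2 * sigma) ^+ 2)%R.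
have a0 : (0 < a)%R by rewrite ltr_pwDl// sqr_ge0.
have -> : (a^-1 + a^-1 = 2 / a)%R by field; rewrite gt_eqF.
rewrite ler_pdivrMr// mulrC ler_pdivlMr ?ltr_pwDl ?sqr_ge0//.
by rewrite /a exprMn; move: s2; set s := (sigma ^+ 2)%R => s2; lra.
Qed.

Lemma fin_array_prod_double th A B (sigma : R) : (1 <= sigma)%R ->
  finite_array f A -> finite_array f B -> dominated th (fun _ _ => 1%R) ->
  pnorm f sigma (fin_array_prod th A B) <=
    pnorm f (2 * sigma) A * pnorm f (2 * sigma) B.
Proof.
move=> s1 fA fB dom; have s0 : (0 < 2 * sigma)%R by lra.
exact: (fin_array_prod_norm_le1 s1 s0 s0 (double_radius s1)).
Qed.

Lemma fin_array_prod_diff_le th A A' B B' (sigma : R) : (1 <= sigma)%R ->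
  finite_array f A -> finite_array f A' -> finite_array f B -> finite_array f B' ->
  dominated th (fun _ _ => 1%R) ->
  pnorm f sigma (array_sub (fin_array_prod th A B) (fin_array_prod th A' B')) <=
    pnorm f (2 * sigma) (array_sub A A') * pnorm f (2 * sigma) B +
    pnorm f (2 * sigma) A' * pnorm f (2 * sigma) (array_sub B B').
Proof.
move=> s1 fA fA' fB fB' dom; have s0 : (0 <= sigma)%R by exact: le_trans s1.
apply: le_trans (_ : _ <= pnorm f sigma (fin_array_prod th (array_sub A A') B) +
   pnorm f sigma (fin_array_prod th A' (array_sub B B'))) _.
  apply: pnorm_split => // ga x; exact: fin_array_prod_diff.
apply: leeD; apply: fin_array_prod_double => //.
- exact: (finite_array_sub hE hf).
- exact: (finite_array_sub hE hf).
Qed.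

Lemma cvg_frakA2_fin A (u : nat -> array) (rho : R) : (1 <= rho)%R ->
  cvg_frakA2 f u A -> exists2 K : R, (0 < K)%R &
    \forall n \near \oo, pnorm f rho (u n) <= K%:E.
Proof.
move=> r1 [fu fA uA]; have r0 : (0 <= rho)%R by exact: le_trans r1.
have : pnorm f rho A < +oo by case: fA => _; exact.
have := pnorm_ge0 f A r0; case AE : (pnorm f rho A) => [p||//] // p0 _.
exists (p + 1)%R; first by rewrite ltr_wpDl.
have := (ecvg0P (fun n => pnorm_ge0 f (array_sub (u n) A) r0)).1 (uA rho r1) 1%R ltr01.
apply: filterS => n un.
have := pnorm_triangle f (u n) A (fun _ _ => 0%R) r0.
rewrite !pnorm_sub0 AE EFinD => h; apply: le_trans h _.
by rewrite [leRHS]addeC; apply: leeD.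
Qed.

Lemma prod_vanish (x y : nat -> \bar R) (K : R) : (0 < K)%R ->
  (forall n, 0 <= x n) -> (forall n, 0 <= y n) ->
  x n @[n --> \oo] --> 0 -> (\forall n \near \oo, y n <= K%:E) ->
  x n * y n @[n --> \oo] --> 0.
Proof.
move=> K0 x0 y0 xv yK.
apply: (@ecvg0_le _ _ (fun n => K%:E * x n)) => [n||].
- by rewrite mule_ge0.
- move: yK; apply: filterS => n yn; rewrite muleC; exact: lee_wpmul2r.
- exact: ecvg0Z.
Qed.

(** Two pairs of approximating sequences give the same limit of products;
    hence the limit along truncations is the limit along all approximations. *)
Lemma fin_array_prod_close th (A B : array) (u u' v v' : nat -> array) (sigma : R) :
  (1 <= sigma)%R -> dominated th (fun _ _ => 1%R) ->
  (forall n, finite_array f (u n)) -> (forall n, finite_array f (u' n)) ->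
  (forall n, finite_array f (v n)) -> (forall n, finite_array f (v' n)) ->
  cvg_frakA2 f u A -> cvg_frakA2 f u' A -> cvg_frakA2 f v B -> cvg_frakA2 f v' B ->
  pnorm f sigma (array_sub (fin_array_prod th (u n) (v n))
    (fin_array_prod th (u' n) (v' n))) @[n --> \oo] --> 0.
Proof.
move=> s1 dom fu fu' fv fv' uA u'A vB v'B.
have s2 : (1 <= 2 * sigma)%R by lra.
have s0 : (0 <= sigma)%R by lra.
have s20 : (0 <= 2 * sigma)%R by lra.
have dif (C : array) (w w' : nat -> array) : cvg_frakA2 f w C -> cvg_frakA2 f w' C ->
    pnorm f (2 * sigma) (array_sub (w n) (w' n)) @[n --> \oo] --> 0.
  move=> [_ _ wC] [_ _ w'C].
  apply: (@ecvg0_le _ _ (fun n => pnorm f (2 * sigma) (array_sub (w n) C) +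
     pnorm f (2 * sigma) (array_sub (w' n) C))).
  - by move=> n; exact: pnorm_ge0.
  - by apply: nearW => n; rewrite (pnorm_subC _ (w' n))//; exact: pnorm_triangle.
  - by apply: ecvg0D; [exact: wC|exact: w'C].
apply: ecvg0_le; last 1 first.
- apply: ecvg0D; last first.
  + have [K K0 hK] := cvg_frakA2_fin s2 u'A.
    apply: (prod_vanish K0 _ _ (dif _ _ _ vB v'B) hK) => n; exact: pnorm_ge0.
  + have [K K0 hK] := cvg_frakA2_fin s2 vB.
    apply: (prod_vanish K0 _ _ (dif _ _ _ uA u'A) hK) => n; exact: pnorm_ge0.
- by move=> n; exact: pnorm_ge0.
- apply: nearW => n; rewrite /= [X in _ + X]muleC; exact: fin_array_prod_diff_le.
Qed.

(** The product of finite arrays is Lipschitz for the norms of the doubled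
    radius, so it extends by completeness. *)
Lemma array_prod_spec th A B : dominated th (fun _ _ => 1%R) ->
  frakA2 f A -> frakA2 f B ->
  frakA2 f (array_prod f th A B) /\
  forall An Bn : nat -> array,
    (forall n, finite_array f (An n)) -> (forall n, finite_array f (Bn n)) ->
    cvg_frakA2 f An A -> cvg_frakA2 f Bn B ->
    cvg_frakA2 f (fun n => fin_array_prod th (An n) (Bn n)) (array_prod f th A B).
Proof.
move=> dom fA fB.
suff : [set C : array | frakA2 f C /\ forall An Bn : nat -> array,
    (forall n, finite_array f (An n)) -> (forall n, finite_array f (Bn n)) ->
    cvg_frakA2 f An A -> cvg_frakA2 f Bn B ->
    cvg_frakA2 f (fun n => fin_array_prod th (An n) (Bn n)) C] (array_prod f th A B) by [].
apply: xgetPex.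
(* The limit is constructed along the truncations. *)
pose a n := trunc (midx_upto n) A; pose b n := trunc (midx_upto n) B.
have fa n : finite_array f (a n) by exact: trunc_finite.
have fb n : finite_array f (b n) by exact: trunc_finite.
have aA : cvg_frakA2 f a A by exact: trunc_cvg.
have bB : cvg_frakA2 f b B by exact: trunc_cvg.
pose P n := fin_array_prod th (a n) (b n).
have fP n : finite_array f (P n) by exact: fin_array_prod_finite.
have [] := @frakA2_complete _ _ _ _ dot f hE hf P.
- by move=> n; exact: finite_array_frakA2.
- move=> rho r1 e e0.
  have r2 : (1 <= 2 * rho)%R by lra.
  have r0 : (0 <= rho)%R by lra.
  have r20 : (0 <= 2 * rho)%R by lra.
  have [K K0 [N1 _ hK]] := cvg_frakA2_fin r2 aA.
  have [L L0 [N2 _ hL]] := cvg_frakA2_fin r2 bB.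
  have Cauchy (C : array) (w : nat -> array) (d : R) : cvg_frakA2 f w C -> (0 < d)%R ->
      exists M, forall n m, (M <= n)%N -> (M <= m)%N ->
      pnorm f (2 * rho) (array_sub (w n) (w m)) <= d%:E.
    move=> [_ _ /(_ _ r2) wC] d0.
    have d2 : (0 < d / 2)%R by lra.
    have [M _ hM] := (ecvg0P (fun n => pnorm_ge0 f (array_sub (w n) C) r20)).1 wC _ d2.
    exists M => n m Mn Mm; apply: le_trans (pnorm_triangle f _ C _ r20) _.
    rewrite (pnorm_subC _ C)// (splitr d) EFinD; apply: leeD; exact: hM.
  have [M1 hM1] := Cauchy A a (e / 2 / L)%R aA (divr_gt0 (divr_gt0 e0 (ltr0Sn _ 1)) L0).
  have [M2 hM2] := Cauchy B b (e / 2 / K)%R bB (divr_gt0 (divr_gt0 e0 (ltr0Sn _ 1)) K0).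
  exists (maxn (maxn N1 N2) (maxn M1 M2)) => n m; rewrite !geq_max.
  move=> /andP[/andP[N1n N2n] /andP[M1n M2n]] /andP[/andP[N1m N2m] /andP[M1m M2m]].
  apply: le_trans (fin_array_prod_diff_le r1 (fa n) (fa m) (fb n) (fb m) dom) _.
  rewrite (splitr e) EFinD; apply: leeD.
    rewrite (_ : (e / 2)%:E = (e / 2 / L)%:E * L%:E); last by rewrite -EFinM divfK// gt_eqF.
    apply: lee_pmul; rewrite ?pnorm_ge0//; [exact: hM1|exact: hL].
  rewrite (_ : (e / 2)%:E = K%:E * (e / 2 / K)%:E); last first.
    by rewrite -EFinM [in RHS]mulrC divfK// gt_eqF.
  by apply: lee_pmul; rewrite ?pnorm_ge0//; [exact: hK|exact: hM2].
- move=> C [_ fC PC]; exists C; split; first exact: fC.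
  move=> An Bn fAn fBn AnA BnB; split; [|exact: fC|].
    by move=> n; apply: finite_array_frakA2; exact: fin_array_prod_finite.
  move=> rho r1; have r0 : (0 <= rho)%R by exact: le_trans r1.
  apply: ecvg0_le; last 1 first.
  + apply: ecvg0D; first exact: (fin_array_prod_close r1 dom fAn fa fBn fb AnA aA BnB bB).
    exact: (PC rho r1).
  + by move=> n; exact: pnorm_ge0.
  + by apply: nearW => n; exact: pnorm_triangle.
Qed.

End FiniteProducts.

(** * The rate of convergence of the products *)

Section FallingFactorialRatios.
Context {R : realType}.
Implicit Types (N g r : nat).

(** The last inequality is Weierstrass's: a product of numbers in [0, 1]
    falls short of 1 by at most the sum of the individual shortfalls. *)
Lemma prod_unit_interval (I : Type) (s : seq I) (x : I -> R) :
  (forall i, 0 <= x i <= 1) ->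
  [/\ 0 <= \prod_(i <- s) x i, \prod_(i <- s) x i <= 1 &
      1 - \sum_(i <- s) (1 - x i) <= \prod_(i <- s) x i].
Proof.
move=> x01; elim: s => [|i s [p0 p1 ps]].
  by rewrite !big_nil subr0 ler01 lexx.
rewrite !big_cons; have /andP[xi0 xi1] := x01 i; split.
- exact: mulr_ge0.
- by rewrite mulr_ile1.
- move: ps p0 p1; set S := \sum_(j <- s) _; set P := \prod_(j <- s) _ => ps p0 p1.
  have : 0 <= (1 - x i) * (1 - P) by rewrite mulr_ge0 ?subr_ge0.
  by lra.
Qed.

Definition falling_ratio N g r : R := ((N - g) ^_ r)%:R / N%:R ^+ r.

Lemma falling_ratioE N g r :
  falling_ratio N g r = \prod_(i < r) ((N - g - i)%:R / N%:R).
Proof.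
rewrite /falling_ratio ffact_prod natr_prod prodf_div; congr (_ / _).
by rewrite prodr_const card_ord.
Qed.

Lemma falling_factor_bounds N g i : 0 <= ((N - g - i)%:R / N%:R : R) <= 1.
Proof.
rewrite divr_ge0 ?ler0n//=; case: N => [|N]; first by rewrite invr0 mulr0.
by rewrite ler_pdivrMr ?ltr0n// mul1r ler_nat; lia.
Qed.

Lemma falling_ratio_bounds N g r : 0 <= falling_ratio N g r <= 1.
Proof.
rewrite falling_ratioE; have [p0 p1 _] := prod_unit_interval (index_enum 'I_r)
  (fun i : 'I_r => falling_factor_bounds N g i).
by rewrite p0 p1.
Qed.

Lemma bin2_natr n : 'C(n, 2)%:R = n%:R * (n%:R - 1) / 2 :> R.
Proof.
elim: n => [|n IH]; first by rewrite bin0n mul0r mul0r.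
by rewrite binS bin1 natrD IH -natr1; field.
Qed.

(** The factors fall short of 1 by at most (g + i)/N, and these add up to (r
    g + C(r, 2))/N. *)
Lemma one_sub_falling_ratio_le N g r : (0 < N)%N ->
  1 - falling_ratio N g r <= 'C(g + 2 * r, 2)%:R / N%:R.
Proof.
move=> N0; have Np : 0 < N%:R :> R by rewrite ltr0n.
rewrite falling_ratioE; have [_ _] := prod_unit_interval (index_enum 'I_r)
  (fun i : 'I_r => falling_factor_bounds N g i).
rewrite lerBlDr -lerBlDl => h; apply: le_trans h _.
apply: (@le_trans _ _ (\sum_(i < r) ((g + i)%:R / N%:R))).
  apply: ler_sum => i _; rewrite lerBlDr -mulrDl -natrD ler_pdivlMr// mul1r ler_nat.
  lia.
rewrite -mulr_suml ler_pM2r ?invr_gt0//.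
have -> : \sum_(i < r) (g + i)%:R = r%:R * g%:R + 'C(r, 2)%:R :> R.
  elim: r => [|r IH]; first by rewrite big_ord0 bin0n mul0r addr0.
  by rewrite big_ord_recr/= IH binS bin1 !natrD -natr1; ring.
rewrite !bin2_natr natrD natrM.
have g0 : 0 <= g%:R :> R by rewrite ler0n.
have r0 : r%:R = 0 :> R \/ (1 : R) <= r%:R.
  by case: (r) => [|k]; [left|right; rewrite ler1n].
have g1 : g%:R = 0 :> R \/ (1 : R) <= g%:R.
  by case: (g) => [|k]; [left|right; rewrite ler1n].
(* Either number is 0 or at least 1; without integrality the inequality
   fails. *)
by case: r0 => [->|r1]; case: g1 => [->|g1]; nra.
Qed.

Lemma bin2_superadditive (I : Type) (s : seq I) (n : I -> nat) :
  (\sum_(i <- s) 'C(n i, 2) <= 'C(\sum_(i <- s) n i, 2))%N.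
Proof.
elim: s => [|i s IH]; first by rewrite !big_nil.
rewrite !big_cons; apply: leq_trans (leq_add (leqnn _) IH) _.
move: (n i) (\sum_(j <- s) n j)%N => a b; rewrite -(ler_nat R) natrD !bin2_natr natrD.
by have := ler0n R a; have := ler0n R b; nra.
Qed.

(** C(M, 2) q^(M - 2) (1 - q)^2 is one term of the binomial expansion of (q
    + (1 - q))^M = 1. *)
Lemma bin2_geometric_le (q : R) M : 0 <= q -> q < 1 ->
  'C(M, 2)%:R * q ^+ M <= q ^+ 2 / (1 - q) ^+ 3.
Proof.
move=> q0 q1; have p0 : 0 < 1 - q by rewrite subr_gt0.
have p1 : 1 - q <= 1 by lra.
case: M => [|[|M]]; try by rewrite bin_small// mul0r divr_ge0 ?exprn_ge0// ltW.
rewrite ler_pdivlMr ?exprn_gt0//.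
have h : 'C(M.+2, 2)%:R * q ^+ M * (1 - q) ^+ 2 <= 1.
  suff : 'C(M.+2, 2)%:R * q ^+ M * (1 - q) ^+ 2 <= (q + (1 - q)) ^+ M.+2.
    by rewrite [q + _]addrC subrK expr1n.
  have i2 : (2 < M.+3)%N by [].
  rewrite [leRHS]exprDn.
  have -> : 'C(M.+2, 2)%:R * q ^+ M * (1 - q) ^+ 2 =
      q ^+ (M.+2 - 2) * (1 - q) ^+ 2 *+ 'C(M.+2, 2).
    by rewrite -[RHS]mulr_natl subn2/= mulrA.
  rewrite (bigD1 (Ordinal i2))//= lerDl; apply: sumr_ge0 => i _.
  by rewrite mulrn_wge0// mulr_ge0 ?exprn_ge0// ltW.
have -> : 'C(M.+2, 2)%:R * q ^+ M.+2 * (1 - q) ^+ 3 =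
   q ^+ 2 * (('C(M.+2, 2)%:R * q ^+ M * (1 - q) ^+ 2) * (1 - q)).
  by rewrite -addn2 exprD; ring.
rewrite -[leRHS]mulr1; apply: ler_wpM2l; first exact: sqr_ge0.
apply: mulr_ile1 => //; last exact: ltW.
by rewrite !mulr_ge0 ?exprn_ge0// ltW.
Qed.

End FallingFactorialRatios.

Section Vartheta.
Context {R : realType} {dim : option nat}.
Implicit Types (al be r ga : midx dim) (N : nat).

Lemma vartheta_bounds N al be r ga : 0 <= (vartheta N al be r ga : R) <= 1.
Proof.
rewrite /vartheta; case: ifP => _; last by rewrite lexx ler01.
have [p0 p1 _] := prod_unit_interval (finsupp r)
  (fun j => @falling_ratio_bounds R N (ga j) (r j)).
by apply/andP; split.
Qed.

Lemma vartheta_dominated N : dominated (@vartheta R dim N) (fun _ _ => 1).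
Proof.
move=> al be r ga _; have /andP[h0 h1] := vartheta_bounds N al be r ga.
by rewrite ger0_norm.
Qed.

Lemma contraction_mdeg al be r ga : Defs.contraction al be r ga ->
  (mdeg al + mdeg be = mdeg ga + 2 * mdeg r)%N.
Proof.
move=> /contractionP[mu [nu [-> -> ->]]]; rewrite !mdeg_add; lia.
Qed.

(** Each coordinate contributes at most the pairs formed inside its own
    exponents, and outside the admissible range the total degree exceeds [N]. *)
Lemma vartheta_defect N al be r ga : (0 < N)%N -> Defs.contraction al be r ga ->
  `|vartheta N al be r ga - 1| <= 'C(mdeg al + mdeg be, 2)%:R / N%:R :> R.
Proof.
move=> N0 c; have Np : 0 < N%:R :> R by rewrite ltr0n.
have /andP[h0 h1] := vartheta_bounds N al be r ga.
rewrite distrC ger0_norm ?subr_ge0//.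
rewrite /vartheta; case: asboolP => [_|nb].
  have [_ _ h] := prod_unit_interval (finsupp r)
    (fun j => @falling_ratio_bounds R N (ga j) (r j)).
  apply: (@le_trans _ _ (\sum_(j <- finsupp r) (1 - falling_ratio N (ga j) (r j) : R))).
    by move: h; rewrite lerBlDr -lerBlDl.
  apply: (@le_trans _ _ (\sum_(j <- finsupp r) ('C(ga j + 2 * r j, 2)%:R / N%:R))).
    by apply: ler_sum => j _; exact: one_sub_falling_ratio_le.
  rewrite -mulr_suml ler_pM2r ?invr_gt0// -natr_sum ler_nat.
  apply: leq_trans (@bin2_superadditive R _ _ _) _; apply: leq_bin2l.
  rewrite (contraction_mdeg c) big_split/= -big_distrr/= leq_add2r.
  rewrite (mdegE (fsubsetUl (finsupp ga) (finsupp r))).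
  rewrite [leqRHS](big_fsetID _ (mem (finsupp r)))/=.
  rewrite (_ : [fset x in (finsupp ga `|` finsupp r) | x \in finsupp r]%fset = finsupp r).
    exact: leq_addr.
  by apply/fsetP => j; rewrite !inE andbC; case: (j \in finsupp r); rewrite ?orbT.
(* Outside the range theta is 0, and the claim is that the bound is at least
   1. *)
rewrite subr0 ler_pdivlMr// mul1r ler_nat.
suff h : (N < mdeg al + mdeg be)%N.
  apply: (@leq_trans 'C(N.+1, 2)); last exact: leq_bin2l.
  by rewrite binS bin1 leq_addl.
apply: contra_notT nb; rewrite -leqNgt => h j.
have [_ _ gj] := c j.
have := mdeg_ge al j; have := mdeg_ge be j => h2 h3.
by split; lia.
Qed.

End Vartheta.

Section ProductApproximation.
Context {R : realType} {E : completeNormedModType R[i]} {dimH dimE : option nat}.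
Variables (dot : {dot E for Num.conj}) (f : ix dimE -> E).
Hypotheses (hE : norm_from_dot dot) (hf : orthonormal_basis dot f).
Notation array := (coeff_array dimH E).
Implicit Types (A B : array).
Local Open Scope ereal_scope.

Lemma one_dominated : @dominated R dimH (fun _ _ _ _ => 1%R) (fun _ _ => 1%R).
Proof. by move=> *; rewrite normr1. Qed.

Lemma starN_spec N A B : frakA2 f A -> frakA2 f B ->
  frakA2 f (starN f N A B) /\
  forall An Bn : nat -> array,
    (forall n, finite_array f (An n)) -> (forall n, finite_array f (Bn n)) ->
    cvg_frakA2 f An A -> cvg_frakA2 f Bn B ->
    cvg_frakA2 f (fun n => fin_array_prod (vartheta N) (An n) (Bn n)) (starN f N A B).
Proof. exact: (array_prod_spec hE hf (@vartheta_dominated R dimH N)). Qed.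

Lemma star_spec A B : frakA2 f A -> frakA2 f B ->
  frakA2 f (star f A B) /\
  forall An Bn : nat -> array,
    (forall n, finite_array f (An n)) -> (forall n, finite_array f (Bn n)) ->
    cvg_frakA2 f An A -> cvg_frakA2 f Bn B ->
    cvg_frakA2 f (fun n => fin_array_prod (fun _ _ _ _ => 1%R) (An n) (Bn n)) (star f A B).
Proof. exact: (array_prod_spec hE hf one_dominated). Qed.

Section Rate.
Variables (sigma rho eta Rp Sp : R).
Hypotheses (sigma1 : (1 <= sigma)%R) (rho0 : (0 < rho)%R) (eta0 : (0 < eta)%R).
Hypothesis hyp : ((1 + rho ^+ 2)^-1 + (1 + eta ^+ 2)^-1 <= (1 + sigma ^+ 2)^-1)%R.
Hypotheses (rhoR : (rho < Rp)%R) (etaS : (eta < Sp)%R).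
Let q : R := Num.max (rho / Rp)%R (eta / Sp)%R.
Let Rp0 : (0 < Rp)%R. Proof. exact: lt_trans rhoR. Qed.
Let Sp0 : (0 < Sp)%R. Proof. exact: lt_trans etaS. Qed.

Let q0 : (0 <= q)%R.
Proof. by rewrite /q le_max (divr_ge0 (ltW rho0) (ltW Rp0)). Qed.

Let q1 : (q < 1)%R.
Proof. by rewrite /q gt_max !ltr_pdivrMr// !mul1r rhoR etaS. Qed.

(** The difference of the products is a product with kernel theta - 1, so
    the product estimate applies with the degree weights of
    [vartheta_defect]; these are absorbed by the ratios rho/Rp and eta/Sp,
    both at most q. *)
Lemma fin_array_prod_rate N A B : (0 < N)%N -> finite_array f A -> finite_array f B ->
  pnorm f sigma (array_sub (fin_array_prod (vartheta N) A B)
                           (fin_array_prod (fun _ _ _ _ => 1%R) A B)) <=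
  (q ^+ 2 / (N%:R * (1 - q) ^+ 3))%:E * pnorm f Rp A * pnorm f Sp B.
Proof.
move=> N0 fA fB; have Np : (0 < N%:R :> R)%R by rewrite ltr0n.
set K : R := (q ^+ 2 / (N%:R * (1 - q) ^+ 3))%R.
have K0 : (0 <= K)%R by rewrite divr_ge0 ?mulr_ge0 ?sqr_ge0 ?exprn_ge0// subr_ge0 ltW.
rewrite (_ : array_sub _ _ = fin_array_prod (fun al be r ga => vartheta N al be r ga - 1)%R A B).
  apply: le_trans (fin_array_prod_norm_le hE hf sigma1 rho0 eta0 hyp fA fB
     (tau := fun m n => ('C(m + n, 2)%:R / N%:R)%R) _ _) _.
  - by move=> al be r ga c; exact: vartheta_defect.
  - by move=> m n; rewrite divr_ge0.
  have nR m : 0 <= (Rp ^+ m)%:E * l2deg (hsa f A) m.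
    by rewrite mule_ge0 ?l2deg_ge0// lee_fin exprn_ge0// ltW.
  have nS m : 0 <= (Sp ^+ m)%:E * l2deg (hsa f B) m.
    by rewrite mule_ge0 ?l2deg_ge0// lee_fin exprn_ge0// ltW.
  rewrite (pnormE _ _ (ltW Rp0)) (pnormE _ _ (ltW Sp0)) -muleA /degnorm esumM//.
  rewrite -esumZl//; last by move=> m; apply: esum_ge0 => n _; rewrite mule_ge0.
  apply: le_esum => m _; rewrite -esumZl//; last by move=> n; rewrite mule_ge0.
  apply: le_esum => n _.
  rewrite [X in _ * X <= _]muleACA [X in _ <= _ * X]muleACA !muleA -!EFinM.
  apply: lee_wpmul2r; first exact: l2deg_ge0.
  apply: lee_wpmul2r; first exact: l2deg_ge0.
  rewrite lee_fin.
  have le1 (x y : R) k : (0 < x)%R -> (0 < y)%R -> (x / y <= q)%R -> (x ^+ k <= q ^+ k * y ^+ k)%R.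
    move=> x0 y0; rewrite ler_pdivrMr// => xy; rewrite -exprMn.
    apply: lerXn2r => //; rewrite nnegrE; first exact: ltW.
    by rewrite mulr_ge0// ltW.
  have ler : (rho ^+ m <= q ^+ m * Rp ^+ m)%R by apply: le1 => //; rewrite /q le_max lexx.
  have les : (eta ^+ n <= q ^+ n * Sp ^+ n)%R by apply: le1 => //; rewrite /q le_max lexx orbT.
  apply: (@le_trans _ _ ('C(m + n, 2)%:R / N%:R * ((q ^+ m * Rp ^+ m) * (q ^+ n * Sp ^+ n))))%R.
    rewrite -mulrA; apply: ler_wpM2l; first by rewrite divr_ge0.
    by apply: ler_pM; rewrite ?exprn_ge0// ltW.
  rewrite (_ : ('C(m + n, 2)%:R / N%:R * (q ^+ m * Rp ^+ m * (q ^+ n * Sp ^+ n)) =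
    ('C(m + n, 2)%:R / N%:R * q ^+ (m + n)) * (Rp ^+ m * Sp ^+ n))%R); last first.
    by rewrite exprD; ring.
  rewrite -[leRHS]mulrA; apply: ler_wpM2r.
    by rewrite mulr_ge0 ?exprn_ge0// ltW.
  rewrite /K invfM [leLHS]mulrAC [leRHS]mulrCA [leRHS]mulrC.
  apply: ler_wpM2r; first by rewrite invr_ge0 ltW.
  exact: bin2_geometric_le.
by apply/funext => ga; apply/funext => x; exact: (fin_array_prod_kernel_diff _ _ _ _ fA fB).
Qed.

(** The bound for finite arrays passes to the limit along truncations, which
    only decrease the norms on the right. *)
Lemma starN_star_le N A B : (0 < N)%N -> frakA2 f A -> frakA2 f B ->
  pnorm f sigma (array_sub (starN f N A B) (star f A B)) <=
  (q ^+ 2 / (N%:R * (1 - q) ^+ 3))%:E * pnorm f Rp A * pnorm f Sp B.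
Proof.
move=> N0 fA fB; have s0 : (0 <= sigma)%R by exact: le_trans sigma1.
set K : R := (q ^+ 2 / (N%:R * (1 - q) ^+ 3))%R.
have K0 : (0 <= K)%R.
  by rewrite divr_ge0 ?mulr_ge0 ?sqr_ge0 ?exprn_ge0// subr_ge0 ltW.
pose a n := trunc (midx_upto n) A; pose b n := trunc (midx_upto n) B.
have fa n : finite_array f (a n) by exact: trunc_finite.
have fb n : finite_array f (b n) by exact: trunc_finite.
have [_ /(_ a b fa fb (trunc_cvg fA) (trunc_cvg fB))[_ _ /(_ _ sigma1) h1]] := starN_spec N fA fB.
have [_ /(_ a b fa fb (trunc_cvg fA) (trunc_cvg fB))[_ _ /(_ _ sigma1) h2]] := star_spec fA fB.
apply: (lee_lim0 (ecvg0D h1 h2)) => n; first by rewrite adde_ge0// pnorm_ge0.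
apply: le_trans (pnorm_triangle f _ (fin_array_prod (vartheta N) (a n) (b n)) _ s0) _.
rewrite (pnorm_subC f (starN f N A B) _ s0).
apply: (@le_trans _ _ (pnorm f sigma (array_sub (fin_array_prod (vartheta N) (a n) (b n)) (starN f N A B)) +
  (pnorm f sigma (array_sub (fin_array_prod (vartheta N) (a n) (b n))
                           (fin_array_prod (fun _ _ _ _ => 1%R) (a n) (b n))) +
   pnorm f sigma (array_sub (fin_array_prod (fun _ _ _ _ => 1%R) (a n) (b n)) (star f A B))))).
  by rewrite leeD2l// pnorm_triangle.
rewrite addeCA; apply: leeD => //.
apply: le_trans (fin_array_prod_rate N0 (fa n) (fb n)) _.
have le1 (rr : R) (C : array) : (0 < rr)%R -> pnorm f rr (trunc (midx_upto n) C) <= pnorm f rr C.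
  by move=> r0; apply: pnorm_le; [exact: ltW|exact: hsa_trunc_le].
rewrite -!muleA; apply: lee_wpmul2l; first by rewrite lee_fin.
by apply: lee_pmul; rewrite ?(pnorm_ge0 _ _ (ltW Rp0)) ?(pnorm_ge0 _ _ (ltW Sp0))//; exact: le1.
Qed.

End Rate.
End ProductApproximation.

(** * Budget projections and noise amplification *)

(** The majorant controls the tail uniformly in [n], and what remains is a
    finite sum. *)
Lemma esum_dominated_cvg0 (R : realType) (I : choiceType) (a : nat -> I -> R) (b : I -> R) :
  (forall n i, 0 <= a n i <= b i) -> (\esum_(i in setT) (b i)%:E < +oo)%E ->
  (forall i, a n i @[n --> \oo] --> (0 : R)) ->
  (\esum_(i in setT) (a n i)%:E)%E @[n --> \oo] --> 0%E.
Proof.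
move=> ab bfin acv.
have a0 n i : 0 <= a n i by case/andP: (ab n i).
have ale n i : a n i <= b i by case/andP: (ab n i).
have b0 i : 0 <= b i by exact: le_trans (ale 0%N i).
have s0 n : (0 <= \esum_(i in setT) (a n i)%:E)%E.
  by apply: esum_ge0 => i _; rewrite lee_fin.
apply/ecvg0P => // e e0.
have e2 : 0 < e / 2 by rewrite divr_gt0.
have [X hX] := esum_tail (fun i => (b0 i : (0 <= (b i)%:E)%E)) bfin e2.
have h : \sum_(i <- X) a n i @[n --> \oo] --> (0 : R).
  rewrite [X in _ --> X](_ : 0 = \sum_(i <- X) (0 : R)); last by rewrite big1.
  by apply: cvg_big => // ; exact: add_continuous.
move/cvgrPdist_le : h => /(_ _ e2); apply: filterS => n.
rewrite sub0r normrN ger0_norm; last by apply: sumr_ge0 => i _.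
move=> hn; rewrite (esumID [set` X]); last by move=> i _; rewrite lee_fin.
rewrite !setTI (splitr e) EFinD; apply: leeD.
  rewrite (@esum_seq _ _ X)//; first by rewrite sumEFin lee_fin.
  by move=> i; rewrite lee_fin.
by apply: le_trans hX; apply: le_esum => i _; rewrite lee_fin.
Qed.

Section BudgetProjections.
Context {R : realType} {E : completeNormedModType R[i]} {dimH dimE : option nat}.
Variables (dot : {dot E for Num.conj}) (f : ix dimE -> E).
Hypotheses (hE : norm_from_dot dot) (hf : orthonormal_basis dot f).
Notation array := (coeff_array dimH E).
Notation data := (obs_data (R := R) dimH dimE).
Implicit Types (A B C : array) (al : midx dimH) (b : budget) (y z : data).

Lemma assembleE b y al x : assemble dot f b y al x =
  if retained_idx b al then
    \sum_(k <- ixs (bL b)) (\sum_(l <- ixs (bL b)) y al k l * dot x (f l)) *: f k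
  else 0.
Proof.
rewrite /assemble; case: ifP => // _; rewrite fsbig_ixs; apply: eq_bigr => k _.
by rewrite fsbig_ixs scaler_suml.
Qed.

Lemma assemble_basis b y al j : assemble dot f b y al (f j) =
  if retained_idx b al && (val j < bL b)%N then
    \sum_(k <- ixs (bL b)) y al k j *: f k else 0.
Proof.
rewrite assembleE; case: ifP => //= _.
have e k : \sum_(l <- ixs (bL b)) y al k l * dot (f j) (f l) =
    if (val j < bL b)%N then y al k j else 0.
  under eq_bigr do rewrite (dot_basis hf).
  case: ifPn => jL; last first.
    rewrite big_seq big1// => l; rewrite mem_ixs => lL.
    by case: eqVneq => [jl|]; rewrite ?mulr0//; rewrite jl lL in jL.
  rewrite (bigD1_seq j) ?ixs_uniq ?mem_ixs//= eqxx mulr1 big1 ?addr0// => l lj.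
  by rewrite eq_sym (negbTE lj) mulr0.
under eq_bigr do rewrite e; case: ifP => // _.
by rewrite big1// => k _; rewrite scale0r.
Qed.

Lemma rnorm_assemble_basis b y al j : rnorm (assemble dot f b y al (f j)) ^+ 2 =
  if retained_idx b al && (val j < bL b)%N then
    \sum_(k <- ixs (bL b)) cmod (y al k j) ^+ 2 else 0.
Proof.
rewrite assemble_basis; case: ifP => _; last by rewrite rnorm0 expr0n.
by rewrite (rnorm_sqr_comb hE hf) ?ixs_uniq.
Qed.

Lemma assemble_linear b y al : linear (assemble dot f b y al).
Proof.
move=> c u v; rewrite !assembleE; case: ifP => _; last by rewrite scaler0 addr0.
rewrite scaler_sumr -big_split/=; apply: eq_bigr => k _.
rewrite scalerA -scalerDl mulr_sumr -big_split/=; congr (_ *: _).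
by apply: eq_bigr => l _; rewrite dotDl dotZl mulrDr mulrCA.
Qed.

Lemma assemble_hs b y al : hilbert_schmidt f (assemble dot f b y al).
Proof.
pose K := \sum_(k <- ixs (bL b)) \sum_(l <- ixs (bL b)) cmod (y al k l).
have rf (k : ix dimE) : rnorm (f k) = 1.
  apply/eqP; rewrite -(@eqrXn2 _ 2)// ?rnorm_ge0// expr1n; apply/eqP.
  by rewrite (rnorm_sqr hE) (dot_basis hf) eqxx.
apply: (@hilbert_schmidtP _ _ _ f _ K); first exact: assemble_linear.
  move=> x; rewrite assembleE; case: ifP => _; last first.
    rewrite rnorm0 mulr_ge0 ?rnorm_ge0// /K; apply: sumr_ge0 => k _.
    by apply: sumr_ge0 => l _; exact: cmod_ge0.
  rewrite (le_trans (rnorm_sum _ _))// /K mulr_suml; apply: ler_sum => k _.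
  rewrite rnormZ rf mulr1 mulr_suml.
  have : cmod (\sum_(l <- ixs (bL b)) y al k l * dot x (f l)) <=
      \sum_(l <- ixs (bL b)) cmod (y al k l * dot x (f l)).
    elim/big_rec2: _ => [|l u v _ h]; first by rewrite cmod0.
    by rewrite (le_trans (cmodD _ _))// lerD2l.
  move/le_trans; apply; apply: ler_sum => l _.
  rewrite cmodM ler_wpM2l ?cmod_ge0// (le_trans (cauchy_schwarz_dot hE _ _))//.
  by rewrite rf mulr1.
rewrite /hs_norm2 (esum_support (F := seq_fset tt (ixs (bL b)))).
- by rewrite sumEFin ltry.
- by move=> k; rewrite lee_fin sqr_ge0.
- move=> k; rewrite seq_fsetE mem_ixs => /negbTE kL.
  by rewrite rnorm_assemble_basis kL andbF.
Qed.

Lemma retained_idx_finite b : exists F : {fset midx dimH},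
  forall al, al \notin F -> retained_idx b al = false.
Proof.
pose n : midx dimH := [fsfun j in seq_fset tt (ixs (bd b)) => bM b | 0%N].
exists (box n) => al; apply: contraNF => /andP[dal /allP sal]; apply/in_box => j.
rewrite fsfun_fun seq_fsetE mem_ixs; case: ifPn => jd.
  by rewrite (leq_trans (mdeg_ge _ _)).
rewrite leqn0; apply: contraNT jd => aj; apply: sal.
by rewrite mem_finsupp.
Qed.

Lemma assemble_finite b y : finite_array f (assemble dot f b y).
Proof.
have [F hF] := retained_idx_finite b.
apply: (@finite_array_intro _ _ _ _ _ _ F); first exact: assemble_hs.
by move=> al /hF alF; apply/funext => x; rewrite assembleE alF.
Qed.

Lemma assemble_sub b y z al x :
  assemble dot f b y al x - assemble dot f b z al x = assemble dot f b (data_sub y z) al x.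
Proof.
rewrite !assembleE; case: ifP => _; last by rewrite subr0.
rewrite -sumrB; apply: eq_bigr => k _; rewrite -scalerBl -sumrB; congr (_ *: _).
by apply: eq_bigr => l _; rewrite -mulrBl.
Qed.

Lemma eq_assemble b y z :
  (forall al k l, retained b al k l -> y al k l = z al k l) ->
  assemble dot f b y = assemble dot f b z.
Proof.
move=> yz; apply/funext => al; apply/funext => x; rewrite !assembleE; case: ifP => // al_ret.
apply: eq_big_seq => k; rewrite mem_ixs => kL; congr (_ *: _).
apply: eq_big_seq => l; rewrite mem_ixs => lL.
by rewrite yz// /retained /retained_row al_ret kL lL.
Qed.

Lemma budget_proj_basis b A al j : budget_proj dot f b A al (f j) =
  if retained_idx b al && (val j < bL b)%N then
    proj_on dot f (ixs (bL b)) (A al (f j)) else 0.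
Proof. by rewrite /budget_proj assemble_basis. Qed.

(** On each basis vector a budget projection either vanishes or is an
    orthogonal projection, so it does not increase Hilbert--Schmidt norms. *)
Lemma hsa_budget_proj_le b A al : (hsa f (budget_proj dot f b A) al <= hsa f A al)%E.
Proof.
rewrite /hsa /hsn; apply: sqrte_le; first exact: hs_norm2_ge0.
apply: le_esum => k _; rewrite lee_fin budget_proj_basis.
apply: lerXn2r; rewrite ?nnegrE ?rnorm_ge0//; case: ifP => _.
  by apply: (proj_on_le hE hf); exact: ixs_uniq.
by rewrite rnorm0 rnorm_ge0.
Qed.

Lemma pnorm_budget_proj_sub (sigma : R) b A B : 0 <= sigma ->
  (pnorm f sigma (array_sub (budget_proj dot f b A) (budget_proj dot f b B)) <=
   pnorm f sigma (array_sub A B))%E.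
Proof.
move=> s0; rewrite (_ : array_sub _ _ = budget_proj dot f b (array_sub A B)).
  by apply: pnorm_le => // al; exact: hsa_budget_proj_le.
apply/funext => al; apply/funext => x.
apply: etrans (assemble_sub b (fun be => entry dot f (A be))
  (fun be => entry dot f (B be)) al x) _.
rewrite /budget_proj; congr (assemble dot f b _ al x).
by apply/funext => be; apply/funext => k; apply/funext => l; rewrite /data_sub /entry dotBl.
Qed.

(** By Pythagoras the residual loses one square for each further basis
    vector. *)
Lemma proj_on_antimono (s s' : seq (ix dimE)) x : uniq s -> uniq s' ->
  {subset s <= s'} -> rnorm (x - proj_on dot f s' x) <= rnorm (x - proj_on dot f s x).
Proof.
move=> us us' ss'.
rewrite -ler_sqr ?nnegrE ?rnorm_ge0// !(pythagoras hE hf)// lerD2l lerN2.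
rewrite [leRHS](bigID (mem s))/= -[leLHS]addr0; apply: lerD; last first.
  by apply: sumr_ge0 => k _; exact: sqr_ge0.
rewrite -[leRHS]big_filter le_eqVlt; apply/orP; left; apply/eqP; apply: perm_big.
apply: uniq_perm => //; first by rewrite filter_uniq.
by move=> k; rewrite mem_filter/=; apply/idP/andP => [ks|[]//]; rewrite ss'.
Qed.

(** Dominated convergence over the pairs of a multi-index and a basis
    vector: each residual is at most the full term, and it vanishes because
    every coordinate is eventually retained and the projections converge. *)
Lemma budget_proj_cvg (b : nat -> budget) C (sigma : R) : 1 <= sigma ->
  cofinal_budgets dimH dimE b -> frakA2 f C ->
  pnorm f sigma (array_sub C (budget_proj dot f (b n) C)) @[n --> \oo] --> 0%E.
Proof.
move=> s1 [cM cd cL] fC; have s0 : 0 <= sigma by exact: le_trans s1.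
pose rho := 2 * sigma.
have r1 : 1 <= rho by rewrite /rho; lra.
have rk k : 0 <= rho ^+ k by rewrite exprn_ge0// (le_trans _ r1).
pose D n := array_sub C (budget_proj dot f (b n) C).
pose w (p : midx dimH * ix dimE) (x : E) := (rho ^+ mdeg p.1 * rnorm x) ^+ 2.
have wE (A : array) : wnorm rho (hsa f A) =
    (\esum_(p in [set: midx dimH * ix dimE]) (w p (A p.1 (f p.2)))%:E)%E.
  rewrite /wnorm (_ : [set: midx dimH * ix dimE] = setT `*`` (fun=> setT)); last first.
    by apply/seteqP; split.
  rewrite -(esum_esum (a := fun al k => (w (al, k) (A al (f k)))%:E)); last first.
    by move=> al k _ _; rewrite lee_fin sqr_ge0.
  apply: eq_esum => al _; rewrite sqreM /hsa hsn_sqr -esumZl ?sqre_ge0//; last first.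
    by move=> k; rewrite lee_fin sqr_ge0.
  by apply: eq_esum => k _; rewrite -EFin_expe -EFinM -exprMn.
have DE n al k : D n al (f k) = if retained_idx (b n) al && (val k < bL (b n))%N then
     C al (f k) - proj_on dot f (ixs (bL (b n))) (C al (f k)) else C al (f k).
  by rewrite /D /array_sub budget_proj_basis; case: ifP => //; rewrite subr0.
have wD : wnorm rho (hsa f (D n)) @[n --> \oo] --> 0%E.
  under eq_cvg do rewrite wE.
  apply: (@esum_dominated_cvg0 _ _ _ (fun p => w p (C p.1 (f p.2)))).
  - move=> n [al k] /=; rewrite sqr_ge0/= /w; apply: lerXn2r; rewrite ?nnegrE ?mulr_ge0 ?rnorm_ge0//.
    apply: ler_wpM2l => //; rewrite DE; case: ifP => // _.
    rewrite -ler_sqr ?nnegrE ?rnorm_ge0// (pythagoras hE hf) ?ixs_uniq//.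
    by rewrite lerBlDr lerDl sumr_ge0// => l _; exact: sqr_ge0.
  - by rewrite -wE; exact: frakA2_wnorm.
  - move=> [al k] /=; set x := C al (f k).
    have h : rnorm (D n al (f k)) @[n --> \oo] --> (0 : R).
      apply/cvgrPdist_le => e e0.
      move/cvgrPdist_le : (expansion_cvg hE hf x) => /(_ e e0)[M _ /(_ M (leqnn M))] hM.
      move: hM; rewrite /= sub0r normrN ger0_norm ?rnorm_ge0// => hM.
      have evd : \forall n \near \oo, {in finsupp al, forall j, (val j < bd (b n))%N}.
        have : forall s : seq (ix dimH), \forall n \near \oo, {in s, forall j, (val j < bd (b n))%N}.
          elim=> [|j s IH]; first by apply: nearW.
          move: (cd j) IH; apply: filterS2 => n hj hs i; rewrite inE => /orP[/eqP ->//|]; exact: hs.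
        exact.
      have evL : \forall n \near \oo, {in ixs M, forall j : ix dimE, (val j < bL (b n))%N}.
        have : forall s : seq (ix dimE), \forall n \near \oo, {in s, forall j, (val j < bL (b n))%N}.
          elim=> [|j s IH]; first by apply: nearW.
          move: (cL j) IH; apply: filterS2 => n hj hs i; rewrite inE => /orP[/eqP ->//|]; exact: hs.
        exact.
      near=> n.
      rewrite sub0r normrN ger0_norm ?rnorm_ge0// DE.
      have -> : retained_idx (b n) al && (val k < bL (b n))%N.
        apply/andP; split; last by near: n; exact: cL.
        apply/andP; split; first by near: n; exact: cM.
        by apply/allP; near: n.
      apply: le_trans hM; apply: proj_on_antimono; rewrite ?ixs_uniq// => j jM.
      by rewrite mem_ixs; move: j jM; near: n.
    have h2 : rho ^+ mdeg al * rnorm (D n al (f k)) @[n --> \oo] --> (0 : R).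
      by rewrite -[X in _ --> X](mulr0 (rho ^+ mdeg al)); apply: cvgM => //; exact: cvg_cst.
    rewrite -[X in _ --> X](mulr0 (0 : R)); exact: (cvgM h2 h2).
apply: (@ecvg0_le _ _ (fun n => 2%:E * sqrte (wnorm rho (hsa f (D n))))%E).
- by move=> n; exact: pnorm_ge0.
- by apply: nearW => n; exact: pnorm_le_wnorm.
- by apply: ecvg0Z; apply: ecvg0_sqrte => // n; exact: wnorm_ge0.
Unshelve. all: by end_near. Qed.

End BudgetProjections.

Section NoiseAmplification.
Context {R : realType} {E : completeNormedModType R[i]} {dimH dimE : option nat}.
Variables (dot : {dot E for Num.conj}) (f : ix dimE -> E).
Hypotheses (hE : norm_from_dot dot) (hf : orthonormal_basis dot f).
Variable r : ix dimE -> R.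
Hypothesis r_gt0 : forall k, 0 < r k.
Notation data := (obs_data (R := R) dimH dimE).
Implicit Types (al : midx dimH) (b : budget) (y z : data).

(** The infimum defining [kappaL] is over finitely many positive numbers,
    hence positive, and it is a lower bound of both eigenvalues. *)
Lemma kappaL_bound L (k l : ix dimE) : (val k < L)%N -> (val l < L)%N ->
  (r k * r l)^-1 <= kappaL r L.
Proof.
move=> kL lL; rewrite /kappaL; set S := [set r i | i in _].
have [c c0 hc] : exists2 c, 0 < c & forall i : ix dimE, i \in ixs L -> c <= r i.
  elim: (ixs L) => [|i s [c c0 hc]]; first by exists 1.
  exists (Num.min (r i) c); first by rewrite lt_min r_gt0.
  by move=> j; rewrite inE => /orP[/eqP ->|/hc]; rewrite ge_min ?lexx// orbC => ->.
have lbS : lbound S c by move=> _ [i iL <-]; apply: hc; rewrite mem_ixs.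
have Sk : S (r k) by exists k.
have Sl : S (r l) by exists l.
have cS : c <= inf S by apply: lb_le_inf => //; exists (r k).
have i0 : 0 < inf S by exact: lt_le_trans cS.
have hk : inf S <= r k by apply: ge_inf => //; exists c.
have hl : inf S <= r l by apply: ge_inf => //; exists c.
rewrite lef_pV2 ?posrE ?mulr_gt0 ?exprn_gt0// expr2.
by apply: ler_pM => //; exact: ltW.
Qed.

(** Falling factorials are submultiplicative: taking all factors from one
    descending sequence gives smaller factors than restarting it in each
    coordinate. *)
Lemma dweight_ge N al : (mdeg al <= N)%N -> (0 < N)%N ->
  (N ^_ mdeg al)%:R / N%:R ^+ mdeg al <= dweight N al :> R.
Proof.
move=> alN N0; rewrite /dweight prodf_div prodrXr -/(mdeg al).
apply: ler_wpM2r; first by rewrite invr_ge0 exprn_ge0.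
rewrite -natr_prod ler_nat /mdeg; elim: (finsupp al : seq _) => [|j s IH].
  by rewrite !big_nil.
rewrite !big_cons; apply: leq_trans (leq_mul (leqnn _) IH).
move: (\sum_(i <- s) al i)%N => m; rewrite !ffact_prod big_split_ord/=.
by apply: leq_mul => //; apply: leq_prod => i _; rewrite leq_sub2l// leq_addl.
Qed.

Lemma inv_sqrt_dweight_le N al : (mdeg al <= N)%N -> (0 < N)%N ->
  [/\ 0 < dweight N al :> R & (Num.sqrt (dweight N al))^-1 <= chiN (mdeg al) N :> R].
Proof.
move=> alN N0; have Np : 0 < N%:R :> R by rewrite ltr0n.
have p0 : 0 < (N ^_ mdeg al)%:R / N%:R ^+ mdeg al :> R.
  by rewrite divr_gt0 ?exprn_gt0// ltr0n ffact_gt0.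
have h := dweight_ge alN N0; have d0 := lt_le_trans p0 h; split => //.
rewrite /chiN -invf_div sqrtrV ?(ltW p0)// lef_pV2 ?posrE ?sqrtr_gt0//.
exact: ler_wsqrtr.
Qed.

Local Open Scope ereal_scope.

Lemma hs_norm2_assemble_le b y al :
  hs_norm2 f (assemble dot f b y al) <=
  \esum_(p in [set p : ix dimE * ix dimE | retained b al p.1 p.2])
     (cmod (y al p.1 p.2) ^+ 2)%:E.
Proof.
rewrite /hs_norm2 (@eq_esum _ _ _ _ (fun l =>
   \esum_(k in [set k | retained b al k l]) (cmod (y al k l) ^+ 2)%:E)); last first.
  move=> l _; rewrite (rnorm_assemble_basis hE hf); case: ifP => [/andP[h1 h2]|h].
    rewrite (@esum_seq _ _ (ixs (bL b))) ?ixs_uniq//.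
    - by rewrite sumEFin.
    - by move=> k; rewrite lee_fin sqr_ge0.
    - by move=> k; rewrite /= /retained /retained_row h1 h2 andbT mem_ixs.
  rewrite esum1// => k /= /and3P[h1 _ h2].
  by move: h; rewrite h1 (_ : (val l < bL b)%N).
rewrite esum_esum; last by move=> *; rewrite lee_fin sqr_ge0.
apply: (@esum_inj_le _ _ _ _ _ (fun p : ix dimE * ix dimE => (p.2, p.1))
  (fun p => (cmod (y al p.1 p.2) ^+ 2)%:E)).
  by move=> [l k] [l' k'] _ _ [-> ->].
by move=> [l k] /= [].
Qed.

(** In each degree the reconstruction divides the data by r_k r_l and by the
    square root of the variance; the former costs at most [kappaL], the
    latter at most [chiN], and Parseval turns the entries into
    Hilbert--Schmidt norms. *)
Lemma pnorm_reconstruct_le b N z (delta : nat -> R) (sigma : R) : (0 <= sigma)%R ->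
  (0 < N)%N -> (bM b <= N)%N ->
  (forall m, (m <= bM b)%N -> data_norm b m z <= (delta m)%:E) ->
  pnorm f sigma (reconstruct dot f r (dweight N) b z) <= (noise_term r sigma b N delta)%:E.
Proof.
move=> s0 N0 MN hz; rewrite pnormE//.
set A := reconstruct _ _ _ _ _ _.
have k0 : (0 <= kappaL r (bL b))%R by rewrite invr_ge0 sqr_ge0.
have chi0 m : (0 <= chiN m N :> R)%R by exact: sqrtr_ge0.
have deg m : (m <= bM b)%N -> l2deg (hsa f A) m <= (kappaL r (bL b) * chiN m N * delta m)%:E.
  move=> mM.
  apply: (@le_trans _ _ ((kappaL r (bL b) * chiN m N)%:E * data_norm b m z)); last first.
    by rewrite [leRHS]EFinM; apply: lee_wpmul2l; [rewrite lee_fin mulr_ge0|exact: hz].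
  rewrite /data_norm poweR12_sqrt; last first.
    by apply: esum_ge0 => *; rewrite lee_fin sqr_ge0.
  rewrite -[X in X%:E * _]ger0_norm ?mulr_ge0// -sqrtr_sqr -[(Num.sqrt _)%:E]/(sqrte (_%:E)).
  rewrite -sqrteM ?lee_fin ?sqr_ge0//; apply: sqrte_le.
    by apply: esum_ge0 => *; exact: sqre_ge0.
  rewrite -esumZl ?lee_fin ?sqr_ge0//; last by move=> t; rewrite lee_fin sqr_ge0.
  set F := (fun t : midx dimH * ix dimE * ix dimE => _ * _).
  have F0 t : 0 <= F t by rewrite /F mule_ge0// lee_fin sqr_ge0.
  apply: (@le_trans _ _ (\esum_(al in [set al | mdeg al = m])
     \esum_(p in [set p : ix dimE * ix dimE | retained b al p.1 p.2]) F (al, p.1, p.2))).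
    apply: le_esum => al /= dal; rewrite /hsa hsn_sqr.
    apply: le_trans (hs_norm2_assemble_le _ _ _) _; apply: le_esum => -[k l] /= /and3P[_ kL lL].
    rewrite /F/= -EFinM lee_fin -exprMn; apply: lerXn2r.
    - by rewrite nnegrE cmod_ge0.
    - by rewrite nnegrE !mulr_ge0 ?cmod_ge0.
    rewrite cmodM -fmorphV/= cmod_real mulrC; apply: ler_wpM2r; first exact: cmod_ge0.
    have alN : (mdeg al <= N)%N by rewrite dal (leq_trans mM).
    have [d0 hd] := inv_sqrt_dweight_le alN N0.
    rewrite ger0_norm; last first.
      by rewrite invr_ge0 !mulr_ge0 ?sqrtr_ge0 ?ltW.
    rewrite invfM; apply: ler_pM.
    - by rewrite invr_ge0 mulr_ge0 ?ltW.
    - by rewrite invr_ge0 sqrtr_ge0.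
    - exact: kappaL_bound.
    - by rewrite -dal.
  rewrite esum_esum//.
  apply: (@esum_inj_le _ _ _ _ _
    (fun p : midx dimH * (ix dimE * ix dimE) => (p.1, p.2.1, p.2.2)) F).
    by move=> [al [k l]] [al' [k' l']] _ _ /= [-> -> ->].
  by move=> [al [k l]] /= [].
(* Degrees beyond the budget are reconstructed as zero. *)
have deg0 m : (bM b < m)%N -> l2deg (hsa f A) m = 0.
  move=> Mm; rewrite /l2deg esum1 ?sqrte0// => al /= dal.
  rewrite /hsa hsn_sqr (_ : A al = fun=> 0%R).
    by rewrite -hsn_sqr hsn0 expe2 mule0.
  apply/funext => x; rewrite /A /reconstruct assembleE /retained_idx dal.
  by rewrite leqNgt Mm.
rewrite /degnorm (esumID [set m | (m <= bM b)%N]); last first.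
  by move=> m _; rewrite mule_ge0 ?l2deg_ge0// lee_fin exprn_ge0.
rewrite !setTI [X in _ + X]esum1 ?adde0; last first.
  by move=> m /= /negP; rewrite -ltnNge => /deg0 ->; rewrite mule0.
rewrite (@esum_seq _ _ (iota 0 (bM b).+1)) ?iota_uniq//.
- rewrite -[(bM b).+1]subn0 -/(index_iota 0 (bM b).+1) big_mkord /noise_term mulr_sumr -sumEFin.
  apply: lee_sum => m _; rewrite (_ : (_ * (_ * _ * _))%R =
    (sigma ^+ m * (kappaL r (bL b) * chiN m N * delta m))%R); last by ring.
  rewrite EFinM; apply: lee_wpmul2l; first by rewrite lee_fin exprn_ge0.
  by apply: deg; rewrite -ltnS.
- by move=> m; rewrite mule_ge0 ?l2deg_ge0// lee_fin exprn_ge0.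
- by move=> m; rewrite mem_iota/=.
Qed.

End NoiseAmplification.

(** * Means of random variables *)

Section BasisSums.
Context {R : realType} {dim : option nat}.
Local Open Scope ereal_scope.

Lemma ixs_sum_cvg (a : ix dim -> \bar R) : (forall k, 0 <= a k) ->
  (\sum_(k <- ixs n) a k)%R @[n --> \oo] --> \esum_(k in setT) a k.
Proof.
move=> a0.
have ixsS m n : (m <= n)%N -> {subset @ixs dim m <= ixs n}.
  by move=> mn k; rewrite !mem_ixs => h; exact: leq_trans mn.
have mono : {homo (fun n => (\sum_(k <- ixs n) a k)%R) : m n / (m <= n)%N >-> m <= n}.
  move=> m n mn.
  rewrite -(esum_seq (D := [set` ixs m])) ?ixs_uniq//.
  rewrite -(esum_seq (D := [set` ixs n])) ?ixs_uniq//.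
  by apply: esum_subset => k /=; exact: ixsS.
have -> : \esum_(k in setT) a k = ereal_sup (range (fun n => (\sum_(k <- ixs n) a k)%R)).
  apply/eqP; rewrite eq_le; apply/andP; split.
    apply: ge_ereal_sup => _ [X [Xfin _] <-].
    have [N HN] := ixs_sub (fset_set X).
    apply: (@le_trans _ _ (\sum_(k <- ixs N) a k)%R); last by apply: ereal_sup_ubound; exists N.
    rewrite fsbig_finite//= -(esum_seq (D := [set` fset_set X]))//.
    rewrite -(esum_seq (D := [set` ixs N])) ?ixs_uniq//.
    by apply: esum_subset => k /=; exact: HN.
  apply: ge_ereal_sup => _ [n _ <-].
  rewrite -(esum_seq (D := [set` ixs n])) ?ixs_uniq//.
  exact: esum_subset.
exact: ereal_nondecreasing_cvgn.
Qed.

Context {d : measure_display} {T : measurableType d}.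

Lemma measurable_esum_ix (a : ix dim -> T -> \bar R) :
  (forall k w, 0 <= a k w) -> (forall k, measurable_fun setT (a k)) ->
  measurable_fun setT (fun w => \esum_(k in setT) a k w).
Proof.
move=> a0 ma.
apply: (@emeasurable_fun_cvg _ _ _ _ (fun n w => (\sum_(k <- ixs n) a k w)%R)).
  by move=> n; exact: emeasurable_sum.
by move=> w _; exact: ixs_sum_cvg.
Qed.

(** Monotone convergence along the partial sums over [ixs]. *)
Lemma integral_esum_ix (mu : {measure set T -> \bar R}) (a : ix dim -> T -> \bar R) :
  (forall k w, 0 <= a k w) -> (forall k, measurable_fun setT (a k)) ->
  \int[mu]_w (\esum_(k in setT) a k w) = \esum_(k in setT) \int[mu]_w a k w.
Proof.
move=> a0 ma.
have h1 := @cvg_monotone_convergence _ _ _ mu setT measurableT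
  (fun n w => (\sum_(k <- ixs n) a k w)%R).
have /h1{}h1 : forall n, measurable_fun setT (fun w => (\sum_(k <- ixs n) a k w)%R).
  by move=> n; exact: emeasurable_sum.
have /h1{}h1 : forall (n : nat) (w : T), setT w -> 0 <= (\sum_(k <- ixs n) a k w)%R.
  by move=> n w _; exact: sume_ge0.
have /h1{}h1 : forall w : T, setT w ->
    {homo (fun n => (\sum_(k <- ixs n) a k w)%R) : m n / (m <= n)%N >-> m <= n}.
  move=> w _ m n mn.
  rewrite -(esum_seq (D := [set` ixs m])) ?ixs_uniq//.
  rewrite -(esum_seq (D := [set` ixs n])) ?ixs_uniq//.
  by apply: esum_subset => k /=; rewrite !mem_ixs => h; exact: leq_trans mn.
have E w : limn (fun n => (\sum_(k <- ixs n) a k w)%R) = \esum_(k in setT) a k w.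
  by apply/cvg_lim => //; exact: ixs_sum_cvg.
rewrite (_ : (fun w => limn _) = (fun w => \esum_(k in setT) a k w)) in h1; last first.
  by apply/funext => w; exact: E.
rewrite -(cvg_lim _ h1)//; apply/cvg_lim => //.
rewrite (_ : (fun n => _) = (fun n => (\sum_(k <- ixs n) (\int[mu]_w a k w)%E)%R)).
  by apply: ixs_sum_cvg => k; exact: integral_ge0.
by apply/funext => n; rewrite ge0_integral_sum.
Qed.

End BasisSums.

Section Means.
Context {R : realType} {d : measure_display} {T : measurableType d}.
Variable P : probability T R.
Implicit Types F G : T -> R.

(** Integrability and value of the mean in one statement, so that means can
    be computed by linearity and limits without separate integrability
    proofs. *)
Definition has_mean F (c : R) :=
  P.-integrable setT (EFin \o F) /\ (\int[P]_w (F w)%:E = c%:E)%E.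

Lemma has_mean_measurable F c : has_mean F c -> measurable_fun setT F.
Proof. by move=> [/measurable_int/measurable_EFinP]. Qed.

Lemma has_meanD F G c c' : has_mean F c -> has_mean G c' ->
  has_mean (fun w => F w + G w) (c + c').
Proof.
move=> [iF mF] [iG mG]; split; first exact: (integrableD measurableT iF iG).
rewrite (_ : (fun w => _) = (fun w => ((F w)%:E + (G w)%:E)%E)).
  by rewrite integralD// mF mG EFinD.
by apply/funext => w; rewrite EFinD.
Qed.

Lemma has_meanZ (k : R) F c : has_mean F c -> has_mean (fun w => k * F w) (k * c).
Proof.
move=> [iF mF]; split; first exact: (integrableZl measurableT k iF).
rewrite (_ : (fun w => _) = (fun w => (k%:E * (F w)%:E)%E)).
  by rewrite integralZl// mF EFinM.
by apply/funext => w; rewrite EFinM.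
Qed.

Lemma has_mean0 : has_mean (fun _ => 0) 0.
Proof. by split; [exact: integrable0 | exact: integral0]. Qed.

Lemma has_mean_sum (I : eqType) (s : seq I) (F : I -> T -> R) (c : I -> R) :
  (forall i, i \in s -> has_mean (F i) (c i)) ->
  has_mean (fun w => \sum_(i <- s) F i w) (\sum_(i <- s) c i).
Proof.
elim: s => [|i s IH] h.
  rewrite big_nil (_ : (fun w => _) = (fun _ => 0)); first exact: has_mean0.
  by apply/funext => w; rewrite big_nil.
rewrite big_cons (_ : (fun w => _) = (fun w => F i w + \sum_(j <- s) F j w)).
  apply: has_meanD; first by apply: h; rewrite mem_head.
  by apply: IH => j js; apply: h; rewrite in_cons js orbT.
by apply/funext => w; rewrite big_cons.
Qed.

Lemma has_mean_ae F G c : has_mean F c -> measurable_fun setT G ->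
  {ae P, forall w, F w = G w} -> has_mean G c.
Proof.
move=> [iF mF] mG FG.
have mG' : measurable_fun setT (EFin \o G) by exact/measurable_EFinP.
have mF' := measurable_int _ iF.
have FG' : ae_eq P setT (EFin \o F) (EFin \o G).
  by apply: filterS FG => w /= -> _.
split; last by rewrite -mF; apply/esym/ae_eq_integral.
apply/integrableP; split=> //.
rewrite (@ae_eq_integral _ _ _ P setT (fun w => `|(EFin \o F) w|%E)) //.
- by case/integrableP : iF.
- exact: measurableT_comp.
- exact: measurableT_comp.
- by apply: filterS FG' => w h _; rewrite h.
Qed.

Lemma has_mean_unique F c c' : has_mean F c -> has_mean F c' -> c = c'.
Proof. by move=> [_ h] [_]; rewrite h => -[]. Qed.

(** Convergence in L^1: integrability of the limit follows from that of one
    approximation at finite distance. *)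
Lemma has_mean_limit (Fn : nat -> T -> R) F (cn : nat -> R) c :
  measurable_fun setT F -> (forall n, has_mean (Fn n) (cn n)) ->
  (\int[P]_w `|F w - Fn n w|%:E)%E @[n --> \oo] --> 0%E ->
  cn n @[n --> \oo] --> c -> has_mean F c.
Proof.
move=> mF hFn lim0 limc.
have mFn n := has_mean_measurable (hFn n).
have mD n : measurable_fun setT (fun w => F w - Fn n w) by exact: measurable_funB.
have mI n : measurable_fun setT (fun w => `|F w - Fn n w|%:E).
  by apply/measurable_EFinP; exact: measurableT_comp.
have iD : \forall n \near \oo, P.-integrable setT (EFin \o (fun w => F w - Fn n w)).
  have /(ecvg0P (fun n => @integral_ge0 _ _ _ P setT _ (fun w _ => _))) := lim0.
  move=> /(_ (fun n w => normr_ge0 _)) /(_ 1 ltr01); apply: filterS => n h.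
  apply/integrableP; split; first exact/measurable_EFinP.
  by apply: le_lt_trans h _; exact: ltry.
have iF : P.-integrable setT (EFin \o F).
  case: iD => N _ /(_ N (leqnn N)) /= iN.
  apply: (eq_integrable measurableT) (integrableD measurableT iN (hFn N).1).
  by move=> w _ /=; rewrite -EFinD subrK.
split=> //.
have ifin := integrable_fin_num measurableT iF.
rewrite -[LHS]fineK//; congr EFin.
set m := fine _.
rewrite -(cvg_lim _ limc)//; apply/esym/cvg_lim => //.
apply/cvgrPdist_le => e e0.
have /(ecvg0P (fun n => @integral_ge0 _ _ _ P setT _ (fun w _ => _))) := lim0.
move=> /(_ (fun n w => normr_ge0 _)) /(_ e e0); apply: filterS => n h.
rewrite -lee_fin; apply: le_trans h.
have [iFn En] := hFn n.
have E2 : (m - cn n)%:E = (\int[P]_w (F w - Fn n w)%:E)%E.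
  rewrite (_ : (fun w => _) = (fun w => ((F w)%:E - (Fn n w)%:E)%E)).
    by rewrite integralB// En EFinB /m fineK.
  by apply/funext => w; rewrite EFinB.
rewrite -[leLHS]/(`|(m - cn n)%:E|%E) E2.
by apply: le_abse_integral => //; apply/measurable_EFinP.
Qed.

End Means.

(** * Chaos systems *)

Section Contractions.
Context {R : realType} {dim : option nat}.
Implicit Types al be r ga : midx dim.

(** The multi-index that is left when [r] is contracted out of [al] and
    [be]. *)
Definition mcon al be r := madd (msub al r) (msub be r).

Lemma contraction_mconP al be r ga : Defs.contraction al be r ga <->
  [/\ r \in box al, r \in box be & ga = mcon al be r].
Proof.
split=> [/contractionP[mu [nu [-> -> ->]]]|[/in_box ra /in_box rb ->]].
  by split; [apply/in_box; exact: mle_maddr|apply/in_box; exact: mle_maddr|rewrite /mcon !madd_addK].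
apply/contractionP; exists (msub al r), (msub be r).
by rewrite !madd_subK.
Qed.

Lemma mcon_eq0 al be r : r \in box al -> r \in box be -> mcon al be r = mzero -> al = r /\ be = r.
Proof.
move=> /in_box ra /in_box rb h.
have hj j : (msub al r j + msub be r j = 0)%N by rewrite -maddE -/(mcon al be r) h mzeroE.
split; apply/fsfunP => j; move: (hj j) (ra j) (rb j); rewrite !msubE; lia.
Qed.

Lemma mcon_self al : mcon al al al = mzero.
Proof. by apply/fsfunP => j; rewrite maddE !msubE mzeroE subnn. Qed.

Lemma mcon_inj (g r : midx dim) : {in [pred al | r \in box al] &, injective (fun al => mcon g al r)}.
Proof.
move=> al be /in_box ra /in_box rb /fsfunP h; apply/fsfunP => j.
by move: (h j) (ra j) (rb j); rewrite !maddE !msubE; lia.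
Qed.

Lemma product_coeff_self al : product_coeff al al al mzero = 1 :> R.
Proof.
have := @product_coeffE R dim mzero mzero al.
have z n : madd mzero n = n by apply/fsfunP => j; rewrite maddE mzeroE.
rewrite !z => ->.
have b n : mbinom n n = 1%N by rewrite /mbinom big1// => j _; rewrite binn.
by rewrite !b sqrtr1.
Qed.

Lemma mbinom_le (n k : midx dim) : mle k n -> (mbinom n k <= 2 ^ mdeg n)%N.
Proof.
move=> kn; rewrite (@mbinomE _ (finsupp n)) ?finsupp_mle//.
rewrite /mdeg expn_sum; apply: leq_prod => j _.
have := expnDn 1 1 (n j); rewrite addn1 => ->.
rewrite -[leqLHS]muln1 -[leqLHS]muln1 (bigD1 (inord (k j)))//= !exp1n inordK ?ltnS//.
by rewrite !muln1 leq_addr.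
Qed.

(** The square is a product of three binomial coefficients, each at most a
    power of two whose exponent is the degree of the multi-index it comes
    from. *)
Lemma product_coeff_sqr_le (g al r : midx dim) : r \in box g -> r \in box al ->
  product_coeff g al r (mcon g al r) ^+ 2 <= 4 ^+ (mdeg g + mdeg al) :> R.
Proof.
move=> rg ra.
have /contractionP[mu [nu [-> -> ->]]] : Defs.contraction g al r (mcon g al r).
  exact/contraction_mconP.
rewrite product_coeffE sqr_sqrtr ?ler0n// -natrX ler_nat !mdeg_add.
rewrite (@leq_trans (2 ^ (mdeg mu + mdeg nu) * 2 ^ (mdeg mu + mdeg r) * 2 ^ (mdeg nu + mdeg r))%N)//.
  apply: leq_mul; first apply: leq_mul.
  - by rewrite -mdeg_add; apply: mbinom_le; exact: mle_maddl.
  - by rewrite -mdeg_add; apply: mbinom_le; exact: mle_maddr.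
  - by rewrite -mdeg_add; apply: mbinom_le; exact: mle_maddr.
rewrite -!expnD (_ : 4 = 2 ^ 2)%N// -expnM leq_exp2l//; lia.
Qed.

End Contractions.

Section ChaosSystems.
Context {R : realType} {dim : option nat} {d : measure_display} {T : measurableType d}.
Variable P : probability T R.
Variables (psi : midx dim -> T -> R) (th : midx dim -> midx dim -> midx dim -> midx dim -> R).

Definition pcoef al be r : R :=
  product_coeff al be r (mcon al be r) * th al be r (mcon al be r).

(** What signs and Gaussians have in common: all moments needed follow from
    the linearization of products of two basis functions and from the means
    of single ones. The linearization holds only almost surely because the
    signs take the values 1 and -1 only almost surely. *)
Definition chaos_system :=
  [/\ dominated th (fun _ _ => 1),
      forall al, has_mean P (psi al) (al == mzero)%:R &
      forall al be, {ae P, forall w, psi al w * psi be w =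
        \sum_(r <- box al | r \in box be) pcoef al be r * psi (mcon al be r) w}].

Hypothesis sys : chaos_system.

(** The second moment of [psi al], by [mean_psi2]. *)
Definition chaos_weight al : R := th al al al mzero.

Lemma psi_measurable al : measurable_fun setT (psi al).
Proof. by have [_ h _] := sys; exact: has_mean_measurable (h al). Qed.

Lemma chaos_weight_le1 al : `|chaos_weight al| <= 1.
Proof.
have [h _ _] := sys; apply: h; apply/contraction_mconP.
by rewrite mcon_self; split=> //; apply/in_box.
Qed.

(** In the linearization of the product only a complete contraction leaves
    the constant function, and it exists only if the two multi-indices
    agree. *)
Lemma mean_psi2 al be :
  has_mean P (fun w => psi al w * psi be w) ((al == be)%:R * chaos_weight al).
Proof.
have [_ h1 h2] := sys.
have mp : measurable_fun setT (fun w => psi al w * psi be w).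
  by apply: measurable_funM; exact: psi_measurable.
have h : has_mean P (fun w => \sum_(r <- box al | r \in box be) pcoef al be r * psi (mcon al be r) w)
    (\sum_(r <- [fset r in box al | r \in box be]%fset) pcoef al be r * (mcon al be r == mzero)%:R).
  rewrite (_ : (fun w => _) = (fun w => \sum_(r <- [fset r in box al | r \in box be]%fset) pcoef al be r * psi (mcon al be r) w)).
    by apply: has_mean_sum => r _; exact: has_meanZ.
  by apply/funext => w; rewrite big_fset_condE.
have /(has_mean_ae h mp) : {ae P, forall w, \sum_(r <- box al | r \in box be) pcoef al be r * psi (mcon al be r) w = psi al w * psi be w}.
  by apply: filterS (h2 al be) => w ->.
congr has_mean.
have [->|neq] := eqVneq al be.
  have bb : be \in [fset r in box be | r \in box be]%fset.
    by rewrite !inE/= andbb; apply/in_box.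
  rewrite (big_fsetD1 be bb)/= mcon_self eqxx mulr1 big1_seq ?addr0 ?mul1r.
    by rewrite /pcoef mcon_self product_coeff_self mul1r.
  move=> r /=; rewrite !inE/= => /and3P[rb r1 _].
  case: eqP => [/(mcon_eq0 r1 r1)[h' _]|_]; last by rewrite mulr0.
  by rewrite h' eqxx in rb.
rewrite mul0r big1_seq// => r /=; rewrite !inE/= => /andP[r1 r2].
case: eqP => [/(mcon_eq0 r1 r2)[h' h'']|_]; last by rewrite mulr0.
by rewrite h' h'' eqxx in neq.
Qed.

(** Linearize the product of two factors and use orthogonality with the
    third. *)
Lemma mean_psi3 g al be :
  has_mean P (fun w => psi g w * (psi al w * psi be w))
    (chaos_weight g * \sum_(r <- [fset r in box al | r \in box be]%fset | mcon al be r == g) pcoef al be r).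
Proof.
have [_ h1 h2] := sys.
have h : has_mean P (fun w => \sum_(r <- [fset r in box al | r \in box be]%fset) pcoef al be r * (psi g w * psi (mcon al be r) w))
    (\sum_(r <- [fset r in box al | r \in box be]%fset) pcoef al be r * ((g == mcon al be r)%:R * chaos_weight g)).
  by apply: has_mean_sum => r _; apply: has_meanZ; exact: mean_psi2.
have mp : measurable_fun setT (fun w => psi g w * (psi al w * psi be w)).
  by apply: measurable_funM; [|apply: measurable_funM]; exact: psi_measurable.
have /(has_mean_ae h mp) : {ae P, forall w, \sum_(r <- [fset r in box al | r \in box be]%fset) pcoef al be r * (psi g w * psi (mcon al be r) w) = psi g w * (psi al w * psi be w)}.
  apply: filterS (h2 al be) => w ->.
  by rewrite -big_fset_condE mulr_sumr; apply: eq_bigr => r _; rewrite mulrCA.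
congr has_mean; rewrite mulr_sumr [RHS]big_mkcond/=; apply: eq_bigr => r _.
by rewrite eq_sym; case: ifP => _; rewrite ?mul1r ?mul0r ?mulr0// mulrC.
Qed.

End ChaosSystems.

(** * Measurability of random operators *)

Section RandomOperators.
Context {R : realType} {E : completeNormedModType R[i]} {dimE : option nat}.
Variables (dot : {dot E for Num.conj}) (f : ix dimE -> E).
Hypotheses (hE : norm_from_dot dot) (hf : orthonormal_basis dot f).
Context {d : measure_display} {T : measurableType d}.
Implicit Types X Y : T -> E -> E.

Lemma dotBr x y z : dot z (x - y) = dot z x - dot z y.
Proof. by rewrite linearBr. Qed.

(** Measurability of all matrix coefficients; the imaginary parts are
    included, as [v] may be multiplied by the imaginary unit. *)
Definition weakly_measurable X :=
  forall x v, measurable_fun setT (fun w => complex.Re (dot (X w x) v)).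

Lemma cvg_le_mul (a C : R) (u e : nat -> R) : (forall n, `|a - u n| <= C * e n) ->
  e n @[n --> \oo] --> 0 -> u n @[n --> \oo] --> a.
Proof.
move=> h e0; apply/cvgrPdist_le => eps eps0.
have Ce : C * e n @[n --> \oo] --> C * 0 by apply: cvgM => //; exact: cvg_cst.
rewrite mulr0 in Ce.
have /cvgrPdist_le/(_ _ eps0) := Ce; apply: filterS => n; rewrite sub0r normrN => hn.
by rewrite (le_trans (h n))// (le_trans (ler_norm _)).
Qed.

Lemma weakly_measurable_Im X x v : weakly_measurable X ->
  measurable_fun setT (fun w => complex.Im (dot (X w x) v)).
Proof.
move=> mX; have := mX x (Complex 0 1 *: v).
rewrite (_ : (fun w => complex.Re _) = (fun w => complex.Im (dot (X w x) v)))//.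
apply/funext => w; rewrite dotZr ReM Re_conj/= mul0r sub0r mulNr opprK mul1r//.
Qed.

(** Parseval writes the norm as a countable sum of measurable functions. *)
Lemma measurable_rnorm2 X x : weakly_measurable X ->
  measurable_fun setT (fun w => rnorm (X w x) ^+ 2).
Proof.
move=> mX; apply/measurable_EFinP.
rewrite (_ : EFin \o _ = fun w =>
  (\esum_(k in [set: ix dimE]) (cmod (dot (X w x) (f k)) ^+ 2)%:E)%E); last first.
  by apply/funext => w; rewrite /= (parseval hE hf).
apply: measurable_esum_ix => [k w|k]; first by rewrite lee_fin sqr_ge0.
apply/measurable_EFinP.
rewrite (_ : (fun w => _) = fun w => complex.Re (dot (X w x) (f k)) ^+ 2
   + complex.Im (dot (X w x) (f k)) ^+ 2); last first.
  by apply/funext => w; rewrite cmod_sqr.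
by apply: measurable_funD; apply: measurable_funX => //; exact: weakly_measurable_Im.
Qed.

Lemma measurable_hs_norm2 X : weakly_measurable X ->
  measurable_fun setT (fun w => hs_norm2 f (X w)).
Proof.
move=> mX; apply: measurable_esum_ix => [k w|k]; first by rewrite lee_fin sqr_ge0.
by apply/measurable_EFinP; exact: measurable_rnorm2.
Qed.

Lemma weakly_measurableB X Y : weakly_measurable X -> weakly_measurable Y ->
  weakly_measurable (fun w x => X w x - Y w x).
Proof.
move=> mX mY x v.
rewrite (_ : (fun w => _) = fun w => complex.Re (dot (X w x) v) - complex.Re (dot (Y w x) v)).
  exact: measurable_funB.
by apply/funext => w; rewrite dotBl ReD ReN.
Qed.

Lemma weakly_measurable_lincomb (I : Type) (s : seq I) (c : I -> T -> R) (A : I -> E -> E) :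
  (forall i, measurable_fun setT (c i)) ->
  weakly_measurable (fun w x => \sum_(i <- s) (c i w)%:C%C *: A i x).
Proof.
move=> mc x v.
rewrite (_ : (fun w => _) = fun w => \sum_(i <- s) c i w * complex.Re (dot (A i x) v)).
  by apply: measurable_sum => i; exact: measurable_funM.
by apply/funext => w; rewrite dot_suml Re_sum; apply: eq_bigr => i _; rewrite dotZl Re_rM.
Qed.

Lemma measurable_Re_mul (z z' : T -> R[i]) :
  measurable_fun setT (fun w => complex.Re (z w)) -> measurable_fun setT (fun w => complex.Im (z w)) ->
  measurable_fun setT (fun w => complex.Re (z' w)) -> measurable_fun setT (fun w => complex.Im (z' w)) ->
  measurable_fun setT (fun w => complex.Re (z w * z' w)).
Proof.
move=> h1 h2 h3 h4.
rewrite (_ : (fun w => _) = fun w => complex.Re (z w) * complex.Re (z' w) - complex.Im (z w) * complex.Im (z' w)).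
  by apply: measurable_funB; exact: measurable_funM.
by apply/funext => w; rewrite ReM.
Qed.

(** The matrix entries determine all matrix coefficients as limits, by
    expanding first [v], then [x] in the basis. *)
Lemma weakly_measurable_entries X : (forall w, hilbert_schmidt f (X w)) ->
  (forall k l, measurable_fun setT (fun w => complex.Re (entry dot f (X w) k l)) /\
               measurable_fun setT (fun w => complex.Im (entry dot f (X w) k l))) ->
  weakly_measurable X.
Proof.
move=> hX me.
have step l v : measurable_fun setT (fun w => complex.Re (dot (X w (f l)) v)).
  apply: (@measurable_fun_cvg _ _ _ _
    (fun n w => \sum_(k <- ixs n) complex.Re ((dot v (f k))^* * entry dot f (X w) k l))).
    move=> n; apply: measurable_sum => k.
    by apply: measurable_Re_mul => //; case: (me k l).
  move=> w _.
  apply: (@cvg_le_mul _ (rnorm (X w (f l))) _ (fun n => rnorm (v - proj_on dot f (ixs n) v))).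
    move=> n; apply: le_trans (Re_dot_le hE _ _).
    rewrite dotBr ReD ReN /proj_on dot_sumr Re_sum.
    by under [X in _ <= `|_ - X|]eq_bigr do rewrite dotZr.
  exact: expansion_cvg.
move=> x v.
apply: (@measurable_fun_cvg _ _ _ _
    (fun n w => \sum_(k <- ixs n) complex.Re (dot x (f k) * dot (X w (f k)) v))).
  move=> n; apply: measurable_sum => k; apply: measurable_Re_mul => //.
  have := step k (Complex 0 1 *: v).
  rewrite (_ : (fun w => complex.Re _) = (fun w => complex.Im (dot (X w (f k)) v)))//.
  by apply/funext => w; rewrite dotZr ReM Re_conj/= mul0r sub0r mulNr opprK mul1r.
move=> w _; have lX := (hX w).
have [linX _ _] := lX.
apply: (@cvg_le_mul _ (hsr f (X w) * rnorm v) _ (fun n => rnorm (x - proj_on dot f (ixs n) x))).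
  move=> n.
  have -> : \sum_(k <- ixs n) complex.Re (dot x (f k) * dot (X w (f k)) v)
      = complex.Re (dot (X w (proj_on dot f (ixs n) x)) v).
    rewrite /proj_on (linear_map_sum linX) dot_suml Re_sum; apply: eq_bigr => k _.
    by rewrite (linear_mapZ linX) dotZl.
  rewrite -ReN -ReD -dotBl -(linear_mapB linX).
  apply: (le_trans (Re_dot_le hE _ _)); rewrite mulrAC ler_wpM2r ?rnorm_ge0//.
  exact: (hsr_op_bound hE hf).
exact: expansion_cvg.
Qed.

(** Expanding the inner value [Y w x] in the basis separates the two random
    operators. *)
Lemma weakly_measurable_comp X Y : (forall w, hilbert_schmidt f (X w)) ->
  weakly_measurable X -> weakly_measurable Y -> weakly_measurable (rprod X Y).
Proof.
move=> hX mX mY x v.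
apply: (@measurable_fun_cvg _ _ _ _
    (fun n w => \sum_(k <- ixs n) complex.Re (dot (Y w x) (f k) * dot (X w (f k)) v))).
  move=> n; apply: measurable_sum => k.
  by apply: measurable_Re_mul => //; exact: weakly_measurable_Im.
move=> w _; have lX := (hX w).
have [linX _ _] := lX.
apply: (@cvg_le_mul _ (hsr f (X w) * rnorm v) _ (fun n => rnorm (Y w x - proj_on dot f (ixs n) (Y w x)))).
  move=> n.
  have -> : \sum_(k <- ixs n) complex.Re (dot (Y w x) (f k) * dot (X w (f k)) v)
      = complex.Re (dot (X w (proj_on dot f (ixs n) (Y w x))) v).
    rewrite /proj_on (linear_map_sum linX) dot_suml Re_sum; apply: eq_bigr => k _.
    by rewrite (linear_mapZ linX) dotZl.
  rewrite -ReN -ReD -dotBl -(linear_mapB linX).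
  apply: (le_trans (Re_dot_le hE _ _)); rewrite mulrAC ler_wpM2r ?rnorm_ge0//.
  exact: (hsr_op_bound hE hf).
exact: expansion_cvg.
Qed.

Lemma sqr_sum_le (I : Type) (s : seq I) (a : I -> R) :
  (\sum_(i <- s) a i) ^+ 2 <= (size s)%:R * \sum_(i <- s) a i ^+ 2.
Proof.
have -> : (\sum_(i <- s) a i) ^+ 2 = \sum_(i <- s) \sum_(j <- s) a i * a j.
  by rewrite expr2 mulr_suml; apply: eq_bigr => i _; rewrite mulr_sumr.
have -> : (size s)%:R * \sum_(i <- s) a i ^+ 2 = \sum_(i <- s) \sum_(j <- s) (a i ^+ 2 + a j ^+ 2) / 2.
  have cst c : \sum_(j <- s) c = (size s)%:R * c :> R.
    by rewrite big_const_seq count_predT iter_addr_0 mulr_natl.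
  under [RHS]eq_bigr do under eq_bigr do rewrite mulrDl.
  under [RHS]eq_bigr do rewrite big_split/= cst.
  by rewrite big_split/= cst -mulr_sumr -mulr_suml; lra.
apply: ler_sum => i _; apply: ler_sum => j _.
have := sqr_ge0 (a i - a j); rewrite sqrrB; lra.
Qed.

(** Convexity of the square; used only for sums whose length does not grow. *)
Lemma hs_norm2_sum_le (I : choiceType) (s : seq I) (F : I -> E -> E) :
  (hs_norm2 f (fun x => \sum_(i <- s) F i x)%R <=
   (size s)%:R%:E * (\sum_(i <- s) hs_norm2 f (F i))%R)%E.
Proof.
rewrite /hs_norm2 -esum_sum//.
rewrite -esumZl ?lee_fin//; last by move=> k; apply: sume_ge0 => i _; rewrite lee_fin sqr_ge0.
apply: le_esum => k _; rewrite -[X in (_ * X)%E]/(\sum_(i <- s) (rnorm (F i (f k)) ^+ 2)%:E)%E.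
rewrite sumEFin -EFinM lee_fin; apply: le_trans (sqr_sum_le _ _).
  by rewrite ler_sqr ?nnegrE ?rnorm_ge0 ?sumr_ge0// ?rnorm_sum// => i _; exact: rnorm_ge0.
by move=> k i _ _; rewrite lee_fin sqr_ge0.
Qed.

End RandomOperators.

(** * Second moments of partial chaos sums *)

Section SecondMoments.
Context {R : realType} {E : completeNormedModType R[i]} {dimH dimE : option nat}.
Variables (dot : {dot E for Num.conj}) (f : ix dimE -> E).
Hypotheses (hE : norm_from_dot dot) (hf : orthonormal_basis dot f).
Context {d : measure_display} {T : measurableType d}.
Variable P : probability T R.
Variables (psi : midx dimH -> T -> R) (th : midx dimH -> midx dimH -> midx dimH -> midx dimH -> R).
Hypothesis sys : chaos_system P psi th.

(** Orthogonality of distinct basis functions removes the off-diagonal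
    terms. *)
Lemma mean_rnorm2 (I : choiceType) (s : seq I) (phi : I -> midx dimH) (v : I -> E) :
  uniq s -> {in s &, injective phi} ->
  has_mean P (fun w => rnorm (\sum_(i <- s) (psi (phi i) w)%:C%C *: v i) ^+ 2)
    (\sum_(i <- s) chaos_weight th (phi i) * rnorm (v i) ^+ 2).
Proof.
move=> us inj.
rewrite (_ : (fun w => _) = fun w => \sum_(i <- s) \sum_(j <- s)
   complex.Re (dot (v i) (v j)) * (psi (phi i) w * psi (phi j) w)); last first.
  apply/funext => w; rewrite (rnorm_sqr hE) dot_suml Re_sum; apply: eq_bigr => i _.
  rewrite dotZl Re_rM dot_sumr Re_sum mulr_sumr; apply: eq_bigr => j _.
  rewrite dotZr (ReM (_^*)%R) Re_conj /= oppr0 mul0r subr0; ring.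
rewrite (_ : \sum_(i <- s) _ = \sum_(i <- s) \sum_(j <- s)
   complex.Re (dot (v i) (v j)) * ((phi i == phi j)%:R * chaos_weight th (phi i))); last first.
  apply: eq_big_seq => i si; rewrite (bigD1_seq i)//= eqxx mul1r.
  rewrite (rnorm_sqr hE) mulrC big_seq_cond big1 ?addr0// => j /andP[sj ji].
  case: eqP => [h|_]; last by rewrite mul0r mulr0.
  by rewrite (inj _ _ si sj h) eqxx in ji.
apply: has_mean_sum => i _; apply: has_mean_sum => j _; apply: has_meanZ.
exact: mean_psi2.
Qed.

(** The second moments of the basis functions are at most 1. The indexing by
    [phi] allows contracted multi-indices as well. *)
Lemma integral_hs_norm2_le (I : choiceType) (s : seq I) (phi : I -> midx dimH) (A : I -> E -> E) :
  uniq s -> {in s &, injective phi} ->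
  (\int[P]_w hs_norm2 f (fun x => \sum_(i <- s) (psi (phi i) w)%:C%C *: A i x)%R <=
   (\sum_(i <- s) hs_norm2 f (A i))%R)%E.
Proof.
move=> us inj; rewrite /hs_norm2.
have mp (al : midx dimH) : measurable_fun setT (psi al) by exact: psi_measurable sys _.
have wm : weakly_measurable dot (fun w x => \sum_(i <- s) (psi (phi i) w)%:C%C *: A i x).
  exact: weakly_measurable_lincomb.
rewrite integral_esum_ix; first last.
- by move=> k; move/measurable_EFinP: (measurable_rnorm2 hE hf (f k) wm).
- by move=> k w; rewrite lee_fin sqr_ge0.
rewrite -esum_sum; last by move=> k i _ _; rewrite lee_fin sqr_ge0.
apply: le_esum => k _.
have [_ ->] := mean_rnorm2 (fun i => A i (f k)) us inj.
rewrite sumEFin lee_fin; apply: ler_sum => i _.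
rewrite ler_piMl ?sqr_ge0//; apply: le_trans (ler_norm _) _.
exact: chaos_weight_le1 sys _.
Qed.

Definition partial_chaos (F : {fset midx dimH}) (A : coeff_array dimH E) : T -> E -> E :=
  fun w x => \sum_(al <- F) (psi al w)%:C%C *: A al x.

Lemma partial_chaos_measurable F A : weakly_measurable dot (partial_chaos F A).
Proof. by apply: weakly_measurable_lincomb => al; exact: psi_measurable sys _. Qed.

Lemma integral_partial_chaos F A :
  (\int[P]_w hs_norm2 f (partial_chaos F A w) <= (\sum_(al <- F) hs_norm2 f (A al))%R)%E.
Proof. by apply: (integral_hs_norm2_le (phi := id)); [exact: fset_uniq|]. Qed.

(** Counts the contractions with [g] twice, once for the convexity bound and
    once for the sum of their second moments. *)
Definition growth_const (g : midx dimH) : R :=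
  (size (box g))%:R * ((size (box g))%:R * 4 ^+ mdeg g).

Lemma growth_const_ge0 g : 0 <= growth_const g.
Proof. by rewrite /growth_const !mulr_ge0// exprn_ge0. Qed.

(** Multiplication by [psi g] turns a chaos into a sum, over the
    multi-indices [r] below [g], of chaoses whose coefficients are those of
    [A] times a product coefficient. For fixed [r] the contraction is
    injective in [al], so each of them is again orthogonal, and the product
    coefficients grow at most like 2 to the degree. *)
Lemma integral_psi2_partial_chaos g F A :
  (\int[P]_w ((psi g w ^+ 2)%:E * hs_norm2 f (partial_chaos F A w)) <=
   (growth_const g)%:E * (\sum_(al <- F) ((4 ^+ mdeg al)%:E * hs_norm2 f (A al))%E)%R)%E.
Proof.
have mp (al : midx dimH) : measurable_fun setT (psi al) by exact: psi_measurable sys _.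
pose F' r := [fset al in F | r \in box al]%fset.
pose B r al x := (pcoef th g al r)%:C%C *: A al x.
pose Z r w x := \sum_(al <- F' r) (psi (mcon g al r) w)%:C%C *: B r al x.
have mZ r : measurable_fun setT (fun w => hs_norm2 f (Z r w)).
  by apply: (measurable_hs_norm2 hE hf); apply: weakly_measurable_lincomb.
have Z0 r w : (0 <= hs_norm2 f (Z r w))%E by exact: hs_norm2_ge0.
have iZ r : r \in box g ->
   (\int[P]_w hs_norm2 f (Z r w) <= (4 ^+ mdeg g)%:E * (\sum_(al <- F) ((4 ^+ mdeg al)%:E * hs_norm2 f (A al))%E)%R)%E.
  move=> rg; apply: (@le_trans _ _ (\sum_(al <- F' r) hs_norm2 f (B r al))%R).
    apply: (integral_hs_norm2_le (phi := fun al => mcon g al r)); first exact: fset_uniq.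
    move=> al be; rewrite !inE/= => /andP[_ ra] /andP[_ rb]; exact: mcon_inj.
  rewrite ge0_sume_distrr; last by move=> al _; rewrite mule_ge0 ?hs_norm2_ge0// lee_fin exprn_ge0.
  rewrite /F' -big_fset_condE/=.
  apply: (@le_trans _ _ (\sum_(al <- F | r \in box al) ((4 ^+ mdeg g)%:E * ((4 ^+ mdeg al)%:E * hs_norm2 f (A al)))%E)%R).
    apply: lee_sum => al ra; rewrite hs_norm2Z muleA -EFinM -exprD.
    apply: lee_wpmul2r; first exact: hs_norm2_ge0.
    rewrite lee_fin cmod_real real_normK ?num_real// /pcoef exprMn.
    rewrite -[leRHS]mulr1; apply: ler_pM; rewrite ?sqr_ge0// ?product_coeff_sqr_le//.
    rewrite -real_normK ?num_real// expr_le1//.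
    have [h _ _] := sys; apply: h; exact/contraction_mconP.
  rewrite [leLHS]big_mkcond/=; apply: lee_sum => al _; case: ifP => // _.
  by rewrite !mule_ge0 ?hs_norm2_ge0// lee_fin exprn_ge0.
apply: (@le_trans _ _ (\int[P]_w ((size (box g))%:R%:E * (\sum_(r <- box g) hs_norm2 f (Z r w))%R))%E).
  apply: ae_ge0_le_integral => //.
  - by move=> w _; rewrite mule_ge0 ?hs_norm2_ge0// lee_fin sqr_ge0.
  - apply: emeasurable_funM; first by apply/measurable_EFinP; exact: measurable_funX.
    by apply: (measurable_hs_norm2 hE hf); exact: partial_chaos_measurable.
  - by move=> w _; rewrite mule_ge0 ?lee_fin ?ler0n// sume_ge0.
  - by apply: emeasurable_funM => //; exact: emeasurable_sum.
  have [_ _ h] := sys.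
  (* One null set serves all [al], since there are countably many
     multi-indices. *)
  have : {ae P, forall w, forall n, if @choice.pickle_inv (midx dimH) n is Some al then
      psi g w * psi al w = \sum_(r <- box g | r \in box al) pcoef th g al r * psi (mcon g al r) w else True}.
    apply: ae_foralln => n; case: choice.pickle_inv => [al|]; first exact: h.
    exact: filterE.
  apply: filterS => w hw _.
  rewrite (_ : ((psi g w ^+ 2)%:E * _)%E = hs_norm2 f (fun x => \sum_(r <- box g) Z r w x)).
    exact: hs_norm2_sum_le.
  rewrite -(real_normK (num_real (psi g w))) -cmod_real -hs_norm2Z.
  congr hs_norm2; apply/funext => x; rewrite /partial_chaos scaler_sumr.
  rewrite /Z; under [RHS]eq_bigr do rewrite -big_fset_condE/= big_mkcond/=.
  rewrite exchange_big/=; apply: eq_bigr => al _.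
  rewrite -big_mkcond/= scalerA -rmorphM/=.
  have := hw (choice.pickle al); rewrite choice.pickleK_inv => ->.
  rewrite rmorph_sum/= scaler_suml; apply: eq_bigr => r _.
  by rewrite /B scalerA -rmorphM/= mulrC.
rewrite ge0_integralZl//; first last.
- by move=> w _; exact: sume_ge0.
- exact: emeasurable_sum.
rewrite ge0_integral_sum// /growth_const EFinM -muleA; apply: lee_wpmul2l; first by rewrite lee_fin.
rewrite EFinM -muleA; set c := (_ * (\sum_(al <- F) _)%R)%E.
apply: (@le_trans _ _ (\sum_(k <- box g) c)%R).
  by rewrite big_seq_cond [leRHS]big_seq_cond; apply: lee_sum => r /andP[rg _]; exact: iZ.
rewrite big_const_seq count_predT.
elim: (size _) => [|n IH] /=; first by rewrite mul0e.
by rewrite -natr1 EFinD ge0_muleDl ?lee_fin// mul1e addeC leeD2r.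
Qed.

End SecondMoments.

(** * Weighted convergence of chaos sums *)

Lemma contr_set_sum {A : zmodType} {dim : option nat} (F G : {fset midx dim}) g
    (h : midx dim -> midx dim -> midx dim -> A) :
  \sum_(t <- contr_set F G g) h t.1.1 t.1.2 t.2 =
  \sum_(al <- F) \sum_(be <- G)
    \sum_(r <- [fset r in box al | r \in box be]%fset | mcon al be r == g) h al be r.
Proof.
pose S (p : midx dim * midx dim) :=
  [seq r <- [fset r in box p.1 | r \in box p.2]%fset | mcon p.1 p.2 r == g].
pose L := [seq (p, r) | p <- [seq (al, be) | al <- F, be <- G], r <- S p].
rewrite (perm_big L)/=.
  rewrite /L big_allpairs_dep/= big_allpairs_dep/=.
  by apply: eq_bigr => al _; apply: eq_bigr => be _; rewrite big_filter.
apply: uniq_perm; first exact: fset_uniq.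
  apply: allpairs_uniq_dep.
  - by apply: allpairs_uniq => [||[? ?] [? ?] _ _ [-> ->]]//; exact: fset_uniq.
  - by move=> p _; rewrite /S filter_uniq// fset_uniq.
  - by move=> [p r] [p' r'] _ _ /= [-> ->].
move=> t; apply/idP/idP => [/in_contr_set[tF tG /contraction_mconP[ra rb E]]|].
  apply/allpairsPdep; exists t.1, t.2; split.
  - by apply/allpairsP; exists t.1; split=> //; case: (t.1).
  - by rewrite mem_filter -E eqxx/= !inE/= ra rb.
  - by case: t {tF tG ra rb E}.
move=> /allpairsPdep[p [r [/allpairsP[q [qF qG ->]] rS ->]]].
apply/in_contr_set; split=> //=.
move: rS; rewrite mem_filter/= !inE/= => /andP[/eqP <- /andP[ra rb]].
exact/contraction_mconP.
Qed.

Section Pairing.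
Context {R : realType} {E : completeNormedModType R[i]} {dimH dimE : option nat}.
Variables (dot : {dot E for Num.conj}) (f : ix dimE -> E).
Hypotheses (hE : norm_from_dot dot) (hf : orthonormal_basis dot f).
Context {d : measure_display} {T : measurableType d}.
Variable P : probability T R.
Variables (psi : midx dimH -> T -> R) (th : midx dimH -> midx dimH -> midx dimH -> midx dimH -> R).
Hypothesis sys : chaos_system P psi th.
Implicit Types A B : coeff_array dimH E.

(** By linearity everything reduces to [mean_psi3], whose coefficients are
    those of the product of the truncated arrays. *)
Lemma mean_partial_product g F G A B x v : frakA2 f A -> frakA2 f B ->
  has_mean P
    (fun w => psi g w * complex.Re (dot (rprod (partial_chaos psi F A) (partial_chaos psi G B) w x) v))
    (chaos_weight th g * complex.Re (dot (fin_array_prod th (trunc F A) (trunc G B) g x) v)).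
Proof.
move=> hA hB.
have lA al : linear (A al) by case: (frakA2_hs al hA).
have lTA al : linear (trunc F A al).
  by rewrite /trunc; case: ifP => // _ a y z; rewrite scaler0 addr0.
have vo H C : vanishes_off H (trunc H C : coeff_array dimH E).
  by move=> al alH; rewrite /trunc (negbTE alH).
rewrite (fin_array_prodE _ _ _ lTA (vo F A) (vo G B)).
have -> : complex.Re (dot (\sum_(t <- contr_set F G g)
      prod_term th (trunc F A) (trunc G B) g t x) v) =
    \sum_(al <- F) \sum_(be <- G) complex.Re (dot (A al (B be x)) v) *
      \sum_(r <- [fset r in box al | r \in box be]%fset | mcon al be r == g) pcoef th al be r.
  rewrite dot_suml Re_sum.
  rewrite (eq_bigr (fun t => complex.Re (dot (trunc F A t.1.1 (trunc G B t.1.2 x)) v) *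
     (product_coeff t.1.1 t.1.2 t.2 g * th t.1.1 t.1.2 t.2 g))); last first.
    by move=> t _; rewrite /prod_term dotZl Re_rM mulrC.
  rewrite (contr_set_sum F G g (fun al be r => complex.Re (dot (trunc F A al (trunc G B be x)) v) *
     (product_coeff al be r g * th al be r g))).
  apply: eq_big_seq => al alF; apply: eq_big_seq => be beG.
  rewrite mulr_sumr; apply: eq_bigr => r /eqP <-.
  by rewrite /trunc alF beG.
rewrite (_ : (fun w => _) = fun w => \sum_(al <- F) \sum_(be <- G)
   complex.Re (dot (A al (B be x)) v) * (psi g w * (psi al w * psi be w))); last first.
  apply/funext => w; rewrite /rprod /partial_chaos dot_suml Re_sum mulr_sumr.
  apply: eq_bigr => al _.
  rewrite (linear_map_sum (lA al)) dotZl Re_rM dot_suml Re_sum !mulr_sumr.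
  apply: eq_bigr => be _.
  rewrite (linear_mapZ (lA al)) dotZl Re_rM; ring.
rewrite mulr_sumr; apply: has_mean_sum => al _.
rewrite mulr_sumr; apply: has_mean_sum => be _.
rewrite mulrCA; apply: has_meanZ; exact: mean_psi3.
Qed.

Lemma hs_norm2_split (X Y Z : E -> E) : (forall x, X x = Y x + Z x) ->
  (hs_norm2 f X <= 2%:E * hs_norm2 f Y + 2%:E * hs_norm2 f Z)%E.
Proof.
move=> h.
have := hs_norm2_sum_le f [:: true; false] (fun b => if b then Y else Z).
rewrite !big_cons big_nil addr0 /=.
rewrite ge0_muleDr ?hs_norm2_ge0//; congr (_ <= _)%E.
by apply: eq_hs_norm2 => k; rewrite !big_cons big_nil addr0 h.
Qed.

Lemma chaos_sum_measurable A X : is_chaos_sum dot f P psi A X -> weakly_measurable dot X.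
Proof. by move=> [h1 h2 _]; exact: (weakly_measurable_entries hE hf h1 h2). Qed.

Notation stage A n := (partial_chaos psi (midx_upto n) A).

Lemma chaos_sum_stage_cvg A X : is_chaos_sum dot f P psi A X ->
  (\int[P]_w hs_norm2 f (fun x => X w x - stage A n w x)%R)%E @[n --> \oo] --> 0%E.
Proof.
move=> [_ _ h]; apply/ecvg0P.
  by move=> n; apply: integral_ge0 => w _; exact: hs_norm2_ge0.
move=> e e0; have [F0 hF0] := h e e0.
have [N hN] := midx_upto_absorb F0.
by exists N => // n /= nN; apply: hF0; exact: hN.
Qed.

(** The factor 4 to the degree is the price of multiplication by a basis
    function in [integral_psi2_partial_chaos]. *)
Definition heavy_tail A n : \bar R :=
  (\esum_(al in ~` [set` midx_upto n]) ((4 ^+ mdeg al)%:E * hs_norm2 f (A al)))%E.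

Lemma heavy_tail_ge0 A n : (0 <= heavy_tail A n)%E.
Proof. by apply: esum_ge0 => al _; rewrite mule_ge0 ?hs_norm2_ge0// lee_fin exprn_ge0. Qed.

Lemma heavy_weight A al : (((4 ^+ mdeg al)%:E * hs_norm2 f (A al)) =
  ((2 ^+ mdeg al)%:E * hsa f A al) ^+ 2)%E.
Proof.
rewrite sqreM /hsa hsn_sqr; congr (_ * _)%E.
by rewrite -EFin_expe -exprM mulnC exprM; congr (_ ^+ _)%:E; rewrite expr2; lra.
Qed.

Lemma heavy_sum_fin A : frakA2 f A ->
  (\esum_(al in setT) ((4 ^+ mdeg al)%:E * hs_norm2 f (A al)) < +oo)%E.
Proof.
move=> hA; have := frakA2_wnorm hA (_ : 1 <= 2); rewrite ler1n => /(_ isT).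
by rewrite /wnorm; under eq_esum do rewrite -heavy_weight.
Qed.

Lemma heavy_tail_cvg A : frakA2 f A -> heavy_tail A n @[n --> \oo] --> 0%E.
Proof.
move=> hA; apply/ecvg0P; first exact: heavy_tail_ge0.
move=> e e0.
have w0 (al : midx dimH) : (0 <= (4 ^+ mdeg al)%:E * hs_norm2 f (A al))%E.
  by rewrite mule_ge0 ?hs_norm2_ge0// lee_fin exprn_ge0.
have [X hX] := esum_tail w0 (heavy_sum_fin hA) e0.
have [N hN] := midx_upto_absorb X.
exists N => // n /= nN; apply: le_trans hX; apply: esum_subset => al /= h alX; apply: h.
by move/fsubsetP : (hN n nN); apply.
Qed.

Lemma sum_diff_le_tail A (F : {fset midx dimH}) n :
  ((\sum_(al <- (F `\` midx_upto n)%fset) ((4 ^+ mdeg al)%:E * hs_norm2 f (A al))%E)%R <= heavy_tail A n)%E.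
Proof.
rewrite -(esum_seq (D := [set` (F `\` midx_upto n)%fset])) ?fset_uniq//.
  by apply: esum_subset => al /=; rewrite in_fsetD => /andP[/negP].
by move=> al; rewrite mule_ge0 ?hs_norm2_ge0// lee_fin exprn_ge0.
Qed.

Lemma partial_chaos_diff (F G : {fset midx dimH}) A w x : (G `<=` F)%fset ->
  partial_chaos psi F A w x - partial_chaos psi G A w x = partial_chaos psi (F `\` G)%fset A w x.
Proof.
move=> GF; rewrite /partial_chaos (big_fsetID _ (mem G) F)/=.
rewrite (_ : [fset x in F | x \in G]%fset = G); last first.
  by apply/fsetP => al; rewrite !inE/= andbC; case: (boolP (al \in G)) => //= /(fsubsetP GF).
rewrite (_ : [fset x in F | x \notin G]%fset = (F `\` G)%fset); last first.
  by apply/fsetP => al; rewrite !inE/= andbC.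
by rewrite addrAC subrr add0r.
Qed.

(** Monotone convergence in the truncation level [K]. *)
Lemma integral_trunc_le (p : T -> R) (h : T -> \bar R) (b : \bar R) :
  (forall w, 0 <= p w) -> measurable_fun setT p ->
  (forall w, (0 <= h w)%E) -> measurable_fun setT h ->
  (forall K : nat, (\int[P]_w ((Num.min (p w) K%:R)%:E * h w) <= b)%E) ->
  (\int[P]_w ((p w)%:E * h w) <= b)%E.
Proof.
move=> p0 mp h0 mh hK.
have m0 w (K : nat) : 0 <= Num.min (p w) K%:R by rewrite le_min p0 ler0n.
have cv := @cvg_monotone_convergence _ _ _ P setT measurableT
  (fun (K : nat) w => ((Num.min (p w) K%:R)%:E * h w)%E).
have /cv{}cv : forall K : nat, measurable_fun setT (fun w => ((Num.min (p w) K%:R)%:E * h w)%E).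
  move=> K; apply: emeasurable_funM => //; apply/measurable_EFinP.
  exact: measurable_minr.
have /cv{}cv : forall (K : nat) (w : T), setT w -> (0 <= (Num.min (p w) K%:R)%:E * h w)%E.
  by move=> K w _; rewrite mule_ge0// lee_fin.
have /cv{}cv : forall w : T, setT w ->
    {homo (fun K : nat => ((Num.min (p w) K%:R)%:E * h w)%E) : m n / (m <= n)%N >-> (m <= n)%E}.
  move=> w _ m n mn; apply: lee_wpmul2r => //; rewrite lee_fin.
  by rewrite le_min !ge_min lexx/= ler_nat mn orbT.
rewrite (_ : (fun w => limn _) = (fun w => ((p w)%:E * h w)%E)) in cv.
  rewrite -(cvg_lim _ cv)//; apply: lime_le; first by apply/cvg_ex; eexists; exact: cv.
  exact: nearW.
apply/funext => w; apply/cvg_lim => //; apply: cvg_near_cst.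
exists (Num.trunc (p w)).+1 => // K /= hKp.
rewrite (min_l _)//; apply: ltW; apply: lt_le_trans (_ : (Num.trunc (p w)).+1%:R <= _).
  exact: truncnS_gt.
by rewrite ler_nat.
Qed.

Let mpsi al : measurable_fun setT (psi al).
Proof. exact: psi_measurable sys _. Qed.

(** The chaos sum is only known to converge in unweighted L^2. Truncating
    the weight at [K] makes a far stage [m] a good approximation, and the
    difference of two stages is a partial chaos to which the weighted
    estimate applies uniformly in [m] and [K]. *)
Lemma integral_psi2_residual_le g A X n : is_chaos_sum dot f P psi A X ->
  (\int[P]_w ((psi g w ^+ 2)%:E * hs_norm2 f (fun x => X w x - stage A n w x)%R) <=
   (2 * growth_const g)%:E * heavy_tail A n)%E.
Proof.
move=> hX; have wX := chaos_sum_measurable hX.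
have wS H : weakly_measurable dot (partial_chaos psi H A) by exact: (partial_chaos_measurable _ sys).
have mD m : measurable_fun setT (fun w => hs_norm2 f (fun x => X w x - stage A m w x)).
  by apply: (measurable_hs_norm2 hE hf); exact: weakly_measurableB.
have mH H : measurable_fun setT (fun w => hs_norm2 f (partial_chaos psi H A w)).
  exact: (measurable_hs_norm2 hE hf).
have mp2 : measurable_fun setT (fun w => psi g w ^+ 2) by exact: measurable_funX.
apply: integral_trunc_le => //.
- by move=> w; exact: sqr_ge0.
- by move=> w; exact: hs_norm2_ge0.
move=> K; apply/lee_addgt0Pr => e e0.
have u0 m : (0 <= (2 * K%:R)%:E * \int[P]_w hs_norm2 f (fun x => X w x - stage A m w x)%R)%E.
  by rewrite mule_ge0 ?lee_fin ?mulr_ge0 ?ler0n//; apply: integral_ge0 => w _; exact: hs_norm2_ge0.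
have [N _ hN] := (ecvg0P u0).1 (ecvg0Z (2 * K%:R) (chaos_sum_stage_cvg hX)) e e0.
pose m := maxn N n.
have nm : (midx_upto n `<=` (midx_upto m : {fset midx dimH}))%fset.
  by apply/fsubsetP => al; rewrite !in_midx_upto => h; rewrite (leq_trans h)// leq_maxr.
(* The multi-indices entering between the stages [n] and [m]. *)
pose H := (midx_upto m `\` midx_upto n : {fset midx dimH})%fset.
apply: (@le_trans _ _ (\int[P]_w ((2 * K%:R)%:E * hs_norm2 f (fun x => X w x - stage A m w x)%R +
   2%:E * ((psi g w ^+ 2)%:E * hs_norm2 f (partial_chaos psi H A w))))%E).
  apply: ge0_le_integral => //.
  - by move=> w _; rewrite mule_ge0 ?hs_norm2_ge0// lee_fin le_min sqr_ge0 ler0n.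
  - by apply: emeasurable_funM => //; apply/measurable_EFinP; exact: measurable_minr.
  - by apply: emeasurable_funD; apply: emeasurable_funM => //; apply: emeasurable_funM => //; apply/measurable_EFinP.
  move=> w _.
  have m0 : 0 <= Num.min (psi g w ^+ 2) K%:R by rewrite le_min sqr_ge0 ler0n.
  apply: (@le_trans _ _ ((Num.min (psi g w ^+ 2) K%:R)%:E *
     (2%:E * hs_norm2 f (fun x => X w x - stage A m w x)%R + 2%:E * hs_norm2 f (partial_chaos psi H A w)))%E).
    apply: lee_wpmul2l; first by rewrite lee_fin.
    by apply: hs_norm2_split => x; rewrite -(partial_chaos_diff A w x nm) addrA subrK.
  rewrite ge0_muleDr ?mule_ge0 ?hs_norm2_ge0//; apply: leeD.
    rewrite muleA -EFinM; apply: lee_wpmul2r; first exact: hs_norm2_ge0.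
    by rewrite lee_fin mulrC ler_wpM2l// ge_min lexx orbT.
  rewrite muleCA; apply: lee_wpmul2l => //; apply: lee_wpmul2r; first exact: hs_norm2_ge0.
  by rewrite lee_fin ge_min lexx.
rewrite ge0_integralD//; first last.
- by apply: emeasurable_funM => //; apply: emeasurable_funM => //; apply/measurable_EFinP.
- by move=> w _; rewrite !mule_ge0 ?hs_norm2_ge0// lee_fin sqr_ge0.
- exact: emeasurable_funM.
- by move=> w _; rewrite mule_ge0 ?hs_norm2_ge0// lee_fin mulr_ge0.
rewrite ge0_integralZl_EFin ?mulr_ge0//; last by move=> w _; exact: hs_norm2_ge0.
rewrite ge0_integralZl_EFin//; last first.
- by apply: emeasurable_funM => //; apply/measurable_EFinP.
- by move=> w _; rewrite mule_ge0 ?hs_norm2_ge0// lee_fin sqr_ge0.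
rewrite addeC; apply: leeD; last by apply: hN; exact: leq_maxl.
rewrite EFinM -muleA; apply: lee_wpmul2l => //.
apply: le_trans (integral_psi2_partial_chaos hE hf sys g H A) _.
by apply: lee_wpmul2l; rewrite ?lee_fin ?growth_const_ge0// sum_diff_le_tail.
Qed.

Lemma chaos_sum_psi2_cvg g A X : frakA2 f A -> is_chaos_sum dot f P psi A X ->
  (\int[P]_w ((psi g w ^+ 2)%:E * hs_norm2 f (fun x => X w x - stage A n w x)%R))%E
    @[n --> \oo] --> 0%E.
Proof.
move=> hA hX; apply: ecvg0_le (ecvg0Z (2 * growth_const g) (heavy_tail_cvg hA)).
  by move=> n; apply: integral_ge0 => w _; rewrite mule_ge0 ?hs_norm2_ge0// lee_fin sqr_ge0.
by apply: nearW => n; exact: integral_psi2_residual_le.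
Qed.

End Pairing.

(** * Products of chaos sums *)

Section ChaosProduct.
Context {R : realType} {E : completeNormedModType R[i]} {dimH dimE : option nat}.
Variables (dot : {dot E for Num.conj}) (f : ix dimE -> E).
Hypotheses (hE : norm_from_dot dot) (hf : orthonormal_basis dot f).
Context {d : measure_display} {T : measurableType d}.
Variable P : probability T R.
Variables (psi : midx dimH -> T -> R) (th : midx dimH -> midx dimH -> midx dimH -> midx dimH -> R).
Hypothesis sys : chaos_system P psi th.
Implicit Types A B : coeff_array dimH E.
Notation stage A n := (partial_chaos psi (midx_upto n) A).

Lemma hs_norm2_hsr X : hilbert_schmidt f X -> hs_norm2 f X = (hsr f X ^+ 2)%:E.
Proof.
move=> [_ _ h]; rewrite -hsn_sqr (hsrE h) -EFin_expe//.
Qed.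

Lemma partial_chaos_hs F A w : (forall al, hilbert_schmidt f (A al)) ->
  hilbert_schmidt f (partial_chaos psi F A w).
Proof.
move=> hA; apply: (hilbert_schmidt_sum hE hf) => al.
exact: (hilbert_schmidtZ hE hf).
Qed.

(** Replace first the outer, then the inner operator, and split each product
    of an error and a bounded factor by the inequality between arithmetic
    and geometric means: [lam] multiplies the errors and its inverse
    multiplies the bounded quantities. The weight [p] goes to the outer
    operator in both terms. *)
Lemma product_error_le (p lam : R) (X X' Y Y' : E -> E) x v : 0 < lam ->
  hilbert_schmidt f X -> hilbert_schmidt f X' -> hilbert_schmidt f Y -> hilbert_schmidt f Y' ->
  (`|p * complex.Re (dot (X (Y x)) v) - p * complex.Re (dot (X' (Y' x)) v)|%:E <=
   (rnorm x * rnorm v)%:E *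
    ((lam%:E * ((p ^+ 2)%:E * hs_norm2 f (fun x => X x - X' x)%R) + (lam^-1)%:E * hs_norm2 f Y) +
     ((lam^-1)%:E * ((p ^+ 2)%:E * hs_norm2 f X') + lam%:E * hs_norm2 f (fun x => Y x - Y' x)%R)))%E.
Proof.
move=> lam0 hX hX' hY hY'.
have hDX := hilbert_schmidtB hE hf hX hX'.
have hDY := hilbert_schmidtB hE hf hY hY'.
rewrite (hs_norm2_hsr hDX) (hs_norm2_hsr hY) (hs_norm2_hsr hX') (hs_norm2_hsr hDY).
suff : `|p * complex.Re (dot (X (Y x)) v) - p * complex.Re (dot (X' (Y' x)) v)| <=
    (rnorm x * rnorm v) *
    ((lam * (p ^+ 2 * hsr f (fun x => X x - X' x) ^+ 2) + lam^-1 * hsr f Y ^+ 2) +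
     (lam^-1 * (p ^+ 2 * hsr f X' ^+ 2) + lam * hsr f (fun x => Y x - Y' x) ^+ 2)).
  by rewrite -lee_fin !(EFinM, EFinD).
have linX' : linear X' by case: hX'.
have -> : p * complex.Re (dot (X (Y x)) v) - p * complex.Re (dot (X' (Y' x)) v) =
    p * complex.Re (dot (X (Y x) - X' (Y x)) v) + p * complex.Re (dot (X' (Y x - Y' x)) v).
  by rewrite (linear_mapB linX') !dotBl !ReD !ReN; ring.
have amgm (a b mu : R) : 0 < mu -> 0 <= a -> 0 <= b -> `|p| * (a * b) <= mu * (p ^+ 2 * a ^+ 2) + mu^-1 * b ^+ 2.
  move=> mu0 a0 b0.
  have h1 : 0 <= mu^-1 * (mu * (`|p| * a) - b) ^+ 2 by rewrite mulr_ge0 ?sqr_ge0// invr_ge0 ltW.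
  have E1 : mu^-1 * (mu * (`|p| * a) - b) ^+ 2 =
      mu * (p ^+ 2 * a ^+ 2) + mu^-1 * b ^+ 2 - 2 * (`|p| * (a * b)).
    rewrite -(real_normK (num_real p)); field; exact: lt0r_neq0.
  have h2 : 0 <= `|p| * (a * b) by rewrite !mulr_ge0.
  lra.
set a1 := hsr f (fun x => X x - X' x). set b1 := hsr f Y.
set a2 := hsr f X'. set b2 := hsr f (fun x => Y x - Y' x).
have c0 : 0 <= rnorm x * rnorm v by rewrite mulr_ge0 ?rnorm_ge0.
have e1 : `|complex.Re (dot (X (Y x) - X' (Y x)) v)| <= (rnorm x * rnorm v) * (a1 * b1).
  apply: le_trans (Re_dot_le hE _ _) _.
  rewrite (_ : _ * (a1 * b1) = a1 * (b1 * rnorm x) * rnorm v); last by ring.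
  apply: ler_wpM2r; first exact: rnorm_ge0.
  apply: le_trans (hsr_op_bound hE hf (Y x) hDX) _.
  rewrite -/a1; apply: ler_wpM2l; first exact: hsr_ge0.
  exact: hsr_op_bound.
have e2 : `|complex.Re (dot (X' (Y x - Y' x)) v)| <= (rnorm x * rnorm v) * (a2 * b2).
  apply: le_trans (Re_dot_le hE _ _) _.
  rewrite (_ : _ * (a2 * b2) = a2 * (b2 * rnorm x) * rnorm v); last by ring.
  apply: ler_wpM2r; first exact: rnorm_ge0.
  apply: le_trans (hsr_op_bound hE hf (Y x - Y' x) hX') _.
  rewrite -/a2; apply: ler_wpM2l; first exact: hsr_ge0.
  exact: (hsr_op_bound hE hf x hDY).
apply: le_trans (ler_normD _ _) _; rewrite !normrM.
apply: (@le_trans _ _ (rnorm x * rnorm v * (`|p| * (a1 * b1)) + rnorm x * rnorm v * (`|p| * (a2 * b2)))).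
  by apply: lerD; rewrite mulrCA; apply: ler_wpM2l.
rewrite -mulrDr; apply: ler_wpM2l => //; apply: lerD.
  by apply: amgm => //; exact: hsr_ge0.
rewrite -[X in _ + X * _]invrK; apply: amgm; rewrite ?invr_gt0//; exact: hsr_ge0.
Qed.

Definition heavy_sum A : R :=
  fine (\esum_(al in setT) ((4 ^+ mdeg al)%:E * hs_norm2 f (A al)))%E.

Lemma sum_le_heavy A (F : {fset midx dimH}) : frakA2 f A ->
  ((\sum_(al <- F) ((4 ^+ mdeg al)%:E * hs_norm2 f (A al))%E)%R <= (heavy_sum A)%:E)%E.
Proof.
move=> hA.
have w0 (al : midx dimH) : (0 <= (4 ^+ mdeg al)%:E * hs_norm2 f (A al))%E.
  by rewrite mule_ge0 ?hs_norm2_ge0// lee_fin exprn_ge0.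
rewrite /heavy_sum fineK; last first.
  by rewrite ge0_fin_numE ?(heavy_sum_fin hA)//; apply: esum_ge0 => al _; exact: w0.
rewrite -(esum_seq (D := [set` F])) ?fset_uniq//; exact: esum_subset.
Qed.

Lemma heavy_sum_ge0 A : 0 <= heavy_sum A.
Proof.
rewrite fine_ge0//; apply: esum_ge0 => al _.
by rewrite mule_ge0 ?hs_norm2_ge0// lee_fin exprn_ge0.
Qed.

Lemma chaos_sum_moment A X : frakA2 f A -> is_chaos_sum dot f P psi A X ->
  exists2 M : R, 0 <= M & (\int[P]_w hs_norm2 f (X w) <= M%:E)%E.
Proof.
move=> hA hX; have wX := chaos_sum_measurable hE hf hX.
have wS n : weakly_measurable dot (stage A n) by exact: (partial_chaos_measurable _ sys).
have u0 n : (0 <= \int[P]_w hs_norm2 f (fun x => X w x - stage A n w x)%R)%E.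
  by apply: integral_ge0 => w _; exact: hs_norm2_ge0.
have [N _ /(_ N (leqnn N)) /= hN] := (ecvg0P u0).1 (chaos_sum_stage_cvg hX) 1 ltr01.
exists (2 * 1 + 2 * heavy_sum A); first by rewrite addr_ge0 ?mulr_ge0 ?heavy_sum_ge0.
have mD : measurable_fun setT (fun w => hs_norm2 f (fun x => X w x - stage A N w x)).
  by apply: (measurable_hs_norm2 hE hf); exact: weakly_measurableB.
have mS : measurable_fun setT (fun w => hs_norm2 f (stage A N w)).
  exact: (measurable_hs_norm2 hE hf).
apply: (@le_trans _ _ (\int[P]_w (2%:E * hs_norm2 f (fun x => X w x - stage A N w x)%R +
   2%:E * hs_norm2 f (stage A N w)))%E).
  apply: ge0_le_integral => //.
  - by move=> w _; exact: hs_norm2_ge0.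
  - exact: (measurable_hs_norm2 hE hf).
  - by apply: emeasurable_funD; exact: emeasurable_funM.
  - by move=> w _; apply: hs_norm2_split => x; rewrite subrK.
rewrite ge0_integralD//; first last.
- exact: emeasurable_funM.
- by move=> w _; rewrite mule_ge0 ?hs_norm2_ge0.
- exact: emeasurable_funM.
- by move=> w _; rewrite mule_ge0 ?hs_norm2_ge0.
rewrite ge0_integralZl_EFin//; last by move=> w _; exact: hs_norm2_ge0.
rewrite ge0_integralZl_EFin//; last by move=> w _; exact: hs_norm2_ge0.
rewrite (EFinD (2 * 1)) (EFinM 2 1) (EFinM 2 (heavy_sum A)).
apply: leeD; apply: lee_wpmul2l => //.
apply: le_trans (integral_partial_chaos hE hf sys _ _) _.
apply: le_trans (sum_le_heavy (midx_upto N) hA); apply: lee_sum => al _.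
rewrite -[leLHS]mul1e; apply: lee_wpmul2r; first exact: hs_norm2_ge0.
by rewrite lee_fin exprn_ege1// ler1n.
Qed.

Lemma partial_chaos_psi2_moment g A n : frakA2 f A ->
  (\int[P]_w ((psi g w ^+ 2)%:E * hs_norm2 f (stage A n w)) <= (growth_const g * heavy_sum A)%:E)%E.
Proof.
move=> hA; apply: le_trans (integral_psi2_partial_chaos hE hf sys g _ A) _.
rewrite (EFinM (growth_const g)); apply: lee_wpmul2l; last exact: sum_le_heavy.
by rewrite lee_fin growth_const_ge0.
Qed.

(** In the bound of [product_error_le] the terms with the inverse of [lam]
    have bounded means, so they are small for large [lam]; for this fixed
    [lam] the remaining means tend to zero. *)
Lemma chaos_product_error_cvg g A B X Y x v :
  frakA2 f A -> frakA2 f B -> is_chaos_sum dot f P psi A X -> is_chaos_sum dot f P psi B Y ->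
  (\int[P]_w `|psi g w * complex.Re (dot (rprod X Y w x) v) -
     psi g w * complex.Re (dot (rprod (stage A n) (stage B n) w x) v)|%:E)%E @[n --> \oo] --> 0%E.
Proof.
move=> hA hB hX hY.
have wX := chaos_sum_measurable hE hf hX; have wY := chaos_sum_measurable hE hf hY.
have wS C n : weakly_measurable dot (stage C n) by exact: (partial_chaos_measurable _ sys).
have hsX w : hilbert_schmidt f (X w) by case: hX => h _ _; exact: h.
have hsY w : hilbert_schmidt f (Y w) by case: hY => h _ _; exact: h.
have hsS C n w : frakA2 f C -> hilbert_schmidt f (stage C n w).
  by move=> hC; apply: partial_chaos_hs => al; exact: frakA2_hs.
have mp : measurable_fun setT (psi g) by exact: (psi_measurable sys).
have mp2 : measurable_fun setT (fun w => (psi g w ^+ 2)%:E).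
  by apply/measurable_EFinP; exact: measurable_funX.
have [MY MY0 hMY] := chaos_sum_moment hB hY.
pose MX := growth_const g * heavy_sum A.
have MX0 : 0 <= MX by rewrite mulr_ge0 ?growth_const_ge0 ?heavy_sum_ge0.
pose c := rnorm x * rnorm v.
have c0 : 0 <= c by rewrite mulr_ge0 ?rnorm_ge0.
pose a n := (\int[P]_w ((psi g w ^+ 2)%:E * hs_norm2 f (fun x => X w x - stage A n w x)%R))%E.
pose b n := (\int[P]_w hs_norm2 f (fun x => Y w x - stage B n w x)%R)%E.
have a_cvg : a n @[n --> \oo] --> 0%E by exact: (chaos_sum_psi2_cvg hE hf sys).
have b_cvg : b n @[n --> \oo] --> 0%E by exact: (chaos_sum_stage_cvg hY).
pose u n := (\int[P]_w `|psi g w * complex.Re (dot (rprod X Y w x) v) -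
     psi g w * complex.Re (dot (rprod (stage A n) (stage B n) w x) v)|%:E)%E.
have bound n (lam : R) : 0 < lam -> (u n <= c%:E * ((lam%:E * a n + (lam^-1)%:E * MY%:E) +
     ((lam^-1)%:E * MX%:E + lam%:E * b n)))%E.
  move=> lam0.
  have il0 : 0 <= lam^-1 by rewrite invr_ge0 ltW.
  have mDX : measurable_fun setT (fun w => hs_norm2 f (fun x => X w x - stage A n w x)).
    by apply: (measurable_hs_norm2 hE hf); exact: weakly_measurableB.
  have mDY : measurable_fun setT (fun w => hs_norm2 f (fun x => Y w x - stage B n w x)).
    by apply: (measurable_hs_norm2 hE hf); exact: weakly_measurableB.
  have mY : measurable_fun setT (fun w => hs_norm2 f (Y w)) by exact: (measurable_hs_norm2 hE hf).
  have mS : measurable_fun setT (fun w => hs_norm2 f (stage A n w)).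
    exact: (measurable_hs_norm2 hE hf).
  pose f1 w := ((psi g w ^+ 2)%:E * hs_norm2 f (fun x => X w x - stage A n w x)%R)%E.
  pose f2 w := hs_norm2 f (Y w).
  pose f3 w := ((psi g w ^+ 2)%:E * hs_norm2 f (stage A n w))%E.
  pose f4 w := hs_norm2 f (fun x => Y w x - stage B n w x)%R.
  have mf1 : measurable_fun setT f1 by exact: emeasurable_funM.
  have mf3 : measurable_fun setT f3 by exact: emeasurable_funM.
  have f10 w : (0 <= f1 w)%E by rewrite mule_ge0 ?hs_norm2_ge0// lee_fin sqr_ge0.
  have f20 w : (0 <= f2 w)%E by exact: hs_norm2_ge0.
  have f30 w : (0 <= f3 w)%E by rewrite mule_ge0 ?hs_norm2_ge0// lee_fin sqr_ge0.
  have f40 w : (0 <= f4 w)%E by exact: hs_norm2_ge0.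
  have mZ (k : R) h : measurable_fun setT h -> measurable_fun setT (fun w : T => (k%:E * h w)%E).
    by move=> mh; exact: emeasurable_funM.
  apply: (@le_trans _ _ (\int[P]_w (c%:E * ((lam%:E * f1 w + (lam^-1)%:E * f2 w) +
      ((lam^-1)%:E * f3 w + lam%:E * f4 w))))%E).
    apply: ge0_le_integral => //.
    - apply/measurable_EFinP; apply: measurableT_comp => //; apply: measurable_funB;
        by apply: measurable_funM => //; apply: (weakly_measurable_comp hE hf) => // w; exact: hsS.
    - apply: (mZ); apply: emeasurable_funD; apply: emeasurable_funD; exact: mZ.
    - by move=> w _; apply: product_error_le => //; exact: hsS.
  have l0 := ltW lam0.
  rewrite ge0_integralZl_EFin//; first last.
  - apply: emeasurable_funD; apply: emeasurable_funD; exact: mZ.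
  - by move=> w _; repeat apply: adde_ge0; apply: mule_ge0; rewrite ?lee_fin.
  apply: lee_wpmul2l; first by rewrite lee_fin.
  rewrite ge0_integralD//; first last.
  - apply: emeasurable_funD; exact: mZ.
  - by move=> w _; apply: adde_ge0; apply: mule_ge0; rewrite ?lee_fin.
  - apply: emeasurable_funD; exact: mZ.
  - by move=> w _; apply: adde_ge0; apply: mule_ge0; rewrite ?lee_fin.
  rewrite ge0_integralD//; first last.
  - exact: mZ.
  - by move=> w _; apply: mule_ge0; rewrite ?lee_fin.
  - exact: mZ.
  - by move=> w _; apply: mule_ge0; rewrite ?lee_fin.
  rewrite ge0_integralD//; first last.
  - exact: mZ.
  - by move=> w _; apply: mule_ge0; rewrite ?lee_fin.
  - exact: mZ.
  - by move=> w _; apply: mule_ge0; rewrite ?lee_fin.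
  rewrite !ge0_integralZl_EFin//.
  apply: leeD; apply: leeD => //; apply: lee_wpmul2l; rewrite ?lee_fin//.
  exact: partial_chaos_psi2_moment.
have u0 n : (0 <= u n)%E by apply: integral_ge0 => w _; rewrite lee_fin.
apply/(ecvg0P u0) => e e0.
(* With this [lam] the bounded terms contribute less than half of [e]. *)
pose lam := (2 * c * (MY + MX) + 1) / e.
have cM0 : 0 <= c * (MY + MX) by rewrite mulr_ge0 ?addr_ge0.
have lam0 : 0 < lam by rewrite divr_gt0//; lra.
have a0 n : (0 <= a n)%E by apply: integral_ge0 => w _; rewrite mule_ge0 ?hs_norm2_ge0// lee_fin sqr_ge0.
have b0 n : (0 <= b n)%E by apply: integral_ge0 => w _; exact: hs_norm2_ge0.
have ab_cvg := ecvg0Z (c * lam) (ecvg0D a_cvg b_cvg).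
have ab0 n : (0 <= (c * lam)%:E * (a n + b n))%E.
  by apply: mule_ge0; [rewrite lee_fin mulr_ge0// ltW|exact: adde_ge0].
have e20 : 0 < e / 2 by lra.
apply: filterS ((ecvg0P ab0).1 ab_cvg _ e20) => n hn.
apply: le_trans (bound n lam lam0) _.
apply: (@le_trans _ _ ((c * lam)%:E * (a n + b n) + (c * (lam^-1 * (MY + MX)))%:E)%E).
  rewrite -!EFinM; set p := (lam^-1 * MY); set q := (lam^-1 * MX).
  have -> : c * (lam^-1 * (MY + MX)) = c * (p + q) by rewrite /p /q; ring.
  rewrite (addeC q%:E) addeACA -EFinD [X in (_ <= X)%E](_ : _ = c%:E * (lam%:E * (a n + b n)) + c%:E * (p + q)%:E)%E.
    have pq0 : (0 <= (p + q)%:E)%E.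
      by rewrite lee_fin addr_ge0// /p /q mulr_ge0// invr_ge0 ltW.
    have x0 : (0 <= lam%:E * (a n + b n))%E.
      by apply: mule_ge0; [rewrite lee_fin ltW|exact: adde_ge0].
    by rewrite -(@ge0_muleDr _ c%:E _ _ x0 pq0) -(@ge0_muleDr _ lam%:E _ _ (a0 n) (b0 n)).
  by rewrite EFinM -muleA -EFinM.
rewrite [e%:E](_ : _ = (e / 2)%:E + (e / 2)%:E)%E; last by rewrite -EFinD -splitr.
apply: leeD => //; rewrite lee_fin.
rewrite (_ : c * _ = c * (MY + MX) / lam); last by rewrite mulrA mulrAC.
rewrite ler_pdivrMr// (_ : e / 2 * lam = (2 * c * (MY + MX) + 1) / 2).
  by move: (c * (MY + MX)) cM0 (mulrA 2 c (MY + MX)) => t t0 <-; lra.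
by rewrite /lam; field; exact: lt0r_neq0.
Qed.

End ChaosProduct.

(** * Mean of the product and existence of chaos sums *)

Section ChaosMeans.
Context {R : realType} {E : completeNormedModType R[i]} {dimH dimE : option nat}.
Variables (dot : {dot E for Num.conj}) (f : ix dimE -> E).
Hypotheses (hE : norm_from_dot dot) (hf : orthonormal_basis dot f).
Context {d : measure_display} {T : measurableType d}.
Variable P : probability T R.
Variables (psi : midx dimH -> T -> R) (th : midx dimH -> midx dimH -> midx dimH -> midx dimH -> R).
Hypothesis sys : chaos_system P psi th.
Implicit Types A B : coeff_array dimH E.
Notation stage A n := (partial_chaos psi (midx_upto n) A).

Lemma cvg_frakA2_dot (u : nat -> coeff_array dimH E) C g x v : cvg_frakA2 f u C ->
  complex.Re (dot (u n g x) v) @[n --> \oo] --> complex.Re (dot (C g x) v).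
Proof.
move=> [hu hC /(_ 1 (lexx _)) lim0].
have p0 n : (0 <= pnorm f 1 (array_sub (u n) C))%E by exact: pnorm_ge0.
apply/cvgrPdist_le => e e0.
pose c := rnorm x * rnorm v + 1.
have c0 : 0 < c by rewrite ltr_wpDl// mulr_ge0 ?rnorm_ge0.
have ec0 : 0 < e / c by rewrite divr_gt0.
apply: filterS ((ecvg0P p0).1 lim0 _ ec0) => n hn.
have hD : hilbert_schmidt f (array_sub (u n) C g).
  by apply: frakA2_hs; exact: (frakA2_sub hE hf).
have h1 : hsr f (array_sub (u n) C g) <= e / c.
  by rewrite -lee_fin -hsrE; [apply: le_trans hn; exact: hsa_le_pnorm|case: hD].
rewrite distrC -ReN -ReD -dotBl.
apply: le_trans (Re_dot_le hE _ _) _.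
apply: (@le_trans _ _ (e / c * rnorm x * rnorm v)).
  apply: ler_wpM2r; first exact: rnorm_ge0.
  apply: le_trans (hsr_op_bound hE hf x hD) _.
  by apply: ler_wpM2r => //; exact: rnorm_ge0.
rewrite -mulrA mulrAC ler_pdivrMr// ler_pM2l//.
by rewrite /c lerDl.
Qed.

(** The means are known for the stages; they converge by
    [chaos_product_error_cvg] on the left, and on the right because the
    truncations approximate the arrays, hence their products the array
    product. *)
Theorem chaos_product_mean g A B X Y x v :
  frakA2 f A -> frakA2 f B -> is_chaos_sum dot f P psi A X -> is_chaos_sum dot f P psi B Y ->
  has_mean P (fun w => psi g w * complex.Re (dot (rprod X Y w x) v))
    (chaos_weight th g * complex.Re (dot (array_prod f th A B g x) v)).
Proof.
move=> hA hB hX hY.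
have wX := chaos_sum_measurable hE hf hX; have wY := chaos_sum_measurable hE hf hY.
have hsX w : hilbert_schmidt f (X w) by case: hX => h _ _; exact: h.
apply: (@has_mean_limit _ _ _ _
   (fun n w => psi g w * complex.Re (dot (rprod (stage A n) (stage B n) w x) v)) _
   (fun n => chaos_weight th g * complex.Re (dot (fin_array_prod th
      (trunc (midx_upto n) A) (trunc (midx_upto n) B) g x) v))).
- apply: measurable_funM; first exact: (psi_measurable sys).
  exact: (weakly_measurable_comp hE hf).
- by move=> n; exact: (mean_partial_product dot sys g _ _ x v hA hB).
- exact: (chaos_product_error_cvg hE hf sys).
have [dth _ _] := sys.
have [_ h] := array_prod_spec hE hf dth hA hB.
have tf (C : coeff_array dimH E) : frakA2 f C -> forall n, finite_array f (trunc (midx_upto n) C).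
  by move=> hC n; exact: trunc_finite.
have h3 := @cvg_frakA2_dot _ _ g x v (h _ _ (tf _ hA) (tf _ hB) (trunc_cvg hA) (trunc_cvg hB)).
exact: (cvgM (cvg_cst (chaos_weight th g)) h3).
Qed.

Lemma esum_geom_tail_le (n m : nat) : \sum_(n <= k < m) (2^-1 : R) ^+ k <= 2 * 2^-1 ^+ n.
Proof.
have [nm|mn] := leqP n m; last by rewrite big_geq ?(ltnW mn)// mulr_ge0// exprn_ge0.
suff -> : \sum_(n <= k < m) (2^-1 : R) ^+ k = 2 * 2^-1 ^+ n - 2 * 2^-1 ^+ m.
  by rewrite lerBlDr lerDl mulr_ge0// exprn_ge0.
elim: m nm => [|m IH]; first by rewrite leqn0 => /eqP ->; rewrite big_geq// subrr.
rewrite leq_eqVlt ltnS => /orP[/eqP <-|nm]; first by rewrite big_geq// subrr.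
by rewrite big_nat_recr//= IH// exprS; lra.
Qed.

(** Stages chosen so sparsely that the squared L^2 distances decrease like
    8^-n; this beats the factor 4^n used for almost sure convergence. *)
Lemma exists_stages A : frakA2 f A -> exists phi : nat -> nat,
  {homo phi : m n / (m <= n)%N} /\
  forall n (F : {fset midx dimH}), (forall al, al \in F -> al \notin (midx_upto (phi n) : {fset midx dimH})) ->
    ((\sum_(al <- F) hs_norm2 f (A al))%R <= (8^-1 ^+ n)%:E)%E.
Proof.
move=> hA.
have p8 n : 0 < (8^-1 : R) ^+ n by rewrite exprn_gt0// invr_gt0.
have h n : exists N, forall m, (N <= m)%N -> (heavy_tail f A m <= (8^-1 ^+ n)%:E)%E.
  have [N _ hN] := (ecvg0P (heavy_tail_ge0 f A)).1 (heavy_tail_cvg hA) _ (p8 n).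
  by exists N => m Nm; exact: hN.
pose ph n := proj1_sig (cid (h n)).
have hph n m : (ph n <= m)%N -> (heavy_tail f A m <= (8^-1 ^+ n)%:E)%E.
  exact: (proj2_sig (cid (h n))).
exists (fun n => \max_(i < n.+1) ph i)%N; split.
  move=> m n mn; apply/bigmax_leqP => i _.
  by rewrite (leq_bigmax_cond (Ordinal (leq_trans (ltn_ord i) (mn : (m.+1 <= n.+1)%N)))).
move=> n F hF; apply: le_trans (hph n (\max_(i < n.+1) ph i)%N _); last first.
  by rewrite (leq_bigmax_cond (@ord_max n)).
apply: (@le_trans _ _ (\sum_(al <- F) ((4 ^+ mdeg al)%:E * hs_norm2 f (A al))%E)%R).
  apply: lee_sum => al _; rewrite -[leLHS]mul1e; apply: lee_wpmul2r; first exact: hs_norm2_ge0.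
  by rewrite lee_fin exprn_ege1// ler1n.
rewrite -(esum_seq (D := [set` F])) ?fset_uniq//.
  by apply: esum_subset => al /= /hF /negP.
by move=> al; rewrite mule_ge0 ?hs_norm2_ge0// lee_fin exprn_ge0.
Qed.

Lemma half_pow_small (e : R) : 0 < e -> exists n, (2^-1 : R) ^+ n <= e.
Proof.
move=> e0.
have h : `|2^-1 : R| < 1 by rewrite ger0_norm ?invr_ge0// invf_lt1// ltr1n.
have /cvgrPdist_le/(_ _ e0)[N _ /(_ N (leqnn N))] := cvg_expr h.
by rewrite sub0r normrN ger0_norm ?exprn_ge0// => hN; exists N.
Qed.

Section RapidSequence.
Variables (S : nat -> T -> E -> E) (W : T -> \bar R).
Hypothesis S_hs : forall n w, hilbert_schmidt f (S n w).
Hypothesis W_ge0 : forall w, (0 <= W w)%E.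
Hypothesis step_le : forall n w,
  ((4 ^+ n)%:E * hs_norm2 f (fun x => S n.+1 w x - S n w x)%R <= W w)%E.

Let gap w n : R := 2 * 2^-1 ^+ n * Num.sqrt (fine (W w)).

Lemma hsn_step_le w n : W w \is a fin_num ->
  (hsn f (fun x => S n.+1 w x - S n w x)%R <= (2^-1 ^+ n * Num.sqrt (fine (W w)))%:E)%E.
Proof.
move=> Wf; apply: sqrte_le_sqr; first exact: hs_norm2_ge0.
  by rewrite lee_fin mulr_ge0 ?sqrtr_ge0// exprn_ge0.
rewrite -EFin_expe exprMn sqr_sqrtr; last by rewrite fine_ge0.
rewrite EFinM fineK// -exprM mulnC exprM.
have -> : (2^-1 ^+ 2) ^+ n = (4 ^+ n)^-1 :> R.
  by rewrite -exprVn; congr (_ ^+ _); field.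
have p4 : 0 < 4 ^+ n :> R by rewrite exprn_gt0.
apply: (@le_trans _ _ (((4 ^+ n)^-1)%:E * ((4 ^+ n)%:E * hs_norm2 f (fun x => S n.+1 w x - S n w x)%R))%E).
  by rewrite muleA -EFinM mulVf ?mul1e// lt0r_neq0.
by apply: lee_wpmul2l => //; rewrite lee_fin invr_ge0 ltW.
Qed.

Lemma hsn_gap_le w n m : W w \is a fin_num -> (n <= m)%N ->
  (hsn f (fun x => S m w x - S n w x)%R <= (gap w n)%:E)%E.
Proof.
move=> Wf nm.
apply: (@le_trans _ _ ((\sum_(n <= k < m) 2^-1 ^+ k) * Num.sqrt (fine (W w)))%:E); last first.
  by rewrite lee_fin ler_wpM2r ?sqrtr_ge0// esum_geom_tail_le.
elim: m nm => [|m IH].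
  rewrite leqn0 => /eqP ->; rewrite big_geq// mul0r.
  by rewrite (_ : (fun x => _) = fun=> 0) ?hsn0//; apply/funext => x; rewrite subrr.
rewrite leq_eqVlt ltnS => /orP[/eqP <-|nm].
  rewrite big_geq// mul0r.
  by rewrite (_ : (fun x => _) = fun=> 0) ?hsn0//; apply/funext => x; rewrite subrr.
rewrite big_nat_recr//= mulrDl EFinD.
apply: le_trans (leeD (IH nm) (hsn_step_le m Wf)).
rewrite (_ : (fun x => _) = (fun x => (S m w x - S n w x) + (S m.+1 w x - S m w x))); last first.
  by apply/funext => x; rewrite [RHS]addrC addrA subrK.
exact: hsnD.
Qed.

(** Where [W] is finite, the steps decrease geometrically with ratio 1/2 and
    completeness gives a limit; elsewhere the limit is set to zero. *)
Lemma rapid_limit w : exists C : E -> E, hilbert_schmidt f C /\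
  (if W w \is a fin_num then
     (forall x, rnorm (C x - S n w x) @[n --> \oo] --> (0 : R)) /\
     (forall n, (hs_norm2 f (fun x => C x - S n w x)%R <= (4 * 4^-1 ^+ n)%:E * W w)%E)
   else C = fun=> 0).
Proof.
case: (boolP (W w \is a fin_num)) => Wf; last by exists (fun=> 0); split=> //; exact: hilbert_schmidt0.
pose s := Num.sqrt (fine (W w)).
have gap_anti n m : (n <= m)%N -> gap w m <= gap w n.
  move=> nm; rewrite /gap ler_wpM2r ?sqrtr_ge0// ler_wpM2l//.
  by rewrite ler_wiXn2l// ?invr_ge0// invf_le1// ler1n.
(* The distance of two stages is at most the geometric tail [gap]. *)
have cauchy : forall e : R, 0 < e -> exists N, forall n m, (N <= n)%N -> (N <= m)%N ->
    (hsn f (fun x => S n w x - S m w x)%R <= e%:E)%E.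
  move=> e e0.
  have d0 : 0 < e / (2 * s + 1) by rewrite divr_gt0// ltr_wpDl// mulr_ge0// sqrtr_ge0.
  have [N hN] := half_pow_small d0.
  have gN : gap w N <= e.
    have s0 : 0 <= s by exact: sqrtr_ge0.
    have s1 : 0 < 2 * s + 1 by lra.
    move: hN; rewrite ler_pdivlMr// => hN.
    rewrite /gap -/s; apply: le_trans hN.
    have : 0 <= (2^-1 : R) ^+ N by rewrite exprn_ge0.
    by move: (_ ^+ N) => t t0; nra.
  exists N => n m Nn Nm.
  have [nm|/ltnW mn] := leqP n m.
    rewrite (_ : (fun x => _) = (fun x => - (S m w x - S n w x))); last first.
      by apply/funext => x; rewrite opprB.
    rewrite hsnN; apply: le_trans (hsn_gap_le Wf nm) _.
    by rewrite lee_fin (le_trans (gap_anti _ _ Nn)).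
  by apply: le_trans (hsn_gap_le Wf mn) _; rewrite lee_fin (le_trans (gap_anti _ _ Nm)).
have [C [hC cC _]] := hs_complete hE hf (fun n => S_hs n w) cauchy.
exists C; split=> //; split=> // n.
apply: (@hs_norm2_limit _ _ _ f (fun m x => S m w x - S n w x)).
  move=> x; apply: cvg_trans (cC x); apply: near_eq_cvg; apply: nearW => m.
  by congr rnorm; rewrite opprB addrA subrK.
exists n => // m /= nm; rewrite -hsn_sqr.
apply: (@le_trans _ _ ((gap w n)%:E ^+ 2)%E).
  by apply: expe_le; [exact: hsn_ge0|exact: hsn_gap_le].
rewrite -EFin_expe /gap !exprMn sqr_sqrtr ?fine_ge0// EFinM fineK//.
apply: lee_wpmul2r => //; rewrite lee_fin -exprM mulnC exprM.
by rewrite le_eqVlt; apply/orP; left; apply/eqP; congr (_ * _ ^+ _); field.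
Qed.

End RapidSequence.

Lemma hs_norm2N (X : E -> E) : hs_norm2 f (fun x => - X x) = hs_norm2 f X.
Proof. by apply: eq_esum => k _; rewrite rnormN. Qed.

(** Along sparse stages the weighted sum [W] of the squared steps has a
    finite mean, so the stages converge almost surely to a limit that is
    measurable as the limit of measurable operators. The same [W] bounds the
    squared distance to the stages, which gives convergence in L^2, and
    orthogonality extends it from the stages to all larger finite sets. *)
Theorem chaos_sum_exists A : frakA2 f A -> exists X, is_chaos_sum dot f P psi A X.
Proof.
move=> hA; have [phi [phi_mono hphi]] := exists_stages hA.
pose F n : {fset midx dimH} := midx_upto (phi n).
pose D n := (F n.+1 `\` F n)%fset.
have FS m n : (m <= n)%N -> (F m `<=` F n)%fset.
  move=> mn; apply/fsubsetP => al; rewrite !in_midx_upto => h.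
  by apply: leq_trans h _; exact: phi_mono.
pose S n := partial_chaos psi (F n) A.
have SD n w x : S n.+1 w x - S n w x = partial_chaos psi (D n) A w x.
  by apply: partial_chaos_diff; exact: FS.
have wS H : weakly_measurable dot (partial_chaos psi H A) by exact: (partial_chaos_measurable _ sys).
pose t n w := ((4 ^+ n)%:E * hs_norm2 f (partial_chaos psi (D n) A w))%E.
have t0 n w : (0 <= t n w)%E by rewrite mule_ge0 ?hs_norm2_ge0// lee_fin exprn_ge0.
have mH H : measurable_fun setT (fun w => hs_norm2 f (partial_chaos psi H A w)).
  exact: (measurable_hs_norm2 hE hf).
have mt n : measurable_fun setT (t n) by exact: emeasurable_funM.
pose W w := (\sum_(0 <= n <oo) t n w)%E.
have mW : measurable_fun setT W by apply: ge0_emeasurable_sum.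
have W0 w : (0 <= W w)%E by apply: nneseries_ge0.
have tW n w : (t n w <= W w)%E.
  apply: le_trans (nneseries_lim_ge n.+1 _) => //.
  by rewrite big_nat_recr//= leeDr// sume_ge0.
have iW : (\int[P]_w W w <= 2%:E)%E.
  rewrite integral_nneseries//.
  apply: lime_le; first by apply: is_cvg_nneseries => n _ _; exact: integral_ge0.
  apply: nearW => n; apply: (@le_trans _ _ ((\sum_(0 <= k < n) 2^-1 ^+ k)%:E)%E); last first.
    by rewrite lee_fin (le_trans (esum_geom_tail_le 0 n))// mulr1.
  rewrite -sumEFin; apply: lee_sum => k _.
  rewrite ge0_integralZl_EFin//; first last.
    by move=> w _; exact: hs_norm2_ge0.
  apply: (@le_trans _ _ ((4 ^+ k)%:E * (8^-1 ^+ k)%:E)%E).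
    apply: lee_wpmul2l; first by rewrite lee_fin exprn_ge0.
    apply: le_trans (integral_partial_chaos hE hf sys _ _) _.
    by apply: hphi => al; rewrite in_fsetD => /andP[].
  rewrite -EFinM lee_fin -exprMn le_eqVlt; apply/orP; left; apply/eqP.
  by congr (_ ^+ _); field.
have Shs n w : hilbert_schmidt f (S n w).
  by apply: partial_chaos_hs => // al; exact: frakA2_hs.
have stepW n w : ((4 ^+ n)%:E * hs_norm2 f (fun x => S n.+1 w x - S n w x)%R <= W w)%E.
  apply: le_trans (tW n w); apply: lee_wpmul2l; first by rewrite lee_fin exprn_ge0.
  by rewrite le_eqVlt; apply/orP; left; apply/eqP; congr hs_norm2; apply/funext => x; exact: SD.
have /choice[X hX] := rapid_limit Shs W0 stepW.
have Wae : {ae P, forall w, W w \is a fin_num}.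
  have : P.-integrable setT W.
    apply/integrableP; split=> //.
    under eq_integral do rewrite gee0_abs//.
    by apply: le_lt_trans iW _; exact: ltry.
  by move=> /(integrable_ae measurableT); apply: filterS => w /(_ I).
have mfin : measurable [set w | W w \is a fin_num].
  by rewrite -[X in measurable X]setTI; exact: emeasurable_fin_num.
have wX : weakly_measurable dot X.
  move=> x v.
  (* The indicator makes the approximations converge everywhere, in
     accordance with the value zero chosen where [W] is infinite. *)
  apply: (@measurable_fun_cvg _ _ _ _
    (fun n w => \1_[set w | W w \is a fin_num] w * complex.Re (dot (S n w x) v))).
    by move=> n; apply: measurable_funM => //; exact: wS.
  move=> w _; have [hs] := hX w; case: (boolP (W w \is a fin_num)) => Wf.
    move=> [cX _].
    apply: (@cvg_le_mul _ _ (rnorm v) _ (fun n => rnorm (X w x - S n w x))) => // n.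
    rewrite indicE mem_set// mul1r -ReN -ReD -dotBl mulrC.
    exact: Re_dot_le.
  move=> ->; rewrite dot0l.
  have -> : (fun n => \1_[set w | W w \is a fin_num] w * complex.Re (dot (S n w x) v)) = fun=> 0.
    by apply/funext => n; rewrite indicE memNset ?mul0r//=; exact/negP.
  exact: cvg_cst.
exists X; split.
- by move=> w; case: (hX w).
- by move=> k l; split; [exact: wX|exact: weakly_measurable_Im].
move=> eps eps0.
(* The final error is at most 16 * 4^-n + 2 * 8^-n, hence at most 18 * 2^-n. *)
have [n hn] := @half_pow_small (eps / 18) (divr_gt0 eps0 (ltr0Sn _ _)).
exists (F n) => G FG.
pose H := (G `\` F n)%fset.
have mD : measurable_fun setT (fun w => hs_norm2 f (fun x => X w x - partial_chaos psi G A w x)).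
  by apply: (measurable_hs_norm2 hE hf); exact: weakly_measurableB.
have c0 : 0 <= 2 * (4 * 4^-1 ^+ n) :> R by rewrite !mulr_ge0// exprn_ge0.
apply: (@le_trans _ _ (\int[P]_w ((2 * (4 * 4^-1 ^+ n))%:E * W w +
   2%:E * hs_norm2 f (partial_chaos psi H A w)))%E).
  apply: ae_ge0_le_integral => //.
  - by move=> w _; exact: hs_norm2_ge0.
  - by move=> w _; rewrite adde_ge0// mule_ge0 ?hs_norm2_ge0.
  - by apply: emeasurable_funD; exact: emeasurable_funM.
  apply: filterS Wae => w Wf _.
  have [_] := hX w; rewrite Wf => -[_ hb].
  apply: (@le_trans _ _ (2%:E * hs_norm2 f (fun x => X w x - S n w x)%R +
     2%:E * hs_norm2 f (fun x => - partial_chaos psi H A w x)%R)%E).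
    apply: hs_norm2_split => x.
    by rewrite -(partial_chaos_diff psi A w x FG) opprB -/(S n w x) addrA subrK.
  rewrite hs_norm2N; apply: leeD2r; rewrite (EFinM 2) -muleA; exact: lee_wpmul2l.
rewrite ge0_integralD//; first last.
- exact: emeasurable_funM.
- by move=> w _; rewrite mule_ge0 ?hs_norm2_ge0.
- exact: emeasurable_funM.
- by move=> w _; rewrite mule_ge0.
rewrite ge0_integralZl_EFin// ge0_integralZl_EFin//; last by move=> w _; exact: hs_norm2_ge0.
apply: (@le_trans _ _ ((2 * (4 * 4^-1 ^+ n))%:E * 2%:E + 2%:E * (8^-1 ^+ n)%:E)%E).
  apply: leeD; apply: lee_wpmul2l => //.
  apply: le_trans (integral_partial_chaos hE hf sys _ _) _.
  by apply: hphi => al; rewrite in_fsetD => /andP[].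
rewrite -!EFinM -EFinD lee_fin.
have h4 : (4^-1 : R) ^+ n <= 2^-1 ^+ n.
  by apply: lerXn2r; rewrite ?nnegrE ?invr_ge0// lef_pV2 ?posrE// ler_nat.
have h8 : (8^-1 : R) ^+ n <= 2^-1 ^+ n.
  by apply: lerXn2r; rewrite ?nnegrE ?invr_ge0// lef_pV2 ?posrE// ler_nat.
move: h4 h8 hn; rewrite ler_pdivlMr//.
by move: ((4^-1 : R) ^+ n) ((8^-1 : R) ^+ n) ((2^-1 : R) ^+ n) => a b c; lra.
Qed.

End ChaosMeans.

(** * Linearization of products of orthogonal polynomials *)

Section Linearization.
Context {R : realType}.
Variables (x h : R) (q : nat -> R).
Hypothesis q0 : q 0 = 1.
Hypothesis qS : forall n, q n.+1 = x * q n - n%:R * (1 - (n%:R - 1) * h) * q n.-1.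

(** For h = 0 these are the coefficients of the product formula for Hermite
    polynomials; for h = 1/N the second factor is the r-th falling factorial
    of N - (m + n - 2r) divided by N^r. *)
Definition lin_coeff (m n r : nat) : R :=
  (r`! * 'C(m, r) * 'C(n, r))%N%:R * \prod_(i < r) (1 - (m%:R + n%:R - 2 * r%:R + i%:R) * h).

Lemma lin_coeff_left m n r : (m < r)%N -> lin_coeff m n r = 0.
Proof. by move=> mr; rewrite /lin_coeff bin_small// muln0 mul0n mul0r. Qed.

Lemma lin_coeff_right m n r : (n < r)%N -> lin_coeff m n r = 0.
Proof. by move=> nr; rewrite /lin_coeff (bin_small nr) muln0 mul0r. Qed.

Lemma lin_coeff0 m n : lin_coeff m n 0 = 1.
Proof. by rewrite /lin_coeff big_ord0 !bin0 mulr1. Qed.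

Lemma bin_succ_real n r : r.+1%:R * 'C(n, r.+1)%:R = (n%:R - r%:R) * 'C(n, r)%:R :> R.
Proof.
have [nr|rn] := ltnP n r.
  by rewrite !bin_small ?mulr0// ltnW.
rewrite -natrB// -!natrM; congr _%:R.
have := mul_bin_left n r; lia.
Qed.

(** The recurrence obtained by comparing coefficients in q_(m+1) q_n, where
    multiplication by x acts on the expansion of q_m q_n. *)
Lemma lin_coeff_rec m n r :
  lin_coeff m.+1 n r.+1 = lin_coeff m n r.+1 +
    lin_coeff m n r * ((m%:R + n%:R - 2 * r%:R) * (1 - (m%:R + n%:R - 2 * r%:R - 1) * h)) -
    m%:R * (1 - (m%:R - 1) * h) * lin_coeff m.-1 n r.
Proof.
pose s : R := m%:R + n%:R - 2 * r%:R - 1.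
pose Q := \prod_(i < r) (1 - (s + i%:R) * h).
have E1 : lin_coeff m.+1 n r.+1 = r`!%:R * (r.+1%:R * 'C(m.+1, r.+1)%:R) * 'C(n, r.+1)%:R * (Q * (1 - (s + r%:R) * h)).
  rewrite /lin_coeff big_ord_recr/= factS !natrM /Q /s.
  congr (_ * (_ * _)); first by ring.
    by apply: eq_bigr => i _; congr (1 - _ * h); rewrite -!natr1; ring.
  by congr (1 - _ * h); rewrite -!natr1; ring.
have E2 : lin_coeff m n r.+1 = r`!%:R * (r.+1%:R * 'C(m, r.+1)%:R) * 'C(n, r.+1)%:R * ((1 - (s - 1) * h) * Q).
  rewrite /lin_coeff big_ord_recl/= factS !natrM /Q /s.
  congr (_ * (_ * _)); first by ring.
    by congr (1 - _ * h); rewrite -!natr1; ring.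
  by apply: eq_bigr => i _; congr (1 - _ * h); rewrite /bump/= add1n -!natr1; ring.
have E3 : lin_coeff m n r * (1 - s * h) = r`!%:R * 'C(m, r)%:R * 'C(n, r)%:R * (Q * (1 - (s + r%:R) * h)).
  have <- : \prod_(i < r) (1 - (m%:R + n%:R - 2 * r%:R + i%:R) * h) * (1 - s * h) = Q * (1 - (s + r%:R) * h).
    transitivity (\prod_(i < r.+1) (1 - (s + i%:R) * h)); last by rewrite big_ord_recr.
    rewrite big_ord_recl/= addr0 mulrC; congr (_ * _).
    by apply: eq_bigr => i _; congr (1 - _ * h); rewrite /bump/= add1n -!natr1 /s; ring.
  by rewrite /lin_coeff !natrM; ring.
have E4 : m%:R * lin_coeff m.-1 n r = r`!%:R * (r.+1%:R * 'C(m, r.+1)%:R) * 'C(n, r)%:R * Q.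
  have [m0|mp] := posnP m; first by rewrite m0 mul0r bin_small// !(mulr0, mul0r).
  have := mul_bin_diag m r => /(congr1 (fun k => k%:R : R)); rewrite !natrM => <-.
  have -> : Q = \prod_(i < r) (1 - (m.-1%:R + n%:R - 2 * r%:R + i%:R) * h).
    apply: eq_bigr => i _; congr (1 - _ * h).
    by rewrite /s -{1}(prednK mp) -natr1; ring.
  by rewrite /lin_coeff !natrM; ring.
rewrite -/s.
have E5 : lin_coeff m n r * ((m%:R + n%:R - 2 * r%:R) * (1 - s * h)) = (s + 1) * (lin_coeff m n r * (1 - s * h)).
  by rewrite /s; ring.
rewrite E5 E3 E1 E2 (mulrAC m%:R) E4.
have binS : 'C(m.+1, r.+1)%:R = 'C(m, r.+1)%:R + 'C(m, r)%:R :> R by rewrite binS natrD.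
have b1 := bin_succ_real m r; have b2 := bin_succ_real n r.
have rn0 : r.+1%:R != 0 :> R by rewrite pnatr_eq0.
apply: (mulfI rn0); rewrite binS.
move: b1 b2 rn0; rewrite -(natr1 r) /s.
move: ('C(m, r.+1)%:R : R) ('C(m, r)%:R : R) ('C(n, r.+1)%:R : R) ('C(n, r)%:R : R) => c1 c b1 b hc hb rn0.
have -> : c1 = (m%:R - r%:R) * c / (r%:R + 1) by rewrite -hc mulrAC mulfV ?mul1r.
have -> : b1 = (n%:R - r%:R) * b / (r%:R + 1) by rewrite -hb mulrAC mulfV ?mul1r.
by field.
Qed.

Lemma mul_x n : x * q n = q n.+1 + n%:R * (1 - (n%:R - 1) * h) * q n.-1.
Proof. by rewrite qS subrK. Qed.

(** Induction on [m] through the three-term recurrence, for [m] and its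
    predecessor together; the recurrence is used once for the left factor
    and once, in the opposite direction, for each term of the expansion. *)
Lemma linearization m n :
  q m * q n = \sum_(r < (m + n).+1) lin_coeff m n r * q (m + n - 2 * r).
Proof.
suff H : forall m n, q m * q n = \sum_(r < m.+1) lin_coeff m n r * q (m + n - 2 * r).
  rewrite H (big_ord_widen _ (fun r => lin_coeff m n r * q (m + n - 2 * r)) (_ : m.+1 <= (m + n).+1)%N).
    rewrite big_mkcond/=; apply: eq_bigr => r _; case: ltnP => // mr.
    by rewrite lin_coeff_left ?mul0r.
  by rewrite ltnS leq_addr.
(* The recurrence is of second order, so the claim is proved for [m] and its
   predecessor at once. *)
move=> {}m; suff : (forall n, q m * q n = \sum_(r < m.+1) lin_coeff m n r * q (m + n - 2 * r)) /\
    (forall n, q m.-1 * q n = \sum_(r < m.-1.+1) lin_coeff m.-1 n r * q (m.-1 + n - 2 * r)) by case.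
have base k : q 0 * q k = \sum_(r < 1) lin_coeff 0 k r * q (0 + k - 2 * r).
  by rewrite big_ord1 lin_coeff0 mul1r q0 mul1r muln0 subn0.
elim: m => [|m [IH1 IH2]]; first by split.
split=> // {}n.
rewrite qS mulrBl -(mulrA x) IH1 mulr_sumr -(mulrA _ (q m.-1)) IH2 mulr_sumr.
rewrite (eq_bigr (fun r : 'I_m.+1 => lin_coeff m n r * q (m + n - 2 * r).+1 +
   lin_coeff m n r * ((m + n - 2 * r)%:R * (1 - ((m + n - 2 * r)%:R - 1) * h)) * q (m + n - 2 * r).-1)); last first.
  by move=> r _; rewrite mulrCA mul_x mulrDr -!mulrA.
rewrite big_split/=.
have -> : \sum_(r < m.+1) lin_coeff m n r * q (m + n - 2 * r).+1 =
    q (m.+1 + n) + \sum_(r < m.+1) lin_coeff m n r.+1 * q (m + n - 2 * r.+1).+1.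
  rewrite big_ord_recl/= lin_coeff0 mul1r muln0 subn0; congr (_ + _).
  by rewrite [RHS]big_ord_recr/= lin_coeff_left// mul0r addr0.
have -> : \sum_(r < m.-1.+1) m%:R * (1 - (m%:R - 1) * h) * (lin_coeff m.-1 n r * q (m.-1 + n - 2 * r)) =
    \sum_(r < m.+1) m%:R * (1 - (m%:R - 1) * h) * (lin_coeff m.-1 n r * q (m.-1 + n - 2 * r)).
  case: (m) => [|m']/=; first by rewrite !big_ord1 !mul0r.
  by rewrite [RHS]big_ord_recr/= lin_coeff_left// mul0r mulr0 addr0.
rewrite [RHS]big_ord_recl/= lin_coeff0 mul1r muln0 subn0 -!addrA; congr (_ + _).
rewrite -sumrB -big_split/=; apply: eq_bigr => -[r rm0] _ /=.
have rm : (r <= m)%N by rewrite -ltnS.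
rewrite /bump/= add1n.
have [nr|rn] := ltnP n r.
  by rewrite !lin_coeff_right ?(leq_trans nr)// !mul0r mulr0 subrr addr0.
rewrite lin_coeff_rec.
have sE : (m + n - 2 * r)%:R = m%:R + n%:R - 2 * r%:R :> R.
  have le2 : (2 * r <= m + n)%N by rewrite mul2n -addnn leq_add.
  by rewrite natrB// natrD natrM.
rewrite sE.
have [s0|s1] := posnP (m + n - 2 * r)%N.
  have mr : m = r by lia. have nr : n = r by lia.
  have z1 : lin_coeff m n r.+1 = 0 by rewrite lin_coeff_left// {1}mr.
  have z2 : m%:R + n%:R - 2 * r%:R = 0 :> R by rewrite -sE s0.
  have z3 : m%:R * lin_coeff m.-1 n r = 0.
    case: (m) mr => [|m'] mr; first by rewrite mul0r.
    by rewrite lin_coeff_left ?mulr0// -mr.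
  have z4 c t : m%:R * c * (lin_coeff m.-1 n r * t) = 0 by rewrite mulrACA z3 mul0r.
  have z5 c : m%:R * c * lin_coeff m.-1 n r = 0 by rewrite mulrAC z3 mul0r.
  by rewrite z4 z5 z1 z2; ring.
have -> : (m.+1 + n - 2 * r.+1 = (m + n - 2 * r).-1)%N by lia.
have -> : lin_coeff m n r.+1 * q (m + n - 2 * r.+1).+1 = lin_coeff m n r.+1 * q (m + n - 2 * r).-1.
  have [mr1|mr1] := ltnP m r.+1; first by rewrite lin_coeff_left// !mul0r.
  have [nr1|nr1] := ltnP n r.+1; first by rewrite lin_coeff_right// !mul0r.
  by congr (_ * q _); lia.
have -> : m%:R * (1 - (m%:R - 1) * h) * (lin_coeff m.-1 n r * q (m.-1 + n - 2 * r)) =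
    m%:R * (1 - (m%:R - 1) * h) * (lin_coeff m.-1 n r * q (m + n - 2 * r).-1).
  case: (m) rm s1 => [|m'] rm s1; first by rewrite !mul0r.
  by congr (_ * (_ * q _)); rewrite /=; lia.
ring.
Qed.

End Linearization.

Section TensorProducts.
Context {R : realType} {dim : option nat}.
Variables (h : R) (x : ix dim -> R) (q : ix dim -> nat -> R).
Hypothesis q0 : forall j, q j 0 = 1.
Hypothesis qS : forall j n, q j n.+1 = x j * q j n - n%:R * (1 - (n%:R - 1) * h) * q j n.-1.
Implicit Types al be r ga : midx dim.

Definition tensor al : R := \prod_(j <- finsupp al) (q j (al j) / Num.sqrt (al j)`!%:R).

(** The product over the coordinates of the factors that depend on h; it
    equals [vartheta] for h = 1/N inside the range of the falling
    factorials. *)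
Definition contraction_weight ga r : R :=
  \prod_(j <- finsupp r) \prod_(i < r j) (1 - ((ga j)%:R + i%:R) * h).

Lemma sqrt_prod (I : Type) (s : seq I) (F : I -> R) : (forall i, 0 <= F i) ->
  Num.sqrt (\prod_(i <- s) F i) = \prod_(i <- s) Num.sqrt (F i).
Proof.
move=> F0; elim: s => [|i s IH]; first by rewrite !big_nil sqrtr1.
by rewrite !big_cons sqrtrM// IH.
Qed.

Lemma sqrt_fact_neq0 n : Num.sqrt n`!%:R != 0 :> R.
Proof. by rewrite gt_eqF// sqrtr_gt0 ltr0n fact_gt0. Qed.

Lemma tensorE (S : {fset ix dim}) al : (finsupp al `<=` S)%fset ->
  tensor al = \prod_(j <- S) (q j (al j) / Num.sqrt (al j)`!%:R).
Proof.
move=> sub; apply: (@mprod_incl _ _ _ _ S (fun j n => q j n / Num.sqrt n`!%:R)) => // j.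
by rewrite q0 fact0 sqrtr1 divr1.
Qed.

Lemma finsupp_mcon al be r : (finsupp (mcon al be r) `<=` finsupp (madd al be))%fset.
Proof.
by apply: finsupp_mle => j; rewrite !maddE !msubE leq_add// leq_subr.
Qed.

Lemma product_coeff_prod al be r (S : {fset ix dim}) :
  (finsupp al `<=` S)%fset -> (finsupp be `<=` S)%fset -> (finsupp r `<=` S)%fset ->
  (finsupp (mcon al be r) `<=` S)%fset ->
  product_coeff al be r (mcon al be r) =
  \prod_(j <- S) (((r j)`! * 'C(al j, r j) * 'C(be j, r j))%N%:R *
    (Num.sqrt (mcon al be r j)`!%:R / (Num.sqrt (al j)`!%:R * Num.sqrt (be j)`!%:R))) :> R.
Proof.
move=> sa sb sr sm.
rewrite /product_coeff big_split/=; congr (_ * _).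
  rewrite (mfactE sr) !(mbinomE _ sr) -!big_split/=.
  by rewrite natr_prod.
rewrite sqrtrM ?ler0n// sqrtrV ?ler0n// (mfactE sa) (mfactE sb) (mfactE sm).
rewrite -big_split/= !natr_prod !sqrt_prod; try by move=> *; rewrite ler0n.
rewrite -prodfV -big_split/=; apply: eq_bigr => j _.
by rewrite natrM sqrtrM ?ler0n.
Qed.

(** Expanding the product over the coordinates of the one-dimensional
    linearizations gives a sum over the multi-indices below [al] + [be]; the
    terms that are not below both [al] and [be] have a vanishing binomial
    coefficient. *)
Lemma tensor_product al be : tensor al * tensor be =
  \sum_(r <- box al | r \in box be)
    (product_coeff al be r (mcon al be r) * contraction_weight (mcon al be r) r) * tensor (mcon al be r).
Proof.
pose S := finsupp (madd al be).
have sa : (finsupp al `<=` S)%fset by exact: finsupp_maddl.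
have sb : (finsupp be `<=` S)%fset by exact: finsupp_maddr.
pose F j k := lin_coeff h (al j) (be j) k * q j (al j + be j - 2 * k) /
   (Num.sqrt (al j)`!%:R * Num.sqrt (be j)`!%:R).
rewrite (tensorE sa) (tensorE sb) -big_split/=.
rewrite (eq_bigr (fun j => \sum_(k < (madd al be j).+1) F j k)); last first.
  move=> j _; rewrite mulrACA (linearization (q0 j) (qS j)) mulr_suml maddE -invfM.
  by [].
rewrite prod_sum_box.
rewrite (bigID (fun r => (r \in box al) && (r \in box be)))/= [X in _ + X]big1_seq ?addr0.
  rewrite big_fset_condE [RHS]big_fset_condE/=.
  rewrite (_ : [fset r in box (madd al be) | _]%fset = [fset r in box al | r \in box be]%fset).
    apply: eq_big_seq => r; rewrite !inE/= => /andP[ra rb].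
    move/in_box : (ra) => lra; move/in_box : (rb) => lrb.
    have sr : (finsupp r `<=` S)%fset.
      by apply: fsubset_trans sa; exact: finsupp_mle.
    have sm : (finsupp (mcon al be r) `<=` S)%fset by exact: finsupp_mcon.
    rewrite (tensorE sm) (product_coeff_prod sa sb sr sm).
    rewrite /contraction_weight (@mprod_incl _ _ _ _ S (fun j n => \prod_(i < n) (1 - ((mcon al be r j)%:R + i%:R) * h)))//; last first.
      by move=> j; rewrite big_ord0.
    rewrite -!big_split/=; apply: eq_bigr => j _.
    rewrite /F /lin_coeff.
    have mE : (al j + be j - 2 * r j = mcon al be r j)%N.
      rewrite maddE !msubE.
      have h1 : (r j <= al j)%N := lra j.
      have h2 : (r j <= be j)%N := lrb j.
      move: (al j) (be j) (r j) h1 h2 => a b c; lia.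
    have mR : (al j)%:R + (be j)%:R - 2 * (r j)%:R = (mcon al be r j)%:R :> R.
      have le2 : (2 * r j <= al j + be j)%N by rewrite mul2n -addnn leq_add.
      by rewrite -mE natrB// natrD natrM.
    rewrite mE mR.
    have n1 := sqrt_fact_neq0 (mcon al be r j).
    have n2 := sqrt_fact_neq0 (al j).
    have n3 := sqrt_fact_neq0 (be j).
    by field; rewrite n1 n2 n3.
  apply/fsetP => r; rewrite !inE/=; apply/andP/andP => [[_ /andP[]]//|[ra rb]].
  split; last by rewrite ra rb.
  apply/in_box => j; rewrite maddE; move/in_box : ra => /(_ j); lia.
move=> r /andP[nr rS].
suff [j jS rj] : exists2 j, j \in S & (al j < r j)%N || (be j < r j)%N.
  apply/eqP; rewrite prodf_seq_eq0; apply/hasP; exists j => //=.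
  rewrite /F; apply/eqP; case/orP: rj => rj.
    by rewrite lin_coeff_left// !mul0r.
  by rewrite lin_coeff_right// !mul0r.
move/in_box : rS => rS.
have ex : exists j, ((al j < r j) || (be j < r j))%N.
  apply: contrapT => /forallNP no; move/negP : nr; apply; apply/andP; split; apply/in_box => j;
    by have /negP := no j; rewrite negb_or -!leqNgt => /andP[].
case: ex => j rj; exists j => //.
apply/negPn/negP => jS.
have := rS j; rewrite (fsfun_dflt jS) leqn0 => /eqP r0.
by move: rj; rewrite r0 !ltn0.
Qed.

End TensorProducts.

(** * Means of products of independent variables *)

Section Independence.
Import HBNNSimple.
Context {R : realType} {d : measure_display} {T : measurableType d}.
Variable P : probability T R.

Lemma has_mean_nonneg (F : T -> R) c : (forall w, 0 <= F w) -> measurable_fun setT F ->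
  (\int[P]_w (F w)%:E = c%:E)%E -> has_mean P F c.
Proof.
move=> F0 mF iF; split=> //; apply/integrableP; split; first exact/measurable_EFinP.
under eq_integral do rewrite /= ger0_norm//.
by rewrite iF ltry.
Qed.

Lemma has_mean_mono_limit (u : nat -> T -> R) (F : T -> R) (c : nat -> R) l :
  (forall n w, 0 <= u n w) -> (forall w, {homo u^~ w : n m / (n <= m)%N >-> n <= m}) ->
  (forall n, has_mean P (u n) (c n)) -> (forall w, u n w @[n --> \oo] --> F w) ->
  c n @[n --> \oo] --> l -> has_mean P F l.
Proof.
move=> u0 um hu cu cl.
have mu n := has_mean_measurable (hu n).
have mF : measurable_fun setT F by apply: (measurable_fun_cvg mu) => w _; exact: cu.
have F0 w : 0 <= F w.
  rewrite -(cvg_lim _ (cu w))//; apply: limr_ge; last exact: nearW.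
  by apply/cvg_ex; exists (F w); exact: cu.
apply: has_mean_nonneg => //.
have cv := @cvg_monotone_convergence _ _ _ P setT measurableT (fun n w => (u n w)%:E).
have /cv{}cv : forall n, measurable_fun setT (fun w => (u n w)%:E).
  by move=> n; exact/measurable_EFinP.
have /cv{}cv : forall (n : nat) (w : T), setT w -> (0 <= (u n w)%:E)%E.
  by move=> n w _; rewrite lee_fin.
have /cv{}cv : forall w : T, setT w -> {homo (fun n => (u n w)%:E) : m n / (m <= n)%N >-> (m <= n)%E}.
  by move=> w _ m n mn; rewrite lee_fin um.
rewrite (_ : (fun w => limn _) = (fun w => (F w)%:E)) in cv; last first.
  by apply/funext => w; apply/cvg_lim => //; apply: cvg_EFin; [exact: nearW|exact: cu].
rewrite (_ : (fun n => _) = (fun n => (c n)%:E)) in cv; last first.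
  by apply/funext => n; case: (hu n).
have cv2 : (c n)%:E @[n --> \oo] --> l%:E by apply: cvg_EFin => //; exact: nearW.
by rewrite -(cvg_lim _ cv)// -(cvg_lim _ cv2).
Qed.

Lemma has_mean_fimfun (X : {RV P >-> R}) (G : T -> R) (c : R) (h : {nnsfun R >-> R}) :
  (forall B, measurable B -> has_mean P (fun w => \1_B (X w) * G w) (fine (P (X @^-1` B)) * c)) ->
  has_mean P (fun w => h (X w) * G w)
    (\sum_(i < #|` fset_set (range h)|) (fset_set (range h))`_i * fine (P (X @^-1` (h @^-1` [set (fset_set (range h))`_i]))) * c).
Proof.
move=> hB; set s := fset_set _.
rewrite (_ : (fun w => _) = fun w => \sum_(i < #|`s|) s`_i * (\1_(h @^-1` [set s`_i]) (X w) * G w)).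
  apply: has_mean_sum => i _; rewrite -mulrA; apply: has_meanZ; apply: hB.
  by rewrite -[X in measurable X]setTI; exact: measurable_funP.
apply/funext => w; rewrite fimfunEord mulr_suml; apply: eq_bigr => i _.
by rewrite mulrA.
Qed.

Lemma has_mean_indic (X : {RV P >-> R}) B : measurable B ->
  has_mean P (fun w => \1_B (X w)) (fine (P (X @^-1` B))).
Proof.
move=> mB.
have mXB : measurable (X @^-1` B).
  by rewrite -[X in measurable X]setTI; exact: measurable_funP.
apply: has_mean_nonneg.
- by move=> w; rewrite indicE.
- by apply: measurableT_comp => //; exact: measurable_indic.
rewrite (_ : (fun w => _) = (fun w => (\1_(X @^-1` B) w)%:E)); last by apply/funext => w; rewrite !indicE.
by rewrite integral_indic// setIT fineK// fin_num_measure.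
Qed.

(** The standard extension from indicators to nonnegative functions, through
    simple functions and monotone convergence. The cofactor [G] is left
    unspecified so that the variables can be treated one at a time. *)
Lemma independence_extend (X : {RV P >-> R}) (G : T -> R) (c : R) (phi : R -> R) m :
  (forall w, 0 <= G w) ->
  (forall B, measurable B -> has_mean P (fun w => \1_B (X w) * G w) (fine (P (X @^-1` B)) * c)) ->
  (forall x, 0 <= phi x) -> measurable_fun setT phi ->
  has_mean P (fun w => phi (X w)) m ->
  has_mean P (fun w => phi (X w) * G w) (m * c).
Proof.
move=> G0 hB phi0 mphi hm.
have mphi' : measurable_fun setT (EFin \o phi) by exact/measurable_EFinP.
pose h := nnsfun_approx measurableT mphi'.
have hcv x : h n x @[n --> \oo] --> phi x.
  have := cvg_nnsfun_approx measurableT mphi' (fun x _ => phi0 x : (0 <= (phi x)%:E)%E) (I : setT x).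
  by move=> /fine_cvg.
have hmono x : {homo (fun n => h n x) : n k / (n <= k)%N >-> n <= k}.
  by move=> n k nk; have /lefP := nd_nnsfun_approx measurableT mphi' nk; apply.
pose mn n := \sum_(i < #|` fset_set (range (h n))|) (fset_set (range (h n)))`_i *
   fine (P (X @^-1` ((h n) @^-1` [set (fset_set (range (h n)))`_i]))).
have h1 n : has_mean P (fun w => h n (X w)) (mn n).
  have := @has_mean_fimfun X (fun=> 1) 1 (h n).
  rewrite (_ : (fun w => h n (X w) * 1) = (fun w => h n (X w))); last first.
    by apply/funext => w; rewrite mulr1.
  rewrite (eq_bigr (fun i : 'I__ => (fset_set (range (h n)))`_i *
   fine (P (X @^-1` ((h n) @^-1` [set (fset_set (range (h n)))`_i]))))); last by move=> i _; rewrite mulr1.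
  apply=> B mB; rewrite mulr1.
  rewrite (_ : (fun w => \1_B (X w) * 1) = (fun w => \1_B (X w))); last first.
    by apply/funext => w; rewrite mulr1.
  exact: has_mean_indic.
have h2 n : has_mean P (fun w => h n (X w) * G w) (mn n * c).
  by rewrite /mn mulr_suml; exact: has_mean_fimfun.
have cvm : mn n @[n --> \oo] --> m.
  have [_ im] := hm.
  have cv := @cvg_monotone_convergence _ _ _ P setT measurableT (fun n w => (h n (X w))%:E).
  have /cv{}cv : forall n, measurable_fun setT (fun w => (h n (X w))%:E).
    by move=> n; apply/measurable_EFinP; exact: has_mean_measurable (h1 n).
  have /cv{}cv : forall (n : nat) (w : T), setT w -> (0 <= (h n (X w))%:E)%E.
    by move=> n w _; rewrite lee_fin.
  have /cv{}cv : forall w : T, setT w -> {homo (fun n => (h n (X w))%:E) : m n / (m <= n)%N >-> (m <= n)%E}.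
    by move=> w _ k n kn; rewrite lee_fin; exact: hmono.
  rewrite (_ : (fun w => limn _) = (fun w => (phi (X w))%:E)) in cv; last first.
    by apply/funext => w; apply/cvg_lim => //; apply: cvg_EFin; [exact: nearW|exact: hcv].
  rewrite (_ : (fun n => _) = (fun n => (mn n)%:E)) in cv; last first.
    by apply/funext => n; case: (h1 n).
  by move: cv; rewrite im => /fine_cvg.
apply: (has_mean_mono_limit _ _ h2) => [n w|w n k nk|w|].
- by rewrite mulr_ge0.
- by rewrite ler_wpM2r// hmono.
- by apply: cvgM; [exact: hcv|exact: cvg_cst].
- by apply: cvgM => //; exact: cvg_cst.
Qed.

Lemma has_mean_exists (F : T -> R) : P.-integrable setT (EFin \o F) -> exists c, has_mean P F c.
Proof.
move=> iF; exists (fine (\int[P]_w (F w)%:E)%E); split=> //.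
by rewrite fineK// integrable_fin_num.
Qed.

Lemma has_mean_pos_neg (F : T -> R) c : has_mean P F c -> exists a b,
  [/\ has_mean P (fun w => Num.max (F w) 0) a, has_mean P (fun w => Num.max (- F w) 0) b & c = a - b].
Proof.
move=> hF; have mF := has_mean_measurable hF; have [iF _] := hF.
have max_le (x : R) : `|Num.max x 0| <= `|x|.
  by rewrite ger0_norm ?le_max ?lexx ?orbT// ge_max normr_ge0 ler_norm.
have [a ha] : exists a, has_mean P (fun w => Num.max (F w) 0) a.
  apply: has_mean_exists; apply: (le_integrable measurableT _ _ iF).
    by apply/measurable_EFinP; exact: measurable_maxr.
  by move=> w _ /=; rewrite lee_fin.
have [b hb] : exists b, has_mean P (fun w => Num.max (- F w) 0) b.
  apply: has_mean_exists; apply: (le_integrable measurableT _ _ iF).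
    by apply/measurable_EFinP; apply: measurable_maxr => //; exact: measurable_funN.
  by move=> w _ /=; rewrite lee_fin (le_trans (max_le _))// normrN.
exists a, b; split=> //; apply: has_mean_unique hF _.
rewrite -mulN1r (_ : F = fun w => Num.max (F w) 0 + -1 * Num.max (- F w) 0).
  by apply: has_meanD => //; exact: has_meanZ.
apply/funext => w; rewrite mulN1r; case: (leP 0 (F w)) => h.
  by rewrite max_r ?subr0// oppr_le0.
by rewrite max_l ?opprK ?add0r// oppr_ge0 ltW.
Qed.

Context {I : choiceType}.
Variable X : I -> {RV P >-> R}.
Hypothesis X_indep : mutually_independent X.

Lemma independence_indic (l : seq I) (B : I -> set R) : uniq l -> (forall i, measurable (B i)) ->
  has_mean P (fun w => \prod_(i <- l) \1_(B i) (X i w)) (\prod_(i <- l) fine (P (X i @^-1` B i))).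
Proof.
move=> ul mB.
pose J := [fset i in l]%fset.
have pJ (F : I -> R) : \prod_(i <- l) F i = \prod_(i <- J) F i.
  by apply: perm_big; apply: uniq_perm => // i; rewrite !inE.
have mX i : measurable (X i @^-1` B i).
  by rewrite -[Y in measurable Y]setTI; exact: measurable_funP.
have mJ : measurable (\bigcap_(i in [set` J]) (X i @^-1` B i)).
  by apply: fin_bigcap_measurable => //; exact: finite_fset.
rewrite pJ (_ : (fun w => _) = (fun w => \1_(\bigcap_(i in [set` J]) (X i @^-1` B i)) w)).
  apply: has_mean_nonneg.
  - by move=> w; rewrite indicE.
  - exact: measurable_indic.
  - by rewrite integral_indic// setIT; exact: X_indep.
apply/funext => w; rewrite pJ; case: (boolP (w \in \bigcap_(i in [set` J]) (X i @^-1` B i))).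
  move=> h; rewrite indicE h; move: h; rewrite inE => h.
  rewrite big1_seq// => i /= iJ; rewrite indicE mem_set//; exact: h.
move=> h; rewrite indicE (negbTE h); apply/eqP; rewrite prodf_seq_eq0; apply/hasP.
move: h; rewrite notin_setE => /existsNP[i /not_implyP[iJ nB]].
by exists i => //=; rewrite indicE memNset.
Qed.

(** Induction on the variables already extended from indicators to
    nonnegative functions; the others still carry indicators, which leaves
    room for the test set of the next one. *)
Lemma independence_nonneg (l l' : seq I) (phi : I -> R -> R) (m : I -> R) (B : I -> set R) :
  uniq (l ++ l') -> (forall i, measurable_fun setT (phi i)) -> (forall i x, 0 <= phi i x) ->
  (forall i, i \in l -> has_mean P (fun w => phi i (X i w)) (m i)) -> (forall i, measurable (B i)) ->
  has_mean P (fun w => \prod_(i <- l) phi i (X i w) * \prod_(i <- l') \1_(B i) (X i w))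
    (\prod_(i <- l) m i * \prod_(i <- l') fine (P (X i @^-1` B i))).
Proof.
move=> + mphi phi0 hm.
elim: l l' B hm => [|i l IH] l' B hm /= ul mB.
  rewrite big_nil mul1r (_ : (fun w => _) = (fun w => \prod_(i <- l') \1_(B i) (X i w))).
    exact: independence_indic.
  by apply/funext => w; rewrite big_nil mul1r.
move: ul => /andP[nil ul].
rewrite big_cons -mulrA (_ : (fun w => _) = fun w => phi i (X i w) *
    (\prod_(i <- l) phi i (X i w) * \prod_(i <- l') \1_(B i) (X i w))); last first.
  by apply/funext => w; rewrite big_cons -mulrA.
have il' : i \notin l' by move: nil; rewrite mem_cat negb_or => /andP[].
apply: independence_extend => //; last by apply: hm; rewrite mem_head.
  by move=> w; rewrite mulr_ge0// prodr_ge0// => k _; rewrite indicE.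
move=> C mC.
(* The test set of the new variable is handed to the induction as an
   indicator. *)
have := IH (i :: l') (fun k => if k == i then C else B k).
rewrite !big_cons eqxx.
have E0 (F G : I -> R) : (forall k, k != i -> F k = G k) -> \prod_(k <- l') F k = \prod_(k <- l') G k.
  by move=> h; apply: eq_big_seq => k kl'; apply: h; apply: contraNneq il' => <-.
rewrite (E0 _ (fun k => fine (P (X k @^-1` B k)))); last by move=> k /negbTE ->.
rewrite mulrCA; set c := _ * _.
move=> h; have {}h : has_mean P (fun w => \prod_(i <- l) phi i (X i w) *
    \prod_(k <- (i :: l')) \1_(if k == i then C else B k) (X k w)) c.
  apply: h => [k kl||k].
  - by apply: hm; rewrite in_cons kl orbT.
  - by rewrite uniq_catC/= mem_cat orbC -mem_cat nil/= uniq_catC.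
  - by case: eqP.
move: h; congr has_mean; apply/funext => w; rewrite big_cons eqxx mulrCA.
by congr (_ * (_ * _)); apply: E0 => k /negbTE ->.
Qed.

(** Induction on the variables whose functions may change sign: each is
    split into its positive and negative part and joins the nonnegative
    ones. *)
Lemma independence_mean (l l' : seq I) (phi : I -> R -> R) (m : I -> R) :
  uniq (l ++ l') -> (forall i, measurable_fun setT (phi i)) ->
  (forall i x, i \in l' -> 0 <= phi i x) ->
  (forall i, i \in l ++ l' -> has_mean P (fun w => phi i (X i w)) (m i)) ->
  has_mean P (fun w => \prod_(i <- l ++ l') phi i (X i w)) (\prod_(i <- l ++ l') m i).
Proof.
elim: l l' phi m => [|i l IH] l' phi m /= ul mphi phi0 hm.
  pose phi' i := if i \in l' then phi i else fun=> 0.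
  have := @independence_nonneg l' [::] phi' m (fun=> setT).
  rewrite cats0 big_nil mulr1 (_ : (fun w => _ * _) = (fun w => \prod_(i <- l') phi i (X i w))).
    apply=> //; rewrite /phi'.
    - by move=> i; case: ifP => // _; exact: measurable_cst.
    - by move=> i x; case: ifP => // il'; exact: phi0.
    - by move=> i il'; rewrite il'; exact: hm.
  by apply/funext => w; rewrite big_nil mulr1; apply: eq_big_seq => i il'; rewrite /phi' il'.
have [a [b [ha hb mE]]] := has_mean_pos_neg (hm i (mem_head _ _)).
move: (ul) => /andP[nil ull].
have part (g : R -> R) c : measurable_fun setT g -> (forall x, 0 <= g x) ->
    has_mean P (fun w => g (X i w)) c ->
    has_mean P (fun w => g (X i w) * \prod_(k <- l ++ l') phi k (X k w)) (c * \prod_(k <- l ++ l') m k).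
  move=> mg g0 hg.
  have := IH (i :: l') (fun k => if k == i then g else phi k) (fun k => if k == i then c else m k).
  have E0 (F G : I -> R) : (forall k, k != i -> F k = G k) ->
      \prod_(k <- l ++ i :: l') F k = F i * \prod_(k <- l ++ l') G k.
    move=> h; rewrite (perm_big (i :: l ++ l'))/=; last by rewrite perm_catC/= perm_cons perm_catC.
    rewrite big_cons; congr (_ * _); apply: eq_big_seq => k kl; apply: h.
    by apply: contraNneq nil => <-.
  rewrite (E0 _ m); last by move=> k /negbTE ->.
  rewrite eqxx (_ : (fun w => \prod_(k <- l ++ i :: l') _) = (fun w => g (X i w) * \prod_(k <- l ++ l') phi k (X k w))).
    apply.
    - by rewrite uniq_catC/= mem_cat orbC -mem_cat nil/= uniq_catC.
    - by move=> k; case: eqP.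
    - by move=> k x; rewrite in_cons; case: eqP => // _ /= kl; exact: phi0.
    - move=> k; rewrite mem_cat in_cons; case: eqP => [-> //|_ /= kl].
      by apply: hm; rewrite in_cons mem_cat kl orbT.
  apply/funext => w; rewrite (E0 _ (fun k => phi k (X k w))) ?eqxx//.
  by move=> k /negbTE ->.
have h1 := part (fun x => Num.max (phi i x) 0) a.
have h2 := part (fun x => Num.max (- phi i x) 0) b.
rewrite big_cons mE mulrBl -[X in _ - X]mul1r -mulNr.
rewrite (_ : (fun w => _) = fun w => Num.max (phi i (X i w)) 0 * \prod_(k <- l ++ l') phi k (X k w) +
   -1 * (Num.max (- phi i (X i w)) 0 * \prod_(k <- l ++ l') phi k (X k w))).
  apply: has_meanD; last apply: has_meanZ.
    by apply: h1 => //; [exact: measurable_maxr|move=> x; rewrite le_max lexx orbT].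
  apply: h2 => //; [|by move=> x; rewrite le_max lexx orbT].
  by apply: measurable_maxr => //; exact: measurable_funN.
apply/funext => w; rewrite big_cons mulN1r -mulrBl; congr (_ * _).
case: (leP 0 (phi i (X i w))) => h.
  by rewrite max_r ?subr0// oppr_le0.
by rewrite max_l ?opprK ?add0r// oppr_ge0 ltW.
Qed.

Lemma independent_product_mean (l : seq I) (phi : I -> R -> R) (m : I -> R) :
  uniq l -> (forall i, measurable_fun setT (phi i)) ->
  (forall i, i \in l -> has_mean P (fun w => phi i (X i w)) (m i)) ->
  has_mean P (fun w => \prod_(i <- l) phi i (X i w)) (\prod_(i <- l) m i).
Proof.
by move=> ul mphi hm; have := @independence_mean l [::] phi m; rewrite cats0; apply.
Qed.

End Independence.

(** * The chaos of random signs *)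

Section ElementarySymmetric.
Context {R : realType} (N : nat) (x : 'I_N -> R).
Hypothesis x2 : forall a, x a ^+ 2 = 1.

Definition elem_sym (k : nat) : R := \sum_(I : {set 'I_N} | #|I| == k) \prod_(a in I) x a.

(** Each set of k + 1 indices arises from k + 1 choices of a last element. *)
Lemma elem_sym_add k : \sum_(I : {set 'I_N} | #|I| == k) \sum_(a | a \notin I) \prod_(b in a |: I) x b
  = k.+1%:R * elem_sym k.+1.
Proof.
rewrite (exchange_big_dep predT)//=.
transitivity (\sum_(a : 'I_N) \sum_(J : {set 'I_N} | (#|J| == k.+1) && (a \in J)) \prod_(b in J) x b).
  apply: eq_bigr => a _.
  rewrite (reindex_onto (fun J : {set 'I_N} => J :\ a)%SET (fun I : {set 'I_N} => a |: I)%SET)/=; last first.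
    by move=> I /andP[_ aI]; rewrite finset.setU1K.
  apply: eq_big => [J|J /andP[_ /eqP ->]//].
  have [aJ|aJ] := boolP (a \in J).
    by rewrite finset.setD1K// eqxx andbT andbT finset.setD11 andbT [X in _ = (X == _)](cardsD1 a) aJ add1n eqSS.
  rewrite andbF; apply/negbTE/negP => /andP[_ /eqP E]; move: aJ; rewrite -E.
  by rewrite finset.setU11.
rewrite (exchange_big_dep (fun J : {set 'I_N} => #|J| == k.+1))/=; last by move=> a J _ /andP[].
rewrite /elem_sym mulr_sumr; apply: eq_bigr => J Jk.
under eq_bigl do rewrite Jk.
by rewrite big_const iter_addr_0 (eqP Jk) mulr_natl.
Qed.

(** Each set of k indices arises by deleting one of the N - k elements
    outside it. *)
Lemma elem_sym_del k : \sum_(I : {set 'I_N} | #|I| == k.+1) \sum_(a in I) \prod_(b in I :\ a) x b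
  = (N%:R - k%:R) * elem_sym k.
Proof.
rewrite (exchange_big_dep predT)//=.
transitivity (\sum_(a : 'I_N) \sum_(J : {set 'I_N} | (#|J| == k) && (a \notin J)) \prod_(b in J) x b).
  apply: eq_bigr => a _.
  rewrite (reindex_onto (fun J : {set 'I_N} => a |: J)%SET (fun I : {set 'I_N} => I :\ a)%SET)/=; last first.
    by move=> I /andP[_ aI]; rewrite finset.setD1K.
  apply: eq_big => [J|J /andP[_ /eqP ->]//].
  have [aJ|aJ] := boolP (a \in J).
    rewrite andbF; apply/negbTE/negP => /andP[_ /eqP E]; move: aJ; rewrite -E.
    by rewrite finset.setD11.
  by rewrite finset.setU1K// eqxx andbT finset.setU11 andbT cardsU1 aJ add1n eqSS andbT.
rewrite (exchange_big_dep (fun J : {set 'I_N} => #|J| == k))/=; last by move=> a J _ /andP[].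
rewrite /elem_sym mulr_sumr; apply: eq_bigr => J Jk.
under eq_bigl do rewrite Jk /= -finset.in_setC.
have cJ : N%:R - k%:R = #|(~: J)%SET|%:R :> R.
  by rewrite -[in N%:R](card_ord N) -(cardsC J) (eqP Jk) natrD addrAC subrr add0r.
by rewrite big_const iter_addr_0 cJ mulr_natl.
Qed.

(** Multiplying by a variable that is already present removes it, because
    its square is 1. *)
Lemma elem_sym_rec n : (\sum_a x a) * elem_sym n = n.+1%:R * elem_sym n.+1 +
  (if n is n'.+1 then (N%:R - n'%:R) * elem_sym n' else 0).
Proof.
rewrite -elem_sym_add.
have -> : (if n is n'.+1 then (N%:R - n'%:R) * elem_sym n' else 0) =
    \sum_(I : {set 'I_N} | #|I| == n) \sum_(a in I) \prod_(b in I :\ a) x b.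
  case: n => [|n]; last by rewrite elem_sym_del.
  by rewrite big1// => I; rewrite cards_eq0 => /eqP ->; rewrite big_pred0// => a; rewrite inE.
rewrite -big_split/= /elem_sym mulr_sumr; apply: eq_bigr => I _.
(* The new index either enlarges the set or cancels against its own
   occurrence. *)
rewrite mulr_suml (bigID (mem I))/= addrC; congr (_ + _); apply: eq_bigr => a aI.
  by rewrite big_setU1.
rewrite [X in _ * X](big_setD1 a aI)/= mulrA -expr2 x2 mul1r.
by [].
Qed.

Lemma elem_sym_large k : (N < k)%N -> elem_sym k = 0.
Proof.
move=> Nk; rewrite /elem_sym big_pred0// => I; apply/negbTE.
by rewrite neq_ltn (leq_ltn_trans _ Nk)// -[X in (_ <= X)%N]card_ord max_card.
Qed.

Lemma elem_sym0 : elem_sym 0 = 1.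
Proof.
rewrite /elem_sym (big_pred1 (finset.set0 : {set _})); first by rewrite big_pred0// => a; rewrite inE.
by move=> I /=; rewrite cards_eq0.
Qed.

(** The normalization k! N^(-k/2) turns [elem_sym_rec] into the three-term
    recurrence with h = 1/N. *)
Lemma elem_sym_normalized_rec n : (0 < N)%N ->
  let Q k := k`!%:R * Num.sqrt N%:R ^- k * elem_sym k in
  Q n.+1 = (\sum_a x a / Num.sqrt N%:R) * Q n - n%:R * (1 - (n%:R - 1) * N%:R^-1) * Q n.-1.
Proof.
move=> N0 Q; rewrite /Q -mulr_suml.
have sN : Num.sqrt N%:R != 0 :> R by rewrite gt_eqF// sqrtr_gt0 ltr0n.
have s2 : Num.sqrt N%:R ^+ 2 = N%:R :> R by rewrite sqr_sqrtr// ler0n.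
have := elem_sym_rec n.
set e1 := \sum_a x a; set s := Num.sqrt _ in sN s2 *.
have NE : N%:R^-1 = s^-1 ^+ 2 :> R by rewrite exprVn s2.
case: n => [|n].
  rewrite addr0 mul1r => h; rewrite mul0r mul0r subr0 fact0 expr0 invr1 !mul1r expr1 mulrAC h.
  by rewrite mulrC.
move=> h.
have -> : (n.+2)`!%:R * s ^- n.+2 * elem_sym n.+2 = (n.+1)`!%:R * s ^- n.+2 * (n.+2%:R * elem_sym n.+2).
  by rewrite factS natrM; ring.
have -> : n.+2%:R * elem_sym n.+2 = e1 * elem_sym n.+1 - (N%:R - n%:R) * elem_sym n by rewrite h addrK.
rewrite NE -s2 /= factS natrM -natr1 -!exprVn !exprS.
by field.
Qed.

End ElementarySymmetric.

Section SignChaos.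
Context {R : realType} {dim : option nat} {d : measure_display} {T : measurableType d}.
Variable P : probability T R.
Variable xi : ix dim -> nat -> {RV P >-> R}.
Hypothesis xi_indep : mutually_independent (fun ja : ix dim * nat => xi ja.1 ja.2).
Hypothesis xi_sign : forall j a, symmetric_sign (xi j a).

Lemma sign_values_ae (X : {RV P >-> R}) : symmetric_sign X ->
  {ae P, forall w, X w = 1 \/ X w = -1}.
Proof.
move=> [p1 p2].
have mX (c : R) : measurable [set w | X w = c].
  by rewrite (_ : [set w | X w = c] = X @^-1` [set c]).
have PU : P ([set w | X w = 1] `|` [set w | X w = -1]) = 1%E.
  rewrite measureU//; last by rewrite -subset0 => w [/= ->]; lra.
  transitivity ((2^-1)%:E + (2^-1)%:E : \bar R)%E; first by congr (_ + _)%E.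
  by rewrite -EFinD; congr EFin; lra.
have mU := measurableU _ _ (mX 1) (mX (-1)).
exists (~` ([set w | X w = 1] `|` [set w | X w = -1])); split=> //.
- exact: measurableC.
- by rewrite probability_setC// PU subee.
Qed.

Lemma sign_sqr_ae : {ae P, forall w, forall j a, xi j a w ^+ 2 = 1}.
Proof.
(* The pairs of indices are countable, so they share one null set. *)
have h : {ae P, forall w, forall n, if choice.unpickle n is Some ja then (xi (ja : ix dim * nat).1 ja.2 w) ^+ 2 = 1 else True}.
  apply: ae_foralln => n; case: choice.unpickle => [[j a]|]; last exact: filterE.
  by apply: filterS (sign_values_ae (xi_sign j a)) => w /= [] ->; lra.
apply: filterS h => w h j a; have := h (choice.pickle (j, a)).
by rewrite choice.pickleK.
Qed.

Lemma sign_mean j a : has_mean P (xi j a) 0.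
Proof.
have [p1 p2] := xi_sign j a.
have h1 := has_mean_indic (xi j a) (measurable_set1 1).
have h2 := has_mean_indic (xi j a) (measurable_set1 (-1)).
have := has_meanD h1 (has_meanZ (-1) h2).
rewrite (_ : fine _ + _ = 0); last first.
  rewrite (_ : xi j a @^-1` [set 1] = [set w | xi j a w = 1])//.
  by rewrite (_ : xi j a @^-1` [set -1] = [set w | xi j a w = -1])// p1 p2 /=; lra.
move=> /has_mean_ae; apply; first exact: measurable_funP.
apply: filterS (sign_values_ae (xi_sign j a)) => w [] ->; rewrite !indicE.
  by rewrite mem_set// memNset ?mulr0 ?addr0//=; lra.
by rewrite memNset ?mem_set//= ?mulr1 ?add0r//; lra.
Qed.

(** Distinct signs are independent and centred. *)
Lemma sign_product_mean (J : seq (ix dim * nat)) : uniq J ->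
  has_mean P (fun w => \prod_(p <- J) xi p.1 p.2 w) (J == [::])%:R.
Proof.
move=> uJ.
have := independent_product_mean xi_indep (phi := fun _ x => x) (m := fun=> 0) uJ.
rewrite (_ : \prod_(i <- J) 0 = (J == [::])%:R); last first.
  by case: J {uJ} => [|p J]; rewrite ?big_nil// big_cons mul0r.
by apply=> [i|[j a] _]; [exact: measurable_id|exact: sign_mean].
Qed.

(** Expanding the coordinates one after the other turns the product into a
    sum of products of distinct signs; the signs already extracted are kept
    in [J] to make the induction work. *)
Lemma Qsum_product_mean N (k : ix dim -> nat) (s : seq (ix dim)) (J : seq (ix dim * nat)) :
  uniq s -> uniq J -> (forall p, p \in J -> p.1 \notin s) ->
  has_mean P (fun w => \prod_(j <- s) Qsum xi j (k j) N w * \prod_(p <- J) xi p.1 p.2 w)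
    (all (fun j => k j == 0)%N s && (J == [::]))%:R.
Proof.
elim: s J => [|j s IH] J /=.
  move=> _ uJ _; rewrite (_ : (fun w => _) = (fun w => \prod_(p <- J) xi p.1 p.2 w)).
    exact: sign_product_mean.
  by apply/funext => w; rewrite big_nil mul1r.
move=> /andP[js us] uJ hJ.
pose c : R := (k j)`!%:R * Num.sqrt N%:R ^- (k j).
(* The signs of the set [I] in coordinate [j] join the extracted ones; they
   are new because [j] does not occur in [s]. *)
pose JI (I : {set 'I_N}) := [seq (j, val a) | a <- enum I] ++ J.
have uJI I : uniq (JI I).
  rewrite cat_uniq uJ andbT map_inj_uniq ?enum_uniq/=; last by move=> a b [] /val_inj.
  apply/hasPn => p pJ; apply/mapP => -[a _ pE].
  by have := hJ p pJ; rewrite pE mem_head.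
have hJI I p : p \in JI I -> p.1 \notin s.
  rewrite mem_cat => /orP[/mapP[a _ ->]//|pJ].
  by have := hJ p pJ; rewrite in_cons negb_or => /andP[].
pose L := seq.filter (fun I : {set 'I_N} => #|I| == k j) (index_enum _).
have := has_meanZ c (has_mean_sum (s := L) (fun I _ => IH (JI I) us (uJI I) (@hJI I))).
rewrite (_ : (fun w => c * _) = (fun w => \prod_(j0 <- j :: s) Qsum xi j0 (k j0) N w * \prod_(p <- J) xi p.1 p.2 w)); last first.
  apply/funext => w; rewrite big_cons [Qsum _ j _ _ _]/Qsum -/c /L big_filter -2!(mulrA c); congr (_ * _).
  rewrite -mulrA mulr_suml; apply: eq_bigr => I _; rewrite /JI big_cat/= big_map big_enum/=.
  by rewrite mulrCA.
congr has_mean.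
have [k0|kn0] := eqVneq (k j) 0%N; last first.
  rewrite big1_seq ?mulr0// => I /=; rewrite mem_filter => /andP[/eqP Ik _].
  rewrite [X in (_ && X)](_ : _ = false) ?andbF// /JI.
  have : (0 < size (enum I))%N by rewrite -cardE Ik lt0n.
  by case: (enum I).
rewrite /L big_filter (big_pred1 (finset.set0 : {set _})); last first.
  by move=> I /=; rewrite k0 cards_eq0.
by rewrite /c k0 /JI enum_set0/= fact0 expr0 invr1 !mul1r.
Qed.

Lemma PsiN_mean N al : has_mean P (PsiN xi N al) (al == mzero)%:R.
Proof.
have := Qsum_product_mean N al (fset_uniq (finsupp al)) (isT : uniq [::]).
rewrite andbT => /(_ (fun p => _))/(has_meanZ (\prod_(j <- finsupp al) (Num.sqrt (al j)`!%:R)^-1)).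
rewrite (_ : (fun w => _ * _) = PsiN xi N al); last first.
  apply/funext => w; rewrite big_nil mulr1 /PsiN -big_split/=.
  by apply: eq_bigr => j _; rewrite mulrC.
move=> h; have {}h := h ltac:(by move=> p; rewrite in_nil).
move: h; congr has_mean.
have [->|nz] := eqVneq al mzero.
  by rewrite finsupp0 big_nil mulr1 /=.
rewrite (_ : all _ _ = false) ?mulr0//; apply/negbTE/allPn.
have [j ja] : exists j, j \in finsupp al.
  apply: contrapT => /forallNP no; move/eqP : nz; apply; apply/fsfunP => j.
  by rewrite mzeroE fsfun_dflt//; exact/negP.
by exists j => //; rewrite -mem_finsupp.
Qed.

(** The truncated differences agree with the real ones except beyond the
    range, where both products contain a zero factor. *)
Lemma falling_ratio_real N g r : (0 < N)%N -> (g <= N)%N ->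
  falling_ratio N g r = \prod_(i < r) (1 - (g%:R + i%:R) * N%:R^-1) :> R.
Proof.
move=> N0 gN; rewrite falling_ratioE.
have Nn0 : N%:R != 0 :> R by rewrite pnatr_eq0 -lt0n.
have [rN|Nr] := leqP r (N - g).
  apply: eq_bigr => i _; have iN : (i <= N - g)%N by rewrite ltnW// (leq_trans _ rN).
  by rewrite natrB// natrB//; field.
have zero (F : nat -> R) : F (N - g)%N = 0 -> \prod_(i < r) F i = 0.
  by move=> F0; rewrite (bigD1 (Ordinal Nr))//= F0 mul0r.
rewrite (zero (fun i => (N - g - i)%:R / N%:R)) ?subnn ?mul0r//.
rewrite (zero (fun i => 1 - (g%:R + i%:R) * N%:R^-1))// natrB// (addrC g%:R) subrK.
by rewrite mulfV// subrr.
Qed.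

Lemma Qsum0 N j w : Qsum xi j 0 N w = 1.
Proof.
have := elem_sym0 (fun a : 'I_N => xi j a w); rewrite /elem_sym /Qsum => ->.
by rewrite fact0 expr0 invr1 !mulr1.
Qed.

Lemma Qsum_large N j k w : (N < k)%N -> Qsum xi j k N w = 0.
Proof.
move=> Nk; have := elem_sym_large (fun a : 'I_N => xi j a w) Nk; rewrite /elem_sym /Qsum => ->.
by rewrite mulr0.
Qed.

Lemma PsiN_large N (al : midx dim) j w : (N < al j)%N -> PsiN xi N al w = 0.
Proof.
move=> h; apply/eqP; rewrite prodf_seq_eq0; apply/hasP; exists j => /=.
  by rewrite mem_finsupp -lt0n (leq_ltn_trans _ h).
by rewrite Qsum_large// mul0r.
Qed.

(** The two weights may differ when the contracted multi-index leaves the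
    range of the falling factorials, but then the basis function vanishes. *)
Lemma vartheta_tensor N (al be r : midx dim) w : (0 < N)%N ->
  (forall j, (al j <= N)%N) -> (forall j, (be j <= N)%N) ->
  contraction_weight N%:R^-1 (mcon al be r) r * PsiN xi N (mcon al be r) w =
  vartheta N al be r (mcon al be r) * PsiN xi N (mcon al be r) w.
Proof.
move=> N0 aN bN.
have [cN|] := pselect (forall j, (mcon al be r j <= N)%N); last first.
  move=> /existsNP[j /negP]; rewrite -ltnNge => h.
  by rewrite (PsiN_large _ h) !mulr0.
congr (_ * _); rewrite /vartheta asboolT; last by move=> j; split.
by apply: eq_bigr => j _; rewrite -falling_ratio_real.
Qed.

(** The linearization formula with h = 1/N. When a component of a factor
    exceeds N both sides vanish, the right one by the convention in
    [vartheta]. *)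
Theorem sign_chaos_system N : (0 < N)%N -> chaos_system P (PsiN xi N) (vartheta N).
Proof.
move=> N0; split.
- exact: vartheta_dominated.
- by move=> al; exact: PsiN_mean.
move=> al be; apply: filterS sign_sqr_ae => w hw.
have q0 j : Qsum xi j 0 N w = 1 by exact: Qsum0.
have qS j n : Qsum xi j n.+1 N w = (\sum_(a < N) xi j a w / Num.sqrt N%:R) * Qsum xi j n N w
    - n%:R * (1 - (n%:R - 1) * N%:R^-1) * Qsum xi j n.-1 N w.
  exact: (elem_sym_normalized_rec (x := fun a : 'I_N => xi j a w)).
rewrite (tensor_product q0 qS).
have [aN|] := pselect (forall j, (al j <= N)%N); last first.
  move=> aN; have [j /negP] : exists j, ~ (al j <= N)%N by exact/existsNP.
  rewrite -ltnNge => h.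
  rewrite -(tensor_product q0 qS) [tensor _ al](PsiN_large w h) mul0r.
  rewrite big1// => r _; rewrite /pcoef /vartheta asboolF ?mulr0 ?mul0r//.
  by move=> /(_ j)[]; rewrite leqNgt h.
have [bN|] := pselect (forall j, (be j <= N)%N); last first.
  move=> bN; have [j /negP] : exists j, ~ (be j <= N)%N by exact/existsNP.
  rewrite -ltnNge => h.
  rewrite -(tensor_product q0 qS) [tensor _ be](PsiN_large w h) mulr0.
  rewrite big1// => r _; rewrite /pcoef /vartheta asboolF ?mulr0 ?mul0r//.
  by move=> /(_ j)[_]; rewrite leqNgt h.
apply: eq_bigr => r _; rewrite /pcoef -(mulrA _ (contraction_weight _ _ _)).
rewrite -(mulrA _ (vartheta _ _ _ _ _)); congr (_ * _).
exact: vartheta_tensor.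
Qed.

Lemma sign_chaos_weight N (al : midx dim) : chaos_weight (@vartheta R dim N) al = dweight N al.
Proof.
rewrite /chaos_weight /vartheta; case: asboolP => [h|].
  by apply: eq_bigr => j _; rewrite mzeroE subn0.
move=> /existsNP[j h]; apply/esym/eqP; rewrite prodf_seq_eq0; apply/hasP; exists j => /=.
  rewrite mem_finsupp; apply/eqP => a0; apply: h; rewrite mzeroE a0 leq0n.
  by split.
have lt : (N < al j)%N.
  by rewrite ltnNge; apply/negP => aN; apply: h; rewrite mzeroE aN.
by rewrite ffact_small// mul0r.
Qed.

End SignChaos.

(** * The Gaussian chaos *)

Section GaussianIntegrals.
Context {R : realType}.
Local Notation mu := (@lebesgue_measure R).
Implicit Types p : {poly R}.

(** Induction on the degree: half of the exponent is kept for the factor x,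
    which it dominates. *)
Lemma poly_growth p (e : R) : 0 < e ->
  exists2 C : R, 0 <= C & forall x, `|p.[x]| <= C * expR (e * x ^+ 2).
Proof.
elim/poly_ind: p e => [|p c IH] e e0.
  by exists 0 => // x; rewrite horner0 normr0 mul0r.
have e20 : 0 < e / 2 by lra.
have [C C0 hC] := IH _ e20.
exists (C * (1 + 2 / e) + `|c|).
  by rewrite addr_ge0// mulr_ge0// addr_ge0// divr_ge0// ltW.
move=> x; rewrite hornerMXaddC; apply: le_trans (ler_normD _ _) _.
have ex1 : 1 <= expR (e / 2 * x ^+ 2).
  by apply: le_trans (expR_ge1Dx _); rewrite lerDl mulr_ge0 ?sqr_ge0// ltW.
have ex2 : 1 <= expR (e * x ^+ 2).
  by apply: le_trans (expR_ge1Dx _); rewrite lerDl mulr_ge0 ?sqr_ge0// ltW.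
rewrite mulrDl; apply: lerD; last by rewrite ler_peMr.
rewrite normrM.
have -> : expR (e * x ^+ 2) = expR (e / 2 * x ^+ 2) * expR (e / 2 * x ^+ 2).
  by rewrite -expRD; congr expR; field.
rewrite mulrACA; apply: ler_pM => //.
have h1 := expR_ge1Dx (e / 2 * x ^+ 2).
have h2 : `|x| <= 1 + x ^+ 2.
  have := sqr_ge0 (`|x| - 1); rewrite sqrrB expr1n mulr1 real_normK ?num_real//.
  by have := normr_ge0 x; lra.
(* A quadratic is dominated by the exponential with the other half of the
   exponent. *)
have h3 : x ^+ 2 <= 2 / e * expR (e / 2 * x ^+ 2).
  rewrite -[leLHS](_ : 2 / e * (e / 2 * x ^+ 2) = _); last by field; exact: lt0r_neq0.
  by apply: ler_wpM2l; [rewrite divr_ge0// ltW|lra].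
by rewrite mulrDl mul1r; lra.
Qed.

Definition gauss_weight (x : R) : R := expR (- (x ^+ 2 / 2)).

Lemma gauss_weight_pdf x : normal_pdf 0 1 x = normal_peak 1 * gauss_weight x.
Proof.
rewrite normal_pdfE// /normal_fun /gauss_weight; congr (_ * expR _).
by rewrite subr0 expr1n mulNr.
Qed.

Lemma gauss_weight_decay p : exists2 C : R, 0 <= C &
  forall x, `|p.[x] * gauss_weight x| <= C * expR (- (x ^+ 2 / 4)).
Proof.
have [C C0 hC] := @poly_growth p (1 / 4) ltac:(lra).
exists C => // x; rewrite normrM (ger0_norm (expR_ge0 _)).
have -> : expR (- (x ^+ 2 / 4)) = expR (1 / 4 * x ^+ 2) * gauss_weight x.
  by rewrite /gauss_weight -expRD; congr expR; field.
by rewrite mulrA; apply: ler_wpM2r => //; exact: expR_ge0.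
Qed.

Lemma measurable_horner p : measurable_fun setT (fun x : R => p.[x]).
Proof. by apply: continuous_measurable_fun; exact: continuous_horner. Qed.

Lemma measurable_gauss_weight : measurable_fun setT gauss_weight.
Proof.
apply: measurableT_comp => //; apply: measurableT_comp => //.
by apply: measurable_funM => //; exact: measurable_funX.
Qed.

(** The decay bound is a multiple of the normal density of variance 2. *)
Lemma integrable_poly_gauss p : mu.-integrable setT (fun x => (p.[x] * gauss_weight x)%:E).
Proof.
have [C C0 hC] := gauss_weight_decay p.
have s0 : Num.sqrt 2 != 0 :> R by rewrite gt_eqF// sqrtr_gt0.
have k0 := normal_peak_gt0 s0.
apply: (@le_integrable _ _ _ mu setT measurableT _
   (fun x => ((C / normal_peak (Num.sqrt 2))%:E * (normal_pdf 0 (Num.sqrt 2) x)%:E)%E)).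
- apply/measurable_EFinP; apply: measurable_funM; first exact: measurable_horner.
  exact: measurable_gauss_weight.
- move=> x _; rewrite /= lee_fin; apply: le_trans (hC x) _.
  rewrite normal_pdfE// mulrA divfK ?lt0r_neq0// ger0_norm; last by rewrite mulr_ge0// normal_fun_ge0.
  rewrite ler_wpM2l// /normal_fun ler_expR subr0 mulNr sqr_sqrtr// lerN2.
  by rewrite -mulr_natr; lra.
- by apply: integrableZl => //; exact: integrable_normal_pdf.
Qed.

Lemma hermiteS n : hermite n.+1 = 'X * hermite n - (hermite n)^`() :> {poly R}.
Proof. by []. Qed.

Lemma hermite_deriv n : (hermite n.+1)^`() = (n.+1)%:R *: hermite n :> {poly R}.
Proof.
elim: n => [|n IH].
  by rewrite hermiteS /= mulr1 derivB derivX derivC deriv0 subr0 scale1r.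
rewrite hermiteS derivB derivM derivX mul1r IH derivZ.
rewrite -addrA -scalerAr -scalerBr -hermiteS -[X in X + _]scale1r -scalerDl.
by rewrite nat1r.
Qed.

Lemma hermite_eval_rec n x : (hermite n.+1).[x] =
  x * (hermite n).[x] - n%:R * (hermite n.-1).[x] :> R.
Proof.
case: n => [|n]; rewrite hermiteS.
  by rewrite /= mulr1 derivC subr0 mul0r subr0 hornerX hornerC mulr1.
by rewrite hornerD hornerN hornerM hornerX hermite_deriv hornerZ.
Qed.

(** A primitive of the next weighted Hermite polynomial, which is how those
    of positive degree are seen to integrate to zero. *)
Definition hermite_primitive n (x : R) : R := - ((hermite n).[x] * gauss_weight x).

Lemma is_derive_gauss_weight (x : R) : is_derive x 1 gauss_weight (- x * gauss_weight x).
Proof.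
have h : is_derive x 1 (fun y : R => - (y ^+ 2 / 2)) (- x).
  have := @is_deriveN _ _ _ (fun y : R => y ^+ 2 / 2) x 1 x.
  apply.
  have hM := @is_deriveM _ _ (fun y : R => y ^+ 2) (fun _ => 2^-1) x 1 _ _ (is_deriveX 2 (is_derive_id x 1)) (is_derive_cst _ _ _).
  refine (is_derive_eq (hM : is_derive x 1 (fun y : R => y ^+ 2 / 2) _) _); rewrite scaler0 add0r /= expr1.
  by rewrite -[LHS]/(2^-1 * (2 * x * 1)); lra.
have hC := @is_derive1_comp _ expR (fun y : R => - (y ^+ 2 / 2)) x _ _ (is_derive_expR _) h.
by refine (is_derive_eq (hC : is_derive x 1 gauss_weight _) _); rewrite /gauss_weight mulrC.
Qed.

Lemma is_derive_hermite_primitive n (x : R) :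
  is_derive x 1 (hermite_primitive n) ((hermite n.+1).[x] * gauss_weight x).
Proof.
have h := @is_deriveM _ _ (horner (hermite n)) gauss_weight x 1 _ _ (is_derive_poly _ _) (is_derive_gauss_weight x).
have hN := is_deriveN h.
refine (is_derive_eq (hN : is_derive x 1 (hermite_primitive n) _) _).
rewrite hermiteS hornerD hornerN hornerM hornerX /GRing.scale/=; ring.
Qed.

Lemma continuous_hermite_weighted n : continuous (fun x : R => (hermite n).[x] * gauss_weight x).
Proof.
move=> x; apply: cvgM; first exact: continuous_horner.
apply/differentiable_continuous/derivable1_diffP.
by have [] := is_derive_gauss_weight x.
Qed.

Lemma integral_hermite_segment n (k : R) : 0 < k ->
  (\int[mu]_(x in `[(- k)%R, k]) ((hermite n.+1).[x] * gauss_weight x)%:E =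
   (hermite_primitive n k - hermite_primitive n (- k))%:E)%E.
Proof.
move=> k0; rewrite EFinB; apply: continuous_FTC2.
- by lra.
- by apply: continuous_subspaceT; exact: continuous_hermite_weighted.
- have cF x : hermite_primitive n y @[y --> x] --> hermite_primitive n x.
    by apply: cvgN; exact: continuous_hermite_weighted.
  split.
  + by move=> x _; have [] := is_derive_hermite_primitive n x.
  + exact: cvg_at_right_filter.
  + exact: cvg_at_left_filter.
- by move=> x _; rewrite derive1E; exact: (@derive_val _ _ _ _ _ _ _ (is_derive_hermite_primitive n x)).
Qed.

Lemma hermite_primitive_vanish n (s : R) : s ^+ 2 = 1 ->
  hermite_primitive n (s * k.+1%:R) @[k --> \oo] --> (0 : R).
Proof.
move=> s2; have [C C0 hC] := gauss_weight_decay (hermite n).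
(* The factor 4 comes from exp(k^2/4) >= k/4, crude but sufficient for a
   harmonic bound. *)
apply: (@cvg_le_mul _ _ (4 * C) _ (@harmonic R)); last exact: cvg_harmonic.
move=> k; rewrite sub0r normrN /hermite_primitive normrN.
apply: le_trans (hC _) _; rewrite exprMn s2 mul1r /harmonic/=.
have k0 : 0 < k.+1%:R :> R by rewrite ltr0n.
have k1 : 1 <= k.+1%:R :> R by rewrite ler1n.
have h := expR_ge1Dx (k.+1%:R ^+ 2 / 4 : R).
rewrite expRN -mulrA mulrCA; apply: ler_wpM2l => //.
rewrite -(invf_div k.+1%:R) lef_pV2 ?posrE ?expR_gt0 ?divr_gt0//.
by apply: le_trans h; nra.
Qed.

Lemma integral_hermite_segment_cvg n :
  (\int[mu]_(x in `[(- k.+1%:R)%R, k.+1%:R]) ((hermite n.+1).[x] * gauss_weight x)%:E)%E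
    @[k --> \oo] --> (\int[mu]_x ((hermite n.+1).[x] * gauss_weight x)%:E)%E.
Proof.
pose f x := ((hermite n.+1).[x] * gauss_weight x)%:E : \bar R.
pose fk (k : nat) := f \_ `[- k.+1%:R, k.+1%:R].
have mf : measurable_fun setT f := measurable_int _ (integrable_poly_gauss _).
have mk (k : nat) : measurable (`[- k.+1%:R, k.+1%:R] : set R) by exact: measurable_itv.
have cv x : fk k x @[k --> \oo] --> f x.
  apply: cvg_near_cst; exists (Num.trunc `|x|) => // k /= hk.
  rewrite /fk patchE mem_set//= in_itv/= -ler_norml ltW//.
  by rewrite (lt_le_trans (truncnS_gt _))// ler_nat ltnS.
rewrite (_ : (fun k : nat => _) = (fun k => \int[mu]_x fk k x)%E); last first.
  by apply/funext => k; rewrite [LHS]integral_mkcond.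
have mfk k : measurable_fun setT (fk k).
  by apply: (iffLR (measurable_restrictT _ (mk k))); exact: measurable_funTS.
have bk k x : (`|fk k x| <= `|f x|)%E.
  by rewrite /fk patchE; case: ifP => // _; rewrite abse0.
have fint : mu.-integrable setT (fun x => `|f x|%E).
  by apply: integrable_abse; exact: integrable_poly_gauss.
have [||_ _ //] := @dominated_convergence _ _ _ mu setT measurableT fk f (fun x => `|f x|%E) mfk mf _ fint.
- by apply: aeW => x _; exact: cv.
- by apply: aeW => x k _; exact: bk.
Qed.

(** The primitive vanishes at both ends of a growing segment. *)
Lemma integral_hermite n : (\int[mu]_x ((hermite n.+1).[x] * gauss_weight x)%:E = 0)%E.
Proof.
have h1 := @integral_hermite_segment_cvg n.
have h2 : (hermite_primitive n k.+1%:R - hermite_primitive n (- k.+1%:R))%:E @[k --> \oo] --> (0 : \bar R).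
  apply: cvg_EFin; first exact: nearW.
  rewrite -[X in _ --> X](subrr 0); apply: cvgB.
    have := @hermite_primitive_vanish n 1 (expr1n _ _).
    by under eq_fun do rewrite mul1r.
  have := @hermite_primitive_vanish n (-1) _; under eq_fun do rewrite mulN1r.
  by apply; rewrite sqrrN expr1n.
rewrite -(cvg_lim _ h1)// -(cvg_lim _ h2)//; congr (limn _); apply/funext => k.
by rewrite integral_hermite_segment// ltr0n.
Qed.

End GaussianIntegrals.

Section GaussianChaos.
Import HBNNSimple.
Context {R : realType} {d : measure_display} {T : measurableType d}.
Variable P : probability T R.
Local Notation mu := (@lebesgue_measure R).

Lemma normal_prob_indic (B : set R) : measurable B ->
  (\int[mu]_x (\1_B x * normal_pdf 0 1 x)%:E = normal_prob 0 1 B)%E.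
Proof.
move=> mB; rewrite /normal_prob [RHS]integral_mkcond; apply: eq_integral => x _.
by rewrite patchE indicE; case: ifP => _; rewrite ?mul1r ?mul0r.
Qed.

(** Change of variables for the law of [g], first for simple functions, then
    by monotone convergence on both sides. *)
Lemma gaussian_density (g : {RV P >-> R}) (phi : R -> R) : standard_gaussian g ->
  (forall x, 0 <= phi x) -> measurable_fun setT phi ->
  (\int[P]_w (phi (g w))%:E = \int[mu]_x (phi x * normal_pdf 0 1 x)%:E)%E.
Proof.
move=> hg phi0 mphi.
have mphi' : measurable_fun setT (EFin \o phi) by exact/measurable_EFinP.
pose h := nnsfun_approx measurableT mphi'.
have hcv x : h n x @[n --> \oo] --> phi x.
  have := cvg_nnsfun_approx measurableT mphi' (fun x _ => phi0 x : (0 <= (phi x)%:E)%E) (I : setT x).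
  by move=> /fine_cvg.
have hmono x : {homo (fun n => h n x) : n k / (n <= k)%N >-> n <= k}.
  by move=> n k nk; have /lefP := nd_nnsfun_approx measurableT mphi' nk; apply.
have pdf0 (x : R) : 0 <= normal_pdf 0 1 x by exact: normal_pdf_ge0.
have mh n : measurable_fun setT (h n : R -> R) by exact: measurable_funP.
have step n : (\int[P]_w (h n (g w))%:E = \int[mu]_x (h n x * normal_pdf 0 1 x)%:E)%E.
  have hm := @has_mean_fimfun _ _ _ P g (fun=> 1) 1 (h n).
  rewrite (_ : (fun w => h n (g w) * 1) = (fun w => h n (g w))) in hm; last first.
    by apply/funext => w; rewrite mulr1.
  have /hm{hm}[_ ->] : forall B : set R, measurable B ->
      has_mean P (fun w => \1_B (g w) * 1) (fine (P (g @^-1` B)) * 1).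
    move=> B mB; rewrite mulr1 (_ : (fun w => _) = (fun w => \1_B (g w))); first exact: has_mean_indic.
    by apply/funext => w; rewrite mulr1.
  set s := fset_set _.
  have mB i : measurable (h n @^-1` [set s`_i]).
    by rewrite -[X in measurable X]setTI; exact: measurable_funP.
  have s0 (i : 'I_#|`s|) : 0 <= s`_i.
    have : s`_i \in s by rewrite mem_nth.
    by rewrite in_fset_set// inE => -[x _ <-].
  rewrite (_ : (fun x => _) = (fun x => (\sum_(i < #|`s|) (s`_i)%:E * (\1_(h n @^-1` [set s`_i]) x * normal_pdf 0 1 x)%:E)%E)); last first.
    apply/funext => x; rewrite fimfunEord -/s mulr_suml -sumEFin; apply: eq_bigr => i _.
    by rewrite -EFinM mulrA.
  have mI i : measurable_fun setT (fun x => (\1_(h n @^-1` [set s`_i]) x * normal_pdf 0 1 x)%:E).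
    by apply/measurable_EFinP; apply: measurable_funM; [exact: measurable_indic|exact: measurable_normal_pdf].
  have I0 i x : (0 <= (\1_(h n @^-1` [set s`_i]) x * normal_pdf 0 1 x)%:E)%E.
    by rewrite lee_fin mulr_ge0// indicE.
  rewrite ge0_integral_sum//; first last.
  - by move=> i x _; rewrite mule_ge0// lee_fin.
  - by move=> i; apply: measurable_funeM; exact: mI.
  rewrite -sumEFin; apply: eq_bigr => i _; rewrite mulr1.
  have -> : (\int[mu]_x ((s`_i)%:E * (\1_(h n @^-1` [set s`_i]) x * normal_pdf 0 1 x)%:E) =
      (s`_i)%:E * normal_prob 0 1 (h n @^-1` [set s`_i]))%E.
    rewrite -(normal_prob_indic (mB i)); apply: ge0_integralZl_EFin => //.
    exact: mI.
  rewrite -hg// EFinM fineK//; apply: fin_num_measure.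
  by rewrite -[X in measurable X]setTI; exact: measurable_funP.
have cvP := @cvg_monotone_convergence _ _ _ P setT measurableT (fun n w => (h n (g w))%:E).
have /cvP{}cvP : forall n, measurable_fun setT (fun w => (h n (g w))%:E).
  by move=> n; apply/measurable_EFinP; exact: measurableT_comp.
have /cvP{}cvP : forall (n : nat) (w : T), setT w -> (0 <= (h n (g w))%:E)%E.
  by move=> n w _; rewrite lee_fin.
have /cvP{}cvP : forall w : T, setT w -> {homo (fun n => (h n (g w))%:E) : m n / (m <= n)%N >-> (m <= n)%E}.
  by move=> w _ k n kn; rewrite lee_fin; exact: hmono.
rewrite (_ : (fun w => limn _) = (fun w => (phi (g w))%:E)) in cvP; last first.
  by apply/funext => w; apply/cvg_lim => //; apply: cvg_EFin; [exact: nearW|exact: hcv].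
have cvM := @cvg_monotone_convergence _ _ _ mu setT measurableT (fun n x => (h n x * normal_pdf 0 1 x)%:E).
have /cvM{}cvM : forall n, measurable_fun setT (fun x => (h n x * normal_pdf 0 1 x)%:E).
  by move=> n; apply/measurable_EFinP; apply: measurable_funM => //; exact: measurable_normal_pdf.
have /cvM{}cvM : forall (n : nat) (x : R), setT x -> (0 <= (h n x * normal_pdf 0 1 x)%:E)%E.
  by move=> n x _; rewrite lee_fin mulr_ge0.
have /cvM{}cvM : forall x : R, setT x -> {homo (fun n => (h n x * normal_pdf 0 1 x)%:E) : m n / (m <= n)%N >-> (m <= n)%E}.
  by move=> x _ k n kn; rewrite lee_fin ler_wpM2r// hmono.
rewrite (_ : (fun x => limn _) = (fun x => (phi x * normal_pdf 0 1 x)%:E)) in cvM; last first.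
  apply/funext => x; apply/cvg_lim => //; apply: cvg_EFin; first exact: nearW.
  by apply: cvgM; [exact: hcv|exact: cvg_cst].
rewrite -(cvg_lim _ cvP)// -(cvg_lim _ cvM)//; congr (limn _).
by apply/funext => n; exact: step.
Qed.

Lemma gaussian_mean (g : {RV P >-> R}) (phi : R -> R) c : standard_gaussian g ->
  measurable_fun setT phi ->
  mu.-integrable setT (fun x => (phi x * normal_pdf 0 1 x)%:E) ->
  (\int[mu]_x (phi x * normal_pdf 0 1 x)%:E = c%:E)%E ->
  has_mean P (fun w => phi (g w)) c.
Proof.
move=> hg mphi iphi ic.
have pdf0 (x : R) : 0 <= normal_pdf 0 1 x by exact: normal_pdf_ge0.
split.
  apply/integrableP; split; first by apply/measurable_EFinP; exact: measurableT_comp.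
  under eq_integral do rewrite /=.
  rewrite (gaussian_density (phi := fun x => `|phi x|))//; last exact: measurableT_comp.
  case/integrableP : iphi => _; congr (_ < _)%E; apply: eq_integral => x _ /=.
  by rewrite normrM (ger0_norm (pdf0 x)).
rewrite -ic integralE [RHS]integralE; congr (_ - _)%E.
  under eq_integral do rewrite funeposE -EFin_max.
  rewrite (gaussian_density (phi := fun x => Num.max (phi x) 0))//; first last.
  - exact: measurable_maxr.
  - by move=> x; rewrite le_max lexx orbT.
  apply: eq_integral => x _; rewrite funeposE -EFin_max; congr EFin.
  by rewrite maxr_pMl// mul0r.
under eq_integral do rewrite funenegE -EFinN -EFin_max.
rewrite (gaussian_density (phi := fun x => Num.max (- phi x) 0))//; first last.
- by apply: measurable_maxr => //; exact: measurable_funN.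
- by move=> x; rewrite le_max lexx orbT.
apply: eq_integral => x _; rewrite funenegE -EFinN -EFin_max; congr EFin.
by rewrite maxr_pMl// mul0r mulNr.
Qed.

Lemma hermite_mean (g : {RV P >-> R}) n : standard_gaussian g ->
  has_mean P (fun w => (hermite n).[g w]) (n == 0%N)%:R.
Proof.
move=> hg.
have pdfE p : (fun x : R => (p.[x] * normal_pdf 0 1 x)%:E) =
    (fun x => ((normal_peak 1)%:E * (p.[x] * gauss_weight x)%:E)%E).
  by apply/funext => x; rewrite gauss_weight_pdf -EFinM mulrCA.
apply: (gaussian_mean (phi := fun x => (hermite n).[x])) => //.
- exact: measurable_horner.
- by rewrite pdfE; apply: integrableZl => //; exact: integrable_poly_gauss.
case: n => [|n] /=.
  by rewrite -(@integral_normal_pdf R 0 1); apply: eq_integral => x _; rewrite hornerC mul1r.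
rewrite pdfE integralZl//; last exact: integrable_poly_gauss.
by rewrite integral_hermite mule0.
Qed.

Context {dim : option nat}.
Variable g : ix dim -> {RV P >-> R}.
Hypothesis g_indep : mutually_independent g.
Hypothesis g_gauss : forall j, standard_gaussian (g j).

Lemma Psi_mean al : has_mean P (Psi g al) (al == mzero)%:R.
Proof.
have h := @independent_product_mean _ _ _ P _ g g_indep (finsupp al)
  (fun j x => (Num.sqrt (al j)`!%:R)^-1 * (hermite (al j)).[x])
  (fun j => (Num.sqrt (al j)`!%:R)^-1 * (al j == 0%N)%:R) (fset_uniq _).
rewrite (_ : (fun w => _) = Psi g al) in h; last first.
  by apply/funext => w; apply: eq_bigr => j _; rewrite mulrC.
rewrite (_ : (al == mzero)%:R = \prod_(j <- finsupp al) ((Num.sqrt (al j)`!%:R)^-1 * (al j == 0%N)%:R)).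
  apply: h => [j|j _]; last by apply: has_meanZ; exact: hermite_mean.
  by apply: measurable_funM => //; exact: measurable_horner.
have [->|nz] := eqVneq al mzero; first by rewrite finsupp0 big_nil.
have [j ja] : exists j, j \in finsupp al.
  apply: contrapT => /forallNP no; move/eqP : nz; apply; apply/fsfunP => j.
  by rewrite mzeroE fsfun_dflt//; exact/negP.
apply/esym/eqP; rewrite prodf_seq_eq0; apply/hasP; exists j => //=.
by move: ja; rewrite mem_finsupp => /negbTE ->; rewrite mulr0.
Qed.

(** The linearization formula with h = 0, where all contraction weights are
    1. *)
Theorem gaussian_chaos_system : chaos_system P (Psi g) (fun _ _ _ _ => 1).
Proof.
split.
- exact: one_dominated.
- exact: Psi_mean.
move=> al be; apply: aeW => w.
have q0 j : (hermite 0).[g j w] = 1 by rewrite hornerC.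
have qS j n : (hermite n.+1).[g j w] = g j w * (hermite n).[g j w]
    - n%:R * (1 - (n%:R - 1) * 0) * (hermite n.-1).[g j w].
  by rewrite hermite_eval_rec mulr0 subr0 mulr1.
rewrite (tensor_product q0 qS); apply: eq_bigr => r _.
rewrite /pcoef (_ : contraction_weight 0 _ _ = 1)//.
by rewrite /contraction_weight big1// => j _; rewrite big1// => i _; rewrite mulr0 subr0.
Qed.

End GaussianChaos.

(** * Observation and reconstruction *)

Section Observables.
Context {R : realType} {E : completeNormedModType R[i]} {dimH dimE : option nat}.
Variables (dot : {dot E for Num.conj}) (f : ix dimE -> E).
Hypotheses (hE : norm_from_dot dot) (hf : orthonormal_basis dot f).
Variables (Rop : E -> E) (r : ix dimE -> R).
Hypothesis hRop : hilbert_schmidt f Rop.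
Hypothesis hr : forall l, Rop (f l) = (r l)%:C%C *: f l.

(** Positivity gives a nonnegative eigenvalue and injectivity excludes zero. *)
Lemma eigenvalue_gt0 : (forall x, 0 <= dot (Rop x) x) -> injective Rop -> forall l, 0 < r l.
Proof.
move=> Rop_ge0 Rop_inj l.
have d1 : dot (f l) (f l) = 1 by rewrite (dot_basis hf) eqxx.
have r0 : 0 <= r l.
  by have := Rop_ge0 (f l); rewrite hr dotZl d1 mulr1 lecR.
rewrite lt0r r0 andbT; apply/eqP => rl0.
have [linR _ _] := hRop.
have : Rop (f l) = Rop 0 by rewrite hr rl0 scale0r (linear_map0 linR).
move=> /Rop_inj fl0; move: d1; rewrite fl0 dot0l => /eqP.
by rewrite eq_sym oner_eq0.
Qed.

(** The eigenvector relation on the basis says how [Rop] acts on the first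
    argument only; on finite expansions of [y] it gives the claim, and
    continuity of [Rop] does the rest. *)
Lemma dot_eigenvector y k : dot (Rop y) (f k) = (r k)%:C%C * dot y (f k).
Proof.
have [linR _ _] := hRop.
apply/eqP; rewrite -subr_eq0; apply/eqP.
set z := _ - _.
have bound n : (val k < n)%N -> cmod z <= hsr f Rop * rnorm (f k) * rnorm (y - proj_on dot f (ixs n) y).
  move=> kn.
  have -> : z = dot (Rop (y - proj_on dot f (ixs n) y)) (f k).
    rewrite (linear_mapB linR) dotBl /z; congr (_ - _).
    rewrite /proj_on (linear_map_sum linR).
    rewrite (eq_bigr (fun j => (dot y (f j) * (r j)%:C%C) *: f j)); last first.
      by move=> j _; rewrite (linear_mapZ linR) hr scalerA.
    by rewrite (dot_comb hf) ?ixs_uniq// mem_ixs kn mulrC.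
  apply: le_trans (cauchy_schwarz_dot hE _ _) _.
  rewrite mulrAC; apply: ler_wpM2r; first exact: rnorm_ge0.
  exact: hsr_op_bound.
have z0 : cmod z = 0.
  apply/eqP; rewrite eq_le cmod_ge0 andbT; apply/ler_addgt0Pr => e e0; rewrite add0r.
  have cv : hsr f Rop * rnorm (f k) * rnorm (y - proj_on dot f (ixs n) y) @[n --> \oo] --> (0 : R).
    rewrite -[X in _ --> X](mulr0 (hsr f Rop * rnorm (f k))).
    by apply: cvgM; [exact: cvg_cst|exact: expansion_cvg].
  have /cvgrPdist_le/(_ _ e0)[N _ hN] := cv.
  have := hN (maxn N (val k).+1) (leq_maxl _ _); rewrite /= sub0r normrN.
  apply: le_trans; apply: le_trans (ler_norm _); apply: bound.
  exact: leq_maxr.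
have := cmod_sqr z; rewrite z0 expr0n/= => /esym/eqP.
rewrite paddr_eq0 ?sqr_ge0// !sqrf_eq0 => /andP[/eqP re0 /eqP im0].
by move: re0 im0; case: (z) => a b /= -> ->.
Qed.

Lemma entry_sandwich (F : E -> E) k l : linear F ->
  entry dot f (fun x => Rop (F (Rop x))) k l = (r k * r l)%:C%C * entry dot f F k l.
Proof.
move=> linF; rewrite /entry hr (linear_mapZ linF) dot_eigenvector dotZl mulrA.
by rewrite rmorphM.
Qed.

Context {d : measure_display} {T : measurableType d}.
Variable P : probability T R.
Variables (psi : midx dimH -> T -> R) (th : midx dimH -> midx dimH -> midx dimH -> midx dimH -> R).
Hypothesis sys : chaos_system P psi th.
Implicit Types A B : coeff_array dimH E.

Lemma has_mean_expectation (F : T -> R) c : has_mean P F c -> fine 'E_P[F] = c.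
Proof. by move=> [_ h]; rewrite unlock h. Qed.

Lemma chaos_sumP A : frakA2 f A -> is_chaos_sum dot f P psi A (chaos_sum dot f P psi A).
Proof.
move=> hA; have [X hX] := chaos_sum_exists hE hf sys hA.
exact: (@xgetPex _ (fun _ _ => 0) [set X | is_chaos_sum dot f P psi A X] (ex_intro _ X hX)).
Qed.

(** The sandwich by [Rop] multiplies the entry by r_k r_l, and the mean of
    the product against [psi al] is given by [chaos_product_mean], whose
    imaginary part is obtained from a test vector multiplied by the
    imaginary unit. *)
Lemma observe_product b (wt : midx dimH -> R) A B al k l : frakA2 f A -> frakA2 f B ->
  retained b al k l ->
  observe dot f Rop P psi wt b (rprod (chaos_sum dot f P psi A) (chaos_sum dot f P psi B)) al k l =
  ((Num.sqrt (wt al))^-1 * (r k * r l) * chaos_weight th al)%:C%C *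
    entry dot f (array_prod f th A B al) k l.
Proof.
move=> hA hB rt; rewrite /observe rt.
set X := chaos_sum _ _ _ _ A; set Y := chaos_sum _ _ _ _ B; set C := array_prod _ _ _ _.
have hX : is_chaos_sum dot f P psi A X := chaos_sumP hA.
have hY : is_chaos_sum dot f P psi B Y := chaos_sumP hB.
have linXY w : linear (rprod X Y w).
  have [/(_ w)[linX _ _] _ _] := hX; have [/(_ w)[linY _ _] _ _] := hY.
  by move=> a x y; rewrite /rprod linY linX.
pose c := (Num.sqrt (wt al))^-1 * (r k * r l).
have mean v := chaos_product_mean hE hf sys al (f l) v hA hB hX hY.
have ZE w : ((Num.sqrt (wt al))^-1 * psi al w)%:C%C * entry dot f (fun x => Rop (rprod X Y w (Rop x))) k l =
    (c * psi al w)%:C%C * dot (rprod X Y w (f l)) (f k).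
  by rewrite (entry_sandwich _ _ (linXY w)) mulrA -rmorphM /c /=; congr (_%:C%C * _); ring.
have Im_dot y : complex.Im (dot y (f k)) = complex.Re (dot y (Complex 0 1 *: f k)).
  by rewrite dotZr ReM Re_conj/= mul0r sub0r mulNr opprK mul1r.
rewrite /cexpectation.
rewrite (_ : (fun w => complex.Re _) = fun w => c * (psi al w * complex.Re (dot (rprod X Y w (f l)) (f k)))); last first.
  by apply/funext => w; rewrite ZE Re_rM mulrA.
rewrite (_ : (fun w => complex.Im _) = fun w => c * (psi al w * complex.Re (dot (rprod X Y w (f l)) (Complex 0 1 *: f k)))); last first.
  by apply/funext => w; rewrite ZE Im_rM -Im_dot mulrA.
rewrite (has_mean_expectation (has_meanZ c (mean (f k)))).
rewrite (has_mean_expectation (has_meanZ c (mean (Complex 0 1 *: f k)))).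
rewrite -Im_dot /entry -/c !mulrA; apply/eqP; rewrite eq_complex.
by rewrite Re_rM Im_rM /= !eqxx.
Qed.

Hypothesis r_gt0 : forall l, 0 < r l.

(** The observation carries the factor r_k r_l times the second moment over
    its square root, and this is what the reconstruction divides by. *)
Theorem reconstruct_observe b A B : frakA2 f A -> frakA2 f B ->
  (forall al, retained_idx b al -> 0 < chaos_weight th al) ->
  reconstruct dot f r (chaos_weight th) b
    (observe dot f Rop P psi (chaos_weight th) b
      (rprod (chaos_sum dot f P psi A) (chaos_sum dot f P psi B))) =
  budget_proj dot f b (array_prod f th A B).
Proof.
move=> hA hB wt0; apply: eq_assemble => al k l rt.
have /wt0 w0 : retained_idx b al by case/and3P: rt.
rewrite (observe_product _ hA hB rt) mulrAC -fmorphV -rmorphM/=.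
set w := chaos_weight th al in w0 *.
rewrite (_ : _ * _ * w / _ = 1) ?mul1r//.
have sw0 : Num.sqrt w != 0 by rewrite gt_eqF// sqrtr_gt0.
have -> : (Num.sqrt w)^-1 * (r k * r l) * w = r k * r l * Num.sqrt w.
  by rewrite -[X in _ * X = _](sqr_sqrtr (ltW w0)) expr2; field.
by rewrite mulfV// !mulf_neq0// lt0r_neq0.
Qed.

End Observables.

(** * Convergence and the error bound *)

Section Convergence.
Context {R : realType} {E : completeNormedModType R[i]} {dimH dimE : option nat}.
Variables (dot : {dot E for Num.conj}) (f : ix dimE -> E).
Hypotheses (hE : norm_from_dot dot) (hf : orthonormal_basis dot f).
Implicit Types A B : coeff_array dimH E.

(** The rate with a fixed choice of radii in the ratio 1/2. *)
Lemma starN_cvg A B (sigma : R) : frakA2 f A -> frakA2 f B -> 1 <= sigma ->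
  pnorm f sigma (array_sub (starN f N A B) (star f A B)) @[N --> \oo] --> 0%E.
Proof.
move=> hA hB s1.
have s0 : 0 <= sigma by lra.
(* Twice the radius is admissible for the product estimate; twice again
   gives q = 1/2. *)
pose rho := 2 * sigma; pose Rp := 4 * sigma.
have Rp1 : 1 <= Rp by rewrite /Rp; lra.
have pfin C : frakA2 f C -> (pnorm f Rp C \is a fin_num).
  by move=> [_ /(_ _ Rp1) h]; rewrite ge0_fin_numE// pnorm_ge0//; lra.
pose K := fine (pnorm f Rp A) * fine (pnorm f Rp B).
have K0 : 0 <= K by rewrite mulr_ge0 ?fine_ge0 ?pnorm_ge0//; lra.
have bound N : (0 < N)%N ->
    (pnorm f sigma (array_sub (starN f N A B) (star f A B)) <= (4 * K * harmonic N)%:E)%E.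
  move=> N0.
  have rho0 : 0 < rho by rewrite /rho; lra.
  have rR : rho < Rp by rewrite /rho /Rp; lra.
  have := starN_star_le hE hf s1 rho0 rho0 (double_radius s1) rR rR N0 hA hB.
  rewrite maxxx (_ : rho / Rp = 2^-1); last first.
    by rewrite /rho /Rp; field; lra.
  rewrite -[pnorm f Rp A]fineK ?pfin// -[pnorm f Rp B]fineK ?pfin// -!EFinM.
  move=> h; apply: le_trans h _; rewrite lee_fin -mulrA -/K.
  have n0 : 0 < N%:R :> R by rewrite ltr0n.
  have n1 : 1 <= N%:R :> R by rewrite ler1n.
  rewrite (_ : _ / _ = 2 / N%:R); last by field; rewrite lt0r_neq0.
  rewrite /harmonic/= mulrAC ler_pdivrMr// mulrAC ler_pdivlMr ?ltr0n//.
  have -> : N.+1%:R = N%:R + 1 :> R by rewrite natr1.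
  by move: (N%:R : R) n1 => n n1; nra.
have cv : (4 * K * harmonic N)%:E @[N --> \oo] --> (0%E : \bar R).
  apply: cvg_EFin; first exact: nearW.
  rewrite -[X in _ --> X](mulr0 (4 * K)); apply: cvgM; [exact: cvg_cst|exact: cvg_harmonic].
apply: ecvg0_le cv; first by move=> n; exact: pnorm_ge0.
by exists 1%N => // N /= N0; exact: bound.
Qed.

Lemma reconstruct_sub (r : ix dimE -> R) (wt : midx dimH -> R) b (y z : obs_data dimH dimE) :
  array_sub (reconstruct dot f r wt b y) (reconstruct dot f r wt b z) =
  reconstruct dot f r wt b (data_sub y z).
Proof.
apply/funext => al; apply/funext => x; rewrite /array_sub /reconstruct assemble_sub.
pose w (u : obs_data dimH dimE) : obs_data (R := R) dimH dimE :=
  fun al k l => u al k l / (r k * r l * Num.sqrt (wt al))%:C%C.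
suff E1 : data_sub (w y) (w z) = w (data_sub y z) by rewrite -/(w y) -/(w z) E1.
apply/funext => be; apply/funext => k; apply/funext => l.
by rewrite /data_sub /w mulrBl.
Qed.

End Convergence.

Theorem theorem5p8 (R : realType)
  (H : completeNormedModType R) (dotH : {dot H for idfun})
  (hH : norm_from_dot dotH)
  (dimH : option nat) (e : ix dimH -> H) (he : orthonormal_basis dotH e)
  (E : completeNormedModType R[i]) (dotE : {dot E for Num.conj})
  (hE : norm_from_dot dotE)
  (dimE : option nat) (f : ix dimE -> E) (hf : orthonormal_basis dotE f)
  (Rop : E -> E) (hRop : hilbert_schmidt f Rop)
  (Rop_ge0 : forall x, 0 <= dotE (Rop x) x) (Rop_inj : injective Rop)
  (Rop_norm : hs_norm2 f Rop = 1%E)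
  (r : ix dimE -> R) (hr : forall l, Rop (f l) = (r l)%:C%C *: f l)
  (d1 : measure_display) (T1 : measurableType d1) (P1 : probability T1 R)
  (xi : ix dimH -> nat -> {RV P1 >-> R})
  (xi_indep : mutually_independent (fun ja : ix dimH * nat => xi ja.1 ja.2))
  (xi_sign : forall j a, symmetric_sign (xi j a))
  (d2 : measure_display) (T2 : measurableType d2) (P2 : probability T2 R)
  (g : ix dimH -> {RV P2 >-> R})
  (g_indep : mutually_independent g)
  (g_gauss : forall j, standard_gaussian (g j))
  (A B : coeff_array dimH E) (hA : frakA2 f A) (hB : frakA2 f B) :
  let ObN b N := observe dotE f Rop P1 (PsiN xi N) (dweight N) b
    (rprod (PhiN dotE f xi N A) (PhiN dotE f xi N B)) in
  let Ob b := observe dotE f Rop P2 (Psi g) (fun _ => 1) b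
    (rprod (Phi dotE f g A) (Phi dotE f g B)) in
  let DbN b N := reconstruct dotE f r (dweight N) b in
  let Db b := reconstruct dotE f r (fun _ => 1) b in
  let Pb b := budget_proj dotE f b in
  [/\ forall b N, (0 < N)%N -> (bM b <= N)%N ->
        DbN b N (ObN b N) = Pb b (starN f N A B),
      forall b, cvg_frakA2 f (fun N => Pb b (starN f N A B)) (Pb b (star f A B)),
      forall b, Pb b (star f A B) = Db b (Ob b),
      forall b N (y : obs_data dimH dimE) (delta : nat -> R),
        (0 < N)%N -> (bM b <= N)%N ->
        (forall m, (m <= bM b)%N ->
          (data_norm b m (data_sub y (ObN b N)) <= (delta m)%:E)%E) ->
        forall sigma rho eta Rp Sp : R,
        1 <= sigma -> 0 < rho -> 0 < eta ->
        (1 + rho ^+ 2)^-1 + (1 + eta ^+ 2)^-1 <= (1 + sigma ^+ 2)^-1 ->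
        rho < Rp -> eta < Sp ->
        let q := Num.max (rho / Rp) (eta / Sp) in
        (pnorm f sigma (array_sub (DbN b N y) (star f A B)) <=
           (noise_term r sigma b N delta)%:E +
           pnorm f sigma (array_sub (star f A B) (Pb b (star f A B))) +
           (q ^+ 2 / (N%:R * (1 - q) ^+ 3))%:E * pnorm f Rp A * pnorm f Sp B)%E
    & forall (b : nat -> budget) (y : nat -> obs_data dimH dimE)
        (delta : nat -> nat -> R),
        cofinal_budgets dimH dimE b ->
        (forall N, (0 < N)%N -> (bM (b N) <= N)%N) ->
        (forall N m, (0 < N)%N -> (m <= bM (b N))%N ->
          (data_norm (b N) m (data_sub (y N) (ObN (b N) N)) <= (delta N m)%:E)%E) ->
        (forall sigma, 1 <= sigma ->
          noise_term r sigma (b N) N (delta N) @[N --> \oo] --> 0) ->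
        cvg_frakA2 f (fun N => DbN (b N) N (y N)) (star f A B)].

Proof.
move=> ObN Ob DbN Db Pb.
have r_gt0 : forall l, 0 < r l by exact: (eigenvalue_gt0 hf hRop hr Rop_ge0 Rop_inj).
have weight b N al : (0 < N)%N -> (bM b <= N)%N -> retained_idx b al -> 0 < dweight N al :> R.
  move=> N0 bN /andP[al_le _]; apply: (inv_sqrt_dweight_le _ N0).1.
  exact: leq_trans bN.
have part1 b N : (0 < N)%N -> (bM b <= N)%N -> DbN b N (ObN b N) = Pb b (starN f N A B).
  move=> N0 bN.
  have sys := sign_chaos_system xi_indep xi_sign N0.
  have wE : chaos_weight (@vartheta R dimH N) = dweight N by apply/funext => al; exact: sign_chaos_weight.
  have := reconstruct_observe hE hf hRop hr sys r_gt0 (b := b) hA hB.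
  by rewrite wE; apply=> al; exact: weight.
have fin_assemble b y : frakA2 f (assemble dotE f b y : coeff_array dimH E).
  by apply: finite_array_frakA2; exact: assemble_finite.
have [star_in _] := star_spec hE hf hA hB.
have part4 b N (y : obs_data dimH dimE) (delta : nat -> R) :
    (0 < N)%N -> (bM b <= N)%N ->
    (forall m, (m <= bM b)%N -> (data_norm b m (data_sub y (ObN b N)) <= (delta m)%:E)%E) ->
    forall sigma : R, 1 <= sigma ->
    (pnorm f sigma (array_sub (DbN b N y) (star f A B)) <=
      (noise_term r sigma b N delta)%:E +
      pnorm f sigma (array_sub (star f A B) (Pb b (star f A B))) +
      pnorm f sigma (array_sub (starN f N A B) (star f A B)))%E.
  move=> N0 bN hy sigma s1.
  have s0 : 0 <= sigma by lra.
  apply: le_trans (pnorm_triangle _ _ (Pb b (starN f N A B)) _ s0) _.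
  rewrite -addeA; apply: leeD.
    rewrite -(part1 _ _ N0 bN) reconstruct_sub.
    exact: (pnorm_reconstruct_le hE hf r_gt0 s0 N0 bN hy).
  apply: le_trans (pnorm_triangle _ _ (Pb b (star f A B)) _ s0) _.
  rewrite (pnorm_subC f (star f A B) (Pb b (star f A B)) s0) addeC; apply: leeD => //.
  exact: (pnorm_budget_proj_sub hE hf b _ _ s0).
split.
- exact: part1.
- move=> b; split=> [N||sigma s1]; [exact: fin_assemble|exact: fin_assemble|].
  have s0 : 0 <= sigma by lra.
  apply: ecvg0_le (starN_cvg hE hf hA hB s1); first by move=> n; exact: pnorm_ge0.
  by apply: nearW => N; exact: pnorm_budget_proj_sub.
- move=> b.
  have sys := gaussian_chaos_system g_indep g_gauss.
  by have := reconstruct_observe hE hf hRop hr sys r_gt0 (b := b) hA hB (fun al _ => ltr01).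
- move=> b N y delta N0 bN hy sigma rho eta Rp Sp s1 rho0 eta0 hyp rR eS; cbv zeta.
  apply: le_trans (part4 b N y delta N0 bN hy sigma s1) _; apply: leeD2l.
  exact: (starN_star_le hE hf s1 rho0 eta0 hyp rR eS N0 hA hB).
- move=> b y delta cof bN hy hnoise; split=> [N||sigma s1].
  + exact: fin_assemble.
  + exact: star_in.
  + have s0 : 0 <= sigma by lra.
    have cv_noise : (noise_term r sigma (b N) N (delta N))%:E @[N --> \oo] --> (0%E : \bar R).
      by apply: cvg_EFin; [exact: nearW|exact: hnoise].
    have cv_tail := budget_proj_cvg hE hf s1 cof star_in.
    apply: ecvg0_le (ecvg0D (ecvg0D cv_noise cv_tail) (starN_cvg hE hf hA hB s1)).
      by move=> n; exact: pnorm_ge0.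
    exists 1%N => // N /= N0; apply: part4 => //; first exact: bN.
    by move=> m; exact: hy.
Qed.
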